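(* Let $v:\mathbb R^2\to\mathbb R$ be smooth, compactly supported, non-positive and radial, with a unique non-degenerate minimum $v_0<0$ at $0$; write $v(r)$ for its radial profile and let $a>0$ be the smallest positive number with $\mathrm{supp}(v)\subset\overline B(0,a)$. Let $B>0$ and $L>a$. Let $\varphi$ be the normalized, radial, real-valued ground state of $(-ih\nabla-\mathbf A^{\mathrm{rad}})^2+v$ on $L^2(\mathbb R^2)$, where $\mathbf A^{\mathrm{rad}}(x,y)=\frac B2(-y,x)$, and define \[\varphi_\ell(x,y)=e^{-i\sigma_\ell/h}\varphi(x+L,y),\quad \varphi_r(x,y)=e^{-i\sigma_r/h}\varphi(x-L,y),\] with $\sigma_\ell(x,y)=\frac B2y(L-x)$, $\sigma_r(x,y)=-\frac B2y(L+x)$. Let \[w_h=\int_{\mathbb R^2}v(x+L,y)\,\varphi_\ell(x,y)\,\overline{\varphi_r(x,y)}\,dx\,dy.\] Then there exists a constant $C(B,L,v)>0$ such that \[w_h=-C(B,L,v)\,h^{1/2}e^{-S/h}(1+o(1))\quad\text{as }h\to0,\] with \[S=2d(0,L)+\int_0^L\Big(\sqrt{\tfrac{B^2(2L-r)^2}{4}-v_0}-\sqrt{\tfrac{B^2r^2}{4}-v_0}\Big)dr,\qquad d(0,L)=\int_0^L\sqrt{\tfrac{B^2r^2}{4}+v(r)-v_0}\,dr.\]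
   Context: $\varphi_\ell$ and $\varphi_r$ are the normalized ground states of $(-ih\nabla-\mathbf A)^2+v(x+L,y)$ and $(-ih\nabla-\mathbf A)^2+v(x-L,y)$ respectively, where $\mathbf A(x,y)=(0,Bx)$; $w_h$ is called the hopping coefficient. *)

(* Defs.v *)
From HB Require Import structures.
From mathcomp Require Import all_boot all_order all_algebra.
From mathcomp Require Import all_classical all_reals all_analysis.
Set Implicit Arguments. Unset Strict Implicit. Unset Printing Implicit Defensive.
Import Order.TTheory GRing.Theory Num.Theory.
Import numFieldNormedType.Exports.
Local Open Scope classical_set_scope.
Local Open Scope ring_scope.

Section Defs.
Variable R : realType.

(* Euclidean radius (the canonical norm on R*R in mathcomp is the max norm) *)
Definition eucl_rad (z : R * R) : R := Num.sqrt (z.1 ^+ 2 + z.2 ^+ 2).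

Definition dx (f : R * R -> R) : R * R -> R := fun z => 'D_((1, 0) : R * R) f z.
Definition dy (f : R * R -> R) : R * R -> R := fun z => 'D_((0, 1) : R * R) f z.

Fixpoint Ck (n : nat) (f : R * R -> R) : Prop :=
  match n with
  | O => continuous f
  | S n' => (forall z, differentiable f z) /\ Ck n' (dx f) /\ Ck n' (dy f)
  end.

Definition smooth2 (f : R * R -> R) : Prop := forall n, Ck n f.

Definition mu2 := ((@lebesgue_measure R) \x (@lebesgue_measure R))%E.

Definition Arad1 (B : R) (z : R * R) : R := - (B / 2) * z.2.
Definition Arad2 (B : R) (z : R * R) : R := (B / 2) * z.1.

(* |(-i h grad - A) u|^2 for u = u1 + i u2, written out in real coordinates *)
Definition mag_density (B h : R) (u1 u2 : R * R -> R) (z : R * R) : R :=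
  (h * dx u2 z - Arad1 B z * u1 z) ^+ 2 + (h * dx u1 z + Arad1 B z * u2 z) ^+ 2
+ (h * dy u2 z - Arad2 B z * u1 z) ^+ 2 + (h * dy u1 z + Arad2 B z * u2 z) ^+ 2.

(* quadratic form of (-i h grad - A^eucl_rad)^2 + v at u = u1 + i u2 *)
Definition energy (v : R * R -> R) (B h : R) (u1 u2 : R * R -> R) : \bar R :=
  (\int[mu2]_z (mag_density B h u1 u2 z)%:E
   + \int[mu2]_z (v z * (u1 z ^+ 2 + u2 z ^+ 2))%:E)%E.

Definition admissible (B h : R) (u1 u2 : R * R -> R) : Prop :=
  (forall z, differentiable u1 z) /\ (forall z, differentiable u2 z) /\
  continuous (dx u1) /\ continuous (dy u1) /\
  continuous (dx u2) /\ continuous (dy u2) /\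
  (\int[mu2]_z ((u1 z ^+ 2 + u2 z ^+ 2))%:E = 1)%E /\
  (\int[mu2]_z (mag_density B h u1 u2 z)%:E < +oo)%E.

Definition radial_real_ground_state (v : R * R -> R) (B h : R)
    (phi : R * R -> R) : Prop :=
  admissible B h phi (fun _ => 0%R) /\
  (forall z z', eucl_rad z = eucl_rad z' -> phi z = phi z') /\
  (forall u1 u2, admissible B h u1 u2 ->
     (energy v B h phi (fun _ => 0%R) <= energy v B h u1 u2)%E).

Definition sigma_l (B L : R) (z : R * R) : R := B / 2 * z.2 * (L - z.1).
Definition sigma_r (B L : R) (z : R * R) : R := - (B / 2) * z.2 * (L + z.1).

(* w_h = \int v(x+L,y) phi_l conj(phi_r), with
   phi_l = e^{-i sigma_l/h} phi(x+L,y), phi_r = e^{-i sigma_r/h} phi(x-L,y);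
   real and imaginary parts *)
Definition hop_re (v : R * R -> R) (B L h : R) (phi : R * R -> R) : R :=
  Rintegral mu2 setT (fun z =>
    v (z.1 + L, z.2) * phi (z.1 + L, z.2) * phi (z.1 - L, z.2)
    * cos ((sigma_r B L z - sigma_l B L z) / h)).
Definition hop_im (v : R * R -> R) (B L h : R) (phi : R * R -> R) : R :=
  Rintegral mu2 setT (fun z =>
    v (z.1 + L, z.2) * phi (z.1 + L, z.2) * phi (z.1 - L, z.2)
    * sin ((sigma_r B L z - sigma_l B L z) / h)).

Definition agmon_d (vp : R -> R) (v0 B L : R) : R :=
  Rintegral (@lebesgue_measure R) `[0, L] (fun r =>
    Num.sqrt (B ^+ 2 * r ^+ 2 / 4 + vp r - v0)).
Definition action_S (vp : R -> R) (v0 B L : R) : R :=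
  2 * agmon_d vp v0 B L +
  Rintegral (@lebesgue_measure R) `[0, L] (fun r =>
    Num.sqrt (B ^+ 2 * (2 * L - r) ^+ 2 / 4 - v0)
    - Num.sqrt (B ^+ 2 * r ^+ 2 / 4 - v0)).

End Defs.

(* Main.v *)
Require Import Defs.
From HB Require Import structures.
From mathcomp Require Import all_boot all_order all_algebra.
From mathcomp Require Import all_classical all_reals all_analysis measurable_realfun.
From mathcomp Require Import ring lra.
Set Implicit Arguments.
Unset Strict Implicit.
Unset Printing Implicit Defensive.
Import Order.TTheory GRing.Theory Num.Theory.
Import numFieldNormedType.Exports.
Local Open Scope classical_set_scope.
Local Open Scope ring_scope.

(** In the variable [s = |z|^2] the radial ground state has a profile [F] solving
    [4 h^2 (s F')' = (V - Lam) F], with [V s = B^2 s / 4 + v - v_0] and [Lam] the energy counted from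
    [v_0]. A Gaussian trial function and the monotonicity of [s psi^2 u u'], where [u = F / psi] and
    [psi = exp (- d / h - Q)] is the first-order WKB function, give [Lam = 4 p00 h + O(h^2)]; barriers
    for [u'] then give [F = F(0) psi (1 + O(sqrt h))] up to [s = 4 L^2], and the normalisation gives
    [h c F(0)^2 -> 2 p00], [c] being the area of the unit disc.

    Averaging over rotations, [w_h] is [c / (2 pi)] times the integral of [v F j(sqrt s)], where [j(r)]
    is the integral of [phi(x - 2 L, y) cos(B L y / h)] over the angles of the circle of radius [r].
    For [r <= L] the translated potential vanishes on that circle, so [j] solves the radial equation
    without potential and [v F j(sqrt s)] is the derivative of a Wronskian: [w_h] reduces to values of
    [F] and [j] at distance [L], and to [j(0) = 2 pi F(4 L^2)]. Comparison of [j] with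
    [I_0(sqrt(-lam) r / h)] times its WKB correction shows that [j(L) / j(0)] is of size
    [sqrt h * exp (m(L) / h)], where [m] is the primitive of [sqrt (B^2 r^2 / 4 - lam)]; the three
    exponents [d(L^2)], [d(4 L^2)] and [m(L)] combine to [S]. *)

(** The phase [B L y / h] makes [w_h] exponentially smaller than the integral of the modulus of its
    integrand, so estimates of [F] inside the integral would lose the result. The exact Wronskian
    identity avoids this: afterwards only pointwise values with relative error o(1) enter, and its
    two terms, one with [F' < 0] and one with [j' / j > 0], add up instead of cancelling. Powers of
    [h]: the Wronskian has a factor [h^2], its derivative costs [1 / h], and [F(0)^2] is of order
    [1 / h]. What remains is the [sqrt h] of [j(L) / j(0)], that is, [I_0(x)] behaving like
    [exp(x) / sqrt x] at [x] of order [1 / h]. The energy also sits in the exponent [m(L) / h]. A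
    shift of order [h] there multiplies the result by a constant, so the energy is needed up to
    o(h); its coefficient [4 p00] is visible in the constant [C]. All estimates before the limit
    hold at fixed [h], with constants independent of [h] and explicit smallness conditions. Relative
    errors are controlled by dividing by the model solution, bounding the derivative of the quotient
    by a multiple of its own maximum, and absorbing. *)

(** * Derivatives and one-dimensional inequalities *)

(* A constant rather than a notation, so that type class search is not triggered on it. *)
Definition der {R : realType} (x : R) (f : R -> R) (d : R) := is_derive x 1 f d.

Section Derivatives.
Context {R : realType}.
Implicit Types (f g : R -> R) (x c : R).

Lemma der_eq f x (d d' : R) : der x f d -> d = d' -> der x f d'.
Proof. by move=> ? <-. Qed.

Lemma derC c x : der x (fun=> c) (0 : R).
Proof. exact: is_derive_cst. Qed.

Lemma derI x : der x (fun y : R => y) (1 : R).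
Proof. exact: is_derive_id. Qed.

Lemma derD f g x (df dg : R) : der x f df -> der x g dg ->
  der x (fun y => f y + g y) (df + dg).
Proof. by rewrite /der => ? ?; exact: is_deriveD. Qed.

Lemma derN f x (df : R) : der x f df -> der x (fun y => - f y) (- df).
Proof. by rewrite /der => ?; exact: is_deriveN. Qed.

Lemma derM f g x (df dg : R) : der x f df -> der x g dg ->
  der x (fun y => f y * g y) (f x * dg + g x * df).
Proof. by rewrite /der => ? ?; exact: is_deriveM. Qed.

Lemma derX f n x (df : R) : der x f df ->
  der x (fun y => f y ^+ n) (n%:R * f x ^+ n.-1 * df).
Proof.
rewrite /der => hf; rewrite (_ : (fun y => f y ^+ n) = f ^+ n); first exact: is_deriveX.
by apply/funext => y; rewrite exprfctE.
Qed.

Lemma derV f x (df : R) : der x f df -> f x != 0 ->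
  der x (fun y => (f y)^-1) (- df / f x ^+ 2).
Proof.
move=> hf fx; apply: (der_eq (is_deriveV fx hf)).
by rewrite /GRing.scale/= mulNr [- df / _]mulNr mulrC.
Qed.

Lemma der_comp f g x (df dg : R) : der (f x) g dg -> der x f df ->
  der x (fun y => g (f y)) (dg * df).
Proof. by move=> hg hf; exact: (@is_derive1_comp R g f x _ _ hg hf). Qed.

Lemma der_expR f x (df : R) : der x f df ->
  der x (fun y => expR (f y)) (expR (f x) * df).
Proof. by move=> ?; apply: der_comp => //; rewrite /der; exact: is_derive_expR. Qed.

Lemma der_sin f x (df : R) : der x f df ->
  der x (fun y => sin (f y)) (cos (f x) * df).
Proof. by move=> ?; apply: der_comp => //; rewrite /der; exact: is_derive_sin. Qed.

Lemma der_cos f x (df : R) : der x f df ->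
  der x (fun y => cos (f y)) (- sin (f x) * df).
Proof. by move=> ?; apply: der_comp => //; rewrite /der; exact: is_derive_cos. Qed.

Lemma der_sqrt f x (df : R) : der x f df -> 0 < f x ->
  der x (fun y => Num.sqrt (f y)) (df / (2 * Num.sqrt (f x))).
Proof.
move=> hf fx; apply: der_eq.
  by apply: (der_comp (g := Num.sqrt) _ hf); exact: is_derive1_sqrt.
by rewrite mulrC.
Qed.

Lemma der_near f g x (d : R) : (\forall y \near x, f y = g y) -> der x f d ->
  der x g d.
Proof. exact: near_eq_is_derive. Qed.

Lemma der_cvg f x (d : R) : der x f d -> {for x, continuous f}.
Proof. by move=> [df _]; apply: differentiable_continuous; exact/derivable1_diffP. Qed.

Lemma der_uniq f x (d d' : R) : der x f d -> der x f d' -> d = d'.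
Proof. by move=> [_ <-] [_ <-]. Qed.

Lemma der_mono f (df : R -> R) (a b : R) : a <= b ->
  (forall x : R, a <= x <= b -> der x f (df x)) ->
  (forall x : R, a <= x <= b -> 0 <= df x) -> f a <= f b.
Proof.
rewrite le_eqVlt => /orP[/eqP->//|ab] Hd Hs.
have [||c] := @MVT R f df a b ab.
- by move=> x; rewrite in_itv/= => /andP[ax xb]; apply: Hd; rewrite !ltW.
- apply: derivable_within_continuous => x; rewrite in_itv/= => xab.
  by have [] := Hd x xab.
rewrite in_itv/= => /andP[ac cb] E.
rewrite -subr_ge0 E mulr_ge0 ?subr_ge0 ?(ltW ab)//.
by apply: Hs; rewrite !ltW.
Qed.

(** Monotonicity of [g + f] and [g - f]. Error estimates below take this form rather than that of an
    integral inequality, since the majorant [dg] always has an explicit primitive. *)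
Lemma der_bound f g (df dg : R -> R) (a b : R) : a <= b ->
  (forall x : R, a <= x <= b -> der x f (df x)) ->
  (forall x : R, a <= x <= b -> der x g (dg x)) ->
  (forall x : R, a <= x <= b -> `|df x| <= dg x) -> `|f b - f a| <= g b - g a.
Proof.
move=> ab Hf Hg H; rewrite ler_norml; apply/andP; split.
  have : g a + f a <= g b + f b; last by lra.
  apply: (@der_mono (fun x => g x + f x) (fun x => dg x + df x) a b ab) => x xab.
  - by apply: derD; [exact: Hg|exact: Hf].
  - by have := H x xab; rewrite ler_norml; lra.
have : g a - f a <= g b - f b; last by lra.
apply: (@der_mono (fun x => g x - f x) (fun x => dg x - df x) a b ab) => x xab.
- by apply: derD; [exact: Hg|apply: derN; exact: Hf].
- by have := H x xab; rewrite ler_norml; lra.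
Qed.

(** The radial equations are singular at the origin, so a one-sided limit stands in for the value at
    the left endpoint. If [f b < l], then [f b < f x] for some small [x], against monotonicity on
    [[x, b]]. *)
Lemma der_mono0 f (df : R -> R) (b l : R) : 0 < b ->
  f x @[x --> 0^'+] --> l ->
  (forall x : R, 0 < x <= b -> der x f (df x)) ->
  (forall x : R, 0 < x <= b -> 0 <= df x) -> l <= f b.
Proof.
move=> b0 fl Hd Hs; rewrite leNgt; apply/negP => fbl.
suff : \forall x \near (0 : R)^'+, False by move=> /filter_ex[].
near=> x; have : f b < f x by near: x; exact: (cvgr_gt _ fl _ fbl).
apply/negP; rewrite -leNgt; have x0 : 0 < x by [].
have xb : x <= b by near: x; exact: nbhs_right_le.
apply: (@der_mono f df) => // y /andP[xy yb]; [apply: Hd|apply: Hs];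
  by rewrite yb (lt_le_trans x0 xy).
Unshelve. all: by end_near. Qed.

Lemma cvg0_norm_le f g : (forall x : R, 0 < x -> `|f x| <= g x) ->
  g x @[x --> 0^'+] --> 0 -> f x @[x --> 0^'+] --> 0.
Proof.
move=> fg g0; apply/norm_cvg0P; apply: (squeeze_cvgr _ (cvg_cst 0) g0).
near=> x; rewrite normr_ge0/=; apply: fg; near: x; exact: nbhs_right_gt.
Unshelve. all: by end_near. Qed.

Lemma cvg_right_id : x @[x --> (0 : R)^'+] --> (0 : R).
Proof. exact: cvg_at_right_filter cvg_id. Qed.

Lemma der_bound0 f g (df dg : R -> R) (b l m : R) : 0 < b ->
  f x @[x --> 0^'+] --> l -> g x @[x --> 0^'+] --> m ->
  (forall x : R, 0 < x <= b -> der x f (df x)) ->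
  (forall x : R, 0 < x <= b -> der x g (dg x)) ->
  (forall x : R, 0 < x <= b -> `|df x| <= dg x) -> `|f b - l| <= g b - m.
Proof.
move=> b0 fl gm Hf Hg H; rewrite ler_norml; apply/andP; split.
  have : m + l <= g b + f b; last by lra.
  apply: (@der_mono0 (fun x => g x + f x) (fun x => dg x + df x)) => //.
  - exact: cvgD.
  - by move=> x xab; apply: derD; [exact: Hg|exact: Hf].
  - by move=> x xab; have := H x xab; rewrite ler_norml; lra.
have : m - l <= g b - f b; last by lra.
apply: (@der_mono0 (fun x => g x - f x) (fun x => dg x - df x)) => //.
- exact: cvgB.
- by move=> x xab; apply: derD; [exact: Hg|apply: derN; exact: Hf].
- by move=> x xab; have := H x xab; rewrite ler_norml; lra.
Qed.

Lemma expR_sub1_le (x y : R) : `|x| <= y -> `|expR x - 1| <= y * expR y.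
Proof.
rewrite ler_norml => /andP[yx xy]; have y0 : 0 <= y by lra.
have ey : 1 <= expR y by rewrite -expR0 ler_expR.
have exy : expR x <= expR y by rewrite ler_expR.
have H1 := expR_ge1Dx x; have ex := expR_gt0 x.
have : (1 + - x) * expR x <= expR (- x) * expR x by rewrite ler_pM2r// expR_ge1Dx.
rewrite mulrC [X in _ <= X]mulrC expRxMexpNx_1 => H2.
by rewrite ler_norml; apply/andP; split; nra.
Qed.

Lemma expRN_le_inv (x : R) : 0 < x -> expR (- x) <= x^-1.
Proof.
move=> x0; rewrite expRN lef_pV2 ?posrE ?expR_gt0//.
by apply: le_trans (expR_ge1Dx x); rewrite lerDr.
Qed.

End Derivatives.

Section SupBound.
Context {R : realType}.

(** Absorption: take for [M] the maximum of [|u|], which exists once [u] is completed at 0 by its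
    limit. Then [M <= |u0| + eps * M], and [eps <= 1/2] concludes. Both comparisons with model
    solutions, for the ground state and for its angular average, close in this way. *)
Lemma der_eps_bound (u du : R -> R) (b u0 eps : R) : 0 < b ->
  u s @[s --> 0^'+] --> u0 ->
  (forall s : R, 0 < s <= b -> der s u (du s)) ->
  (forall M, (forall s, 0 < s <= b -> `|u s| <= M) ->
     forall s, 0 < s <= b -> `|u s - u0| <= eps * M) ->
  eps <= 2^-1 -> forall s, 0 < s <= b -> `|u s| <= 2 * `|u0|.
Proof.
move=> b0 cu dus H e2.
pose v (s : R) := `|if s == 0 then u0 else u s|.
have [|c] := @EVT_max R v 0 b (ltW b0).
  apply/continuous_within_itvP => //; split.
  - move=> x; rewrite in_itv/= => /andP[x0 xb].
    apply: cvg_norm; rewrite (gt_eqF x0).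
    have ux : der x u (du x) by apply: dus; rewrite x0 ltW.
    apply: (@cvg_trans _ (u t @[t --> x])); last exact: (der_cvg ux).
    apply: near_eq_cvg; near=> t; rewrite gt_eqF//; near: t; exact: lt_nbhsr.
  - apply: cvg_norm; rewrite eqxx.
    apply: (@cvg_trans _ (u t @[t --> 0^'+])); last exact: cu.
    by apply: near_eq_cvg; near=> t; rewrite gt_eqF.
  - apply: cvg_norm; rewrite (gt_eqF b0); apply: cvg_at_left_filter.
    have ub : der b u (du b) by apply: dus; rewrite b0 lexx.
    apply: (@cvg_trans _ (u t @[t --> b])); last exact: (der_cvg ub).
    apply: near_eq_cvg; near=> t; rewrite gt_eqF//; near: t; exact: lt_nbhsr.
rewrite in_itv/= => /andP[c0 cb] cmax.
have uM s : 0 < s <= b -> `|u s| <= v c.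
  move=> /andP[s0 ss1]; have := cmax s; rewrite in_itv/= (ltW s0) ss1 => /(_ isT).
  by rewrite {1}/v (gt_eqF s0).
suff M2 : v c <= 2 * `|u0| by move=> s /uM /le_trans; apply.
have [c_0|cn0] := eqVneq c 0.
  by rewrite /v c_0 eqxx; have := normr_ge0 u0; lra.
have c_gt0 : 0 < c by rewrite lt_def cn0.
have := H _ uM c; rewrite c_gt0 cb => /(_ isT) Hc.
have vE : v c = `|u c| by rewrite /v (negbTE cn0).
have M0 : 0 <= v c by rewrite normr_ge0.
have := ler_wpM2r M0 e2; have := ler_normD (u c - u0) u0; rewrite subrK -vE; lra.
Unshelve. all: by end_near. Qed.

End SupBound.

(** * Primitives of functions continuous on the open half-line *)

Section Primitives.
Context {R : realType}.
Notation mu := (@lebesgue_measure R).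
Implicit Types f : R -> R.

(** The WKB coefficients divide by [s], so continuity and bounds are available only for [s > 0]. The
    value at 0, fixed by the convention on division by zero, does not affect integrals but must
    enter the bound, hence the maximum with [|f 0|]. *)
Lemma integrable_locally_bounded f (b K : R) :
  (forall x : R, 0 < x -> {for x, continuous f}) ->
  (forall x : R, 0 < x <= b -> `|f x| <= K) -> mu.-integrable `[0, b] (EFin \o f).
Proof.
move=> cf fK.
have mf : measurable_fun `[0, b] f.
  apply/measurable_fun_itv_obnd_cbndP.
  apply: (measurable_funS (E := `]0, +oo[%classic : set R)) => //.
    by move=> x /=; rewrite !in_itv/= => /andP[->].
  apply: open_continuous_measurable_fun; first exact: interval_open.
  by move=> x; rewrite inE/= in_itv/= andbT; exact: cf.
apply: measurable_bounded_integrable => //.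
- by rewrite /= lebesgue_measure_itv/=; case: ifPn => // _; rewrite ltry.
- exists (Num.max K `|f 0|); split; first exact: num_real.
  move=> M KM x /=; rewrite in_itv/= => /andP[]; rewrite le_eqVlt.
  move: KM; rewrite gt_max => /andP[KM fM] /orP[/eqP <- _|x0 xb]; first exact: ltW.
  by rewrite (le_trans _ (ltW KM))// fK// x0.
Qed.

Lemma primitive_der f (K : R -> R) (x : R) : 0 < x ->
  (forall y, 0 < y -> {for y, continuous f}) ->
  (forall b y, 0 < y <= b -> `|f y| <= K b) ->
  der x (fun y => \int[mu]_(t in `[0, y]) f t)%R (f x).
Proof.
move=> x0 cf fK.
have xu : x < x + 1 by rewrite ltrDl.
have := @continuous_FTC1_closed R f 0 x (x + 1) xu _ x0 (cf _ x0).
case; first by apply: integrable_locally_bounded => // y; exact: fK.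
move=> df E; split; first exact: df.
by rewrite -derive1E; exact: E.
Qed.

Lemma primitive_bound f (K x : R) : 0 <= x ->
  (forall y, 0 < y -> {for y, continuous f}) ->
  (forall y, 0 < y <= x -> `|f y| <= K) ->
  `|\int[mu]_(t in `[0, x]) f t| <= K * x.
Proof.
move=> x0 cf fK.
have [->|x0'] := eqVneq x 0; first by rewrite set_itv1 Rintegral_set1 normr0 mulr0.
have xp : 0 < x by rewrite lt_def x0' x0.
have intf : mu.-integrable `]0, x] (EFin \o f).
  apply: integrableS (integrable_locally_bounded cf fK) => //.
  by move=> t /=; rewrite !in_itv/= => /andP[/ltW -> ->].
rewrite -Rintegral_itv_obnd_cbnd//.
apply: le_trans (le_normr_Rintegral _ _) _ => //.
have lex : (mu `]0%R, x]%classic < +oo)%E.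
  by rewrite /= lebesgue_measure_itv/= lte_fin xp -EFinB ltry.
have -> : K * x = (\int[mu]_(t in `]0%R, x]) K)%R.
  by rewrite Rintegral_cst//= lebesgue_measure_itv/= lte_fin xp -EFinB/= subr0.
apply: le_Rintegral => //.
- exact: (integrable_norm intf).
- apply/measurable_bounded_integrable => //.
  by exists `|K|; split => // M KM ? _ /=; exact: ltW.
Qed.

End Primitives.

(* [der_tac tac] differentiates a compound expression structurally; [tac] handles the atoms.  Side
   conditions of the rules for inverses and square roots are left as goals. *)
Ltac der_rec tac :=
  first [ tac
        | eapply derI
        | eapply derC
        | eapply derN; der_rec tac
        | eapply derX; der_rec tac
        | eapply derD; [der_rec tac | der_rec tac]
        | eapply derV; [der_rec tac | idtac]
        | eapply derM; [der_rec tac | der_rec tac]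
        | eapply der_expR; der_rec tac
        | eapply der_sin; der_rec tac
        | eapply der_cos; der_rec tac
        | eapply der_sqrt; [der_rec tac | idtac] ].
Ltac der_tac tac := eapply der_eq; [der_rec tac | idtac]; rewrite /=.

Ltac nz := rewrite ?andbT; repeat first [assumption | (apply/andP; split) | by rewrite pnatr_eq0
  | apply: lt0r_neq0; assumption | apply: mulf_neq0 | apply: expf_neq0
  | apply: invr_neq0].

Ltac nn := repeat first [assumption | exact: ler0n | exact: ler01 | exact: sqr_ge0
  | exact: expR_ge0 | exact: sqrtr_ge0 | exact: normr_ge0 | (apply: ltW; assumption)
  | apply: mulr_ge0 | apply: addr_ge0 | apply: divr_ge0 | rewrite invr_ge0 | apply: exprn_ge0].
Ltac pp := repeat first [assumption | exact: ltr01 | (rewrite ltr0n; done) | exact: expR_gt0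
  | rewrite sqrtr_gt0 | apply: mulr_gt0 | apply: divr_gt0 | rewrite invr_gt0 | apply: exprn_gt0
  | apply: addr_gt0].

(** * WKB coefficients *)

Section Bounded.
Context {R : realType}.
Implicit Types f g : R -> R.

Definition bdd f := exists K, forall s : R, 0 < s -> `|f s| <= K.

Lemma bdd_eq f g : (forall s : R, 0 < s -> f s = g s) -> bdd f -> bdd g.
Proof. by move=> fg [K fK]; exists K => s s0; rewrite -fg// fK. Qed.

Lemma bddC (c : R) : bdd (fun=> c).
Proof. by exists `|c|. Qed.

Lemma bddD f g : bdd f -> bdd g -> bdd (fun s => f s + g s).
Proof.
move=> [K fK] [M gM]; exists (K + M) => s s0.
by rewrite (le_trans (ler_normD _ _))// lerD// ?fK ?gM.
Qed.

Lemma bddN f : bdd f -> bdd (fun s => - f s).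
Proof. by move=> [K fK]; exists K => s s0; rewrite normrN fK. Qed.

Lemma bddM f g : bdd f -> bdd g -> bdd (fun s => f s * g s).
Proof.
move=> [K fK] [M gM]; exists (K * M) => s s0.
by rewrite normrM ler_pM// ?fK ?gM.
Qed.

End Bounded.

Ltac bdd_tac := repeat first [assumption | apply: bddD | apply: bddN | apply: bddM | apply: bddC].

Section WKBCoefficients.
Context {R : realType}.
Variables (B b a2 K0 kap : R) (U U1 U2 : R -> R).
Hypotheses (B0 : 0 < B) (b0 : 0 < b) (a20 : 0 < a2) (kap0 : 0 <= kap).
Hypothesis dU : forall s : R, 0 < s -> der s U (U1 s).
Hypothesis dU1 : forall s : R, 0 < s -> der s U1 (U2 s).
Hypothesis bU2 : forall s : R, 0 < s -> `|U2 s| <= K0.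
Hypothesis bU1 : forall s : R, 0 < s -> `|U1 s - kap| <= K0 * s.
Hypothesis bU : forall s : R, 0 < s -> `|U s - kap * s| <= K0 * s ^+ 2.
Hypothesis U0 : forall s : R, 0 < s -> 0 <= U s.
Hypothesis Ub : forall s : R, a2 < s -> U s = b /\ U1 s = 0.

(** With [V = s * wkb_W], the ansatz [exp (- (d / h + Q))] in [4 h^2 (s F')' = (V - Lam) F] gives
    the eikonal equation [4 s d'^2 = V] at leading order, so [wkb_p0 = d']. Factoring out [s] keeps
    [p0] regular at the origin, where its value is [wkb_p00]. *)
Definition wkb_W s := U s / s + B ^+ 2 / 4.
Definition wkb_p00 := Num.sqrt (kap + B ^+ 2 / 4) / 2.
Definition wkb_p0 s := Num.sqrt (wkb_W s) / 2.
Let N s := U1 s * s - U s.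
Definition wkb_p0' s := (U1 s * s - U s) / s ^+ 2 / (8 * wkb_p0 s).
Let p0'' s := (U2 s / s - 2 * N s / s ^+ 3) / (8 * wkb_p0 s)
              - (wkb_p0' s) ^+ 2 / wkb_p0 s.
(** The solution [Q'] of the transport equation at the next order in [h]. Subtracting [p00] makes
    the quotient by [s] bounded at the origin, which forces the first-order energy [4 * p00 * h]. *)
Definition wkb_p1 s := ((wkb_p0 s - wkb_p00) / s + wkb_p0' s) / (2 * wkb_p0 s).
Definition wkb_p1' s :=
  ((s * wkb_p0' s - (wkb_p0 s - wkb_p00)) / s ^+ 2 + p0'' s) / (2 * wkb_p0 s)
  - wkb_p1 s * wkb_p0' s / wkb_p0 s.

Local Notation W := wkb_W.
Local Notation p0 := wkb_p0.
Local Notation p00 := wkb_p00.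
Local Notation p0' := wkb_p0'.
Local Notation p1 := wkb_p1.
Local Notation p1' := wkb_p1'.

Lemma wkb_W_ge (s : R) : 0 < s -> B ^+ 2 / 4 <= W s.
Proof. by move=> s0; rewrite lerDr divr_ge0 ?(ltW s0)// U0. Qed.

Let B24 : 0 < B ^+ 2 / 4. Proof. by rewrite divr_gt0// exprn_gt0. Qed.

Let W_gt0 (s : R) : 0 < s -> 0 < W s.
Proof. by move=> s0; apply: lt_le_trans (wkb_W_ge s0). Qed.

Lemma wkb_p0_sqr (s : R) : 0 < s -> 4 * p0 s ^+ 2 = W s.
Proof.
move=> s0; rewrite /p0 expr_div_n sqr_sqrtr ?(ltW (W_gt0 s0))//.
by field.
Qed.

Lemma wkb_p0_ge (s : R) : 0 < s -> B / 4 <= p0 s.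
Proof.
move=> s0; have p0_ge0 : 0 <= p0 s by rewrite divr_ge0// sqrtr_ge0.
rewrite -ler_sqr ?nnegrE ?divr_ge0 ?(ltW B0)//.
have -> : (B / 4) ^+ 2 = B ^+ 2 / 4 / 4 by field.
by have := wkb_W_ge s0; rewrite -wkb_p0_sqr//; lra.
Qed.

Lemma wkb_p0_gt0 (s : R) : 0 < s -> 0 < p0 s.
Proof. by move=> s0; apply: lt_le_trans (wkb_p0_ge s0); rewrite divr_gt0. Qed.

Lemma wkb_p00_sqr : 4 * p00 ^+ 2 = kap + B ^+ 2 / 4.
Proof.
rewrite /p00 expr_div_n sqr_sqrtr; last by rewrite addr_ge0// ltW.
by field.
Qed.

Lemma wkb_p00_ge : B / 4 <= p00.
Proof.
have p00_ge0 : 0 <= p00 by rewrite divr_ge0// sqrtr_ge0.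
rewrite -ler_sqr ?nnegrE ?divr_ge0 ?(ltW B0)//.
have -> : (B / 4) ^+ 2 = B ^+ 2 / 4 / 4 by field.
by have := wkb_p00_sqr; have := kap0; lra.
Qed.

Let dW (s : R) : 0 < s -> der s W (N s / s ^+ 2).
Proof.
move=> s0; rewrite /W.
der_tac ltac:(eapply dU); rewrite ?gt_eqF//.
by rewrite /N; field; rewrite gt_eqF.
Qed.

Lemma wkb_dp0 (s : R) : 0 < s -> der s p0 (p0' s).
Proof.
move=> s0; have Ws := W_gt0 s0; rewrite /p0.
der_tac ltac:(eapply dW) => //.
by rewrite /p0' /p0 /N; field; rewrite !gt_eqF//= sqrtr_gt0.
Qed.

Let dp0' (s : R) : 0 < s -> der s p0' (p0'' s).
Proof.
move=> s0; have p0s := wkb_p0_gt0 s0; rewrite /p0'.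
der_tac ltac:(first [eapply dU1 | eapply dU | eapply wkb_dp0]); try assumption; try by nz.
by rewrite /p0'' /p0' /N /=; field; nz.
Qed.

Lemma wkb_dp1 (s : R) : 0 < s -> der s p1 (p1' s).
Proof.
move=> s0; have p0s := wkb_p0_gt0 s0; rewrite /p1.
der_tac ltac:(first [eapply dp0' | eapply wkb_dp0]); try assumption; try by nz.
by rewrite /p1' /p1 /=; field; nz.
Qed.

Lemma wkb_transport (s : R) : 0 < s ->
  8 * s * p0 s * p1 s = 4 * (s * p0' s + p0 s) - 4 * p00.
Proof.
by move=> s0; have p0s := wkb_p0_gt0 s0; rewrite /p1; field; nz.
Qed.

Let N_le (s : R) : 0 < s -> `|N s| <= 2 * K0 * s ^+ 2.
Proof.
move=> s0; have -> : N s = (U1 s - kap) * s - (U s - kap * s) by rewrite /N; ring.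
apply: le_trans (ler_normB _ _) _; rewrite normrM (gtr0_norm s0).
have := bU s0; have : `|U1 s - kap| * s <= K0 * s * s by rewrite ler_pM2r ?bU1.
by rewrite expr2; lra.
Qed.

(** It suffices to bound [W], because [p0 <= 1 + 4 * p0 ^+ 2]. For [s <= a2] the Taylor bounds at
    the bottom of the well apply; beyond, [U] is the constant [b] and [U / s] decreases. [bdd_sN]
    splits in the same way. *)
Lemma wkb_bdd_p0 : bdd p0.
Proof.
exists (1 + B ^+ 2 / 4 + kap + K0 * a2 + b / a2) => s s0.
have p0s := wkb_p0_gt0 s0; rewrite gtr0_norm//.
have K00 : 0 <= K0 by apply: le_trans (bU2 s0).
have p0W : p0 s <= 1 + W s by rewrite -wkb_p0_sqr//; nra.
suff : U s / s <= kap + K0 * a2 + b / a2 by move: p0W; rewrite /W; lra.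
rewrite ler_pdivrMr//; have [sa|sa] := leP s a2.
- have := ler_normlW (bU s0).
  have Ks : K0 * s ^+ 2 <= K0 * a2 * s by rewrite expr2 mulrA ler_pM2r// ler_wpM2l.
  have : 0 <= b / a2 * s by rewrite mulr_ge0 ?divr_ge0 ?ltW.
  by lra.
- have [-> _] := Ub sa.
  have : b / a2 * a2 <= b / a2 * s by rewrite ler_wpM2l ?divr_ge0 ?ltW.
  rewrite divfK ?gt_eqF//.
  have : 0 <= kap * s by rewrite mulr_ge0// ltW.
  have : 0 <= K0 * a2 * s by rewrite !mulr_ge0// ltW.
  by lra.
Qed.

Let bddV : bdd (fun s => (p0 s)^-1).
Proof.
exists (4 / B) => s s0; have p0s := wkb_p0_gt0 s0.
rewrite gtr0_norm ?invr_gt0// -invf_div.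
have B4 : 0 < B / 4 by rewrite divr_gt0.
by rewrite lef_pV2//; exact: wkb_p0_ge.
Qed.

Let NN_le (s : R) : 0 < s -> `|N s / s ^+ 2| <= 2 * K0.
Proof.
move=> s0; rewrite normrM normfV [`|s ^+ 2|]gtr0_norm ?exprn_gt0//.
by rewrite ler_pdivrMr ?exprn_gt0// N_le.
Qed.

Let bdd_N : bdd (fun s => N s / s ^+ 2).
Proof. by exists (2 * K0); exact: NN_le. Qed.

Let bdd_sN : bdd (fun s => s * (N s / s ^+ 2)).
Proof.
exists (2 * K0 * a2 + b / a2) => s s0.
have K00 : 0 <= K0 by apply: le_trans (bU2 s0).
have [sa|sa] := leP s a2.
- apply: (@le_trans _ _ (2 * K0 * a2)); last by rewrite lerDl divr_ge0 ?ltW.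
  by rewrite normrM mulrC (gtr0_norm s0) ler_pM ?(ltW s0)// NN_le.
- apply: (@le_trans _ _ (b / a2)); last by rewrite lerDr !mulr_ge0// ltW.
  have [Us U1s] := Ub sa; rewrite /N Us U1s mul0r sub0r.
  have -> : s * (- b / s ^+ 2) = - (b / s) by field; rewrite gt_eqF.
  rewrite normrN gtr0_norm ?divr_gt0// ler_pM2l//.
  by rewrite lef_pV2 ?posrE// ltW.
Qed.

Let bdd_p0' : bdd p0'.
Proof.
apply: (bdd_eq (f := fun s => N s / s ^+ 2 * (8^-1 * (p0 s)^-1))); last by bdd_tac.
by move=> s s0; have p0s := wkb_p0_gt0 s0; rewrite /p0' /N; field; nz.
Qed.

Let bdd_sp0' : bdd (fun s => s * p0' s).
Proof.
apply: (bdd_eq (f := fun s => s * (N s / s ^+ 2) * (8^-1 * (p0 s)^-1))); last by bdd_tac.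
by move=> s s0; have p0s := wkb_p0_gt0 s0; rewrite /p0' /N; field; nz.
Qed.

(** Since [U2] is only bounded, [p0''] may grow like [1 / s] at the origin. The weight [s]
    compensates, and it is present where the second derivative is used: [gs_e] contains
    [s * p1']. *)
Let bdd_sp0'' : bdd (fun s => s * p0'' s).
Proof.
have bU2' : bdd U2 by exists K0.
apply: (bdd_eq (f := fun s => (U2 s - 2 * (N s / s ^+ 2)) * (8^-1 * (p0 s)^-1)
     - s * p0' s * p0' s * (p0 s)^-1)); last by bdd_tac.
move=> s s0; have p0s := wkb_p0_gt0 s0.
by rewrite /p0''; field; nz.
Qed.

(** The squares differ by [(U s - kap * s) / (4 * s)], at most [K0 * s / 4] in modulus, and
    [p0 + p00 >= B / 2]. *)
Lemma wkb_p0_sub (s : R) : 0 < s -> `|p0 s - p00| <= K0 / (2 * B) * s.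
Proof.
move=> s0; have p0s := wkb_p0_ge s0; have p00s := wkb_p00_ge; have B0' := B0.
have : `|p0 s - p00| * (p0 s + p00) <= K0 * s / 4.
  rewrite -[p0 s + p00]gtr0_norm; last by lra.
  rewrite -normrM; have -> : (p0 s - p00) * (p0 s + p00) = (U s - kap * s) / s / 4.
    transitivity ((4 * p0 s ^+ 2 - 4 * p00 ^+ 2) / 4); first by field.
    by rewrite wkb_p0_sqr// wkb_p00_sqr /W; field; rewrite gt_eqF.
  rewrite normrM [`|4^-1|]gtr0_norm// ler_pM2r// normrM normfV (gtr0_norm s0).
  by rewrite ler_pdivrMr// -mulrA -expr2 bU.
have : `|p0 s - p00| * (B / 2) <= `|p0 s - p00| * (p0 s + p00).
  by rewrite ler_wpM2l//; lra.
move=> /le_trans/[apply]; rewrite -ler_pdivlMr ?divr_gt0// => /le_trans; apply.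
by rewrite le_eqVlt; apply/orP; left; apply/eqP; field; rewrite gt_eqF.
Qed.

Let bdd_diff : bdd (fun s => (p0 s - p00) / s).
Proof.
exists (K0 / (2 * B)) => s s0.
by rewrite normrM normfV (gtr0_norm s0) ler_pdivrMr// wkb_p0_sub.
Qed.

Lemma wkb_bdd_p1 : bdd p1.
Proof.
apply: (bdd_eq (f := fun s => ((p0 s - p00) / s + p0' s) * (2^-1 * (p0 s)^-1))).
  by move=> s s0; have p0s := wkb_p0_gt0 s0; rewrite /p1; field; nz.
by bdd_tac.
Qed.

Lemma wkb_bdd_sp1 : bdd (fun s => s * p1 s).
Proof.
have := wkb_bdd_p0 => ?.
apply: (bdd_eq (f := fun s => ((p0 s - p00) + s * p0' s) * (2^-1 * (p0 s)^-1))).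
  by move=> s s0; have p0s := wkb_p0_gt0 s0; rewrite /p1; field; nz.
by bdd_tac.
Qed.

Lemma wkb_bdd_sp1' : bdd (fun s => s * p1' s).
Proof.
have := wkb_bdd_p1 => ?.
apply: (bdd_eq (f := fun s => (p0' s - (p0 s - p00) / s + s * p0'' s)
   * (2^-1 * (p0 s)^-1) - p1 s * (s * p0' s) * (p0 s)^-1)).
  by move=> s s0; have p0s := wkb_p0_gt0 s0; rewrite /p1'; field; nz.
by bdd_tac.
Qed.

End WKBCoefficients.

(** * The radial ground state on the half-line *)

Section GroundState.
Context {R : realType}.
Variables (B b a2 p00 K : R) (V p0 p0' p1 p1' d Q : R -> R).
Hypotheses (B0 : 0 < B) (b0 : 0 < b) (a20 : 0 < a2) (K1 : 1 <= K).
Hypothesis p0_sqr : forall s : R, 0 < s -> 4 * s * p0 s ^+ 2 = V s.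
Hypothesis p0_ge : forall s : R, 0 < s -> B / 4 <= p0 s.
Hypothesis p0_le : forall s : R, 0 < s -> p0 s <= K.
Hypothesis transport : forall s : R, 0 < s ->
  8 * s * p0 s * p1 s = 4 * (s * p0' s + p0 s) - 4 * p00.
Hypothesis dp0 : forall s : R, 0 < s -> der s p0 (p0' s).
Hypothesis dp1 : forall s : R, 0 < s -> der s p1 (p1' s).
Hypothesis p1_le : forall s : R, 0 < s -> `|p1 s| <= K.
Hypothesis sp1_le : forall s : R, 0 < s -> `|s * p1 s| <= K.
Hypothesis sp1'_le : forall s : R, 0 < s -> `|s * p1' s| <= K.
Hypothesis dd : forall s : R, 0 < s -> der s d (p0 s).
Hypothesis dQ : forall s : R, 0 < s -> der s Q (p1 s).
Hypothesis d_bound : forall s : R, 0 < s -> B / 4 * s <= d s <= K * s.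
Hypothesis Q_bound : forall s : R, 0 < s -> `|Q s| <= K * s.
Hypothesis Vb : forall s : R, a2 < s -> b <= V s.

Variables (h Lam : R) (F F1 F2 : R -> R).
Hypothesis h0 : 0 < h.
Hypothesis dF : forall s : R, 0 < s -> der s F (F1 s).
Hypothesis dF1 : forall s : R, 0 < s -> der s F1 (F2 s).
Hypothesis ode : forall s : R, 0 < s ->
  4 * h ^+ 2 * (s * F2 s + F1 s) = (V s - Lam) * F s.
Hypothesis F_0 : F s @[s --> 0^'+] --> F 0.
Hypothesis sF1_0 : s * F1 s @[s --> 0^'+] --> (0 : R).
Hypothesis F_inf : forall X e : R, 0 < e -> exists2 s, X < s &
  s * F s ^+ 2 <= e /\ s * F1 s ^+ 2 <= e.
Hypothesis F_neq0 : exists2 s, 0 < s & F s != 0.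

(** [gs_mu] measures how far the energy is from its harmonic value [4 * p00 * h], on the scale
    [h ^+ 2]; [gs_e] is what the first-order WKB function leaves uncancelled. The extra parameter
    [k] of [gs_psi] tilts the exponent and produces super- and subsolutions. *)
Definition gs_mu := (4 * p00 * h - Lam) / (4 * h ^+ 2).
Definition gs_e s := s * p1 s ^+ 2 - s * p1' s - p1 s.
Definition gs_P s := p0 s / h + p1 s.
Definition gs_psi (k s : R) := expR (- (d s / h + Q s + k * s)).
Local Notation mu := gs_mu.
Local Notation e := gs_e.
Local Notation P := gs_P.
Local Notation psi := gs_psi.

Lemma gs_e_le (s : R) : 0 < s -> `|e s| <= 3 * K ^+ 2.
Proof.
move=> s0; have K1' := K1; have p1s := p1_le s0; have := sp1'_le s0; have := sp1_le s0.
have : `|s * p1 s ^+ 2| <= K ^+ 2.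
  by rewrite expr2 mulrA normrM expr2 ler_pM// sp1_le.
rewrite /e; move=> H1 H2 H3.
apply: le_trans (ler_normB _ _) _.
have := ler_normB (s * p1 s ^+ 2) (s * p1' s).
have : K <= K ^+ 2 by nra.
lra.
Qed.

(* The residual of the WKB function [exp (-(d / h + Q))] reduces to [mu - e] by the eikonal and
   transport equations. *)
Lemma gs_residual (k s : R) : 0 < s ->
  (V s - Lam) / (4 * h ^+ 2) + (P s + k) + s * (p0' s / h + p1' s) - s * (P s + k) ^+ 2
  = mu - e s + k * (1 - 2 * s * P s) - s * k ^+ 2.
Proof.
move=> s0; rewrite -p0_sqr//.
rewrite /mu.
have E : 4 * p00 = 4 * (s * p0' s + p0 s) - 8 * s * p0 s * p1 s by rewrite transport//; ring.
rewrite E /e /P; field; nz.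
Qed.

Lemma gs_psi_gt0 k s : 0 < psi k s. Proof. exact: expR_gt0. Qed.

Lemma gs_dpsi (k s : R) : 0 < s -> der s (psi k) (- (P s + k) * psi k s).
Proof.
move=> s0; rewrite /psi; der_tac ltac:(first [eapply dd|eapply dQ]) => //.
by rewrite /P; ring.
Qed.

Lemma gs_dP (s : R) : 0 < s -> der s P (p0' s / h + p1' s).
Proof.
move=> s0; rewrite /P; der_tac ltac:(first [eapply dp0|eapply dp1]) => //.
by ring.
Qed.

(** This is [s * psi ^+ 2 * (F / psi)'], because [psi' = - (P + k) * psi]. In this form the equation
    has no zeroth-order part left: the derivative of [y] is [psi * F] times the WKB residual, so
    bounds on the residual integrate directly. *)
Definition gs_y (k s : R) := s * psi k s * (F1 s + (P s + k) * F s).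
Local Notation y := gs_y.

Lemma gs_ode (s : R) : 0 < s -> s * F2 s = (V s - Lam) / (4 * h ^+ 2) * F s - F1 s.
Proof. by move=> s0; rewrite mulrAC -ode//; field; nz. Qed.

Lemma gs_dy (k s : R) : 0 < s ->
  der s (y k) (psi k s * F s * (mu - e s + k * (1 - 2 * s * P s) - s * k ^+ 2)).
Proof.
move=> s0; rewrite /y.
der_tac ltac:(first [eapply gs_dpsi|eapply gs_dP|eapply dF|eapply dF1]) => //.
rewrite -gs_residual//.
transitivity (psi k s * (F1 s + (P s + k) * F s)
  + psi k s * (s * F2 s + s * (p0' s / h + p1' s) * F s + s * (P s + k) * F1 s
   - s * (P s + k) * (F1 s + (P s + k) * F s))); first by ring.
by rewrite gs_ode//; ring.
Qed.

(** The energy identity of the radial equation. Both terms are nonnegative wherever [V >= Lam], so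
    beyond the well it controls the sign of [F * F1] and the mass of [F ^+ 2]. *)
Lemma gs_dFF1 (s : R) : 0 < s -> der s (fun s => s * (F s * F1 s))
  (s * F1 s ^+ 2 + (V s - Lam) / (4 * h ^+ 2) * F s ^+ 2).
Proof.
move=> s0; der_tac ltac:(first [eapply dF|eapply dF1]) => //.
transitivity (s * F1 s ^+ 2 + F s * (s * F2 s + F1 s)); first by ring.
by rewrite gs_ode//; ring.
Qed.

Lemma gs_P_le (s : R) : 0 < s -> h <= 1 -> `|P s| <= 2 * K / h.
Proof.
move=> s0 h1; have := p1_le s0; have := p0_le s0; have := p0_ge s0.
have B0' := B0; have K1' := K1.
move=> H1 H2 H3; rewrite /P; apply: le_trans (ler_normD _ _) _.
rewrite normrM normfV (gtr0_norm h0) [`|p0 s|]gtr0_norm; last by lra.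
have : p0 s / h <= K / h by rewrite ler_pM2r ?invr_gt0.
have : K <= K / h by rewrite ler_pdivlMr//; nra.
by lra.
Qed.

Hypothesis h1 : h <= 1.

Let FF1_small (s eps : R) : 0 < s -> s * F s ^+ 2 <= eps -> s * F1 s ^+ 2 <= eps ->
  `|s * (F s * F1 s)| <= eps.
Proof.
move=> s0 H1 H2; have : 0 <= s * (F s - F1 s) ^+ 2 by rewrite mulr_ge0 ?sqr_ge0 ?ltW.
have : 0 <= s * (F s + F1 s) ^+ 2 by rewrite mulr_ge0 ?sqr_ge0 ?ltW.
by rewrite ler_norml => ? ?; apply/andP; split; lra.
Qed.

(* If [mu] exceeded the bound on [e], then [s psi^2 u u'] with [u = F / psi] would be strictly
   increasing between its two zero limits. *)
Lemma gs_mu_le : mu <= 3 * K ^+ 2.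
Proof.
rewrite leNgt; apply/negP => muK.
(* With [u = F / psi] and [k = 0] this is [s * psi ^+ 2 * u * u'], written without [psi]; its
   derivative is a square plus [F ^+ 2 * (mu - e)]. *)
pose G (s : R) := s * (F s * F1 s) + s * P s * F s ^+ 2.
have emu (s : R) : 0 < s -> 0 < mu - e s.
  by move=> /gs_e_le; rewrite ler_norml; lra.
have dG (s : R) : 0 < s -> der s G (s * (F1 s + P s * F s) ^+ 2 + F s ^+ 2 * (mu - e s)).
  move=> s0; have := gs_residual 0 s0; rewrite !(mul0r, addr0, expr0n, mulr0, subr0)/= => E.
  apply: der_eq.
    apply: derD; first exact: gs_dFF1.
    by der_rec ltac:(first [eapply gs_dP|eapply dF]).
  by rewrite /= -E; ring.
have dG0 (s : R) : 0 < s -> 0 <= s * (F1 s + P s * F s) ^+ 2 + F s ^+ 2 * (mu - e s).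
  move=> s0; have := emu s s0 => /ltW es.
  by apply: addr_ge0; apply: mulr_ge0 => //; rewrite ?sqr_ge0 ?(ltW s0).
have G_0 : G s @[s --> 0^'+] --> (0 : R).
  suff : G s @[s --> 0^'+] --> F 0 * 0 + 0 by rewrite mulr0 addr0.
  apply: cvgD.
    have -> : (fun s => s * (F s * F1 s)) = (fun s => F s * (s * F1 s)).
      by apply/funext => s; ring.
    exact: (cvgM F_0 sF1_0).
  apply: (@cvg0_norm_le _ _ (fun s => 2 * K / h * (s * F s ^+ 2))) => [s s0|].
    have -> : s * P s * F s ^+ 2 = P s * (s * F s ^+ 2) by ring.
    rewrite normrM [X in _ * X]ger0_norm; last first.
      by rewrite mulr_ge0 ?sqr_ge0// ltW.
    by rewrite ler_wpM2r ?gs_P_le// mulr_ge0 ?sqr_ge0// ltW.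
  suff : 2 * K / h * (s * F s ^+ 2) @[s --> 0^'+] --> 2 * K / h * (0 * (F 0 * F 0)).
    by rewrite mul0r mulr0.
  apply: cvgM; first exact: cvg_cst.
  apply: cvgM; first exact: cvg_right_id.
  under eq_fun do rewrite expr2.
  exact: (cvgM F_0 F_0).
have Gge (s : R) : 0 < s -> 0 <= G s.
  move=> s0; apply: (der_mono0 s0 G_0) => x /andP[x0 _]; [exact: dG|exact: dG0].
have Gle (s : R) : 0 < s -> G s <= 0.
  move=> s0; apply/ler_addgt0Pl => eps eps0; rewrite addr0.
  have e'0 : 0 < eps / (1 + 2 * K / h).
    by rewrite divr_gt0// ltr_wpDr// divr_ge0 ?(ltW h0)//; have := K1; lra.
  have [t st [H1 H2]] := F_inf s e'0.
  have t0 : 0 < t by apply: lt_trans st.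
  have : G s <= G t.
    apply: (der_mono (ltW st) (df := fun s => s * (F1 s + P s * F s) ^+ 2 + F s ^+ 2 * (mu - e s))) => x /andP[sx _];
    have x0 := lt_le_trans s0 sx; [exact: dG|exact: dG0].
  move=> /le_trans; apply; rewrite /G.
  have := ler_normlW (FF1_small t0 H1 H2).
  have : t * P t * F t ^+ 2 <= 2 * K / h * (eps / (1 + 2 * K / h)).
    have := ler_normlW (gs_P_le t0 h1) => PK.
    rewrite mulrAC mulrC; apply: (@le_trans _ _ (2 * K / h * (t * F t ^+ 2))).
      by rewrite ler_wpM2r// mulr_ge0 ?sqr_ge0// ltW.
    by rewrite ler_wpM2l// divr_ge0 ?(ltW h0)//; have := K1; lra.
  move=> H3 H4; apply: le_trans (lerD H4 H3) _.
  have e2 : 0 < 1 + 2 * K / h by rewrite ltr_wpDr// divr_ge0 ?(ltW h0)//; have := K1; lra.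
  rewrite -[X in X + _]mul1r -mulrDl mulrC divfK//; exact: lt0r_neq0.
(* Squeezed between its two limits, [G] vanishes identically, and so does its derivative; but that
   derivative is positive wherever [F] is not zero. *)
have [s s0 Fs] := F_neq0.
have G0 (t : R) : 0 < t -> G t = 0 by move=> t0; apply/eqP; rewrite eq_le Gle// Gge.
have := dG s s0; have : der s G 0.
  apply: (@der_near _ (fun=> 0)); last exact: derC.
  by near=> t; rewrite G0//; near: t; exact: lt_nbhsr.
move=> /der_uniq/[apply]/eqP; rewrite eq_sym paddr_eq0.
- by rewrite [X in _ && X]mulf_eq0 sqrf_eq0 (negbTE Fs) [mu - _ == _]gt_eqF ?emu//= andbF.
- by rewrite mulr_ge0 ?sqr_ge0 ?(ltW s0).
- by have := emu s s0 => /ltW es; rewrite mulr_ge0 ?sqr_ge0.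
Unshelve. all: by end_near. Qed.

Hypothesis mu_ge : - (3 * K ^+ 2) <= mu.
Hypothesis Lam_le : Lam <= b / 2.
(** Chosen so that beyond [a2] the tilt by [k = kk * h] dominates the residual: [h * P >= B / 8]
    gives [k * 2 * s * P >= kk * a2 * B / 4 = 24 * K ^+ 2], against [|mu - e| <= 6 * K ^+ 2]. *)
Let kk := 96 * K ^+ 2 / (a2 * B).
Hypothesis hs : h * (16 * (K + kk + 1 + a2^-1)) <= B.

Let KK : 1 <= K ^+ 2. Proof. by have := K1; nra. Qed.

Let kk_gt0 : 0 < kk.
Proof. by have KK' := KK; apply: divr_gt0; [lra|exact: mulr_gt0]. Qed.

Let kkE : kk * a2 * B = 96 * K ^+ 2.
Proof. by rewrite /kk; field; nz. Qed.

Let hsE : [/\ h * K <= B / 16, h * kk <= B / 16, h <= B / 16 & 16 * h <= B * a2].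
Proof.
have a2V : 0 < a2^-1 by rewrite invr_gt0.
have K1' := K1; have kk0 := kk_gt0; have h0' := h0; have hs' := hs.
have H1 : 0 <= h * K by nra.
have H2 : 0 <= h * kk by nra.
have H3 : 0 <= h * a2^-1 by nra.
split; [lra|lra|lra|].
suff : 16 * (h * a2^-1) * a2 <= B * a2 by rewrite -!mulrA mulVf ?mulr1//; nz.
by rewrite ler_pM2r//; lra.
Qed.

Lemma gs_res_le (s : R) : 0 < s -> `|mu - e s| <= 6 * K ^+ 2.
Proof.
by move=> /gs_e_le; have := gs_mu_le; have := mu_ge; rewrite !ler_norml; lra.
Qed.

Lemma gs_P_ge (s : R) : 0 < s -> B / 8 <= h * P s.
Proof.
move=> s0; rewrite /P mulrDr mulrCA divff ?mulr1; last by nz.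
have := p0_ge s0; have := p1_le s0; rewrite ler_norml => /andP[p1s _].
have [hK _ _ _] := hsE; have h0' := h0.
have : - (h * K) <= h * p1 s by rewrite -mulrN ler_pM2l.
have := B0; lra.
Qed.

(** Beyond the well the energy identity makes [s * F * F1] nondecreasing, and it is arbitrarily
    small at suitable points near infinity. *)
Lemma gs_FF1_le0 (s : R) : a2 < s -> s * (F s * F1 s) <= 0.
Proof.
move=> as_; have s0 : 0 < s by apply: lt_trans as_.
apply/ler_addgt0Pl => eps eps0; rewrite addr0.
have [t st [H1 H2]] := F_inf s eps0.
have t0 : 0 < t by apply: lt_trans st.
apply: le_trans (ler_normlW (FF1_small t0 H1 H2)).
apply: (der_mono (ltW st) (f := fun s => s * (F s * F1 s))) => x /andP[sx _].
  by apply: gs_dFF1; apply: lt_le_trans sx.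
have x0 : 0 < x by apply: lt_le_trans sx.
have := Vb (lt_le_trans as_ sx); have := Lam_le; have b0' := b0; move=> H3 H4.
apply: addr_ge0; first by rewrite mulr_ge0 ?sqr_ge0// ltW.
rewrite mulr_ge0 ?sqr_ge0// divr_ge0//; first by lra.
by apply: mulr_ge0 => //; exact: sqr_ge0.
Qed.

Lemma gs_FF_nonincr (s t : R) : a2 < s -> s <= t -> F t ^+ 2 <= F s ^+ 2.
Proof.
move=> as_ st; rewrite -lerN2.
apply: (der_mono st (f := fun t => - F t ^+ 2) (df := fun t => - (2 * (F t * F1 t)))).
  move=> x /andP[sx _].
  have x0 : 0 < x by apply: lt_le_trans sx; apply: lt_trans as_.
  by der_tac ltac:(eapply dF) => //; ring.
move=> x /andP[sx _].
have x0 : 0 < x by apply: lt_le_trans sx; apply: lt_trans as_.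
by have := gs_FF1_le0 (lt_le_trans as_ sx); rewrite pmulr_rle0//; lra.
Qed.

(** A change of sign would produce a zero of [F], and [F ^+ 2] is nonincreasing beyond the well, so
    [F] would stay zero after it. *)
Lemma gs_F_ge0 (s t : R) : a2 < s -> s <= t -> 0 <= F s -> 0 <= F t.
Proof.
move=> as_ st Fs; rewrite leNgt; apply/negP => Ft.
have s0 : 0 < s by apply: lt_trans as_.
have [||c] := @IVT R F s t 0 st.
- apply: derivable_within_continuous => x; rewrite in_itv/= => /andP[sx _].
  by have [] := dF (lt_le_trans s0 sx).
- by rewrite ge_min (ltW Ft) orbT le_max Fs.
rewrite in_itv/= => /andP[sc ct] Fc.
have := gs_FF_nonincr (lt_le_trans as_ sc) ct; rewrite Fc expr0n/=.
by rewrite real_leNgt ?num_real// exprn_even_gt0//= lt_eqF.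
Qed.

Lemma gs_psi_le (k s : R) : 0 < s -> - kk * h <= k -> s * psi k s <= 1.
Proof.
move=> s0 kk_k; rewrite /psi expRN -ler_pdivlMr ?invr_gt0 ?expR_gt0// invrK mul1r.
have sx : s <= d s / h + Q s + k * s.
  have /andP[d_s _] := d_bound s0; have := Q_bound s0; rewrite ler_norml => /andP[Qs _].
  have [hK hkk hB _] := hsE; have h0' := h0; have h1' := h1; have kk0 := kk_gt0.
  have : (K + kk + 1) * s <= d s / h by rewrite ler_pdivlMr//; nra.
  have : - kk * s <= k * s by rewrite ler_pM2r//; nra.
  by lra.
have := expR_ge1Dx (d s / h + Q s + k * s); lra.
Qed.

Let y_small (k s eps : R) : 1 <= s -> `|k| <= kk * h -> 0 < eps ->
  s * F s ^+ 2 <= eps ^+ 2 -> s * F1 s ^+ 2 <= eps ^+ 2 ->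
  `|y k s| <= (1 + 2 * K / h + kk) * eps.
Proof.
move=> s1 kle eps0 H1 H2; have s0 : 0 < s by apply: lt_le_trans s1.
have sqr_small (x : R) : s * x ^+ 2 <= eps ^+ 2 -> `|x| <= eps.
  move=> H; rewrite -ler_sqr ?nnegrE ?(ltW eps0)// real_normK ?num_real//.
  by apply: le_trans H; rewrite ler_peMl ?sqr_ge0.
have := sqr_small _ H1; have := sqr_small _ H2 => F1e Fe.
rewrite /y normrM -[leRHS]mul1r; apply: ler_pM => //.
  rewrite ger0_norm; last by rewrite mulr_ge0 ?expR_ge0 ?(ltW s0).
  apply: gs_psi_le => //; move: kle; rewrite ler_norml mulNr => /andP[//].
apply: le_trans (ler_normD _ _) _; rewrite normrM.
have -> : (1 + 2 * K / h + kk) * eps = eps + (2 * K / h + kk) * eps by ring.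
apply: lerD => //.
apply: ler_pM => //; apply: le_trans (ler_normD _ _) _; apply: lerD; first exact: gs_P_le.
by apply: (le_trans kle); rewrite ler_piMr// ltW.
Qed.

Let y_limit (k s eps : R) : 0 < s -> `|k| <= kk * h -> 0 < eps ->
  exists2 t, s < t & `|y k t| <= eps.
Proof.
move=> s0 kle eps0.
have c0 : 0 < 1 + 2 * K / h + kk.
  have : 0 <= 2 * K / h by rewrite divr_ge0 ?(ltW h0)//; have := K1; lra.
  by have := kk_gt0; lra.
have e'0 : 0 < eps / (1 + 2 * K / h + kk) by rewrite divr_gt0.
have [t] := F_inf (Num.max s 1) (exprn_gt0 2 e'0).
rewrite gt_max => /andP[st t1] [H1 H2]; exists t => //.
apply: (le_trans (y_small (ltW t1) kle e'0 H1 H2)).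
by rewrite mulrC divfK//; nz.
Qed.

(* Comparison at infinity with the WKB function corrected by [exp (-+ kk h s)], which is a
   super- resp. subsolution beyond the support of the well. *)
Lemma gs_boundary_pos (s : R) : a2 < s -> 0 <= F s ->
  `|F1 s + P s * F s| <= kk * h * F s.
Proof.
move=> as_ Fs; have s0 : 0 < s by apply: lt_trans as_.
have kh0 : 0 < kk * h by rewrite mulr_gt0.
have [hK hkk hB ha] := hsE; have kk0 := kk_gt0; have h0' := h0; have KK' := KK.
have B0' := B0; have a20' := a20; have kkE' := kkE.
have y_sgn (k t : R) : 0 < t -> (0 <= y k t) = (0 <= F1 t + (P t + k) * F t).
  by move=> t0; rewrite pmulr_rge0 ?mulr_gt0 ?expR_gt0.
have y_sgn' (k t : R) : 0 < t -> (y k t <= 0) = (F1 t + (P t + k) * F t <= 0).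
  by move=> t0; rewrite pmulr_rle0 ?mulr_gt0 ?expR_gt0.
have key (t : R) : s <= t -> [/\ 0 < t, 0 <= psi (kk * h) t * F t,
    0 <= psi (- (kk * h)) t * F t, `|mu - e t| <= 6 * K ^+ 2
    & 24 * K ^+ 2 <= kk * h * (2 * t * P t) /\ kk * t * B <= 4 * (kk * h * (2 * t * P t))].
  move=> st; have t0 : 0 < t by apply: lt_le_trans st.
  have Ft := gs_F_ge0 as_ st Fs.
  have kt : kk * t * B <= 4 * (kk * h * (2 * t * P t)).
    have : kk * t * (B / 8) <= kk * t * (h * P t) by apply: ler_wpM2l; [rewrite mulr_ge0 ?ltW|exact: gs_P_ge].
    by lra.
  split => //; rewrite ?mulr_ge0 ?expR_ge0//; first exact: gs_res_le.
  split => //; have : kk * B * a2 <= kk * B * t.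
    by apply: ler_wpM2l; [rewrite mulr_ge0 ?ltW|apply: le_trans st; exact: ltW].
  by lra.
have kk6 : kk * h <= 6 * K ^+ 2.
  have : kk * (16 * h) <= kk * (B * a2) by rewrite ler_pM2l.
  by lra.
have up : 0 <= F1 s + (P s + kk * h) * F s.
  rewrite -y_sgn// -oppr_le0; apply/ler_addgt0Pl => eps eps0; rewrite addr0.
  have kle : `|kk * h| <= kk * h by rewrite gtr0_norm.
  have [t st yt] := y_limit s0 kle eps0.
  have yt' : - y (kk * h) t <= eps by move: yt; rewrite ler_norml; lra.
  apply: le_trans yt'.
  apply: (der_mono (ltW st) (f := fun s => - y (kk * h) s)) => x /andP[sx _];
    have [x0 pF _ mue [k1 k2]] := key x sx; first by apply: derN; exact: gs_dy.
  rewrite oppr_ge0 mulr_ge0_le0//.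
  have : 0 <= x * (kk * h) ^+ 2 by rewrite mulr_ge0 ?sqr_ge0// ltW.
  by move: mue; rewrite ler_norml => /andP[_]; lra.
have dn : F1 s + (P s - kk * h) * F s <= 0.
  rewrite -y_sgn'//; apply/ler_addgt0Pl => eps eps0; rewrite addr0.
  have kle : `|- (kk * h)| <= kk * h by rewrite normrN gtr0_norm.
  have [t st yt] := y_limit s0 kle eps0.
  apply: le_trans (ler_normlW yt).
  apply: (der_mono (ltW st) (f := y (- (kk * h)))) => x /andP[sx _];
    have [x0 _ pF mue [k1 k2]] := key x sx; first exact: gs_dy.
  rewrite mulr_ge0//.
  (* For the negative tilt the quadratic term has the unfavourable sign; it is at most a quarter of
     the good term [kk * h * (2 * x * P x)]. *)
  have : x * (kk * h) ^+ 2 <= kk * x * B / 16.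
    have : kk * x * (kk * h * h) <= kk * x * (B / 16).
      by apply: ler_wpM2l; [rewrite mulr_ge0 ?ltW|have := h1; nra].
    by lra.
  by move: mue; rewrite ler_norml sqrrN => /andP[+ _]; lra.
by rewrite ler_norml; apply/andP; split; lra.
Qed.

Variable s1 : R.
Hypotheses (as1 : a2 < s1) (Fs1 : 0 <= F s1) (d_0 : d 0 = 0) (Q_0 : Q 0 = 0).
Let s10 : 0 < s1. Proof. exact: lt_trans as1. Qed.

(** In [K2], [s1 * kk] covers the boundary value at [s1], and [24 * K ^+ 2 / B] makes the barrier
    [psi ^+ 2] dominate the residual. [E] bounds [psi ^+ 2] on []0, s1]], only [Q] contributing
    since [d >= 0]. [K4] bounds [u'] in both regimes [s <= h] and [s > h], and [K5] arises from it
    by integrating [1 / sqrt s] up to [s1]. *)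
Definition gs_K2 := s1 * kk + 24 * K ^+ 2 / B.
Definition gs_E := expR (2 * K * s1).
Definition gs_K4 := gs_K2 + 6 * K ^+ 2 * gs_E * expR (4 * K).
Definition gs_K5 := 2 * gs_K4 * Num.sqrt s1.
Local Notation K2 := gs_K2.
Local Notation E := gs_E.
Local Notation K4 := gs_K4.
Local Notation K5 := gs_K5.
Hypothesis hs5 : K5 * Num.sqrt h <= 2^-1.

Let u s := F s / psi 0 s.

Let psiE (s : R) : psi 0 s = expR (- (d s / h + Q s)).
Proof. by rewrite /psi mul0r addr0. Qed.

Let K2_gt0 : 0 < K2.
Proof.
have KK' := KK; apply: addr_gt0; first exact: mulr_gt0.
by apply: divr_gt0 => //; lra.
Qed.

Let K24 : K2 <= K4.
Proof. by rewrite /K4 lerDl; nn. Qed.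

Let d_cvg0 : d x @[x --> 0^'+] --> (0 : R).
Proof.
apply: (@cvg0_norm_le _ _ (fun x => K * x)) => [x x0|].
  have /andP[d1 d2] := d_bound x0; rewrite ger0_norm//; apply: le_trans d1.
  by rewrite mulr_ge0 ?ltW// divr_gt0.
by rewrite -[X in _ --> X](mulr0 K); apply: cvgMr; exact: cvg_right_id.
Qed.

Let psi_cvg0 : psi 0 s @[s --> 0^'+] --> psi 0 0.
Proof.
rewrite /psi; apply: continuous_cvg; first exact: continuous_expR.
apply: cvgN; apply: cvgD; last by apply: cvgMr; exact: cvg_right_id.
have Ks : K * x @[x --> 0^'+] --> 0.
  by rewrite -[X in _ --> X](mulr0 K); apply: cvgMr; exact: cvg_right_id.
apply: cvgD.
  by rewrite d_0; apply: cvgMl; exact: d_cvg0.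
by rewrite Q_0; apply: (cvg0_norm_le _ Ks) => x x0; exact: Q_bound.
Qed.

Let u_cvg0 : u s @[s --> 0^'+] --> F 0.
Proof.
have -> : F 0 = F 0 / psi 0 0.
  by rewrite psiE d_0 Q_0 mul0r addr0 oppr0 expR0 divr1.
apply: cvgM; first exact: F_0.
by apply: cvgV; [rewrite gt_eqF// expR_gt0|exact: psi_cvg0].
Qed.

Let du (s : R) : 0 < s -> der s u (y 0 s / (s * psi 0 s ^+ 2)).
Proof.
move=> s0; have ps := gs_psi_gt0 0 s; rewrite /u.
der_tac ltac:(first [eapply gs_dpsi|eapply dF]) => //; first by nz.
by rewrite /y; field; nz.
Qed.

Let psi_leE (s : R) : 0 < s <= s1 -> psi 0 s ^+ 2 <= E.
Proof.
move=> /andP[s0 ss1]; rewrite psiE -expRM_natl ler_expR.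
have /andP[d1 _] := d_bound s0; have := Q_bound s0; rewrite ler_norml => /andP[Q1 _].
have d_ge0 : 0 <= d s / h.
  by rewrite divr_ge0 ?(ltW h0)//; apply: le_trans d1; rewrite mulr_ge0 ?ltW// divr_gt0.
have : K * s <= K * s1 by rewrite ler_pM2l//; have := K1; lra.
lra.
Qed.

Let psi_geE (s : R) : 0 < s <= h -> expR (- (4 * K)) <= psi 0 s ^+ 2.
Proof.
move=> /andP[s0 sh]; rewrite psiE -expRM_natl ler_expR.
have /andP[_ d2] := d_bound s0; have := Q_bound s0; rewrite ler_norml => /andP[_ Q2].
have K1' := K1; have h1' := h1.
have d_le : d s / h <= K by rewrite ler_pdivrMr//; nra.
have : K * s <= K by nra.
lra.
Qed.

Section MaxBound.
Variable M : R.
Hypothesis uM : forall s, 0 < s <= s1 -> `|u s| <= M.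

Let M0 : 0 <= M. Proof. by apply: le_trans (@uM s1 _); rewrite ?s10 ?lexx. Qed.

Let FM (s : R) : 0 < s <= s1 -> `|F s| <= psi 0 s * M.
Proof.
move=> ss; have := uM ss; rewrite /u normrM normfV [`|psi _ _|]gtr0_norm ?gs_psi_gt0//.
by rewrite ler_pdivrMr ?gs_psi_gt0// mulrC.
Qed.

Let dy_le (s : R) : 0 < s <= s1 ->
  `|psi 0 s * F s * (mu - e s + 0 * (1 - 2 * s * P s) - s * 0 ^+ 2)|
  <= 6 * K ^+ 2 * M * psi 0 s ^+ 2.
Proof.
move=> ss; have /andP[s0 _] := ss; have ps := gs_psi_gt0 0 s.
rewrite mul0r addr0 expr0n/= mulr0 subr0 -mulrA normrM (gtr0_norm ps) normrM.
have -> : 6 * K ^+ 2 * M * psi 0 s ^+ 2 = psi 0 s * (psi 0 s * M * (6 * K ^+ 2)) by ring.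
by rewrite ler_pM2l// ler_pM ?FM ?gs_res_le.
Qed.

(** Comparison read inwards from [s1], where the boundary estimate gives the value. The derivative
    of [- psi ^+ 2] is [2 * P * psi ^+ 2] with [P >= B / (8 * h)], so a multiple of order [h] of
    [psi ^+ 2] absorbs the bounded residual. *)
Lemma gs_y_le (s : R) : 0 < s <= s1 -> `|y 0 s| <= K2 * h * M * psi 0 s ^+ 2.
Proof.
move=> /andP[s0 ss1]; have p1_ := gs_psi_gt0 0 s1.
have B0' := B0; have M0' := M0; have K20 := K2_gt0; have h0' := h0.
have ys1 : `|y 0 s1| <= K2 * h * M * psi 0 s1 ^+ 2.
  rewrite /y addr0 normrM [`|s1 * _|]gtr0_norm ?mulr_gt0//.
  have H := gs_boundary_pos as1 Fs1.
  have Fm : F s1 <= psi 0 s1 * M by apply/ler_normlW/FM; rewrite s10 lexx.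
  apply: (@le_trans _ _ (s1 * psi 0 s1 * (kk * h * (psi 0 s1 * M)))).
    apply: ler_wpM2l; first by rewrite mulr_ge0 ?ltW.
    apply: (le_trans H); apply: ler_wpM2l; last exact: Fm.
    by rewrite mulr_ge0 ?ltW.
  rewrite (_ : s1 * psi 0 s1 * (kk * h * (psi 0 s1 * M)) = (s1 * kk) * (h * M * psi 0 s1 ^+ 2)); last by ring.
  rewrite (_ : K2 * h * M * psi 0 s1 ^+ 2 = K2 * (h * M * psi 0 s1 ^+ 2)); last by ring.
  by apply: ler_wpM2r; [nn|rewrite lerDl; nn].
have : `|y 0 s1 - y 0 s| <= - (K2 * h * M * psi 0 s1 ^+ 2) - - (K2 * h * M * psi 0 s ^+ 2).
  apply: (der_bound ss1 (f := y 0) (g := fun t => - (K2 * h * M * psi 0 t ^+ 2))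
    (dg := fun t => 2 * K2 * M * (h * P t) * psi 0 t ^+ 2)) => x /andP[sx xs1];
    have x0 := lt_le_trans s0 sx; first exact: gs_dy.
  - by der_tac ltac:(eapply gs_dpsi) => //; ring.
  - apply: le_trans (dy_le _) _; first by rewrite x0.
    rewrite ler_wpM2r ?sqr_ge0//; have HP := gs_P_ge x0.
    have KB : 6 * K ^+ 2 <= 2 * K2 * (B / 8).
      have -> : 2 * K2 * (B / 8) = 6 * K ^+ 2 + s1 * kk * B / 4 by rewrite /K2; field; nz.
      by rewrite lerDl; nn.
    rewrite (_ : 2 * K2 * M * (h * P x) = 2 * K2 * (h * P x) * M); last by ring.
    by apply: ler_wpM2r => //; apply: (le_trans KB); apply: ler_wpM2l => //; nn.
rewrite opprK => H; have := ler_normB (y 0 s1) (y 0 s1 - y 0 s).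
by rewrite subKr; lra.
Qed.

(** The inward barrier gives [u' = O(h / s)], whose integral diverges at the origin. For [s <= h] it
    is replaced by outward integration from [y = 0]: there [y = O(s)] and [psi ^+ 2] is bounded
    below, so [u' = O(1)]. Both are dominated by [sqrt (h / s)], which is integrable; this is the
    source of the relative error [sqrt h]. *)
Let du_le (s : R) : 0 < s <= s1 ->
  `|y 0 s / (s * psi 0 s ^+ 2)| <= K4 * M * Num.sqrt h / Num.sqrt s.
Proof.
move=> ss; have /andP[s0 ss1] := ss; have ps := gs_psi_gt0 0 s.
have M0' := M0; have K20 := K2_gt0; have h0' := h0.
have sp : 0 < s * psi 0 s ^+ 2 by rewrite mulr_gt0 ?exprn_gt0.
have sqs : 0 < Num.sqrt s by rewrite sqrtr_gt0.
have sqh : 0 < Num.sqrt h by rewrite sqrtr_gt0.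
have Es : Num.sqrt s ^+ 2 = s by rewrite sqr_sqrtr// ltW.
have Eh : Num.sqrt h ^+ 2 = h by rewrite sqr_sqrtr// ltW.
rewrite normrM normfV (gtr0_norm sp) ler_pdivrMr//.
have [hs_|sh] := ltP h s.
- apply: (le_trans (gs_y_le ss)).
  have -> : K4 * M * Num.sqrt h / Num.sqrt s * (s * psi 0 s ^+ 2)
    = K4 * M * (Num.sqrt h * Num.sqrt s) * psi 0 s ^+ 2.
    have Esq : s / Num.sqrt s = Num.sqrt s by rewrite -[X in X / _]Es expr2 mulfK//; nz.
    transitivity (K4 * M * Num.sqrt h * (s / Num.sqrt s) * psi 0 s ^+ 2); first by ring.
    by rewrite Esq; ring.
  rewrite ler_wpM2r ?sqr_ge0// mulrAC; apply: ler_pM => //.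
  + by rewrite mulr_ge0// ltW.
  + exact: ltW.
  + by rewrite ler_wpM2r// K24.
  + by rewrite -[leLHS]Eh expr2 ler_pM2l// ler_sqrt// ltW.
- have ylin : `|y 0 s| <= 6 * K ^+ 2 * E * M * s.
    have y0 : y 0 t @[t --> 0^'+] --> (0 : R).
      rewrite (_ : y 0 = fun t => psi 0 t * (t * F1 t) + psi 0 t * F t * (t * P t)); last first.
        by apply/funext => t; rewrite /y; ring.
      have tP0 : t * P t @[t --> 0^'+] --> (0 : R).
        apply: (@cvg0_norm_le _ _ (fun t => 2 * K / h * t)) => [t t0|].
          by rewrite normrM (gtr0_norm t0) mulrC ler_pM2r// gs_P_le.
        by rewrite -[X in _ --> X](mulr0 (2 * K / h)); apply: cvgMr; exact: cvg_right_id.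
      suff : psi 0 t * (t * F1 t) + psi 0 t * F t * (t * P t) @[t --> 0^'+]
          --> psi 0 0 * 0 + psi 0 0 * F 0 * 0 by rewrite !mulr0 addr0.
      by apply: cvgD; [exact: (cvgM psi_cvg0 sF1_0)|exact: (cvgM (cvgM psi_cvg0 F_0) tP0)].
    have : `|y 0 s - 0| <= 6 * K ^+ 2 * E * M * s - 0.
      apply: (der_bound0 s0 y0 (g := fun t => 6 * K ^+ 2 * E * M * t)
         (dg := fun=> 6 * K ^+ 2 * E * M)).
      - by rewrite -[X in _ --> X](mulr0 (6 * K ^+ 2 * E * M)); apply: cvgMr; exact: cvg_right_id.
      - by move=> x /andP[x0 _]; exact: gs_dy.
      - by move=> x _; der_tac fail; ring.
      move=> x /andP[x0 xs]; have xs1 : 0 < x <= s1 by rewrite x0 (le_trans xs).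
      apply: (le_trans (dy_le xs1)).
      rewrite (_ : 6 * K ^+ 2 * E * M = 6 * K ^+ 2 * M * E); last by ring.
      by apply: ler_wpM2l; [nn|exact: psi_leE].
    by rewrite !subr0.
  apply: (le_trans ylin).
  have shr : Num.sqrt s <= Num.sqrt h by apply: ler_wsqrtr.
  have p2 : expR (- (4 * K)) <= psi 0 s ^+ 2 by apply: psi_geE; rewrite s0.
  have p2' : 1 <= expR (4 * K) * psi 0 s ^+ 2.
    apply: le_trans (_ : expR (4 * K) * expR (- (4 * K)) <= _).
      by rewrite expRxMexpNx_1.
    by rewrite ler_pM2l ?expR_gt0.
  have -> : 6 * K ^+ 2 * E * M * s = (6 * K ^+ 2 * E) * (M * (s * 1)) by ring.
  have -> : K4 * M * Num.sqrt h / Num.sqrt s * (s * psi 0 s ^+ 2)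
    = K4 * psi 0 s ^+ 2 * (M * (s * (Num.sqrt h / Num.sqrt s))) by ring.
  have h1s : 1 <= Num.sqrt h / Num.sqrt s by rewrite ler_pdivlMr// mul1r.
  apply: ler_pM.
  + by nn.
  + by rewrite mulr1; nn.
  + apply: (@le_trans _ _ (6 * K ^+ 2 * E * (expR (4 * K) * psi 0 s ^+ 2))).
      by rewrite ler_peMr//; nn.
    rewrite mulrA; apply: ler_wpM2r; first exact: sqr_ge0.
    by rewrite lerDr ltW.
  + by apply: ler_wpM2l => //; apply: ler_wpM2l => //; nn.
Qed.

Lemma gs_u_le (s : R) : 0 < s <= s1 -> `|u s - F 0| <= K5 * Num.sqrt h * M.
Proof.
move=> /andP[s0 ss1].
have -> : K5 * Num.sqrt h * M = 2 * K4 * M * Num.sqrt h * Num.sqrt s1 by rewrite /K5; ring.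
apply: (@le_trans _ _ (2 * K4 * M * Num.sqrt h * Num.sqrt s - 0)).
  apply: (der_bound0 s0 u_cvg0 (g := fun s => 2 * K4 * M * Num.sqrt h * Num.sqrt s)
    (dg := fun s => K4 * M * Num.sqrt h / Num.sqrt s)).
  - rewrite -[X in _ --> X](mulr0 (2 * K4 * M * Num.sqrt h)); apply: cvgMr.
    by rewrite -[X in _ --> X]sqrtr0; apply: cvg_at_right_filter; exact: sqrt_continuous.
  - by move=> x /andP[x0 _]; exact: du.
  - move=> x /andP[x0 _]; have : 0 < Num.sqrt x by rewrite sqrtr_gt0.
    by move=> sx; der_tac fail => //; field; nz.
  - by move=> x /andP[x0 xs]; apply: du_le; rewrite x0 (le_trans xs).
rewrite subr0 ler_wpM2l ?ler_sqrt// ?(ltW s10)//.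
by rewrite !mulr_ge0 ?sqrtr_ge0 ?M0// (le_trans _ K24)// ltW// K2_gt0.
Qed.

End MaxBound.

Let u_le (s : R) : 0 < s <= s1 -> `|u s| <= 2 * `|F 0|.
Proof.
apply: (der_eps_bound s10 u_cvg0 _ _ hs5) => [t /andP[t0 _]|M uM t]; first exact: du.
exact: gs_u_le.
Qed.

(** If [F 0 = 0], the absorbed bound [|u| <= 2 * |F 0|] kills [F] up to [s1], and monotonicity of
    [F ^+ 2] kills it beyond, contradicting [F_neq0]. *)
Lemma gs_F0_neq0 : F 0 != 0.
Proof.
apply/eqP => F00; have Fle (s : R) : 0 < s <= s1 -> F s = 0.
  move=> ss; have := u_le ss; rewrite F00 normr0 mulr0 normr_le0 mulf_eq0 invr_eq0.
  by rewrite [X in _ || X]gt_eqF ?gs_psi_gt0// orbF => /eqP.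
have [s s0 /negP] := F_neq0; apply; have [ss|ss] := leP s s1; first by rewrite Fle// s0.
have := gs_FF_nonincr as1 (ltW ss); rewrite [F s1]Fle ?s10 ?lexx// expr0n/=.
by rewrite -sqrf_eq0 eq_le sqr_ge0 andbT.
Qed.

Lemma gs_main (s : R) : 0 < s <= s1 ->
  `|F s - F 0 * psi 0 s| <= 2 * K5 * Num.sqrt h * `|F 0| * psi 0 s /\
  `|s * (F1 s + P s * F s)| <= 2 * K2 * h * `|F 0| * psi 0 s.
Proof.
move=> ss; have ps := gs_psi_gt0 0 s; split.
  have -> : F s - F 0 * psi 0 s = (u s - F 0) * psi 0 s by rewrite /u; field; nz.
  rewrite normrM (gtr0_norm ps) ler_pM2r//.
  by apply: (le_trans (gs_u_le u_le ss)); rewrite le_eqVlt; apply/orP; left; apply/eqP; ring.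
rewrite -(ler_pM2r ps); have := gs_y_le u_le ss; rewrite /y addr0 => H.
rewrite -[X in _ * X](gtr0_norm ps) -normrM (_ : s * (F1 s + P s * F s) * psi 0 s =
  s * psi 0 s * (F1 s + P s * F s)); last by ring.
by apply: (le_trans H); rewrite le_eqVlt; apply/orP; left; apply/eqP; ring.
Qed.

(** * Normalisation of the ground state *)

Variables (c : R) (N : R -> R).
Hypotheses (c0 : 0 < c) (N_0 : N s @[s --> 0^'+] --> (0 : R)).
Hypothesis dN : forall s : R, 0 < s -> der s N (c * F s ^+ 2).
Hypothesis N_le1 : forall s : R, 0 < s -> N s <= 1.
Hypothesis N_inf : forall X eps : R, 0 < eps -> exists2 s, X < s & 1 - eps <= N s.
Hypothesis p00_ge : B / 4 <= p00.
Hypothesis p0_sub : forall s : R, 0 < s -> `|p0 s - p00| <= K * s.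

Definition gs_A4 := 64 * E * (2 * K + kk) / (b * B).
Local Notation A4 := gs_A4.

(** [F s1] is exponentially small relative to [F 0]; one power of [h], taken from
    [expR (- x) <= 1 / x], is enough here. *)
Let F_s1_sqr : F s1 ^+ 2 <= 8 * h * E / (B * s1) * F 0 ^+ 2.
Proof.
have B0' := B0; have h0' := h0.
have ss1 : 0 < s1 <= s1 by rewrite s10 lexx.
have ps := gs_psi_gt0 0 s1.
have : `|F s1| <= 2 * `|F 0| * psi 0 s1.
  have := u_le ss1; rewrite /u normrM normfV (gtr0_norm ps) ler_pdivrMr//.
rewrite -ler_sqr ?nnegrE ?mulr_ge0 ?(ltW ps)// real_normK ?num_real//.
rewrite !exprMn real_normK ?num_real// => /le_trans; apply.
suff : psi 0 s1 ^+ 2 <= 2 * h * E / (B * s1).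
  move=> H; rewrite mulrC mulrA; apply: (@le_trans _ _ (2 * h * E / (B * s1) * 2 ^+ 2 * F 0 ^+ 2)).
    by rewrite ler_wpM2r ?sqr_ge0// ler_wpM2r.
  by rewrite le_eqVlt; apply/orP; left; apply/eqP; ring.
rewrite psiE -expRM_natl.
have /andP[d1 _] := d_bound s10; have := Q_bound s10; rewrite ler_norml => /andP[Q1 _].
apply: (@le_trans _ _ (expR (2 * K * s1) * expR (- (B * s1 / (2 * h))))).
  rewrite -expRD ler_expR.
  have : B / 4 * s1 / h <= d s1 / h by rewrite ler_pM2r// invr_gt0.
  have -> : B * s1 / (2 * h) = 2 * (B / 4 * s1 / h) by field; nz.
  by lra.
rewrite -/E; have -> : 2 * h * E / (B * s1) = E * (2 * h / (B * s1)) by ring.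
rewrite ler_pM2l ?expR_gt0// expRN -[leRHS]invrK lef_pV2 ?posrE ?expR_gt0 ?invr_gt0 ?divr_gt0 ?mulr_gt0//.
have -> : (2 * h / (B * s1))^-1 = B * s1 / (2 * h) by rewrite invf_div.
by apply: le_trans (expR_ge1Dx _); rewrite lerDr.
Qed.

(** Beyond [s1], [V - Lam >= b / 2], so the mass density is at most the derivative of
    [q * (s * F * F1)] with [q = 8 * c * h ^+ 2 / b]. The outer mass is thus bounded by the flux at
    [s1], where [gs_boundary_pos] gives [- F1 <= (2 * K + kk) / h * F]. *)
Let tail : 1 <= N s1 + c * F 0 ^+ 2 * (A4 * h ^+ 2).
Proof.
have B0' := B0; have h0' := h0; have b0' := b0; have c0' := c0; have KK' := K1; have kk0 := kk_gt0.
have s10' := s10.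
apply/ler_addgt0Pl => eps eps0; have [t st Nt] := N_inf s1 eps0.
have : 1 <= eps + N t by lra.
move=> /le_trans; apply; rewrite lerD2l.
have E0 : 0 < E by exact: expR_gt0.
pose q := c * (8 * h ^+ 2 / b).
have q0 : 0 < q by rewrite /q; pp.
have : N t - q * (t * (F t * F1 t)) <= N s1 - q * (s1 * (F s1 * F1 s1)).
  rewrite -lerN2; apply: (der_mono (ltW st) (f := fun t => - (N t - q * (t * (F t * F1 t))))
    (df := fun t => q * (t * F1 t ^+ 2 + (V t - Lam) / (4 * h ^+ 2) * F t ^+ 2) - c * F t ^+ 2)).
    move=> x /andP[sx _]; have x0 := lt_le_trans s10 sx.
    apply: der_eq; first (apply: derN; apply: derD; first exact: dN).
      by apply: derN; apply: derM; [exact: derC|exact: gs_dFF1].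
    by rewrite /=; ring.
  move=> x /andP[sx _]; have x0 := lt_le_trans s10 sx.
  have := Vb (lt_le_trans as1 sx); have := Lam_le => H1 H2.
  have -> : q * (x * F1 x ^+ 2 + (V x - Lam) / (4 * h ^+ 2) * F x ^+ 2) - c * F x ^+ 2 =
    q * (x * F1 x ^+ 2) + c * F x ^+ 2 * (2 / b * (V x - Lam) - 1).
    by rewrite /q; field; nz.
  apply: addr_ge0; first by nn.
  apply: mulr_ge0; first by nn.
  rewrite subr_ge0 mulrAC ler_pdivlMr// mul1r; lra.
have := gs_FF1_le0 (lt_trans as1 st) => H1 H2.
have {}H2 : N t <= N s1 + q * (- (s1 * (F s1 * F1 s1))).
  have : q * (t * (F t * F1 t)) <= 0 by rewrite pmulr_rle0.
  by lra.
apply: (le_trans H2); rewrite lerD2l.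
have H3 : - (s1 * (F s1 * F1 s1)) <= s1 * F s1 ^+ 2 * ((2 * K + kk) / h).
  have H4 := gs_boundary_pos as1 Fs1; have H5 := gs_P_le s10 h1.
  have H6 : - F1 s1 <= (2 * K + kk) / h * F s1.
    have HP : P s1 * F s1 <= 2 * K / h * F s1 by apply: ler_wpM2r => //; exact: ler_normlW.
    have HP' : kk * h * F s1 <= kk / h * F s1.
      apply: ler_wpM2r => //; apply: ler_wpM2l; first exact: ltW.
      by rewrite -[leRHS]mul1r ler_pdivlMr//; have := h1; nra.
    have HE : (2 * K + kk) / h * F s1 = 2 * K / h * F s1 + kk / h * F s1 by ring.
    by move: H4; rewrite ler_norml HE; lra.
  have -> : - (s1 * (F s1 * F1 s1)) = s1 * F s1 * (- F1 s1) by ring.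
  have -> : s1 * F s1 ^+ 2 * ((2 * K + kk) / h) = s1 * F s1 * ((2 * K + kk) / h * F s1) by ring.
  by apply: ler_wpM2l => //; nn.
apply: (@le_trans _ _ (q * (s1 * (8 * h * E / (B * s1) * F 0 ^+ 2) * ((2 * K + kk) / h)))).
  apply: ler_wpM2l; first exact: ltW.
  apply: (le_trans H3); apply: ler_wpM2r; last by apply: ler_wpM2l; [exact: ltW|exact: F_s1_sqr].
  by apply: divr_ge0; [lra|exact: ltW].
by rewrite le_eqVlt; apply/orP; left; apply/eqP; rewrite /q /A4; field; nz.
Qed.

Definition gs_A1 := 6 * K5 * E.
Definition gs_A2 := 2 * K * E + 4 * K / B.
Definition gs_A5 := 2 * gs_A1 / B + 4 * gs_A2 / B ^+ 2 + 4 / (B ^+ 2 * s1) + A4.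
Local Notation A1 := gs_A1.
Local Notation A2 := gs_A2.
Local Notation A5 := gs_A5.

(** The model density carries the factor [p0 / p00], equal to 1 up to [O(s)], because
    [p0 * expR (- (2 * d / h))] has the exact primitive [- h / 2 * expR (- (2 * d / h))]. The
    normalisation then needs no Laplace asymptotics. *)
Let density (s : R) : 0 < s <= s1 ->
  `|F s ^+ 2 / F 0 ^+ 2 - p0 s / p00 * expR (- (2 * d s / h))|
  <= (A1 * Num.sqrt h + A2 * s) * expR (- (B * s / (2 * h))).
Proof.
move=> ss; have /andP[s0 ss1] := ss; have F00 := gs_F0_neq0.
have B0' := B0; have h0' := h0; have K1' := K1; have ps := gs_psi_gt0 0 s.
have F0q : 0 < F 0 ^+ 2 by rewrite exprn_even_gt0.
have p000 : 0 < p00 by apply: lt_le_trans p00_ge; pp.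
have Fu : F s ^+ 2 / F 0 ^+ 2 = u s ^+ 2 / F 0 ^+ 2 * expR (- (2 * Q s)) * expR (- (2 * d s / h)).
  rewrite -mulrA -expRD (_ : - (2 * Q s) + - (2 * d s / h) = 2%:R * - (d s / h + Q s)); last by ring.
  by rewrite expRM_natl -psiE /u; field; nz.
rewrite {}Fu -mulrBl normrM [X in _ * X]gtr0_norm ?expR_gt0//.
apply: ler_pM => //; last first.
  rewrite ler_expR lerN2; have /andP[d1 _] := d_bound s0.
  rewrite (_ : B * s / (2 * h) = 2 * (B / 4 * s) / h); last by field; nz.
  by rewrite ler_pM2r ?invr_gt0// ler_pM2l.
have u2 : `|u s ^+ 2 / F 0 ^+ 2 - 1| <= 6 * K5 * Num.sqrt h.
  have -> : u s ^+ 2 / F 0 ^+ 2 - 1 = (u s - F 0) * (u s + F 0) / F 0 ^+ 2 by field; nz.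
  rewrite normrM normfV (gtr0_norm F0q) ler_pdivrMr// normrM.
  have H1 := gs_u_le u_le ss; have H2 : `|u s + F 0| <= 3 * `|F 0|.
    by have := u_le ss; have := ler_normD (u s) (F 0); lra.
  apply: (le_trans (ler_pM _ _ H1 H2)) => //.
  by rewrite -real_normK ?num_real// le_eqVlt; apply/orP; left; apply/eqP; ring.
have Q2 : `|expR (- (2 * Q s)) - 1| <= 2 * K * E * s.
  have Qs := Q_bound s0; apply: (le_trans (@expR_sub1_le _ _ (2 * K * s) _)).
    by rewrite normrN normrM gtr0_norm//; lra.
  rewrite mulrAC; apply: ler_wpM2r; first exact: ltW.
  apply: ler_wpM2l; first lra.
  by rewrite ler_expR ler_wpM2l//; lra.
have Qe : expR (- (2 * Q s)) <= E.
  rewrite ler_expR; have := Q_bound s0; rewrite ler_norml => /andP[Q1 _].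
  have : K * s <= K * s1 by rewrite ler_wpM2l//; lra.
  by lra.
have p2 : `|p0 s / p00 - 1| <= 4 * K / B * s.
  have -> : p0 s / p00 - 1 = (p0 s - p00) / p00 by field; nz.
  rewrite normrM normfV (gtr0_norm p000) ler_pdivrMr//.
  apply: (le_trans (p0_sub s0)).
  have : 4 * K / B * s * (B / 4) <= 4 * K / B * s * p00 by apply: ler_wpM2l => //; nn; lra.
  by rewrite (_ : 4 * K / B * s * (B / 4) = K * s)//; field; nz.
have -> : u s ^+ 2 / F 0 ^+ 2 * expR (- (2 * Q s)) - p0 s / p00 =
  (u s ^+ 2 / F 0 ^+ 2 - 1) * expR (- (2 * Q s)) + (expR (- (2 * Q s)) - 1) - (p0 s / p00 - 1) by ring.
apply: (le_trans (ler_normB _ _)).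
have := ler_normD ((u s ^+ 2 / F 0 ^+ 2 - 1) * expR (- (2 * Q s))) (expR (- (2 * Q s)) - 1).
have : `|(u s ^+ 2 / F 0 ^+ 2 - 1) * expR (- (2 * Q s))| <= 6 * K5 * Num.sqrt h * E.
  by rewrite normrM ler_pM// gtr0_norm ?expR_gt0.
rewrite /A1 /A2 mulrDl; lra.
Qed.

Lemma gs_norm : `|(c * F 0 ^+ 2)^-1 - h / (2 * p00)| <= A5 * (h * Num.sqrt h).
Proof.
have B0' := B0; have h0' := h0; have K1' := K1; have F00 := gs_F0_neq0; have s10' := s10.
have c0' := c0.
have F0q : 0 < F 0 ^+ 2 by rewrite exprn_even_gt0.
have p000 : 0 < p00 by apply: lt_le_trans p00_ge; pp.
have K20 := K2_gt0; have K40 : 0 <= K4 by apply: le_trans K24; exact: ltW.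
have K50 : 0 <= K5 by rewrite /K5; nn.
have E0 : 0 < E by exact: expR_gt0.
have A10 : 0 <= A1 by rewrite /A1; nn.
have A20 : 0 <= A2 by rewrite /A2; nn; lra.
have sh0 : 0 < Num.sqrt h by rewrite sqrtr_gt0.
have hsh : h ^+ 2 <= h * Num.sqrt h.
  rewrite expr2 ler_pM2l// -[leLHS](sqr_sqrtr (ltW h0)) expr2 -[leRHS]mulr1 ler_pM2l//.
  by rewrite -sqrtr1 ler_wsqrtr.
pose al := A1 * Num.sqrt h.
(* The derivative of [f] is the difference bounded in [density]; its limit at 0 is [h / (2 * p00)],
   and at [s1] it is the rescaled mass up to [O(h ^+ 2)]. [g] is the explicit primitive of the
   majorant. *)
pose f (t : R) := (c * F 0 ^+ 2)^-1 * N t + h / (2 * p00) * expR (- (2 * d t / h)).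
pose g (t : R) := - (al * (2 * h / B) + A2 * (2 * h / B) * t + A2 * (2 * h / B) ^+ 2)
  * expR (- (B * t / (2 * h))).
have := @der_bound0 _ f g
  (fun t => F t ^+ 2 / F 0 ^+ 2 - p0 t / p00 * expR (- (2 * d t / h)))
  (fun t => (al + A2 * t) * expR (- (B * t / (2 * h)))) s1 (h / (2 * p00))
  (- (al * (2 * h / B) + A2 * (2 * h / B) ^+ 2)) s10.
have fcv : f x @[x --> 0^'+] --> h / (2 * p00).
  suff : f x @[x --> 0^'+] --> (c * F 0 ^+ 2)^-1 * 0 + h / (2 * p00) * expR (- (2 * 0 / h)).
    by rewrite !(mulr0, mul0r) oppr0 expR0 mulr1 add0r.
  apply: cvgD; first by apply: cvgMr; exact: N_0.
  apply: cvgMr; apply: continuous_cvg; first exact: continuous_expR.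
  by apply: cvgN; apply: cvgMl; apply: cvgMr; exact: d_cvg0.
have gcv : g x @[x --> 0^'+] --> - (al * (2 * h / B) + A2 * (2 * h / B) ^+ 2).
  have -> : - (al * (2 * h / B) + A2 * (2 * h / B) ^+ 2) = g 0.
    by rewrite /g !(mulr0, mul0r) oppr0 expR0 mulr1 addr0.
  apply: cvg_at_right_filter; apply: der_cvg; rewrite /g; der_tac fail => //; reflexivity.
have df (x : R) : 0 < x <= s1 -> der x f (F x ^+ 2 / F 0 ^+ 2 - p0 x / p00 * expR (- (2 * d x / h))).
  move=> /andP[x0 _]; rewrite /f; der_tac ltac:(first [eapply dN|eapply dd]) => //.
  by field; nz.
have dg (x : R) : 0 < x <= s1 -> der x g ((al + A2 * x) * expR (- (B * x / (2 * h)))).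
  move=> /andP[x0 _]; rewrite /g; der_tac fail => //.
  by field; nz.
move=> /(_ fcv gcv df dg density) H.
have gle : g s1 <= 0.
  by rewrite /g mulNr oppr_le0; nn.
have f1 : `|f s1 - (c * F 0 ^+ 2)^-1| <= A4 * h ^+ 2 + 4 / (B ^+ 2 * s1) * h ^+ 2.
  rewrite /f (_ : _ - _ = - ((c * F 0 ^+ 2)^-1 * (1 - N s1)) + h / (2 * p00) * expR (- (2 * d s1 / h))); last by ring.
  apply: (le_trans (ler_normD _ _)); rewrite normrN; apply: lerD.
    rewrite ger0_norm; last by rewrite mulr_ge0 ?invr_ge0 ?subr_ge0 ?N_le1//; nn.
    rewrite ler_pdivrMl; last by pp.
    by have := tail; lra.
  rewrite ger0_norm; last by nn.
  apply: (@le_trans _ _ (h / (2 * (B / 4)) * (2 * h / (B * s1)))); last first.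
    by rewrite le_eqVlt; apply/orP; left; apply/eqP; field; nz.
  apply: ler_pM; [by nn|by nn| |].
    apply: ler_wpM2l; first exact: ltW.
    rewrite lef_pV2 ?posrE ?mulr_gt0 ?divr_gt0// ler_pM2l//.
  have /andP[d1 _] := d_bound s10.
  apply: (@le_trans _ _ (expR (- (B * s1 / (2 * h))))).
    rewrite ler_expR lerN2 (_ : B * s1 / (2 * h) = 2 * (B / 4 * s1) / h); last by field; nz.
    by rewrite ler_pM2r ?invr_gt0// ler_pM2l.
  by rewrite -[2 * h / _]invf_div; apply: expRN_le_inv; pp.
have -> : A5 * (h * Num.sqrt h) = al * (2 * h / B) + (4 * A2 / B ^+ 2) * (h * Num.sqrt h)
    + 4 / (B ^+ 2 * s1) * (h * Num.sqrt h) + A4 * (h * Num.sqrt h).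
  by rewrite /A5 /al; field; nz.
have A40 : 0 <= A4 by rewrite /A4; have kk0 := kk_gt0; have b0' := b0; nn; lra.
have H3 : A4 * h ^+ 2 <= A4 * (h * Num.sqrt h) by apply: ler_wpM2l.
have H4 : 4 / (B ^+ 2 * s1) * h ^+ 2 <= 4 / (B ^+ 2 * s1) * (h * Num.sqrt h) by apply: ler_wpM2l => //; nn.
have H5 : A2 * (2 * h / B) ^+ 2 <= 4 * A2 / B ^+ 2 * (h * Num.sqrt h).
  have -> : A2 * (2 * h / B) ^+ 2 = 4 * A2 / B ^+ 2 * h ^+ 2 by field; nz.
  by apply: ler_wpM2l => //; nn.
have := ler_normB (f s1 - h / (2 * p00)) (f s1 - (c * F 0 ^+ 2)^-1).
rewrite (_ : f s1 - h / (2 * p00) - (f s1 - (c * F 0 ^+ 2)^-1) = (c * F 0 ^+ 2)^-1 - h / (2 * p00)); last by ring.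
lra.
Qed.

End GroundState.

(** * Angular integrals and the Bessel function I_0 *)

Section AngularIntegral.
Context {R : realType}.
Notation mu := (@lebesgue_measure R).
Implicit Types f g : R -> R.

Definition angint f : R := (\int[mu]_(t in `[0, 2 * pi]) f t)%R.

Let pi20 : 0 < 2 * pi :> R. Proof. by rewrite mulr_gt0// pi_gt0. Qed.

Let mu_lty : (mu `[0%R, (2 * pi)%R]%classic < +oo)%E.
Proof. by rewrite /= lebesgue_measure_itv/= lte_fin pi20 -EFinB ltry. Qed.

Lemma angint_integrable f : continuous f -> mu.-integrable `[0, 2 * pi] (EFin \o f).
Proof.
move=> cf; apply: continuous_compact_integrable; first exact: segment_compact.
exact: continuous_subspaceT.
Qed.

Lemma eq_angint f g : f =1 g -> angint f = angint g.
Proof. by move=> fg; rewrite /angint; congr Rintegral; apply/funext. Qed.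

Lemma angintD f g : continuous f -> continuous g ->
  angint (fun t => f t + g t) = angint f + angint g.
Proof. by move=> cf cg; rewrite /angint RintegralD//; exact: angint_integrable. Qed.

Lemma angintZ c f : continuous f -> angint (fun t => c * f t) = c * angint f.
Proof. by move=> cf; rewrite /angint RintegralZl//; exact: angint_integrable. Qed.

Lemma angint_cst c : angint (fun=> c) = c * (2 * pi).
Proof.
rewrite /angint Rintegral_cst//= lebesgue_measure_itv/= lte_fin pi20.
by rewrite -EFinB subr0.
Qed.

Lemma le_angint f g : continuous f -> continuous g -> (forall t, f t <= g t) ->
  angint f <= angint g.
Proof. by move=> cf cg fg; apply: le_Rintegral => //; exact: angint_integrable. Qed.

Lemma angint_der f g : continuous g -> (forall t : R, 0 <= t <= 2 * pi -> der t f (g t)) ->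
  angint g = f (2 * pi) - f 0.
Proof.
move=> cg fg; have pi0 : 0 <= 2 * pi :> R by exact: ltW.
have d0 : der (0 : R) f (g 0) by apply: fg; rewrite lexx pi0.
have d1 : der (2 * pi : R) f (g (2 * pi)) by apply: fg; rewrite lexx pi0.
have fI x : x \in `]0%R, (2 * pi)[ -> der x f (g x).
  by rewrite in_itv/= => /andP[? ?]; apply: fg; rewrite !ltW.
rewrite /angint /Rintegral (continuous_FTC2 (F := f) pi20) //.
- exact: continuous_subspaceT.
- split; first by move=> x /fI[].
  + by apply: cvg_at_right_filter; exact: (der_cvg d0).
  + by apply: cvg_at_left_filter; exact: (der_cvg d1).
- by move=> x /fI[_ <-]; rewrite derive1E.
Qed.

Lemma der_angint (f f1 : R -> R -> R) (u v K a : R) : u < a < v ->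
  (forall x t, u < x < v -> der x (f^~ t) (f1 x t)) ->
  (forall x, u < x < v -> continuous (f x)) ->
  (forall x t, u < x < v -> `|f1 x t| <= K) ->
  der a (fun x => angint (f x)) (angint (f1 a)).
Proof.
move=> uav df cf fK.
have Ia : (`]u, v[%classic : set R) a by rewrite /= in_itv.
have d1 x t : u < x < v -> partial1of2 f x t = f1 x t.
  by move=> xuv; rewrite partial1of2E; have [_ ->] := df x t xuv.
have intf x : `]u, v[%classic x -> mu.-integrable `[0, 2 * pi] (EFin \o f x).
  by rewrite /= in_itv/= => xuv; apply: angint_integrable; exact: cf.
have df' x y : `]u, v[%classic x -> `[0, 2 * pi]%classic y -> derivable (f ^~ y) x 1.
  by rewrite /= in_itv/= => xuv _; have [] := df x y xuv.
have intK : mu.-integrable `[0, 2 * pi] (EFin \o (fun _ : R => `|K|)).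
  by apply: angint_integrable => x; exact: cvg_cst.
have fK' x y : `]u, v[%classic x -> `[0, 2 * pi]%classic y -> `|partial1of2 f x y| <= `|K|.
  rewrite /= in_itv/= => xuv _; rewrite d1// (le_trans (fK _ _ xuv))//; exact: ler_norm.
have K0 (y : R) : 0 <= `|K| by [].
have mB : measurable (`[0%R, 2 * pi]%classic : set R) by exact: measurable_itv.
have := @derivable_under_integral R _ _ mu f _ mB a u v Ia intf df' _ K0 intK fK'.
have := @differentiation_under_integral R _ _ mu f _ mB a u v Ia intf df' _ K0 intK fK'.
move=> H1 H2; split; first exact: H2.
rewrite -derive1E [LHS]H1 /angint.
by apply: eq_Rintegral => y _; rewrite d1.
Qed.

End AngularIntegral.

Section Bessel.
Context {R : realType}.
Implicit Types x : R.

Lemma cos_ge_quad (t : R) : 0 <= t -> 1 - t ^+ 2 / 2 <= cos t.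
Proof.
move=> t0; have sin_le (s : R) : 0 <= s -> sin s <= s.
  move=> s0; rewrite -subr_ge0 -[leLHS](_ : 0 - sin 0 = 0); last by rewrite sin0 subr0.
  apply: (der_mono s0 (f := fun s => s - sin s) (df := fun s => 1 - cos s)) => y _.
    by der_tac fail; ring.
  by rewrite subr_ge0 cos_le1.
rewrite -subr_ge0 -[leLHS](_ : cos 0 - (1 - 0 ^+ 2 / 2) = 0); last by rewrite cos0 expr0n/=; field.
apply: (der_mono t0 (f := fun t => cos t - (1 - t ^+ 2 / 2)) (df := fun s => s - sin s)) => y /andP[y0 _].
  by der_tac fail; field.
by rewrite subr_ge0 sin_le.
Qed.

Lemma continuous_der (f g : R -> R) : (forall t : R, der t f (g t)) -> continuous f.
Proof. by move=> fg t; exact: (der_cvg (fg t)). Qed.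

(** [bessel 0] is [2 * pi] times the modified Bessel function of order zero, and [n] counts
    derivatives. It is left unnormalised so as to match the angular integral defining [ang_j]. *)
Definition bessel (n : nat) x : R := angint (fun t => cos t ^+ n * expR (x * cos t)).

Let bcont n x : continuous (fun t : R => cos t ^+ n * expR (x * cos t)).
Proof. by apply: continuous_der => t; der_rec fail. Qed.

Lemma der_bessel n x : der x (bessel n) (bessel n.+1 x).
Proof.
rewrite /bessel; have xx : x - 1 < x < x + 1 by rewrite gtrBl ltrDl ltr01.
apply: (der_angint (f := fun x t => cos t ^+ n * expR (x * cos t))
  (f1 := fun x t => cos t ^+ n.+1 * expR (x * cos t)) (K := expR (`|x| + 1)) xx) => [y t|y|y t].
- by move=> _; der_tac fail; rewrite exprS; ring.
- by move=> _; exact: bcont.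
- move=> /andP[y1 y2]; have ct : `|cos t| <= 1 by rewrite ler_norml cos_geN1 cos_le1.
  rewrite normrM normrX -[leRHS]mul1r ler_pM ?exprn_ile1//.
  rewrite ger0_norm ?expR_ge0// ler_expR (le_trans (ler_norm _))// normrM.
  rewrite -[leRHS]mulr1 ler_pM// ler_norml.
  by have := ler_norm x; have := ler_norm (- x); rewrite normrN; lra.
Qed.

(* The integrand of Bessel's equation is the derivative of [sin t * expR (x * cos t)]. *)
Lemma bessel_ode x : x * bessel 2 x + bessel 1 x = x * bessel 0 x.
Proof.
pose b n t : R := cos t ^+ n * expR (x * cos t).
have cZ c n : continuous (fun t => c * b n t).
  by apply: continuous_der => t; rewrite /b; der_rec fail.
have cD c : continuous (fun t => c * b 2 t + b 1 t).
  by apply: continuous_der => t; rewrite /b; der_rec fail.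
have E : angint (fun t => x * b 2 t + b 1 t + - x * b 0 t) = 0.
  rewrite (@angint_der _ (fun t => sin t * expR (x * cos t))).
  - by rewrite mulr_natl sin2pi sin0 !mul0r subrr.
  - by apply: continuous_der => t; rewrite /b; der_rec fail.
  - move=> t _; der_tac fail; have := cos2Dsin2 t => H; rewrite /b.
    transitivity (expR (x * cos t) * cos t - x * sin t ^+ 2 * expR (x * cos t)); first by ring.
    by rewrite [sin t ^+ 2](_ : _ = 1 - cos t ^+ 2); [ring|lra].
have cb n : continuous (b n) by exact: bcont.
move: E; rewrite (angintD (cD x) (cZ (- x) 0)) (angintD (cZ x 2) (cb 1)).
rewrite (angintZ x (cb 2)) (angintZ (- x) (cb 0)) -![angint (b _)]/(bessel _ x); lra.
Qed.

Lemma bessel0_0 : bessel 0 0 = 2 * pi :> R.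
Proof.
rewrite -[RHS]mul1r -angint_cst; apply: eq_angint => t.
by rewrite expr0 mul0r expR0 mulr1.
Qed.

Lemma bessel_norm x : `|bessel 1 x| <= bessel 0 x.
Proof.
have H t : `|cos t ^+ 1 * expR (x * cos t)| <= expR (x * cos t) :> R.
  rewrite normrM [X in _ * X]ger0_norm ?expR_ge0// ler_piMl ?expR_ge0//.
  by rewrite expr1 ler_norml cos_geN1 cos_le1.
rewrite ler_norml; apply/andP; split.
  rewrite -mulN1r -angintZ//; apply: le_angint => //.
    by apply: continuous_der => t; der_rec fail.
  by move=> t; have := H t; rewrite ler_norml expr0 mul1r mulN1r => /andP[].
by apply: le_angint => // t; have := H t; rewrite ler_norml expr0 mul1r => /andP[].
Qed.

(** Only the angles in [[0, 1 / sqrt x]] are kept; there [cos t >= 1 - t ^+ 2 / 2], so the exponent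
    is at least [x - 1/2]. *)
Lemma bessel0_ge x : 1 <= x -> expR (x - 2^-1) / Num.sqrt x <= bessel 0 x.
Proof.
move=> x1; have x0 : 0 < x by lra.
have sx : 0 < Num.sqrt x by rewrite sqrtr_gt0.
have sx1 : 1 <= Num.sqrt x by rewrite -sqrtr1 ler_wsqrtr.
have pi2 : 2 <= pi :> R by exact: pi_ge2.
pose r := (Num.sqrt x)^-1; have r0 : 0 < r by rewrite invr_gt0.
have r1 : r <= 1 by rewrite invf_le1.
have mE : measurable_fun `[0, 2 * pi] (fun t : R => expR (x * cos t)).
  apply: measurable_funTS; apply: continuous_measurable_fun.
  by apply: continuous_der => t; der_rec fail.
rewrite /bessel (eq_angint (g := fun t => expR (x * cos t))); last by move=> t; rewrite expr0 mul1r.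
have ce : continuous (fun t : R => expR (x * cos t)) by apply: continuous_der => t; der_rec fail.
have -> : expR (x - 2^-1) / Num.sqrt x = (\int[@lebesgue_measure R]_(t in `[0%R, r]) (expR (x - 2^-1)))%R.
  by rewrite Rintegral_cst//= lebesgue_measure_itv/= lte_fin r0 -EFinB subr0.
have sub : (`[0%R, r]%classic : set R) `<=` `[0%R, 2 * pi]%classic.
  move=> t /=; rewrite !in_itv/= => /andP[-> tr]/=.
  by apply: le_trans tr _; apply: le_trans r1 _; lra.
have intr f : continuous f -> (@lebesgue_measure R).-integrable `[0%R, r] (EFin \o f).
  by move=> cf; apply: integrableS (angint_integrable cf).
apply: (@le_trans _ _ (\int[@lebesgue_measure R]_(t in `[0%R, r]) (expR (x * cos t)))%R).
  apply: le_Rintegral => //.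
  - by apply: intr => t; exact: cvg_cst.
  - exact: intr.
  move=> t /=; rewrite in_itv/= => /andP[t0 tr]; rewrite ler_expR.
  have := cos_ge_quad t0; have : x * t ^+ 2 <= 1.
    have : t ^+ 2 <= r ^+ 2 by rewrite ler_sqr ?nnegrE// ltW.
    rewrite /r exprVn sqr_sqrtr ?(ltW x0)// => H.
    by have := ler_wpM2l (ltW x0) H; rewrite divff//; nz.
  by move=> H1 H2; have := ler_wpM2l (ltW x0) H2; lra.
rewrite /angint /Rintegral fine_le//.
- by apply: integrable_fin_num => //; exact: intr.
- by apply: integrable_fin_num => //; exact: angint_integrable.
apply: ge0_subset_integral => //; first by apply/measurable_EFinP.
Qed.

Lemma bessel0_gt0 x : 0 < bessel 0 x.
Proof.
apply: (@lt_le_trans _ _ (angint (fun=> expR (- `|x|)))).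
  by rewrite angint_cst mulr_gt0 ?expR_gt0// mulr_gt0// pi_gt0.
apply: le_angint => [t|//|t]; first exact: cvg_cst.
rewrite expr0 mul1r ler_expR.
have : `|x * cos t| <= `|x|.
  by rewrite normrM ler_piMr// ler_norml cos_geN1 cos_le1.
by rewrite ler_norml => /andP[].
Qed.

(** [u] removes the expected growth [exp(x) / sqrt x], and [Z] is [expR (2 * x) * u']. Since
    [sqrt x * I_0(x)] solves [w'' = (1 - 1 / (4 x^2)) w], the derivative of [Z] has a sign, so [Z]
    is decreasing. *)
Let u x := Num.sqrt x * expR (- x) * bessel 0 x.
Let Z x := Num.sqrt x * expR x * (bessel 0 x / (2 * x) - bessel 0 x + bessel 1 x).

Let du x : 0 < x -> der x u (Z x * expR (- (2 * x))).
Proof.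
move=> x0; have sx : 0 < Num.sqrt x by rewrite sqrtr_gt0.
rewrite /u; der_tac ltac:(eapply der_bessel) => //.
rewrite /Z (_ : - (2 * x) = - x + - x); last by ring.
rewrite expRD expRN; have := expR_gt0 x => ex.
have -> : 1 / (2 * Num.sqrt x) = Num.sqrt x / (2 * x).
  by rewrite -{3}(sqr_sqrtr (ltW x0)); field; nz.
by field; nz.
Qed.

Let u_gt0 x : 0 < x -> 0 < u x.
Proof. by move=> x0; rewrite /u !mulr_gt0 ?expR_gt0 ?bessel0_gt0// sqrtr_gt0. Qed.

Let dZ x : 0 < x -> der x Z (- (expR (2 * x) * u x / (4 * x ^+ 2))).
Proof.
move=> x0; have sx : 0 < Num.sqrt x by rewrite sqrtr_gt0.
rewrite /Z; der_tac ltac:(eapply der_bessel) => //; first by nz.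
have -> : bessel 2 x = bessel 0 x - bessel 1 x / x.
  by apply: (@mulfI _ x); [nz|rewrite mulrBr -bessel_ode; field; nz].
rewrite /u (_ : 2 * x = x + x); last by ring.
rewrite expRD expRN; have := expR_gt0 x => ex.
have -> : 1 / (2 * Num.sqrt x) = Num.sqrt x / (2 * x).
  by rewrite -{3}(sqr_sqrtr (ltW x0)); field; nz.
have x2 : 0 < x + x by lra.
by field; nz.
Qed.

Let u_ge x : 1 <= x -> expR (- 2^-1) <= u x.
Proof.
move=> x1; have x0 : 0 < x by lra.
have sx : 0 < Num.sqrt x by rewrite sqrtr_gt0.
have := bessel0_ge x1; rewrite ler_pdivrMr// expRD -ler_pdivlMl ?expR_gt0//.
by rewrite -expRN /u => /le_trans; apply; rewrite le_eqVlt; apply/orP; left; apply/eqP; ring.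
Qed.

Let Z_le x : 1 <= x -> Z x <= Z 1.
Proof.
move=> x1; rewrite -lerN2.
apply: (der_mono x1 (f := fun x => - Z x) (df := fun x => - - (expR (2 * x) * u x / (4 * x ^+ 2)))).
  by move=> y /andP[y1 _]; apply: derN; apply: dZ; lra.
move=> y /andP[y1 _]; have y0 : 0 < y by lra.
by rewrite opprK; have := u_gt0 y0 => uy; nn.
Qed.

Let exp2_ge x : 0 < x -> expR (- (2 * x)) <= (x ^+ 2)^-1.
Proof.
move=> x0; rewrite (_ : - (2 * x) = - x + - x); last by ring.
rewrite expRD expr2 invfM; have := expRN_le_inv x0 => H.
by apply: ler_pM => //; exact: expR_ge0.
Qed.

(** [Z <= Z 1] gives [u' <= |Z 1| / x ^+ 2], whose integral over [[1, +oo[] is finite. *)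
Let u_bounded : exists2 c, 0 < c & forall x, 1 <= x -> u x <= c.
Proof.
exists (u 1 + `|Z 1|) => [|x x1]; first by rewrite ltr_wpDr// u_gt0.
have : u x - u 1 <= `|Z 1|; last by move: (u x) (u 1) (`|Z 1|) => p q r; lra.
have : u x - (- `|Z 1| * x^-1) <= u 1 - (- `|Z 1| * 1^-1).
  rewrite -lerN2.
  apply: (der_mono x1 (f := fun x => - (u x - (- `|Z 1| * x^-1)))
    (df := fun x => `|Z 1| * (x ^+ 2)^-1 - Z x * expR (- (2 * x)))).
    move=> y /andP[y1 _]; have y0 : 0 < y by lra.
    by der_tac ltac:(eapply du) => //; [nz|field; nz].
  move=> y /andP[y1 _]; have y0 : 0 < y by lra.
  rewrite subr_ge0; apply: (@le_trans _ _ (`|Z 1| * expR (- (2 * y)))).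
    by rewrite ler_wpM2r ?expR_ge0// (le_trans (Z_le y1))// ler_norm.
  by rewrite ler_wpM2l ?exp2_ge.
have : 0 <= `|Z 1| * x^-1 by rewrite mulr_ge0// invr_ge0; lra.
by rewrite invr1 mulr1; move: (u x) (u 1) (`|Z 1|) => p q r; lra.
Qed.

(** Above, [Z] is decreasing. Below, [Z + C * expR (2 * x) / x ^+ 2] is nondecreasing for [x >= 2],
    since [2 - 2 / x >= 1] there and [C] dominates [u]; it is nonnegative at 2 because
    [C >= 4 * |Z 2|]. The factor [expR (- (2 * x))] turns both into [C / x ^+ 2]. *)
Let du_le : exists2 C, 0 < C & forall x, 2 <= x -> `|Z x * expR (- (2 * x))| <= C / x ^+ 2.
Proof.
have [c c0 uc] := u_bounded.
have dZ' := dZ; have Z_le' := Z_le.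
move: dZ' Z_le' uc; move: Z u => Z' u' dZ' Z_le' uc.
pose C := c + `|Z' 1| + 4 * `|Z' 2|.
have C0 : 0 < C by rewrite /C -addrA ltr_wpDr//; nn.
have [Z1n Z2n] : 0 <= `|Z' 1| /\ 0 <= `|Z' 2| by split; exact: normr_ge0.
have cC : c <= C by rewrite /C -addrA lerDl addr_ge0// mulr_ge0.
have Z2C : `|Z' 2| <= C / 4 by rewrite ler_pdivlMr// mulrC /C lerDr addr_ge0// ltW.
have Z1C : `|Z' 1| <= C by rewrite /C addrAC lerDr addr_ge0 ?mulr_ge0// ltW.
clearbody C; exists C => // x x2; have x0 : 0 < x by lra.
have e2 : expR (- (2 * x)) * expR (2 * x) = 1 by rewrite -expRD addNr expR0.
have low : - C * (x ^+ 2)^-1 * expR (2 * x) <= Z' x.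
  have : - 1 * Z' 2 - C * (2 ^+ 2)^-1 * expR (2 * 2) <= 0.
    have : 1 <= expR (2 * 2) :> R by rewrite -expR0 ler_expR mulr_ge0.
    have := ler_norm (- Z' 2); rewrite normrN => H1 H2.
    have : C / 4 <= C / 4 * expR (2 * 2) by rewrite ler_peMr//; lra.
    rewrite (_ : (2 ^+ 2)^-1 = 4^-1 :> R); last by congr (_^-1); ring.
    by move: H1 Z2C; move: (`|Z' 2|) (Z' 2) (expR _) => p q e; lra.
  have : Z' 2 + C * (2 ^+ 2)^-1 * expR (2 * 2) <= Z' x + C * (x ^+ 2)^-1 * expR (2 * x).
    apply: (der_mono x2 (f := fun x => Z' x + C * (x ^+ 2)^-1 * expR (2 * x))
     (df := fun x => expR (2 * x) / x ^+ 2 * (C * (2 - 2 / x) - u' x / 4))).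
      move=> y /andP[y2 _]; have y0 : 0 < y by lra.
      by der_tac ltac:(eapply dZ') => //; [nz|field; nz].
    move=> y /andP[y2 _]; have y0 : 0 < y by lra.
    apply: mulr_ge0; first by nn.
    have : u' y <= c by apply: uc; lra.
    have : 1 <= 2 - 2 / y.
      have : 2 / y <= 1 by rewrite ler_pdivrMr//; lra.
      lra.
    move=> H1 H2; have : C * 1 <= C * (2 - 2 / y) by rewrite ler_wpM2l// ltW.
    by have := le_trans H2 cC; move: (u' y) => p; lra.
  lra.
have up : Z' x <= C by apply: le_trans (le_trans (ler_norm _) Z1C); apply: Z_le'; lra.
rewrite ler_norml; apply/andP; split.
  have := ler_wpM2r (expR_ge0 (- (2 * x))) low; rewrite -[X in X <= _]mulrA [expR (2 * x) * _]mulrC e2 mulr1.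
  by rewrite mulNr.
apply: (@le_trans _ _ (C * expR (- (2 * x)))); first by rewrite ler_wpM2r ?expR_ge0.
by rewrite ler_wpM2l ?exp2_ge// ltW.
Qed.

(** The first quantity is exactly [u' / u], with [u] bounded below by [bessel0_ge]. For [x < 2] the
    bound [|I_0'| <= I_0] suffices: [2 * x ^+ 2 + x / 2] stays below the constant 10. *)
Lemma bessel_log_derivative : exists2 C, 0 < C & forall x, 0 < x ->
  `|bessel 1 x / bessel 0 x - 1 + (2 * x)^-1| <= C / x ^+ 2 /\
  `|bessel 1 x / bessel 0 x - 1| <= C / x.
Proof.
have [C C0 HC] := du_le.
pose C' := C * expR (2^-1) + 10.
have C'0 : 0 < C' by rewrite /C' ltr_wpDl//; nn.
have main x : 0 < x -> `|bessel 1 x / bessel 0 x - 1 + (2 * x)^-1| <= C' / x ^+ 2.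
  move=> x0; have I0 := bessel0_gt0 x; have [x2|x2] := leP 2 x.
    have sx : 0 < Num.sqrt x by rewrite sqrtr_gt0.
    have ex := expR_gt0 x.
    have -> : bessel 1 x / bessel 0 x - 1 + (2 * x)^-1 = Z x * expR (- (2 * x)) / u x.
      rewrite /Z /u (_ : - (2 * x) = - x + - x); last by ring.
      by rewrite expRD expRN; field; nz.
    have ux : 0 < u x by exact: u_gt0.
    rewrite normrM normfV (gtr0_norm ux) ler_pdivrMr//.
    apply: (le_trans (HC x x2)).
    have : C / x ^+ 2 * 1 <= C / x ^+ 2 * (expR (2^-1) * u x).
      apply: ler_wpM2l; first by nn.
      apply: (@le_trans _ _ (expR 2^-1 * expR (- 2^-1))); first by rewrite expRxMexpNx_1.
      by rewrite ler_pM2l ?expR_gt0//; apply: u_ge; lra.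
    rewrite mulr1 => /le_trans; apply.
    have -> : C / x ^+ 2 * (expR 2^-1 * u x) = C * expR 2^-1 / x ^+ 2 * u x by ring.
    apply: ler_wpM2r; first exact: ltW.
    by apply: ler_wpM2r; [rewrite invr_ge0 sqr_ge0|rewrite /C' lerDl].
  have g1 : `|bessel 1 x / bessel 0 x| <= 1.
    by rewrite normrM normfV (gtr0_norm I0) ler_pdivrMr// mul1r bessel_norm.
  have xV : 0 < (2 * x)^-1 by rewrite invr_gt0 mulr_gt0.
  apply: (@le_trans _ _ (2 + (2 * x)^-1)).
    by move: g1; rewrite !ler_norml; lra.
  apply: (@le_trans _ _ (10 / x ^+ 2)); last first.
    by apply: ler_wpM2r; [rewrite invr_ge0 sqr_ge0|rewrite /C' lerDr; nn].
  rewrite ler_pdivlMr ?exprn_gt0// mulrDl.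
  have -> : (2 * x)^-1 * x ^+ 2 = x / 2 by field; nz.
  by nra.
exists (C' + 2) => [|x x0]; first by lra.
have I0 := bessel0_gt0 x; split.
  by apply: (le_trans (main x x0)); apply: ler_wpM2r; [rewrite invr_ge0 sqr_ge0|lra].
have xV : 0 < x^-1 by rewrite invr_gt0.
have -> : (C' + 2) / x = C' / x + 2 / x by ring.
have [x1|x1] := leP 1 x.
  have : C' / x ^+ 2 <= C' / x.
    rewrite expr2 invfM mulrA ler_piMr ?invf_le1//; nn.
  have := main x x0; rewrite invfM !ler_norml; lra.
have g1 : `|bessel 1 x / bessel 0 x| <= 1.
  by rewrite normrM normfV (gtr0_norm I0) ler_pdivrMr// mul1r bessel_norm.
have : 1 <= x^-1 by rewrite invf_ge1// ltW.
have : 0 <= C' * x^-1 by nn.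
by move: g1; rewrite !ler_norml; lra.
Qed.

(** [u' = O(1 / x ^+ 2)] makes [u x - C / x] a lower bound and [u x + C / x] an upper bound for
    every later value; the limit is the supremum of the lower bounds. It is positive by the uniform
    lower bound on [u]. *)
Lemma bessel_limit : exists C l, [/\ 0 < C, 0 < l & forall x, 2 <= x ->
  `|Num.sqrt x * expR (- x) * bessel 0 x - l| <= C / x].
Proof.
have [C C0 HC] := du_le.
have uvar x y : 2 <= x -> x <= y -> `|u y - u x| <= C / x - C / y.
  move=> x2 xy; have -> : C / x - C / y = - (C * y^-1) - (- (C * x^-1)) by ring.
  apply: (der_bound xy (df := fun y => Z y * expR (- (2 * y))) (g := fun y => - (C * y^-1))
    (dg := fun y => C / y ^+ 2)).
  - by move=> z /andP[z1 _]; apply: du; lra.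
  - move=> z /andP[z1 _]; have z0 : 0 < z by lra.
    by der_tac fail; [nz|field; nz].
  - by move=> z /andP[z1 _]; apply: HC; lra.
pose S := [set r | exists2 x, 2 <= x & r = u x - C / x].
have bdS z : 2 <= z -> ubound S (u z + C / z).
  move=> z2 _ [x x2 ->]; have x0 : 0 < x by lra.
  have z0 : 0 < z by lra.
  have Cx : 0 < C / x by rewrite divr_gt0.
  have Cz : 0 < C / z by rewrite divr_gt0.
  have [xz|zx] := leP x z.
    by have := uvar _ _ x2 xz; rewrite ler_norml; move: (u x) (u z) => p q; lra.
  by have := uvar _ _ z2 (ltW zx); rewrite ler_norml; move: (u x) (u z) => p q; lra.
have supS : has_sup S.
  split; first by exists (u 2 - C / 2); exists 2.
  by exists (u 2 + C / 2); apply: bdS.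
have lim x : 2 <= x -> `|u x - sup S| <= C / x.
  move=> x2; have : u x - C / x <= sup S by apply: ub_le_sup; [exact: supS.2|exists x].
  have : sup S <= u x + C / x by apply: ge_sup; [exact: supS.1|exact: bdS].
  by rewrite ler_norml; lra.
exists C, (sup S); split; [exact: C0| |exact: lim].
apply: (@lt_le_trans _ _ (expR (- 2^-1))); first exact: expR_gt0.
apply/ler_addgt0Pr => e e0.
pose x := 2 + C / e; have x2 : 2 <= x by rewrite lerDl divr_ge0 ?ltW.
have x0 : 0 < x by lra.
have Cxe : C / x <= e.
  by rewrite ler_pdivrMr// /x mulrDr [e * (C / e)]mulrC divfK; [have := e0; lra|nz].
have := lim x x2; have := u_ge (x := x); rewrite ler_norml => H1 /andP[_ H2].
by have := H1 ltac:(lra); lra.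
Qed.

End Bessel.

(** * The radial equation outside the well *)

Section FreeSolution.
Context {R : realType}.
Variables (B b1 bet C h rho Kz : R) (m j j1 j2 : R -> R).
Hypotheses (B0 : 0 < B) (b10 : 0 < b1) (b1bet : b1 <= bet) (C0 : 0 < C) (h0 : 0 < h) (h1 : h <= 1).
Hypothesis rho0 : 0 < rho.
Hypothesis bessel_ld : forall x : R, 0 < x ->
  `|bessel 1 x / bessel 0 x - 1 + (2 * x)^-1| <= C / x ^+ 2 /\
  `|bessel 1 x / bessel 0 x - 1| <= C / x.
Definition fs_q (r : R) := Num.sqrt (B ^+ 2 * r ^+ 2 / 4 + bet).
Local Notation q := fs_q.
Hypothesis dm : forall r : R, 0 < r -> der r m (q r).
Hypothesis m_0 : m r @[r --> 0^'+] --> (0 : R).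
Hypothesis dj : forall r : R, 0 < r <= rho -> der r j (j1 r).
Hypothesis dj1 : forall r : R, 0 < r <= rho -> der r j1 (j2 r).
Hypothesis ode : forall r : R, 0 < r <= rho ->
  h ^+ 2 * (r * j2 r + j1 r) = r * q r ^+ 2 * j r.
Hypothesis j_0 : j r @[r --> 0^'+] --> j 0.
Hypothesis rj1_0 : r * j1 r @[r --> 0^'+] --> (0 : R).
Hypothesis Kz_ge : 2 * q rho + B ^+ 2 * rho / (8 * b1) <= Kz.

Let sb := Num.sqrt bet.
Let bet0 : 0 < bet. Proof. exact: lt_le_trans b1bet. Qed.
Let sb0 : 0 < sb. Proof. by rewrite sqrtr_gt0. Qed.
Let sbE : sb ^+ 2 = bet. Proof. by rewrite sqr_sqrtr// ltW. Qed.

Let x_ r := sb * r / h.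
Let g r := bessel 1 (x_ r) / bessel 0 (x_ r).
Let a r := - (B ^+ 2 * r / (8 * q r ^+ 2)).
(** [fs_Y] is the growing WKB solution [exp(m / h) / sqrt (r q)] with its singularity at the origin
    resolved: [r] near 0 is governed by [I_0(sqrt bet * r / h)], and the remaining factor turns the
    constant potential into [q ^+ 2]. [fs_Z] is its logarithmic derivative, [a = - q' / (2 q)]
    coming from [1 / sqrt q]. *)
Definition fs_Z (r : R) := (sb * g r + q r - sb) / h + a r.
Definition fs_Y (r : R) := bessel 0 (x_ r) * expR ((m r - sb * r) / h) / Num.sqrt (q r).
Local Notation Z := fs_Z.
Local Notation Y := fs_Y.

Let q_arg (r : R) : 0 < B ^+ 2 * r ^+ 2 / 4 + bet.
Proof. by apply: ltr_wpDl => //; nn. Qed.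

Lemma fs_q_gt0 (r : R) : 0 < q r. Proof. by rewrite sqrtr_gt0. Qed.

Lemma fs_q_sqr (r : R) : q r ^+ 2 = B ^+ 2 * r ^+ 2 / 4 + bet.
Proof. by rewrite sqr_sqrtr// ltW. Qed.

Let q_ge (r : R) : sb <= q r.
Proof. by rewrite ler_wsqrtr// lerDr; nn. Qed.

Let Y_gt0 (r : R) : 0 < Y r.
Proof. by rewrite /Y divr_gt0 ?mulr_gt0 ?bessel0_gt0 ?expR_gt0// sqrtr_gt0 fs_q_gt0. Qed.

Let dq (r : R) : der r q (B ^+ 2 * r / (4 * q r)).
Proof.
have q0 := fs_q_gt0 r; rewrite /q; der_tac fail => //.
by rewrite -/(q r); field; nz.
Qed.

Let dx (r : R) : der r x_ (sb / h).
Proof. by rewrite /x_; der_tac fail; ring. Qed.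

Let dg (r : R) : 0 < r -> der r g (sb / h * (1 - g r ^+ 2) - g r / r).
Proof.
move=> r0; have I0 := bessel0_gt0 (x_ r).
have xr : 0 < x_ r by rewrite /x_; pp.
rewrite /g; der_tac ltac:(eapply der_comp; [eapply der_bessel|eapply dx]); first by nz.
have -> : bessel 2 (x_ r) = bessel 0 (x_ r) - bessel 1 (x_ r) / x_ r.
  by apply: (@mulfI _ (x_ r)); [nz|rewrite mulrBr -bessel_ode; field; nz].
have -> : bessel 1 (x_ r) / bessel 0 (x_ r) / r = sb / h * (bessel 1 (x_ r) / bessel 0 (x_ r) / x_ r).
  by rewrite /x_; field; nz.
by field; nz.
Qed.

Let a' r := - (B ^+ 2 / (8 * q r ^+ 2)) + B ^+ 4 * r ^+ 2 / (16 * q r ^+ 4).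

Let da (r : R) : der r a (a' r).
Proof.
have q0 := fs_q_gt0 r; rewrite /a; der_tac ltac:(eapply dq); first by nz.
by rewrite /a'; field; nz.
Qed.

Let Z1 r := (sb * (sb / h * (1 - g r ^+ 2) - g r / r) + B ^+ 2 * r / (4 * q r)) / h + a' r.

Let dZ (r : R) : 0 < r -> der r Z (Z1 r).
Proof.
move=> r0; rewrite /Z; der_tac ltac:(first [eapply dg|eapply dq|eapply da]) => //.
by rewrite /Z1; ring.
Qed.

Let dY (r : R) : 0 < r -> der r Y (Z r * Y r).
Proof.
move=> r0; have q0 := fs_q_gt0 r; have I0 := bessel0_gt0 (x_ r).
have sq0 : 0 < Num.sqrt (q r) by rewrite sqrtr_gt0.
rewrite /Y; der_tac ltac:(first [eapply der_comp; [eapply der_bessel|eapply dx]|eapply dm|eapply dq]) => //.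
  by nz.
rewrite /Z /g /a sqr_sqrtr ?(ltW q0)//.
have -> : B ^+ 2 * r / (4 * q r) / (2 * Num.sqrt (q r)) = B ^+ 2 * r / (8 * q r ^+ 2) * Num.sqrt (q r).
  by rewrite -[X in _ = _ / (_ * X ^+ 2) * _](sqr_sqrtr (ltW q0)) -{1}(sqr_sqrtr (ltW q0)); field; nz.
have -> : (Num.sqrt (q r))^-1 = Num.sqrt (q r) / q r.
  by rewrite -{3}(sqr_sqrtr (ltW q0)); field; nz.
by field; nz.
Qed.

(** The defect of [fs_Y] as a potential: [fs_Y] solves the free radial equation exactly with
    [q ^+ 2 / h ^+ 2 - k] in place of [q ^+ 2 / h ^+ 2]. *)
Let k r := (q r ^+ 2 - h ^+ 2 * (Z1 r + Z r ^+ 2 + Z r / r)) / h ^+ 2.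
Definition fs_Kk := B ^+ 2 * (C + 1) / b1.
Local Notation Kk := fs_Kk.

Let kE (r : R) : 0 < r -> h ^+ 2 * k r = - (2 * sb * (q r - sb) * (g r - 1 + (2 * x_ r)^-1)
  + 2 * h * a r * sb * (g r - 1) + h ^+ 2 * (a' r + a r ^+ 2 + a r / r)).
Proof.
move=> r0; have q0 := fs_q_gt0 r.
have aE : B ^+ 2 * r / (4 * q r) = - (2 * a r * q r) by rewrite /a; field; nz.
rewrite /k /Z1 /Z aE /x_ mulrC divfK; last by nz.
have s0 := sb0; field; nz.
Qed.

(** Bounded uniformly in [r] and [h], since each vanishing factor at the origin meets a matching
    singular one: [q - sb] is [O(r ^+ 2)] against a second-order Bessel remainder
    [O(h ^+ 2 / r ^+ 2)], and [a] is [O(r)] against a first-order one [O(h / r)]. *)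
Let k_le (r : R) : 0 < r -> `|k r| <= Kk.
Proof.
move=> r0; have q0 := fs_q_gt0 r; have b10' := b10; have B0' := B0; have s0 := sb0; have C0' := C0.
have xr : 0 < x_ r by rewrite /x_; pp.
have [g1 g2] := bessel_ld xr.
have q2 : b1 <= q r ^+ 2.
  by rewrite fs_q_sqr (le_trans b1bet)// lerDr; nn.
have Br : B ^+ 2 * r ^+ 2 / 4 <= q r ^+ 2 by rewrite fs_q_sqr lerDl ltW.
have q20 : 0 < q r ^+ 2 by rewrite exprn_gt0.
have h20 : 0 < h ^+ 2 by rewrite exprn_gt0.
have Bb : B ^+ 2 / q r ^+ 2 <= B ^+ 2 / b1.
  by apply: ler_wpM2l; [nn|rewrite lef_pV2 ?posrE].
have e_le : `|q r - sb| <= B ^+ 2 * r ^+ 2 / (8 * sb).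
  rewrite ger0_norm ?subr_ge0//.
  have : (q r - sb) * (q r + sb) = B ^+ 2 * r ^+ 2 / 4.
    by transitivity (q r ^+ 2 - sb ^+ 2); [ring|rewrite fs_q_sqr sbE; ring].
  have := q_ge r => qs E; rewrite ler_pdivlMr; last by pp.
  nra.
have a_le : `|a r| <= B ^+ 2 / b1 * r / 8.
  rewrite /a normrN ger0_norm; last by nn.
  have -> : B ^+ 2 * r / (8 * q r ^+ 2) = B ^+ 2 / q r ^+ 2 * (r / 8) by field; nz.
  by rewrite -[leRHS]mulrA; apply: ler_wpM2r => //; nn.
have T1 : `|2 * sb * (q r - sb) * (g r - 1 + (2 * x_ r)^-1)| <= h ^+ 2 * (B ^+ 2 / b1 * C / 4).
  rewrite -mulrA normrM normrM (gtr0_norm s0) (gtr0_norm (ltr0n _ 2)).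
  apply: (@le_trans _ _ (2 * sb * (B ^+ 2 * r ^+ 2 / (8 * sb) * (C / x_ r ^+ 2)))).
    by apply: ler_wpM2l; [nn|rewrite normrM; apply: ler_pM].
  have -> : 2 * sb * (B ^+ 2 * r ^+ 2 / (8 * sb) * (C / x_ r ^+ 2)) =
     h ^+ 2 * (B ^+ 2 / sb ^+ 2 * (C / 4)) by rewrite /x_; field; nz.
  rewrite sbE; apply: ler_wpM2l; first exact: ltW.
  rewrite -[leRHS]mulrA; apply: ler_wpM2r; first by nn.
  by apply: ler_wpM2l; [nn|rewrite lef_pV2 ?posrE].
have T2 : `|2 * h * a r * sb * (g r - 1)| <= h ^+ 2 * (B ^+ 2 / b1 * C / 4).
  have -> : 2 * h * a r * sb * (g r - 1) = 2 * h * sb * (a r * (g r - 1)) by ring.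
  rewrite normrM [`|2 * h * sb|]ger0_norm; last by nn.
  apply: (@le_trans _ _ (2 * h * sb * (B ^+ 2 / b1 * r / 8 * (C / x_ r)))).
    by apply: ler_wpM2l; [nn|rewrite normrM; apply: ler_pM].
  by rewrite le_eqVlt; apply/orP; left; apply/eqP; rewrite /x_; field; nz.
have T3 : `|a' r + a r ^+ 2 + a r / r| <= B ^+ 2 / b1.
  have Ba : B ^+ 4 * r ^+ 2 / q r ^+ 4 <= 4 * (B ^+ 2 / q r ^+ 2).
    have -> : B ^+ 4 * r ^+ 2 / q r ^+ 4 = 4 * (B ^+ 2 / q r ^+ 2) * (B ^+ 2 * r ^+ 2 / 4 / q r ^+ 2).
      by field; nz.
    by apply: ler_piMr; [nn|rewrite ler_pdivrMr// mul1r].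
  have Ba0 : 0 <= B ^+ 4 * r ^+ 2 / q r ^+ 4 by nn.
  have B20 : 0 <= B ^+ 2 / q r ^+ 2 by nn.
  have -> : a' r + a r ^+ 2 + a r / r = - (B ^+ 2 / q r ^+ 2 / 4) + B ^+ 4 * r ^+ 2 / q r ^+ 4 * (5 / 64).
    by rewrite /a' /a; field; nz.
  rewrite ler_norml; lra.
have : `|h ^+ 2 * k r| <= h ^+ 2 * Kk.
  rewrite kE// normrN; apply: (le_trans (ler_normD _ _)).
  have := ler_normD (2 * sb * (q r - sb) * (g r - 1 + (2 * x_ r)^-1)) (2 * h * a r * sb * (g r - 1)).
  have T3' : `|h ^+ 2 * (a' r + a r ^+ 2 + a r / r)| <= h ^+ 2 * (B ^+ 2 / b1).
    by rewrite normrM (gtr0_norm h20) ler_pM2l.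
  have -> : h ^+ 2 * Kk = h ^+ 2 * (B ^+ 2 / b1 * C / 4) + h ^+ 2 * (B ^+ 2 / b1 * C / 4)
     + h ^+ 2 * (B ^+ 2 / b1) + h ^+ 2 * (B ^+ 2 / b1 * C / 2) by rewrite /Kk; field; nz.
  have : 0 <= h ^+ 2 * (B ^+ 2 / b1 * C / 2) by nn.
  lra.
by rewrite normrM (gtr0_norm h20) ler_pM2l.
Qed.

Let hZ_le (r : R) : 0 < r <= rho -> `|h * Z r| <= Kz.
Proof.
move=> /andP[r0 rr]; have q0 := fs_q_gt0 r; have I0 := bessel0_gt0 (x_ r).
have b10' := b10; have B0' := B0; have s0 := sb0; have h0' := h0.
have g1 : `|g r| <= 1.
  by rewrite /g normrM normfV (gtr0_norm I0) ler_pdivrMr// mul1r bessel_norm.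
have qr : q r <= q rho.
  rewrite /q ler_wsqrtr// lerD2r ler_wpM2r// ler_wpM2l ?sqr_ge0//.
  by rewrite ler_sqr ?nnegrE ?(ltW r0) ?(ltW rho0).
have -> : h * Z r = (sb * g r + (q r - sb)) + h * a r by rewrite /Z; field; nz.
have qs := q_ge r.
have H1 : `|sb * g r| <= sb by rewrite normrM (gtr0_norm s0) ler_piMr// ltW.
have q2 : b1 <= q r ^+ 2 by rewrite fs_q_sqr (le_trans b1bet)// lerDr; nn.
have q20 : 0 < q r ^+ 2 by rewrite exprn_gt0.
have H2 : `|h * a r| <= B ^+ 2 * rho / (8 * b1).
  rewrite normrM (gtr0_norm h0) /a normrN ger0_norm; last by nn.
  apply: (@le_trans _ _ (1 * (B ^+ 2 * r / (8 * q r ^+ 2)))); first by apply: ler_wpM2r => //; nn.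
  rewrite mul1r; apply: ler_pM; [nn|nn| |].
    by apply: ler_wpM2l => //; nn.
  by rewrite lef_pV2 ?posrE ?mulr_gt0// ler_pM2l.
apply: (le_trans (ler_normD _ _)).
have := ler_normD (sb * g r) (q r - sb); rewrite [`|q r - sb|]ger0_norm ?subr_ge0//.
by have := Kz_ge; lra.
Qed.

Definition fs_K3 := 2 * Kk / b1 * Kz.
Local Notation K3 := fs_K3.
Hypothesis hs1 : 2 * Kk * h ^+ 2 <= b1.
Hypothesis hs2 : K3 * h * rho <= 2^-1.

Definition fs_Y0 := 2 * pi / Num.sqrt sb.
(** As for the ground state: [y = r * Y ^+ 2 * u'], and its derivative is the residual
    [r * Y * j * k]. *)
Let u r := j r / Y r.
Let y r := r * Y r * (j1 r - Z r * j r).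

Let Kz0 : 0 <= Kz.
Proof. by apply: le_trans (@hZ_le rho _) => //; rewrite rho0 lexx. Qed.

Let Y_cvg0 : Y r @[r --> 0^'+] --> fs_Y0.
Proof.
have -> : fs_Y0 = bessel 0 (sb * 0 / h) * expR ((0 - sb * 0) / h) / Num.sqrt (q 0).
  have -> : q 0 = sb by rewrite /q expr0n/= mulr0 mul0r add0r.
  by rewrite !(mulr0, mul0r) subr0 mul0r expR0 mulr1 bessel0_0.
apply: cvgM; first apply: cvgM.
- apply: cvg_at_right_filter.
  apply: (der_cvg (f := fun r => bessel 0 (sb * r / h))).
  by eapply (@der_comp _ x_); [eapply der_bessel|eapply dx].
- apply: continuous_cvg; first exact: continuous_expR.
  apply: cvgMl; apply: cvgB; first exact: m_0.
  by apply: cvgMr; exact: cvg_right_id.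
- apply: cvgV; first by rewrite gt_eqF// sqrtr_gt0 fs_q_gt0.
  apply: cvg_at_right_filter; apply: continuous_cvg; first exact: sqrt_continuous.
  exact: (der_cvg (dq 0)).
Qed.

Let Y00 : 0 < fs_Y0.
Proof. by rewrite divr_gt0 ?mulr_gt0 ?pi_gt0// sqrtr_gt0. Qed.

Let rZ_cvg0 : r * Z r @[r --> 0^'+] --> (0 : R).
Proof.
apply/cvgr0Pnorm_le => e e0.
have bnd0 : 0 < e * h / (Kz + 1) by have := Kz0; have := h0 => ? ?; apply: divr_gt0; [pp|lra].
near=> r.
have r0 : 0 < r by [].
have rr : r <= rho by near: r; exact: nbhs_right_le.
have h0' := h0; have K0 := Kz0.
have : `|h * Z r| <= Kz by apply: hZ_le; rewrite r0.
rewrite normrM (gtr0_norm h0) => H; rewrite normrM (gtr0_norm r0).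
have re : r <= e * h / (Kz + 1).
  by near: r; exact: nbhs_right_le.
rewrite -(ler_pM2l h0).
apply: (@le_trans _ _ (r * (Kz + 1))).
  by rewrite mulrCA ler_pM2l//; lra.
rewrite -ler_pdivlMr; last lra.
by rewrite [h * e]mulrC.
Unshelve. all: by end_near. Qed.

Let u_cvg0 : u r @[r --> 0^'+] --> j 0 / fs_Y0.
Proof. by apply: cvgM; [exact: j_0|apply: cvgV; [nz|exact: Y_cvg0]]. Qed.

Let du (r : R) : 0 < r <= rho -> der r u (y r / (r * Y r ^+ 2)).
Proof.
move=> rr; have /andP[r0 _] := rr; have Y0 := Y_gt0 r.
rewrite /u; der_tac ltac:(first [eapply dY|eapply dj]) => //; first by nz.
by rewrite /y; field; nz.
Qed.

Let dy (r : R) : 0 < r <= rho -> der r y (r * Y r * j r * k r).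
Proof.
move=> rr; have /andP[r0 _] := rr; have h0' := h0.
rewrite /y; der_tac ltac:(first [eapply dY|eapply dj1|eapply dj|eapply dZ]) => //.
have E : r * j2 r + j1 r = r * q r ^+ 2 * j r / h ^+ 2 by rewrite -ode//; field; nz.
transitivity (Y r * ((r * j2 r + j1 r) - r * (Z1 r + Z r ^+ 2 + Z r / r) * j r)); first by field; nz.
by rewrite E /k; field; nz.
Qed.

Let y_cvg0 : y r @[r --> 0^'+] --> (0 : R).
Proof.
rewrite (_ : y = fun r => Y r * (r * j1 r - r * Z r * j r)); last first.
  by apply/funext => r; rewrite /y; ring.
suff : Y r * (r * j1 r - r * Z r * j r) @[r --> 0^'+] --> fs_Y0 * (0 - 0 * j 0).
  by rewrite mul0r subrr mulr0.
apply: cvgM; first exact: Y_cvg0.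
by apply: cvgB; [exact: rj1_0|apply: cvgM; [exact: rZ_cvg0|exact: j_0]].
Qed.

(** [Y] grows, so the barrier starts at the origin and runs outwards, opposite to [gs_y_le]. The
    derivative of [r * Y ^+ 2 * Z] is [r * Y ^+ 2 * (Z ^+ 2 + q ^+ 2 / h ^+ 2 - k)], of size at
    least [b1 / (2 * h ^+ 2)] times [r * Y ^+ 2] by the smallness of [h], so a multiple of order
    [h ^+ 2] dominates the bounded defect. *)
Let y_le M (r : R) : (forall s, 0 < s <= rho -> `|u s| <= M) -> 0 < r <= rho ->
  `|y r| <= M * K3 * h * (r * Y r ^+ 2).
Proof.
move=> uM rr; have /andP[r0 rrho] := rr; have h0' := h0; have b10' := b10.
have M0 : 0 <= M by apply: le_trans (uM _ rr).
pose A := 2 * Kk / b1 * h ^+ 2 * M.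
have Kk0 : 0 <= Kk by have B0' := B0; have C0' := C0; rewrite /Kk; nn.
have A0 : 0 <= A by rewrite /A; nn.
have : `|y r - 0| <= A * (r * Y r ^+ 2 * Z r) - A * (0 * fs_Y0 ^+ 2).
  apply: (der_bound0 r0 y_cvg0 (g := fun r => A * (r * Y r ^+ 2 * Z r))
   (df := fun r => r * Y r * j r * k r)
   (dg := fun r => A * (r * Y r ^+ 2 * (Z r ^+ 2 + q r ^+ 2 / h ^+ 2 - k r)))).
  - apply: cvgMr.
    rewrite (_ : (fun r => _) = fun r => r * Z r * (Y r * Y r)); last by apply/funext => x; ring.
    by rewrite expr2; apply: cvgM; [exact: rZ_cvg0|apply: cvgM; exact: Y_cvg0].
  - by move=> x /andP[x0 xr]; apply: dy; rewrite x0 (le_trans xr).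
  - move=> x /andP[x0 xr].
    der_tac ltac:(first [eapply dY|eapply dZ]) => //.
    by rewrite /k; field; nz.
  move=> x /andP[x0 xr]; have xx : 0 < x <= rho by rewrite x0 (le_trans xr).
  have Yx := Y_gt0 x; have kx := k_le x0.
  have jx : `|j x| <= M * Y x.
    by have := uM x xx; rewrite /u normrM normfV (gtr0_norm Yx) ler_pdivrMr.
  rewrite normrM normrM [`|x * _|]gtr0_norm; last by pp.
  apply: (@le_trans _ _ (x * Y x * (M * Y x) * Kk)).
    by apply: ler_pM; [nn|nn| |exact: kx]; apply: ler_wpM2l => //; nn.
  have -> : A * (x * Y x ^+ 2 * (Z x ^+ 2 + q x ^+ 2 / h ^+ 2 - k x)) =
     x * Y x * (M * Y x) * (2 * Kk / b1 * (h ^+ 2 * Z x ^+ 2 + q x ^+ 2 - h ^+ 2 * k x)).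
    by rewrite /A; field; nz.
  apply: ler_wpM2l; first by nn.
  set T := _ + _ - _; rewrite (_ : 2 * Kk / b1 * T = Kk * (2 * T / b1)); last by ring.
  apply: ler_peMr => //; rewrite ler_pdivlMr// mul1r /T.
  have q2 : b1 <= q x ^+ 2 by rewrite fs_q_sqr (le_trans b1bet)// lerDr; have B0' := B0; nn.
  have hk : h ^+ 2 * k x <= h ^+ 2 * Kk.
    by apply: ler_wpM2l; [exact: sqr_ge0|exact: ler_normlW].
  have := hs1; have : 0 <= h ^+ 2 * Z x ^+ 2 by rewrite mulr_ge0 ?sqr_ge0.
  lra.
rewrite mul0r mulr0 !subr0 => /le_trans; apply.
have -> : A * (r * Y r ^+ 2 * Z r) = (r * Y r ^+ 2) * (2 * Kk / b1 * h * M) * (h * Z r) by rewrite /A; ring.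
have -> : M * K3 * h * (r * Y r ^+ 2) = (r * Y r ^+ 2) * (2 * Kk / b1 * h * M) * Kz by rewrite /K3; ring.
apply: ler_wpM2l; last exact/ler_normlW/hZ_le.
by nn.
Qed.

Let u_var M : (forall s, 0 < s <= rho -> `|u s| <= M) ->
  forall s, 0 < s <= rho -> `|u s - j 0 / fs_Y0| <= K3 * h * rho * M.
Proof.
move=> uM s ss; have /andP[s0 srho] := ss; have h0' := h0; have b10' := b10; have K0 := Kz0.
have M0 : 0 <= M by apply: le_trans (uM _ ss).
have Kk0 : 0 <= Kk by have B0' := B0; have C0' := C0; rewrite /Kk; nn.
apply: (@le_trans _ _ (M * K3 * h * s - M * K3 * h * 0)).
  apply: (der_bound0 s0 u_cvg0 (g := fun s => M * K3 * h * s) (dg := fun=> M * K3 * h)).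
  - by apply: cvgMr; exact: cvg_right_id.
  - by move=> x /andP[x0 xs]; apply: du; rewrite x0 (le_trans xs).
  - by move=> x _; der_tac fail; ring.
  move=> x /andP[x0 xs]; have xx : 0 < x <= rho by rewrite x0 (le_trans xs).
  have Yx := Y_gt0 x; have xY : 0 < x * Y x ^+ 2 by pp.
  by rewrite normrM normfV (gtr0_norm xY) ler_pdivrMr// y_le.
rewrite mulr0 subr0 (_ : K3 * h * rho * M = M * K3 * h * rho); last by ring.
by apply: ler_wpM2l => //; rewrite /K3; nn.
Qed.

Let u_le s : 0 < s <= rho -> `|u s| <= 2 * `|j 0 / fs_Y0|.
Proof. exact: (der_eps_bound rho0 u_cvg0 du u_var hs2). Qed.

Lemma fs_main :
  `|j rho / Y rho - j 0 / fs_Y0| <= 2 * K3 * h * rho * `|j 0 / fs_Y0| /\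
  `|j1 rho - Z rho * j rho| <= 2 * K3 * h * `|j 0 / fs_Y0| * Y rho.
Proof.
have rr : 0 < rho <= rho by rewrite rho0 lexx.
have Yr := Y_gt0 rho; have r0 := rho0; split.
  by apply: (le_trans (u_var u_le rr)); rewrite le_eqVlt; apply/orP; left; apply/eqP; ring.
have := y_le u_le rr; rewrite /y normrM gtr0_norm; last by pp.
have -> : 2 * `|j 0 / fs_Y0| * K3 * h * (rho * Y rho ^+ 2) =
   rho * Y rho * (2 * K3 * h * `|j 0 / fs_Y0| * Y rho) by ring.
by rewrite ler_pM2l//; pp.
Qed.

Lemma fs_Z_rho : `|h * Z rho - q rho| <= h * ((C + B ^+ 2 * rho ^+ 2 / (8 * b1)) / rho).
Proof.
have q0 := fs_q_gt0 rho; have s0 := sb0; have h0' := h0; have b10' := b10; have B0' := B0.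
have r0 := rho0; have xr : 0 < x_ rho by rewrite /x_; pp.
have [_ g2] := bessel_ld xr.
have -> : h * Z rho - q rho = sb * (g rho - 1) + h * a rho by rewrite /Z; field; nz.
have q2 : b1 <= q rho ^+ 2 by rewrite fs_q_sqr (le_trans b1bet)// lerDr; nn.
have q20 : 0 < q rho ^+ 2 by rewrite exprn_gt0.
have -> : h * ((C + B ^+ 2 * rho ^+ 2 / (8 * b1)) / rho) = sb * (C / x_ rho) + h * (B ^+ 2 * rho / (8 * b1)).
  by rewrite /x_; field; nz.
apply: (le_trans (ler_normD _ _)); apply: lerD.
  by rewrite normrM (gtr0_norm s0) ler_pM2l.
rewrite normrM (gtr0_norm h0) ler_pM2l// /a normrN ger0_norm; last by nn.
by apply: ler_wpM2l; [nn|rewrite lef_pV2 ?posrE ?mulr_gt0// ler_pM2l].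
Qed.

End FreeSolution.

(** * Maps of the plane scaling the area, and radial integrals *)

Section PlaneMeasure.
Context {R : realType}.
Notation leb := (@lebesgue_measure R).
Notation RR := (measurableTypeR R).
Notation m2 := (leb \x leb)%E.

Definition affR (c t : R) : RR -> RR := fun x : R => c * x + t.

(** Uniqueness of Lebesgue measure: the pushforward, rescaled by [c], agrees with it on half-open
    intervals. *)
Lemma lebesgue_measure_affine (c t : R) (A : set RR) : 0 < c -> measurable A ->
  leb ((affR c t) @^-1` A) = (c^-1%:E * leb A)%E.
Proof.
move=> c0 mA; have mf : measurable_fun [set: RR] (affR c t).
  by apply: measurable_funD => //; exact: measurable_funM.
have c0' : 0 <= c by exact: ltW.
suff -> : leb A = (c%:E * leb ((affR c t) @^-1` A))%E.
  by rewrite muleA -EFinM mulVf ?mul1e//; nz.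
pose cn := NngNum c0'.
pose nu : {measure set RR -> \bar R} :=
  measure_function_pushforward__canonical__measure_function_Measure leb mf.
transitivity (mscale cn nu A) => //.
apply: lebesgue_measure_unique => // _ [[a b]] _ <-.
rewrite /= /mscale /pushforward /=.
rewrite [X in _ = (_ * lebesgue_measure X)%E](_ : _ = `](a - t) / c, (b - t) / c]%classic); last first.
  apply/seteqP; split => x /=; rewrite /affR !in_itv/= ltr_pdivrMr// ler_pdivlMr// [x * c]mulrC; lra.
rewrite !lebesgue_measure_itv/= !lte_fin ltr_pM2r ?invr_gt0// ltrD2r.
case: ifPn => _; last by rewrite mule0.
by rewrite -!EFinD -EFinM; congr EFin; field; nz.
Qed.

Lemma m2_fiber (k : R) (f : R -> R -> R) (E : set (RR * RR)) : 0 <= k ->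
  measurable E ->
  (forall x A, measurable (A : set RR) -> leb (f x @^-1` A) = (k%:E * leb A)%E) ->
  m2 ((fun z => (z.1, f z.1 z.2)) @^-1` E) = (k%:E * m2 E)%E.
Proof.
move=> k0 mE fk; rewrite /product_measure1 -ge0_integralZl//; last first.
  exact: measurable_fun_xsection.
apply: eq_integral => x _ /=.
rewrite -(fk x); last exact: measurable_xsection.
by congr (leb _); apply/seteqP; split => y /=; rewrite /xsection/= !inE.
Qed.

Definition swapR (z : RR * RR) : RR * RR := (z.2, z.1).

Lemma measurable_swapR : measurable_fun setT swapR.
Proof. exact: measurable_fun_pair. Qed.

Lemma m2_swap (E : set (RR * RR)) : measurable E -> m2 (swapR @^-1` E) = m2 E.
Proof.
move=> mE; apply/esym.
pose nu : {measure set (RR * RR) -> \bar R} :=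
  measure_function_pushforward__canonical__measure_function_Measure m2 measurable_swapR.
transitivity (nu E) => //.
apply: product_measure_unique => //.
move=> X Y mX mY; rewrite /nu /= /pushforward.
rewrite [X in product_measure1 _ _ X](_ : _ = Y `*` X); last first.
  by apply/seteqP; split => -[x y] /= [].
by rewrite product_measure1E// muleC.
Qed.

(* Measurable maps of the plane multiplying areas of preimages by [k]. *)
Definition scales_m2 (k : R) (T : RR * RR -> RR * RR) := measurable_fun setT T /\
  forall E, measurable E -> m2 (T @^-1` E) = (k%:E * m2 E)%E.

Lemma scales_comp k k' S T : scales_m2 k S -> scales_m2 k' T ->
  scales_m2 (k * k') (S \o T).
Proof.
move=> [mS HS] [mT HT]; split; first exact: measurableT_comp.
move=> E mE; rewrite comp_preimage HT; last first.
  by rewrite -[X in measurable X]setTI; exact: mS.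
by rewrite HS// muleA -EFinM mulrC.
Qed.

Lemma scales_swap : scales_m2 1 swapR.
Proof. by split; [exact: measurable_swapR|move=> E mE; rewrite mul1e m2_swap]. Qed.

Lemma scales_affine (c t u : R) : 0 < c ->
  scales_m2 c^-1 (fun z : RR * RR => (z.1, c * z.2 + (u * z.1 + t)) : RR * RR).
Proof.
move=> c0; split.
  apply: measurable_fun_pair => //; apply: measurable_funD; first exact: measurable_funM.
  by apply: measurable_funD => //; exact: measurable_funM.
move=> E mE; apply: (@m2_fiber c^-1 (fun x y => c * y + (u * x + t))) => //.
  by rewrite invr_ge0 ltW.
by move=> x A mA; exact: lebesgue_measure_affine.
Qed.

Lemma scales_ext k S T : S =1 T -> scales_m2 k S -> scales_m2 k T.
Proof. by move=> /funext ->. Qed.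

Lemma scales_shear1 (u t : R) : scales_m2 1 (fun z : RR * RR => (z.1 + u * z.2 + t, z.2) : RR * RR).
Proof.
have := scales_comp (scales_comp scales_swap (@scales_affine 1 t u ltr01)) scales_swap.
rewrite invr1 !mulr1; apply: scales_ext => -[x y] /=.
by rewrite /swapR/=; congr (_, _); ring.
Qed.

Lemma scales_shear2 (u t : R) : scales_m2 1 (fun z : RR * RR => (z.1, z.2 + u * z.1 + t) : RR * RR).
Proof.
have := @scales_affine 1 t u ltr01; rewrite invr1; apply: scales_ext => -[x y] /=.
by congr (_, _); ring.
Qed.

Lemma scales_flip2 : scales_m2 1 (fun z : RR * RR => (z.1, - z.2) : RR * RR).
Proof.
split; first by apply: measurable_fun_pair => //; exact: measurable_funN.
move=> E mE; apply: (@m2_fiber 1 (fun _ y => - y)) => //.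
by move=> _ A mA; rewrite mul1e; exact: lebesgue_measureN.
Qed.

Lemma scales_dilation (k : R) : 0 < k ->
  scales_m2 (k^-1 ^+ 2) (fun z : RR * RR => (k * z.1, k * z.2) : RR * RR).
Proof.
move=> k0; have := scales_comp (scales_comp scales_swap (@scales_affine k 0 0 k0))
  (scales_comp scales_swap (@scales_affine k 0 0 k0)).
rewrite !mul1r -expr2; apply: scales_ext => -[x y] /=.
by rewrite /swapR/=; congr (_, _); ring.
Qed.

Definition rotv (c s : R) (z : RR * RR) : RR * RR := (c * z.1 - s * z.2, s * z.1 + c * z.2).

(* A rotation is a product of three shears, except the half-turn, which is the square of a
   quarter-turn. *)
Lemma scales_rot (c s : R) : c ^+ 2 + s ^+ 2 = 1 -> scales_m2 1 (rotv c s).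
Proof.
have gen c' s' : c' ^+ 2 + s' ^+ 2 = 1 -> 1 + c' != 0 -> scales_m2 1 (rotv c' s').
  (* [t] is the tangent of the half-angle; the factors are the horizontal shear by [- t], the
     vertical shear by [s'], and the horizontal shear by [- t] again. *)
  move=> E c1; pose t := s' / (1 + c').
  have := scales_comp (scales_comp (scales_shear1 (- t) 0) (scales_shear2 s' 0)) (scales_shear1 (- t) 0).
  rewrite !mulr1; apply: scales_ext => -[x y] /=.
  have ts : t * s' = 1 - c'.
    rewrite /t mulrAC -expr2 (_ : s' ^+ 2 = (1 - c') * (1 + c')) ?mulfK//.
    by transitivity (1 - c' ^+ 2); [rewrite -E; ring|ring].
  have tc : t * (1 + c') = s' by rewrite /t divfK.
  rewrite /rotv/=; congr (_, _).
    transitivity (x * (1 - t * s') - y * t - t * y + t * (t * s') * y); first by ring.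
    by rewrite ts -tc; ring.
  by transitivity (s' * x + y * (1 - t * s')); [ring|rewrite ts; ring].
move=> E; have [c1|c1] := eqVneq (1 + c) 0; last exact: gen.
have cE : c = -1 by apply/eqP; rewrite -subr_eq0 opprK addrC c1.
have sE : s = 0.
  by apply/eqP; rewrite -sqrf_eq0; apply/eqP; move: E; rewrite cE sqrrN expr1n; lra.
have g01 : scales_m2 1 (rotv 0 1).
  by apply: gen; rewrite ?expr0n ?expr1n ?addr0 ?add0r ?oner_eq0.
have := scales_comp g01 g01; rewrite mulr1; apply: scales_ext => -[x y].
by rewrite /rotv/= cE sE; congr (_, _); ring.
Qed.

Lemma scales_ge0_integral T (f : RR * RR -> \bar R) : scales_m2 1 T ->
  measurable_fun setT f -> (forall z, (0 <= f z)%E) ->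
  (\int[m2]_z f (T z) = \int[m2]_z f z)%E.
Proof.
move=> [mT HT] mf f0.
have := @ge0_integral_pushforward _ _ _ _ R T mT m2 setT f measurableT mf (fun y _ => f0 y).
rewrite preimage_setT => <-; apply: eq_measure_integral => //= A mA _.
by rewrite /pushforward HT// mul1e.
Qed.

Lemma scales_integrable T (f : RR * RR -> R) : scales_m2 1 T ->
  m2.-integrable setT (EFin \o f) -> m2.-integrable setT (EFin \o (f \o T)).
Proof.
move=> sT /integrableP[mf intf]; have [mT _] := sT; apply/integrableP; split.
  exact: (measurableT_comp mf mT).
rewrite (scales_ge0_integral (f := fun z => `|(f z)%:E|%E) sT)//.
exact: (measurableT_comp _ mf).
Qed.

Lemma scales_Rintegral T (f : RR * RR -> R) : scales_m2 1 T ->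
  m2.-integrable setT (EFin \o f) ->
  (\int[m2]_z f (T z) = \int[m2]_z f z)%R.
Proof.
move=> sT intf; rewrite /Rintegral; congr fine.
have [mf _] := integrableP _ _ _ intf; have [mT HT] := sT.
have intfT : m2.-integrable (T @^-1` setT) ((EFin \o f) \o T).
  by rewrite preimage_setT; exact: scales_integrable.
have := @integral_pushforward _ _ _ _ R T mT m2 setT _ mf intfT measurableT.
rewrite preimage_setT => <-; apply: eq_measure_integral => //= A mA _.
by rewrite /pushforward HT// mul1e.
Qed.

Definition nrm2 (z : RR * RR) : RR := z.1 ^+ 2 + z.2 ^+ 2.

Lemma measurable_nrm2 : measurable_fun setT nrm2.
Proof.
have : measurable_fun [set: RR * RR] (fun z => (z.1 : R) ^+ 2 + (z.2 : R) ^+ 2 : R).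
  by apply: measurable_funD; apply: measurable_funX.
by [].
Qed.

Let disc (s : R) : set (RR * RR) := nrm2 @^-1` `]-oo, s].

Let measurable_disc (s : R) : measurable (disc s).
Proof. by rewrite -[disc s]setTI; apply: measurable_nrm2. Qed.

Let disc_lt0 (s : R) : s < 0 -> disc s = set0.
Proof.
move=> s0; apply/seteqP; split => // z; rewrite /disc/= in_itv/=.
have H : (0 : R) <= z.1 ^+ 2 + z.2 ^+ 2 by rewrite addr_ge0 ?sqr_ge0.
by move=> zs; have := le_lt_trans zs s0; rewrite ltNge H.
Qed.

(** Comparison of the unit disc with two squares shows that its area is positive and finite;
    dilations give linearity in the squared radius. *)
Lemma m2_disc : exists2 c : R, 0 < c & forall s : R, 0 <= s -> m2 (disc s) = (c * s)%:E.
Proof.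
have sq (x y : R) : measurable (`[x, y]%classic : set RR) by exact: measurable_itv.
have bnd : (m2 (disc 1) <= 4%:E)%E.
  have -> : (4 : R)%:E = m2 (`[-1, 1] `*` `[-1, 1]).
    rewrite product_measure1E//= !lebesgue_measure_itv/= lte_fin.
    have -> : (-1 < 1 :> R) by lra.
    by rewrite -!EFinD -EFinM; congr EFin; ring.
  apply: le_measure; rewrite ?inE//; first exact: measurableX.
  move=> [x y]; rewrite /disc/nrm2/= !in_itv/= => xy.
  by split; apply/andP; split; nra.
have pos : (1%:E <= m2 (disc 1))%E.
  have -> : (1 : R)%:E = m2 (`[- 2^-1, 2^-1] `*` `[- 2^-1, 2^-1]).
    rewrite product_measure1E//= !lebesgue_measure_itv/= lte_fin.
    have -> : (- 2^-1 < 2^-1 :> R) by lra.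
    by rewrite -!EFinD -EFinM; congr EFin; field.
  apply: le_measure; rewrite ?inE//; first exact: measurableX.
  move=> [x y]; rewrite /disc/nrm2/= !in_itv/= => -[/andP[x1 x2] /andP[y1 y2]].
  by nra.
have fin1 : m2 (disc 1) \is a fin_num.
  by rewrite ge0_fin_numE ?measure_ge0//; apply: le_lt_trans bnd _; rewrite ltry.
exists (fine (m2 (disc 1))).
  by apply: (@lt_le_trans _ _ 1) => //; rewrite -lee_fin fineK.
move=> s; rewrite le_eqVlt => /orP[/eqP <-|s0].
  rewrite mulr0; have -> : disc 0 = [set 0%R] `*` [set 0%R].
    apply/seteqP; split => -[x y]; rewrite /disc/nrm2/= in_itv/=.
      move=> H; have x0 := sqr_ge0 x; have y0 := sqr_ge0 y.
      by split; apply/eqP; rewrite -sqrf_eq0; apply/eqP; lra.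
    by move=> [-> ->]; rewrite !expr0n/= addr0.
  by rewrite product_measure1E//= lebesgue_measure_set1 mule0.
have k0 : 0 < (Num.sqrt s)^-1 by rewrite invr_gt0 sqrtr_gt0.
have [_ /(_ _ (measurable_disc 1))] := scales_dilation k0.
rewrite invrK sqr_sqrtr ?(ltW s0)// -[X in (s%:E * X)%E]fineK// -EFinM mulrC => <-.
congr (product_measure1 _ _ _); apply/seteqP; split => -[x y]; rewrite /disc/nrm2/= !in_itv/=;
  rewrite !exprMn -mulrDr exprVn sqr_sqrtr ?(ltW s0)// ler_pdivrMl// mulr1//.
Qed.

Lemma radial_measure : exists2 c : R, 0 < c & forall A : set RR, measurable A ->
  m2 (nrm2 @^-1` A) = (c%:E * leb (A `&` `]0%R, +oo[%classic))%E.
Proof.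
have [c c0 dc] := m2_disc; exists c => // A mA.
pose nu : {measure set RR -> \bar R} :=
  measure_function_pushforward__canonical__measure_function_Measure m2 measurable_nrm2.
have cV : 0 <= c^-1 by rewrite invr_ge0 ltW.
have mN : measurable (`]-oo, 0%R]%classic : set RR) by exact: measurable_itv.
(* The image of the plane measure under [nrm2] charges only the half-line. Rescaled and completed by
   Lebesgue measure on the nonpositive reals, it becomes a measure on the whole line, to which
   uniqueness of Lebesgue measure applies. *)
pose nu' := measure_add (mscale (NngNum cV) nu) (mrestr leb mN).
have nudisc (s : R) : nu (`]-oo, s]%classic) = (c * Num.max s 0)%:E.
  rewrite /nu/= /pushforward -/(disc s); case: (leP s 0) => s0; last by rewrite dc ?ltW.
  move: s0; rewrite le_eqVlt => /orP[/eqP ->|s0]; first by rewrite dc.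
  by rewrite disc_lt0// mulr0 measure0.
have nu'E X : nu' X = (c^-1%:E * nu X + leb (X `&` `]-oo, 0%R]%classic))%E.
  by rewrite /nu' measure_addE.
have lebE B : measurable B -> leb B = nu' B.
  apply: lebesgue_measure_unique => // _ [[a b]] _ <-.
  apply: etrans (esym (nu'E _)).
  have [ab|ba] := ltP a b; last first.
    by rewrite set_itv_ge ?bnd_simp -?leNgt// set0I !measure0 mule0 adde0.
  have -> : `]a, b]%classic `&` `]-oo, 0%R]%classic = `]a, Num.min b 0%R]%classic :> set R.
    by apply/seteqP; split => x /=; rewrite !in_itv/= le_min;
      [move=> [/andP[-> ->] ->]|move=> /andP[-> /andP[-> ->]]].
  have nuab : nu (`]a, b]%classic) = (c * Num.max b 0 - c * Num.max a 0)%:E.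
    have -> : `]a, b]%classic = `]-oo, b]%classic `\` `]-oo, a]%classic :> set R.
      apply/seteqP; split => x /=; rewrite !in_itv/=.
        by move=> /andP[ax ->]; split => //; apply/negP; rewrite -ltNge.
      by move=> [-> /negP]; rewrite -ltNge => ->.
    have fin : (nu (`]-oo, b]%classic) < +oo)%E by rewrite nudisc ltry.
    rewrite measureD//.
    rewrite setIidr; last by move=> x /=; rewrite !in_itv/= => /le_trans; apply; exact: ltW.
    by transitivity ((c * Num.max b 0)%:E - (c * Num.max a 0)%:E)%E => //; congr (_ - _)%E; exact: nudisc.
  rewrite [X in (_ * X)%E]nuab /= !lebesgue_measure_itv/= !lte_fin ab lt_min ab/=.
  rewrite -EFinM -!EFinD -mulrBr mulKf; last by nz.
  case: ifPn => a0; rewrite -?EFinD ?adde0; congr EFin.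
    rewrite (max_r (ltW a0)); case: (leP b 0) => b0; lra.
  have {}a0 : 0 <= a by rewrite leNgt.
  by rewrite max_l ?max_l//; lra.
have mP : measurable (`]0%R, +oo[%classic : set RR) by exact: measurable_itv.
rewrite lebE ?nu'E -?setIA; last exact: measurableI.
rewrite (_ : `]0%R, +oo[%classic `&` `]-oo, 0%R]%classic = set0 :> set R); last first.
  by apply/seteqP; split => x //=; rewrite !in_itv/=; lra.
rewrite setI0 measure0 adde0 muleA -EFinM divff; last by nz.
rewrite mul1e.
have -> : m2 (nrm2 @^-1` A) = nu A by [].
have nuN : nu (A `&` `]-oo, 0%R]%classic) = 0%E.
  apply: (@subset_measure0 _ _ _ nu _ `]-oo, 0%R]%classic) => //; first exact: measurableI.
  by apply: etrans (nudisc 0) _; rewrite maxxx mulr0.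
have E : nu ((A `&` `]0%R, +oo[%classic) `|` (A `&` `]-oo, 0%R]%classic)) = nu (A `&` `]0%R, +oo[%classic).
  by apply: measureU0 => //; exact: measurableI.
rewrite -E -setIUr; congr (nu _); apply/seteqP; split => x //=.
  by move=> Ax; split => //; rewrite !in_itv/= andbT; case: (ltP 0 x); [left|right].
by case.
Qed.

(** The area of the unit disc, kept abstract: it cancels in the end, since the normalisation fixes
    [radial_c * F(0) ^+ 2] and the hopping integral is proportional to the same product. *)
Definition radial_c : R := s2val (cid2 radial_measure).

Lemma radial_c_gt0 : 0 < radial_c.
Proof. exact: (s2valP (cid2 radial_measure)). Qed.

Lemma radial_measureE (A : set RR) : measurable A ->
  m2 (nrm2 @^-1` A) = (radial_c%:E * leb (A `&` `]0%R, +oo[%classic))%E.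
Proof. exact: (s2valP' (cid2 radial_measure)). Qed.

Let mP : measurable (`]0%R, +oo[%classic : set RR).
Proof. exact: measurable_itv. Qed.

Lemma radial_ge0_integral (g : RR -> \bar R) : measurable_fun setT g ->
  (forall s, (0 <= g s)%E) ->
  (\int[m2]_z g (nrm2 z) = radial_c%:E * \int[leb]_(s in `]0%R, +oo[) g s)%E.
Proof.
move=> mg g0.
pose nu : {measure set RR -> \bar R} :=
  measure_function_pushforward__canonical__measure_function_Measure m2 measurable_nrm2.
have := @ge0_integral_pushforward _ _ _ _ R nrm2 measurable_nrm2 m2 setT g measurableT mg (fun y _ => g0 y).
rewrite preimage_setT => <-.
have c0 : 0 <= radial_c by rewrite ltW// radial_c_gt0.
have mN : measurable (`]-oo, 0%R]%classic : set RR) by exact: measurable_itv.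
have NP : setT `\` `]-oo, 0%R]%classic = `]0%R, +oo[%classic :> set R.
  apply/seteqP; split => x /=; rewrite !in_itv/= andbT; first by move=> [_ /negP]; rewrite -ltNge.
  by move=> x0; split => //; apply/negP; rewrite -ltNge.
transitivity (\int[nu]_(x in setT) g x)%E => //.
rewrite (@ge0_negligible_integral _ _ _ nu _ _ g mN measurableT)//; last first.
  apply: etrans (radial_measureE mN) _.
  rewrite (_ : _ `&` _ = set0) ?measure0 ?mule0//.
  by apply/seteqP; split => x //=; rewrite !in_itv/=; lra.
rewrite NP -(ge0_integral_mscale leb mP (NngNum c0))//; last exact: measurable_funTS.
apply: eq_measure_integral => A mA AP.
apply: etrans (radial_measureE mA) _; rewrite (setIidl AP)//.
Qed.

Lemma radial_integrable (g : R -> R) : measurable_fun [set: RR] g ->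
  leb.-integrable `]0%R, +oo[ (EFin \o g) -> m2.-integrable setT (EFin \o (g \o nrm2)).
Proof.
move=> mg /integrableP[_ intg]; apply/integrableP; split.
  by apply/measurable_EFinP; exact: (measurableT_comp mg measurable_nrm2).
rewrite (@radial_ge0_integral (fun s => `|(g s)%:E|%E))//.
  by rewrite lte_mul_pinfty// lee_fin ltW// radial_c_gt0.
by apply: measurableT_comp => //; apply/measurable_EFinP.
Qed.

Lemma radial_Rintegral (g : R -> R) : measurable_fun [set: RR] g ->
  leb.-integrable `]0%R, +oo[ (EFin \o g) ->
  (\int[m2]_z g (nrm2 z) = radial_c * \int[leb]_(s in `]0%R, +oo[) g s)%R.
Proof.
move=> mg ig; rewrite /Rintegral integralE.
have mgp : measurable_fun setT ((EFin \o g)^\+)%E.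
  by apply: measurable_funepos; exact/measurable_EFinP.
have mgn : measurable_fun setT ((EFin \o g)^\-)%E.
  by apply: measurable_funeneg; exact/measurable_EFinP.
rewrite (_ : (fun z => (g (nrm2 z))%:E)^\+%E = (fun z => (EFin \o g)^\+%E (nrm2 z))); last exact: (funepos_comp (EFin \o g) nrm2).
rewrite (_ : (fun z => (g (nrm2 z))%:E)^\-%E = (fun z => (EFin \o g)^\-%E (nrm2 z))); last exact: (funeneg_comp (EFin \o g) nrm2).
rewrite (radial_ge0_integral mgp)// (radial_ge0_integral mgn)// -muleBr//; last first.
  by rewrite fin_num_adde_defr// integrable_pos_fin_num.
by rewrite -integralE fineM// integrable_fin_num.
Qed.

End PlaneMeasure.

(** * Radial functions and the Rayleigh quotient *)

Section PlaneCalculus.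
Context {R : realType}.
Implicit Types (f : R * R -> R) (z : R * R).

Let quot_x f (x y : R) : (fun h : R => h^-1 *: ((f \o shift (x, y)) (h *: ((1, 0) : R * R)) - f (x, y)))
  = (fun h => h^-1 *: (((fun x => f (x, y)) \o shift x) (h *: (1 : R)) - f (x, y))).
Proof.
apply/funext => h /=; congr (_ *: (f _ - _)).
by congr (_, _); transitivity (h *: (0 : R) + y) => //; rewrite scaler0 add0r.
Qed.

Let quot_y f (x y : R) : (fun h : R => h^-1 *: ((f \o shift (x, y)) (h *: ((0, 1) : R * R)) - f (x, y)))
  = (fun h => h^-1 *: (((fun y => f (x, y)) \o shift y) (h *: (1 : R)) - f (x, y))).
Proof.
apply/funext => h /=; congr (_ *: (f _ - _)).
by congr (_, _); transitivity (h *: (0 : R) + x) => //; rewrite scaler0 add0r.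
Qed.

Lemma dxE f z (d : R) : der z.1 (fun x => f (x, z.2)) d -> dx f z = d.
Proof. by case: z => x y [_ <-]; rewrite /dx /derive quot_x. Qed.

Lemma dyE f z (d : R) : der z.2 (fun y => f (z.1, y)) d -> dy f z = d.
Proof. by case: z => x y [_ <-]; rewrite /dy /derive quot_y. Qed.

Lemma der_dx f z : differentiable f z -> der z.1 (fun x => f (x, z.2)) (dx f z).
Proof.
case: z => x y df; have := diff_derivable (v := ((1, 0) : R * R)) df.
by split; [rewrite /derivable -quot_x|rewrite /dx /derive quot_x].
Qed.

Lemma der_dy f z : differentiable f z -> der z.2 (fun y => f (z.1, y)) (dy f z).
Proof.
case: z => x y df; have := diff_derivable (v := ((0, 1) : R * R)) df.
by split; [rewrite /derivable -quot_y|rewrite /dy /derive quot_y].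
Qed.

End PlaneCalculus.

Lemma cvg_sqr {R : realType} {T : Type} {F : set_system T} {FF : Filter F} (f : T -> R) (a : R) :
  f x @[x --> F] --> a -> f x ^+ 2 @[x --> F] --> a ^+ 2.
Proof. by move=> fa; rewrite expr2; under eq_fun do rewrite expr2; exact: cvgM. Qed.

Section RadialFunctions.
Context {R : realType}.
Notation leb := (@lebesgue_measure R).
Notation P := (`]0%R, +oo[%classic : set (measurableTypeR R)).
Implicit Types (u : R * R -> R) (H D : R -> R).

Lemma nrm2_ge0 (z : R * R) : 0 <= nrm2 z :> R.
Proof. by rewrite addr_ge0 ?sqr_ge0. Qed.

Lemma eucl_rad_axis (x : R) : 0 <= x -> eucl_rad (x, 0) = x.
Proof. by move=> x0; rewrite /eucl_rad/= expr0n addr0 sqrtr_sqr ger0_norm. Qed.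

(* [u] is a real C^1 function of the squared radius, with profile [H], and [D] is the profile of
   the square of its gradient. *)
Definition radial_C1 u H D := [/\ forall z, differentiable u z,
  continuous (dx u) /\ continuous (dy u), forall z, u z = H (nrm2 z),
  forall z, dx u z ^+ 2 + dy u z ^+ 2 = D (nrm2 z) & continuous H /\ continuous D].

Lemma continuous_nrm2 : continuous (@nrm2 R : R * R -> R).
Proof.
move=> z; apply: (@cvgD R R).
  by apply: cvg_sqr; exact: cvg_fst.
by apply: cvg_sqr; exact: cvg_snd.
Qed.

Lemma differentiable_nrm2 z : differentiable (@nrm2 R : R * R -> R) z.
Proof.
have d1 : differentiable (fst : R * R -> R) z.
  apply: (@linear_differentiable R (R * R)%type R fst z) => x; exact: cvg_fst.
have d2 : differentiable (snd : R * R -> R) z.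
  apply: (@linear_differentiable R (R * R)%type R snd z) => x; exact: cvg_snd.
have -> : (@nrm2 R : R * R -> R) = ((fst : R * R -> R) * fst + (snd : R * R -> R) * snd).
  by apply/funext => x; rewrite /nrm2 !expr2.
by apply: differentiableD; apply: differentiableM.
Qed.

Lemma radial_C1_der (H H1 : R -> R) : (forall s : R, der s H (H1 s)) -> continuous H1 ->
  radial_C1 (fun z => H (nrm2 z)) H (fun s => 4 * s * H1 s ^+ 2).
Proof.
move=> dH cH1.
have ex z : dx (fun z => H (nrm2 z)) z = H1 (nrm2 z) * (2 * z.1).
  apply: dxE; apply: der_eq.
    apply: (@der_comp _ (fun x => x ^+ 2 + z.2 ^+ 2)); first exact: dH.
    by der_rec fail.
  by rewrite /=; congr (_ * _); ring.
have ey z : dy (fun z => H (nrm2 z)) z = H1 (nrm2 z) * (2 * z.2).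
  apply: dyE; apply: der_eq.
    apply: (@der_comp _ (fun y => z.1 ^+ 2 + y ^+ 2)); first exact: dH.
    by der_rec fail.
  by rewrite /=; congr (_ * _); ring.
split.
- move=> z; apply: differentiable_comp; first exact: differentiable_nrm2.
  by apply/derivable1_diffP; have [] := dH (nrm2 z).
- split; move=> z.
    rewrite (_ : dx _ = fun z => H1 (nrm2 z) * (2 * z.1)); last exact/funext.
    apply: cvgM; first by apply: continuous_comp; [exact: continuous_nrm2|exact: cH1].
    by apply: cvgMr; exact: cvg_fst.
  rewrite (_ : dy _ = fun z => H1 (nrm2 z) * (2 * z.2)); last exact/funext.
  apply: cvgM; first by apply: continuous_comp; [exact: continuous_nrm2|exact: cH1].
  by apply: cvgMr; exact: cvg_snd.
- by [].
- by move=> z; rewrite ex ey /nrm2; ring.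
- split=> s; first exact: (der_cvg (dH s)).
  apply: cvgM; first by apply: cvgMr; exact: cvg_id.
  by apply: cvg_sqr; exact: cH1.
Qed.

Lemma radial_C1Z k u H D : radial_C1 u H D ->
  radial_C1 (fun z => k * u z) (fun s => k * H s) (fun s => k ^+ 2 * D s).
Proof.
move=> [du [cx cy] uH uD [cH cD]].
have ex z : dx (fun z => k * u z) z = k * dx u z.
  by apply: dxE; apply: der_eq; [apply: derM; [exact: derC|exact: der_dx]|rewrite /=; ring].
have ey z : dy (fun z => k * u z) z = k * dy u z.
  by apply: dyE; apply: der_eq; [apply: derM; [exact: derC|exact: der_dy]|rewrite /=; ring].
split.
- by move=> z; apply: differentiableZ.
- split; move=> z.
    by rewrite (_ : dx _ = fun z => k * dx u z); [apply: cvgMr; exact: cx|exact/funext].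
  by rewrite (_ : dy _ = fun z => k * dy u z); [apply: cvgMr; exact: cy|exact/funext].
- by move=> z; rewrite uH.
- by move=> z; rewrite ex ey !exprMn -mulrDr uD.
- by split=> s; apply: cvgMr; [exact: cH|exact: cD].
Qed.

Lemma mag_density_real (B h : R) u z : mag_density B h u (fun=> 0) z =
  h ^+ 2 * (dx u z ^+ 2 + dy u z ^+ 2) + B ^+ 2 / 4 * nrm2 z * u z ^+ 2.
Proof.
have d0 w : dx (fun=> 0 : R) w = 0 by apply: dxE; exact: derC.
have e0 w : dy (fun=> 0 : R) w = 0 by apply: dyE; exact: derC.
by rewrite /mag_density d0 e0 /Arad1 /Arad2 /nrm2; field.
Qed.

Definition igP (f : R -> R) := leb.-integrable P (EFin \o f).
Definition IP (f : R -> R) : R := (\int[leb]_(s in P) f s)%R.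

Lemma IP_E f : igP f -> (\int[leb]_(s in P) (f s)%:E = (IP f)%:E)%E.
Proof. by move=> intf; rewrite /IP /Rintegral fineK// integrable_fin_num. Qed.

Lemma radial_ge0_IP (u : R * R -> R) (f : R -> R) : continuous f ->
  (forall s, 0 <= s -> 0 <= f s) -> (forall z, u z = f (nrm2 z)) ->
  (\int[@mu2 R]_z (u z)%:E = (radial_c (R := R))%:E * \int[leb]_(s in P) (f s)%:E)%E.
Proof.
move=> cf f0 uf.
(* The transfer to the half-line asks for a function nonnegative on the whole line, while [f] has a
   sign only for [s >= 0]; the absolute value changes nothing on the range of [nrm2]. *)
transitivity (\int[@mu2 R]_z (`|f (nrm2 z)|)%:E)%E.
  by apply: eq_integral => z _; rewrite uf ger0_norm// f0// nrm2_ge0.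
rewrite (@radial_ge0_integral _ (fun s => (`|f s|)%:E)); last 2 first.
- apply/measurable_EFinP; apply: measurableT_comp => //.
  exact: continuous_measurable_fun.
- by move=> s; rewrite lee_fin.
congr (_ * _)%E; apply: eq_integral => s; rewrite inE/= in_itv/= andbT => s0.
by rewrite ger0_norm// f0// ltW.
Qed.

End RadialFunctions.

Section RayleighQuotient.
Context {R : realType}.
Notation leb := (@lebesgue_measure R).
Notation P := (`]0%R, +oo[%classic : set (measurableTypeR R)).
Notation c := (@radial_c R).
Variables (v : R * R -> R) (B h b : R) (vh : R -> R) (phi : R * R -> R).
Hypotheses (h0 : 0 < h) (b0 : 0 < b) (cvh : continuous vh).
Hypothesis vE : forall z, v z = vh (nrm2 z).
Hypothesis vh_bound : forall s, - b <= vh s <= 0.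
Hypothesis gs : radial_real_ground_state v B h phi.

Implicit Types (u : R * R -> R) (H D : R -> R).

Let mP : measurable P. Proof. exact: measurable_itv. Qed.
Let c0 : 0 < c. Proof. exact: radial_c_gt0. Qed.

Lemma igP_le (f g : R -> R) : continuous f -> (forall s, 0 < s -> `|f s| <= g s) ->
  igP g -> igP f.
Proof.
move=> cf fg; apply: le_integrable => //.
  by apply/measurable_EFinP; apply: measurable_funTS; exact: continuous_measurable_fun.
move=> s /=; rewrite in_itv/= andbT => s0; rewrite lee_fin.
by apply: le_trans (fg s s0) _; rewrite ler_norm.
Qed.

Lemma igPZ k (f : R -> R) : igP f -> igP (fun s => k * f s).
Proof. by move=> H; apply: (integrableZl mP k H). Qed.

Lemma igPD (f g : R -> R) : igP f -> igP g -> igP (fun s => f s + g s).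
Proof. by move=> H1 H2; apply: (integrableD mP H1 H2). Qed.

Lemma IPZ k (f : R -> R) : igP f -> IP (fun s => k * f s) = k * IP f.
Proof. by move=> H; rewrite /IP RintegralZl. Qed.

Lemma IPD (f g : R -> R) : igP f -> igP g -> IP (fun s => f s + g s) = IP f + IP g.
Proof. by move=> H1 H2; rewrite /IP RintegralD. Qed.

Lemma le_IP (f g : R -> R) : igP f -> igP g -> (forall s, 0 < s -> f s <= g s) ->
  IP f <= IP g.
Proof.
move=> H1 H2 fg; apply: le_Rintegral => // s /=; rewrite in_itv/= andbT; exact: fg.
Qed.

Definition mag (H D : R -> R) s := h ^+ 2 * D s + B ^+ 2 / 4 * s * H s ^+ 2.

Lemma radial_C1_ge0 u H D s : radial_C1 u H D -> 0 <= s -> 0 <= D s.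
Proof.
move=> [_ _ _ uD _] s0; have := uD (Num.sqrt s, 0).
rewrite /nrm2/= expr0n addr0 sqr_sqrtr// => <-.
by rewrite addr_ge0 ?sqr_ge0.
Qed.

Lemma continuous_mag u H D : radial_C1 u H D -> continuous (mag H D).
Proof.
move=> [_ _ _ _ [cH cD]] s; apply: cvgD; first by apply: cvgMr; exact: cD.
by apply: cvgM; [apply: cvgMr; exact: cvg_id|apply: cvg_sqr; exact: cH].
Qed.

Lemma integral_mag u H D : radial_C1 u H D ->
  (\int[@mu2 R]_z (mag_density B h u (fun=> 0) z)%:E = c%:E * \int[leb]_(s in P) (mag H D s)%:E)%E.
Proof.
move=> uHD; apply: radial_ge0_IP; first exact: continuous_mag uHD.
- by move=> s s0; have D0 := radial_C1_ge0 uHD s0; rewrite /mag; nn.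
- by move=> z; have [_ _ uH uD _] := uHD; rewrite mag_density_real /mag -uD -uH.
Qed.

Lemma integral_sqr u H D : radial_C1 u H D ->
  (\int[@mu2 R]_z ((u z ^+ 2 + (0 : R) ^+ 2))%:E = c%:E * \int[leb]_(s in P) (H s ^+ 2)%:E)%E.
Proof.
move=> [_ _ uH _ [cH _]]; apply: radial_ge0_IP.
- by move=> s; apply: cvg_sqr; exact: cH.
- by move=> s _; exact: sqr_ge0.
- by move=> z; rewrite uH expr0n addr0.
Qed.

Lemma igP_vH u H D : radial_C1 u H D -> igP (fun s => H s ^+ 2) ->
  igP (fun s => vh s * H s ^+ 2).
Proof.
move=> [_ _ _ _ [cH _]] iH.
have cHs : continuous (fun s => H s ^+ 2) by move=> s; apply: cvg_sqr; exact: cH.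
apply: (igP_le (g := fun s => b * H s ^+ 2)) (igPZ b iH).
  by move=> s; apply: cvgM; [exact: cvh|exact: cHs].
move=> s _; rewrite normrM [X in _ * X]ger0_norm ?sqr_ge0// ler_wpM2r ?sqr_ge0//.
by have := vh_bound s; rewrite ler_norml; lra.
Qed.

Lemma energy_radial u H D : radial_C1 u H D -> igP (mag H D) -> igP (fun s => H s ^+ 2) ->
  energy v B h u (fun=> 0) = (c * (IP (mag H D) + IP (fun s => vh s * H s ^+ 2)))%:E.
Proof.
move=> uHD im iH; have iv := igP_vH uHD iH.
rewrite /energy (integral_mag uHD) (IP_E im) -EFinM mulrDr EFinD; congr (_ + _)%E.
have [_ _ uH _ [cH _]] := uHD.
have mv : measurable_fun [set: R] (fun s => vh s * H s ^+ 2).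
  apply: continuous_measurable_fun => s; apply: cvgM; first exact: cvh.
  by apply: cvg_sqr; exact: cH.
rewrite -(radial_Rintegral mv iv) /Rintegral fineK; last first.
  by apply: integrable_fin_num => //; exact: (radial_integrable mv iv).
by apply: eq_integral => z _; rewrite vE uH expr0n addr0.
Qed.

Lemma cst0_C1 : [/\ forall z, differentiable (fun _ : R * R => 0 : R) z,
  continuous (dx (fun _ : R * R => 0 : R)) & continuous (dy (fun _ : R * R => 0 : R))].
Proof.
have d0 : dx (fun=> 0 : R) = fun=> 0 by apply/funext => w; apply: dxE; exact: derC.
have e0 : dy (fun=> 0 : R) = fun=> 0 by apply/funext => w; apply: dyE; exact: derC.
by split; [move=> z; exact: differentiable_cst|rewrite d0 => z; exact: cvg_cst|rewrite e0 => z; exact: cvg_cst].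
Qed.

(** Profiles in the squared radius, read along the positive first axis: [profK] is the radial
    derivative and [prof1] the derivative in [s]. As [Num.sqrt] is 0 on negative numbers, [prof] and
    [profK] are continuous on the whole line; [prof1] is meaningful only for [s > 0]. *)
Definition prof (s : R) := phi (Num.sqrt s, 0).
Definition profK (s : R) := dx phi (Num.sqrt s, 0).
Definition prof1 s := profK s / (2 * Num.sqrt s).
Local Notation F := prof.
Local Notation Kf := profK.
Local Notation F1 := prof1.

Let dphi z : differentiable phi z. Proof. by have [[]] := gs. Qed.

Lemma phi_prof z : phi z = F (nrm2 z).
Proof.
have [_ [rad _]] := gs; apply: rad.
by rewrite eucl_rad_axis ?sqrtr_ge0.
Qed.

Lemma der_prof (s : R) : 0 < s -> der s F (F1 s).
Proof.
move=> s0; apply: der_eq.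
  apply: (@der_comp _ Num.sqrt (fun x => phi (x, 0))).
    exact: (der_dx (dphi (Num.sqrt s, 0))).
  by apply: der_sqrt; [exact: derI|].
by rewrite /F1 /Kf mul1r.
Qed.

Lemma continuous_axis : continuous (fun s : R => (Num.sqrt s, 0 : R)).
Proof.
move=> s; have cs : Num.sqrt x @[x --> s] --> Num.sqrt s by exact: sqrt_continuous.
have c0' : (0 : R) @[x --> s] --> (0 : R) by exact: cvg_cst.
exact: (cvg_pair cs c0').
Qed.

Lemma continuous_prof : continuous F.
Proof.
move=> s; apply: (@continuous_comp _ _ _ (fun s : R => (Num.sqrt s, 0 : R)) phi).
  exact: continuous_axis.
exact: differentiable_continuous.
Qed.

Lemma continuous_profK : continuous Kf.
Proof.
move=> s; apply: (@continuous_comp _ _ _ (fun s : R => (Num.sqrt s, 0 : R)) (dx phi)).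
  exact: continuous_axis.
by have [[_ [_ [cx _]]] _] := gs; exact: cx.
Qed.

Lemma nrm2_eq0 (z : R * R) : nrm2 z = 0 -> z = (0, 0).
Proof.
have x0 := sqr_ge0 z.1; have y0 := sqr_ge0 z.2; rewrite /nrm2 => z0.
by case: z x0 y0 z0 => x y /= x0 y0 z0; congr (_, _); apply/eqP; rewrite -sqrf_eq0; apply/eqP; lra.
Qed.

Lemma grad_phi z : nrm2 z != 0 ->
  dx phi z = F1 (nrm2 z) * (2 * z.1) /\ dy phi z = F1 (nrm2 z) * (2 * z.2).
Proof.
move=> z0; have s0 : 0 < nrm2 z by rewrite lt_def z0 nrm2_ge0.
have phiE : phi = fun z => F (nrm2 z) by apply/funext => w; exact: phi_prof.
split; rewrite [in LHS]phiE.
  apply: dxE; apply: der_eq.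
    apply: (@der_comp _ (fun x => x ^+ 2 + z.2 ^+ 2)); first exact: der_prof.
    by der_rec fail.
  by rewrite /=; congr (_ * _); ring.
apply: dyE; apply: der_eq.
  apply: (@der_comp _ (fun y => z.1 ^+ 2 + y ^+ 2)); first exact: der_prof.
  by der_rec fail.
by rewrite /=; congr (_ * _); ring.
Qed.

Lemma grad_phi_radial z : z.1 * dx phi z + z.2 * dy phi z = Num.sqrt (nrm2 z) * Kf (nrm2 z).
Proof.
have [z0|z0] := eqVneq (nrm2 z) 0.
  by rewrite z0 sqrtr0 (nrm2_eq0 z0) !mul0r addr0.
have s0 : 0 < nrm2 z by rewrite lt_def z0 nrm2_ge0.
have [-> ->] := grad_phi z0.
transitivity (2 * nrm2 z * F1 (nrm2 z)); first by rewrite /nrm2; ring.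
have sq0 : 0 < Num.sqrt (nrm2 z) by rewrite sqrtr_gt0.
by rewrite /F1 -{1}(sqr_sqrtr (ltW s0)); field; nz.
Qed.

Lemma radial_C1_phi : radial_C1 phi F (fun s => Kf s ^+ 2).
Proof.
have [[_ [_ [cx [cy _]]]] _] := gs; split=> //.
- exact: phi_prof.
- move=> z; have [z0|z0] := eqVneq (nrm2 z) 0.
    have zE := nrm2_eq0 z0.
    (* At the origin [profK 0] already is [dx phi (0, 0)], so the identity for the gradient reduces
       to the vanishing of [dy phi], which follows from evenness in [y]. *)
    have dy0 : dy phi (0, 0) = 0.
      have H1 := der_dy (dphi (0, 0)).
      have H2 : der (0 : R) (fun y => phi (0, - y)) (- dy phi (0, 0)).
        apply: der_eq.
          apply: (@der_comp _ -%R (fun y => phi (0, y))); first by rewrite oppr0; exact: H1.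
          by apply: derN; exact: derI.
        by rewrite mulrN1.
      have E : (fun y => phi (0, - y)) = (fun y => phi (0, y)).
        by apply/funext => y; rewrite !phi_prof /nrm2/= sqrrN.
      rewrite E in H2; have := der_uniq H1 H2; lra.
    by rewrite z0 zE dy0 /Kf sqrtr0 expr0n addr0.
  have s0 : 0 < nrm2 z by rewrite lt_def z0 nrm2_ge0.
  have [ex ey] := grad_phi z0.
  rewrite ex ey; transitivity (4 * nrm2 z * F1 (nrm2 z) ^+ 2); first by rewrite /nrm2; ring.
  have sq0 : 0 < Num.sqrt (nrm2 z) by rewrite sqrtr_gt0.
  rewrite /F1 -{1}(sqr_sqrtr (ltW s0)); field; nz.
- by split; [exact: continuous_prof|move=> s; apply: cvg_sqr; exact: continuous_profK].
Qed.

Lemma integral_prof_sqr : (c%:E * \int[leb]_(s in P) (F s ^+ 2)%:E = 1)%E.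
Proof.
rewrite -(integral_sqr radial_C1_phi).
by have [[_ [_ [_ [_ [_ [_ [-> _]]]]]]] _] := gs.
Qed.

Let fin_of_ge0 (f : R -> R) : continuous f -> (forall s, 0 < s -> 0 <= f s) ->
  (c%:E * \int[leb]_(s in P) (f s)%:E < +oo)%E -> igP f.
Proof.
move=> cf f0 H; apply/integrableP; split.
  by apply/measurable_EFinP; apply: measurable_funTS; exact: continuous_measurable_fun.
rewrite (_ : (\int[leb]_(x in P) `|(EFin \o f) x| = \int[leb]_(s in P) (f s)%:E)%E); last first.
  by apply: eq_integral => s; rewrite inE/= in_itv/= andbT => s0; rewrite ger0_norm// f0.
move: H; case: (\int[leb]_(s in P) (f s)%:E)%E => [r| |] //.
  by move=> _; exact: ltry.
by rewrite mulry gtr0_sg ?mul1e.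
Qed.

Lemma igP_prof_sqr : igP (fun s => F s ^+ 2).
Proof.
apply: fin_of_ge0; first by move=> s; apply: cvg_sqr; exact: continuous_prof.
- by move=> s _; exact: sqr_ge0.
- by rewrite integral_prof_sqr ltry.
Qed.

Lemma IP_prof_sqr : c * IP (fun s => F s ^+ 2) = 1.
Proof.
by apply: EFin_inj; rewrite EFinM -(IP_E igP_prof_sqr) integral_prof_sqr.
Qed.

Lemma igP_mag_prof : igP (mag F (fun s => Kf s ^+ 2)).
Proof.
apply: fin_of_ge0; first exact: continuous_mag radial_C1_phi.
- by move=> s s0; rewrite /mag; nn.
- rewrite -(integral_mag radial_C1_phi).
  by have [[_ [_ [_ [_ [_ [_ [_ H]]]]]]] _] := gs.
Qed.

Definition gs_lam := c * (IP (mag F (fun s => Kf s ^+ 2)) + IP (fun s => vh s * F s ^+ 2)).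
Local Notation lam := gs_lam.

(** Minimality in homogeneous form, obtained by rescaling the trial function to norm one; a trial
    function of norm zero is treated apart, using [vh >= - b]. Restricting to real radial trial
    functions reduces both sides to integrals over the half-line. *)
Lemma rayleigh u H D : radial_C1 u H D -> igP (mag H D) -> igP (fun s => H s ^+ 2) ->
  lam * IP (fun s => H s ^+ 2) <= IP (mag H D) + IP (fun s => vh s * H s ^+ 2).
Proof.
move=> uHD im iH; have iv := igP_vH uHD iH.
set n := IP (fun s => H s ^+ 2).
have n0 : 0 <= n by apply: Rintegral_ge0 => s _; exact: sqr_ge0.
have m0 : 0 <= IP (mag H D).
  apply: Rintegral_ge0 => s /=; rewrite in_itv/= andbT => s0.
  by have D0 := radial_C1_ge0 uHD (ltW s0); rewrite /mag; nn.
have [nE|nn0] := eqVneq n 0.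
  rewrite nE mulr0; have : IP (fun s => - b * H s ^+ 2) <= IP (fun s => vh s * H s ^+ 2).
    apply: le_IP => //; first exact: igPZ.
    by move=> s _; rewrite ler_wpM2r ?sqr_ge0//; have := vh_bound s; lra.
  by rewrite IPZ// -/n nE mulr0; lra.
have np : 0 < n by rewrite lt_def nn0.
pose k := (Num.sqrt (c * n))^-1.
have cn : 0 < c * n by rewrite mulr_gt0.
have k2 : k ^+ 2 = (c * n)^-1 by rewrite /k exprVn sqr_sqrtr// ltW.
have kHD := radial_C1Z k uHD.
have kiH : igP (fun s => (k * H s) ^+ 2).
  rewrite (_ : (fun s => (k * H s) ^+ 2) = fun s => k ^+ 2 * H s ^+ 2); first exact: igPZ.
  by apply/funext => s; rewrite exprMn.
have magE : mag (fun s => k * H s) (fun s => k ^+ 2 * D s) = fun s => k ^+ 2 * mag H D s.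
  by apply/funext => s; rewrite /mag; ring.
have kim : igP (mag (fun s => k * H s) (fun s => k ^+ 2 * D s)) by rewrite magE; exact: igPZ.
have adm : admissible B h (fun z => k * u z) (fun=> 0).
  have [dku [ckx cky] _ _ _] := kHD; have [d0 cx0 cy0] := cst0_C1.
  split; [exact: dku|split; [exact: d0|split; [exact: ckx|split; [exact: cky|]]]].
  split; [exact: cx0|split; [exact: cy0|split]].
    rewrite (integral_sqr kHD) (IP_E kiH) -EFinM; congr EFin.
    rewrite (_ : (fun s => (k * H s) ^+ 2) = fun s => k ^+ 2 * H s ^+ 2); last first.
      by apply/funext => s; rewrite exprMn.
    by rewrite IPZ// -/n k2; field; nz.
  by rewrite (integral_mag kHD) (IP_E kim) -EFinM ltry.
have [_ [_ /(_ _ _ adm)]] := gs.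
rewrite (energy_radial radial_C1_phi igP_mag_prof igP_prof_sqr) (energy_radial kHD kim kiH) lee_fin.
rewrite magE IPZ// (_ : (fun s => vh s * (k * H s) ^+ 2) = fun s => k ^+ 2 * (vh s * H s ^+ 2)); last first.
  by apply/funext => s; ring.
rewrite IPZ// -mulrDr k2 -/lam => E.
have {}E : lam <= (IP (mag H D) + IP (fun s => vh s * H s ^+ 2)) / n.
  by apply: (le_trans E); rewrite le_eqVlt; apply/orP; left; apply/eqP; field; nz.
by move: E; rewrite ler_pdivlMr.
Qed.

End RayleighQuotient.

(** * The Euler-Lagrange equation *)

Section CompactSupport.
Context {R : realType}.
Notation leb := (@lebesgue_measure R).
Notation P := (`]0%R, +oo[%classic : set (measurableTypeR R)).
Implicit Types f : R -> R.

Lemma integrable_cont_itv f (x y : R) : continuous f -> leb.-integrable `[x, y] (EFin \o f).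
Proof.
move=> cf; apply: continuous_compact_integrable; first exact: segment_compact.
exact: continuous_subspaceT.
Qed.

Lemma igP_compact f (b : R) : continuous f -> (forall s, b < s -> f s = 0) -> igP f.
Proof.
move=> cf f0; have mP : measurable P by exact: measurable_itv.
have : leb.-integrable setT ((EFin \o f) \_ `[0, b]).
  by rewrite -integrable_mkcond//; exact: integrable_cont_itv.
move=> /(integrableS measurableT mP (@subsetT _ _)).
apply: eq_integrable => // s; rewrite inE/= in_itv/= andbT => s0.
rewrite patchE; case: ifPn => //; rewrite notin_setE/= in_itv/= (ltW s0)/= => /negP.
by rewrite -ltNge => bs; rewrite f0.
Qed.

Lemma IP_compact f (b : R) : continuous f -> (forall s, b < s -> f s = 0) ->
  IP f = (\int[leb]_(s in `[0%R, b]) f s)%R.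
Proof.
move=> cf f0; have [b0|b0] := leP b 0.
  transitivity (0 : R).
    rewrite /IP /Rintegral integral0_eq// => s /=; rewrite in_itv/= andbT => s0.
    by rewrite f0// (le_lt_trans b0).
  have [->|bn0] := eqVneq b 0; first by rewrite set_itv1 Rintegral_set1.
  rewrite set_itv_ge ?Rintegral_set0// bnd_simp -ltNge lt_def eq_sym bn0//.
have mP : measurable P by exact: measurable_itv.
rewrite -Rintegral_itv_obnd_cbnd; last first.
  apply: integrableS (integrable_cont_itv 0 b cf) => //.
  by move=> t /=; rewrite !in_itv/= => /andP[/ltW -> ->].
have PE : P `&` `]0, b] = `]0, b]%classic.
  by apply/seteqP; split => x /=; rewrite !in_itv/= andbT; [case|move=> /andP[-> ->]].
rewrite -PE Rintegral_mkcondr /IP; apply: eq_Rintegral => s; rewrite inE/= in_itv/= andbT => s0.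
rewrite patchE; case: ifPn => //; rewrite notin_setE/= in_itv/= s0/= => /negP.
by rewrite -ltNge => bs; rewrite f0.
Qed.

Lemma primitive_der_cont f (x : R) : continuous f -> 0 < x ->
  der x (fun y => \int[leb]_(t in `[0, y]) f t)%R (f x).
Proof.
move=> cf x0; have xu : x < x + 1 by rewrite ltrDl.
have := @continuous_FTC1_closed R f 0 x (x + 1) xu _ x0 (cf x).
case; first exact: integrable_cont_itv.
move=> df E; split; first exact: df.
by rewrite -derive1E; exact: E.
Qed.

Lemma Rintegral_itv_eq0 f (s : R) : (forall t, 0 <= t <= s -> f t = 0) ->
  (\int[leb]_(t in `[0%R, s]) f t)%R = 0.
Proof.
by move=> f0; rewrite /Rintegral integral0_eq// => t /=; rewrite in_itv/= => /f0 ->.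
Qed.

(** A monotone function with equal end values is constant. Twice below this converts a vanishing
    integral of a nonnegative integrand into pointwise vanishing. *)
Lemma der_ge0_flat f (df : R -> R) (al bt : R) : 
  (forall x : R, al <= x <= bt -> der x f (df x)) ->
  (forall x, al <= x <= bt -> 0 <= df x) -> f al = f bt ->
  forall x, al < x < bt -> df x = 0.
Proof.
move=> d0 df0 fE x /andP[ax xb].
have cst y : al < y < bt -> f y = f bt.
  move=> /andP[ay yb]; apply/eqP; rewrite eq_le; apply/andP; split.
    apply: (der_mono (df := df)) (ltW yb) _ _ => t /andP[yt tb].
      by apply: d0; rewrite tb (le_trans (ltW ay)).
    by apply: df0; rewrite tb (le_trans (ltW ay)).
  rewrite -fE; apply: (der_mono (df := df)) (ltW ay) _ _ => t /andP[yt tb].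
    by apply: d0; rewrite yt (le_trans tb (ltW yb)).
  by apply: df0; rewrite yt (le_trans tb (ltW yb)).
have Hx : der x f (df x) by apply: d0; rewrite !ltW.
apply: (der_uniq Hx); apply: der_near (derC (f bt) x).
near=> y; rewrite cst//; apply/andP; split; near: y; [exact: lt_nbhsr|exact: lt_nbhsl].
Unshelve. all: by end_near. Qed.

End CompactSupport.

Section EulerLagrange.
Context {R : realType}.
Notation leb := (@lebesgue_measure R).
Notation P := (`]0%R, +oo[%classic : set (measurableTypeR R)).
Notation c := (@radial_c R).
Variables (v : R * R -> R) (B h b : R) (vh : R -> R) (phi : R * R -> R).
Hypotheses (B0 : 0 < B) (h0 : 0 < h) (b0 : 0 < b) (cvh : continuous vh).
Hypothesis vE : forall z, v z = vh (nrm2 z).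
Hypothesis vh_bound : forall s, - b <= vh s <= 0.
Hypothesis gs : radial_real_ground_state v B h phi.
Local Notation F := (prof phi).
Local Notation Kf := (profK phi).
Local Notation lam := (gs_lam B h vh phi).
Local Notation mag := (mag B h).

(** [g] is the flux [4 * h ^+ 2 * s * F'(s)], written through [profK] so that it is continuous at 0
    and involves first derivatives of [phi] only. The equation to be proved is [g' = q]. *)
Let g s := 2 * h ^+ 2 * (Num.sqrt s * Kf s).
Let q s := (B ^+ 2 / 4 * s + vh s - lam) * F s.

Let cF : continuous F. Proof. exact: continuous_prof gs. Qed.
Let cK : continuous Kf. Proof. exact: continuous_profK gs. Qed.
Let cg : continuous g.
Proof.
move=> s; apply: cvgMr; apply: cvgM; [exact: sqrt_continuous|exact: cK].
Qed.
Let cq : continuous q.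
Proof.
move=> s; apply: cvgM; last exact: cF.
apply: cvgB; last exact: cvg_cst.
by apply: cvgD; [apply: cvgMr; exact: cvg_id|exact: cvh].
Qed.

Section TestFunction.
Variables (chi chi1 : R -> R) (bt : R).
Hypothesis dchi : forall s : R, der s chi (chi1 s).
Hypothesis cchi1 : continuous chi1.
Hypothesis chi_out : forall s, bt < s -> chi s = 0.
Hypothesis chi1_out : forall s, bt < s -> chi1 s = 0.

Let cchi : continuous chi. Proof. by move=> s; exact: (der_cvg (dchi s)). Qed.

Let D t s := Kf s ^+ 2 + 4 * t * (Num.sqrt s * Kf s * chi1 s) + t ^+ 2 * (4 * s * chi1 s ^+ 2).

Lemma radial_C1_perturb t : radial_C1 (fun z => phi z + t * chi (nrm2 z))
  (fun s => F s + t * chi s) (D t).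
Proof.
have [dphi [cxp cyp] phiH phiD _] := radial_C1_phi gs.
have [deta [cxe cye] _ etaD [_ cD2]] := radial_C1_der dchi cchi1.
pose eta z := chi (nrm2 z).
have ex z : dx (fun z => phi z + t * eta z) z = dx phi z + t * dx eta z.
  apply: dxE; apply: derD; first exact: (der_dx (dphi z)).
  by apply: der_eq; [apply: derM; [exact: derC|exact: (der_dx (deta z))]|rewrite mulr0 addr0].
have ey z : dy (fun z => phi z + t * eta z) z = dy phi z + t * dy eta z.
  apply: dyE; apply: derD; first exact: (der_dy (dphi z)).
  by apply: der_eq; [apply: derM; [exact: derC|exact: (der_dy (deta z))]|rewrite mulr0 addr0].
have exe z : dx eta z = chi1 (nrm2 z) * (2 * z.1).
  apply: dxE; apply: der_eq.
    apply: (@der_comp _ (fun x => x ^+ 2 + z.2 ^+ 2)); first exact: dchi.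
    by der_rec fail.
  by rewrite /=; congr (_ * _); ring.
have eye z : dy eta z = chi1 (nrm2 z) * (2 * z.2).
  apply: dyE; apply: der_eq.
    apply: (@der_comp _ (fun y => z.1 ^+ 2 + y ^+ 2)); first exact: dchi.
    by der_rec fail.
  by rewrite /=; congr (_ * _); ring.
split.
- move=> z; apply: differentiableD; first exact: dphi.
  by have [dt _ _ _ _] := radial_C1Z t (radial_C1_der dchi cchi1); exact: dt.
- split=> z.
    have /funext -> := ex.
    by apply: cvgD; [exact: cxp|apply: cvgMr; exact: cxe].
  have /funext -> := ey.
  by apply: cvgD; [exact: cyp|apply: cvgMr; exact: cye].
- by move=> z; rewrite phiH.
- move=> z; rewrite ex ey /D -phiD -(grad_phi_radial gs) exe eye.
  by rewrite /nrm2; ring.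
- split=> s; first by apply: cvgD; [exact: cF|apply: cvgMr; exact: cchi].
  apply: cvgD; first apply: cvgD.
  + by apply: cvg_sqr; exact: cK.
  + by apply: cvgMr; apply: cvgM; [apply: cvgM; [exact: sqrt_continuous|exact: cK]|exact: cchi1].
  + by apply: cvgMr; exact: cD2.
Qed.

Let csK (f : R -> R) : continuous f -> continuous (fun s => Num.sqrt s * Kf s * f s).
Proof.
by move=> cf s; apply: cvgM; [apply: cvgM; [exact: sqrt_continuous|exact: cK]|exact: cf].
Qed.

Let m1 s := 4 * h ^+ 2 * (Num.sqrt s * Kf s * chi1 s) + B ^+ 2 / 2 * (s * (F s * chi s)).
Let m2' s := h ^+ 2 * (4 * s * chi1 s ^+ 2) + B ^+ 2 / 4 * s * chi s ^+ 2.

Let cFc : continuous (fun s => F s * chi s).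
Proof. by move=> s; apply: cvgM; [exact: cF|exact: cchi]. Qed.

Let cm1 : continuous m1.
Proof.
move=> s; apply: cvgD; first by apply: cvgMr; exact: csK.
by apply: cvgMr; apply: cvgM; [exact: cvg_id|exact: cFc].
Qed.

Let cc2 : continuous (fun s => chi s ^+ 2).
Proof. by move=> s; apply: cvg_sqr; exact: cchi. Qed.

Let cm2 : continuous m2'.
Proof.
move=> s; apply: cvgD.
  apply: cvgMr; apply: cvgM; first by apply: cvgMr; exact: cvg_id.
  by apply: cvg_sqr; exact: cchi1.
by apply: cvgM; [apply: cvgMr; exact: cvg_id|exact: cc2].
Qed.

(** The Rayleigh inequality at [F + t * chi] is a quadratic polynomial in [t], zero at [t = 0] and
    nonnegative, so its linear coefficient vanishes; that coefficient is twice the integral of the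
    statement. *)
Lemma weak_form : IP (fun s => g s * chi1 s + q s * chi s) = 0.
Proof.
have im1 : igP m1 by apply: (igP_compact cm1 (b := bt)) => s st; rewrite /m1 chi_out ?chi1_out// !mulr0 addr0.
have im2 : igP m2' by apply: (igP_compact cm2 (b := bt)) => s st; rewrite /m2' chi_out ?chi1_out// expr0n !mulr0 addr0.
have iFc : igP (fun s => F s * chi s).
  by apply: (igP_compact cFc (b := bt)) => s st; rewrite chi_out ?mulr0.
have ic2 : igP (fun s => chi s ^+ 2).
  by apply: (igP_compact cc2 (b := bt)) => s st; rewrite chi_out ?expr0n.
have ivFc : igP (fun s => vh s * (F s * chi s)).
  apply: (igP_compact _ (b := bt)); first by move=> s; apply: cvgM; [exact: cvh|exact: cFc].
  by move=> s st; rewrite chi_out ?mulr0.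
have ivc2 : igP (fun s => vh s * chi s ^+ 2).
  apply: (igP_compact _ (b := bt)); first by move=> s; apply: cvgM; [exact: cvh|exact: cc2].
  by move=> s st; rewrite chi_out ?expr0n ?mulr0.
have iF := igP_prof_sqr gs; have im := igP_mag_prof gs.
have iv := igP_vH cvh vh_bound (radial_C1_phi gs) iF.
pose bb := IP m1 + 2 * IP (fun s => vh s * (F s * chi s)) - 2 * lam * IP (fun s => F s * chi s).
pose dd := IP m2' + IP (fun s => vh s * chi s ^+ 2) - lam * IP (fun s => chi s ^+ 2).
have quad t : 0 <= t * bb + t ^+ 2 * dd.
  have magE : mag (fun s => F s + t * chi s) (D t) =
     fun s => (mag F (fun s => Kf s ^+ 2) s + t * m1 s) + t ^+ 2 * m2' s.
    by apply/funext => s; rewrite /mag /D /m1 /m2'; field.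
  have vhE : (fun s => vh s * (F s + t * chi s) ^+ 2) =
     fun s => (vh s * F s ^+ 2 + 2 * t * (vh s * (F s * chi s))) + t ^+ 2 * (vh s * chi s ^+ 2).
    by apply/funext => s; ring.
  have sqE : (fun s => (F s + t * chi s) ^+ 2) =
     fun s => (F s ^+ 2 + 2 * t * (F s * chi s)) + t ^+ 2 * chi s ^+ 2.
    by apply/funext => s; ring.
  have i1 := igPD im (igPZ t im1); have i2 := igPD iv (igPZ (2 * t) ivFc).
  have i3 := igPD iF (igPZ (2 * t) iFc).
  have imt : igP (mag (fun s => F s + t * chi s) (D t)).
    by rewrite magE; apply: igPD; [exact: i1|exact: igPZ].
  have iFt : igP (fun s => (F s + t * chi s) ^+ 2).
    by rewrite sqE; apply: igPD; [exact: i3|exact: igPZ].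
  have := rayleigh cvh vE vh_bound gs (radial_C1_perturb t) imt iFt.
  rewrite magE vhE sqE.
  rewrite (IPD i1 (igPZ _ im2)) (IPD im (igPZ t im1)) (IPZ _ im2) (IPZ _ im1).
  rewrite (IPD i2 (igPZ _ ivc2)) (IPD iv (igPZ _ ivFc)) (IPZ _ ivc2) (IPZ _ ivFc).
  rewrite (IPD i3 (igPZ _ ic2)) (IPD iF (igPZ _ iFc)) (IPZ _ ic2) (IPZ _ iFc).
  have : lam * IP (fun s => F s ^+ 2) = IP (mag F (fun s => Kf s ^+ 2)) + IP (fun s => vh s * F s ^+ 2).
    rewrite /gs_lam mulrAC (IP_prof_sqr gs) mul1r//.
  rewrite /bb /dd; set x1 := IP _; set x2 := IP _; set x3 := IP _; set x4 := IP _; lra.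
have bb0 : bb = 0.
  apply/eqP; apply/negPn/negP => bn.
  (* With this [t] the value is [bb ^+ 2 / (|dd| + 1)] times [dd / (|dd| + 1) - 1], which is
     negative. *)
  pose t := - bb / (`|dd| + 1).
  have d1 : 0 < `|dd| + 1 by rewrite ltr_wpDl.
  have := quad t.
  have -> : t * bb + t ^+ 2 * dd = bb ^+ 2 / (`|dd| + 1) * (dd / (`|dd| + 1) - 1).
    by rewrite /t; field; nz.
  have b2 : 0 < bb ^+ 2 / (`|dd| + 1) by rewrite divr_gt0// exprn_even_gt0.
  rewrite pmulr_rge0// subr_ge0 ler_pdivlMr// mul1r.
  by have := ler_norm dd; lra.
have -> : (fun s => g s * chi1 s + q s * chi s) =
   fun s => 2^-1 * ((m1 s + 2 * (vh s * (F s * chi s))) + - (2 * lam) * (F s * chi s)).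
  by apply/funext => s; rewrite /g /q /m1; field.
have i4 := igPD im1 (igPZ 2 ivFc); have i5 := igPZ (- (2 * lam)) iFc.
rewrite (IPZ _ (igPD i4 i5)) (IPD i4 i5) (IPD im1 (igPZ _ ivFc)) (IPZ _ ivFc) (IPZ _ iFc).
by rewrite mulNr -/bb bb0 mulr0.
Qed.

End TestFunction.

Let Qp (s : R) := (\int[leb]_(t in `[0%R, s]) q t)%R.
Let G s := g s - Qp s.

(* Du Bois-Reymond: the test function is the primitive of [om * (G - m)], where [om] is a bump on
   the interval and [m] is the [om]-mean of [G]. *)
Lemma du_bois_reymond (al bt s : R) : 0 < al -> al < s < bt ->
  exists m, forall x, al < x < bt -> G x = m.
Proof.
move=> al0 /andP[als sbt]; have bt0 : 0 < bt by lra.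
have albt : al < bt by lra.
pose om (x : R) := Num.max 0 ((x - al) * (bt - x)).
have om_ge0 x : 0 <= om x by rewrite le_max lexx.
have com : continuous om.
  move=> x; apply: (@continuous_max _ _ (fun=> 0) (fun x : R => (x - al) * (bt - x))); first exact: cvg_cst.
  apply: cvgM; first by apply: cvgB; [exact: cvg_id|exact: cvg_cst].
  by apply: cvgB; [exact: cvg_cst|exact: cvg_id].
have om_in x : al < x < bt -> 0 < om x.
  by move=> /andP[ax xb]; rewrite lt_max; apply/orP; right; rewrite mulr_gt0 ?subr_gt0.
have om_out x : x <= al \/ bt <= x -> om x = 0.
  by move=> H; rewrite /om max_l//; case: H => H; nra.
(* [Gt] agrees with [G] on the support of [om] and is continuous everywhere *)
pose Gt x := G (Num.max x al).
have GtE x : al <= x -> Gt x = G x by move=> ?; rewrite /Gt max_l.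
have dQp x : 0 < x -> der x Qp (q x) by move=> x0; exact: primitive_der_cont.
have cGt : continuous Gt.
  move=> x; apply: (@continuous_comp _ _ _ (fun x => Num.max x al) G).
    by apply: (@continuous_max _ _ (fun x => x) (fun=> al)); [exact: cvg_id|exact: cvg_cst].
  have mx0 : 0 < Num.max x al by rewrite lt_max al0 orbT.
  by apply: cvgB; [exact: cg|exact: (der_cvg (dQp _ mx0))].
pose Iom x := (\int[leb]_(t in `[0%R, x]) om t)%R.
have Iom_neq0 : Iom bt != 0.
  apply/eqP => I0.
  have Ial : Iom al = 0 by apply: Rintegral_itv_eq0 => t /andP[_ ta]; apply: om_out; left.
  have dI x : al <= x <= bt -> der x Iom (om x).
    by move=> /andP[ax _]; apply: primitive_der_cont => //; exact: lt_le_trans ax.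
  have H := der_ge0_flat dI (fun x _ => om_ge0 x) (etrans Ial (esym I0)).
  by have := om_in s; rewrite als sbt H ?als// ltxx => /(_ isT).
have coG : continuous (fun x => om x * Gt x) by move=> x; apply: cvgM; [exact: com|exact: cGt].
pose m := (\int[leb]_(t in `[0%R, bt]) (om t * Gt t))%R / Iom bt.
pose chi1 x := om x * Gt x - m * om x.
have cchi1 : continuous chi1.
  by move=> x; apply: cvgB; [exact: coG|apply: cvgMr; exact: com].
have chi1_out x : x <= al \/ bt <= x -> chi1 x = 0.
  by move=> H; rewrite /chi1 om_out// mul0r mulr0 subr0.
pose chi x := (\int[leb]_(t in `[0%R, x]) chi1 t)%R.
have chi_lo x : x <= al -> chi x = 0.
  by move=> xa; apply: Rintegral_itv_eq0 => t /andP[_ tx]; apply: chi1_out; left; exact: le_trans xa.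
have chi_bt : chi bt = 0.
  rewrite /chi /chi1 RintegralB//; last first.
  - apply: (@integrable_cont_itv _ (fun t => m * om t)) => x; apply: cvgMr; exact: com.
  - exact: integrable_cont_itv.
  rewrite RintegralZl//; last exact: integrable_cont_itv.
  by rewrite -/(Iom bt) /m divfK// subrr.
have dchi (x : R) : der x chi (chi1 x).
  have [x0|x0] := ltP 0 x; first exact: primitive_der_cont.
  have xal : x < al by exact: le_lt_trans al0.
  rewrite chi1_out; last by left; exact: ltW.
  apply: der_near (derC 0 x); near=> y; rewrite chi_lo//; apply: ltW; near: y; exact: lt_nbhsl.
have chi_hi x : bt < x -> chi x = 0.
  move=> bx; rewrite -chi_bt; apply/eqP; rewrite -subr_eq0 -normr_le0.
  have := @der_bound _ chi (fun=> 0) chi1 (fun=> 0) bt x (ltW bx) (fun y _ => dchi y) (fun y _ => derC 0 y).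
  rewrite subrr; apply => y /andP[bty _]; rewrite chi1_out ?normr0//; by right.
have chi1_hi x : bt < x -> chi1 x = 0 by move=> bx; apply: chi1_out; right; exact: ltW.
have cchi : continuous chi by move=> x; exact: (der_cvg (dchi x)).
pose gg x := g x * chi1 x + q x * chi x.
have cgg : continuous gg.
  by move=> x; apply: cvgD; apply: cvgM; [exact: cg|exact: cchi1|exact: cq|exact: cchi].
have := weak_form dchi cchi1 chi_hi chi1_hi.
rewrite (IP_compact cgg (b := bt)); last by move=> x bx; rewrite /gg chi_hi// chi1_hi// !mulr0 addr0.
move=> gg0.
(* Integration by parts packed into one function: [T' = (G - m) * chi1 = om * (G - m) ^+ 2]. The
   weak form and the vanishing of [chi] make [T] zero at both ends, which forces [G = m] where
   [om > 0]. *)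
pose T x := (\int[leb]_(t in `[0%R, x]) gg t)%R - m * chi x - Qp x * chi x.
have dT (x : R) : al <= x <= bt -> der x T (om x * (G x - m) ^+ 2).
  move=> /andP[ax xb]; have x0 : 0 < x by exact: lt_le_trans ax.
  apply: der_eq.
    apply: derD; last by apply: derN; apply: derM; [exact: dQp|exact: dchi].
    apply: derD; first exact: (primitive_der_cont cgg x0).
    by apply: derN; apply: derM; [exact: derC|exact: dchi].
  by rewrite /gg /chi1 GtE// /G; ring.
have Tal : T al = 0.
  rewrite /T chi_lo// !mulr0 !subr0; apply: Rintegral_itv_eq0 => t /andP[_ ta].
  by rewrite /gg chi_lo// chi1_out ?mulr0 ?addr0//; left.
have Tbt : T bt = 0 by rewrite /T chi_bt !mulr0 !subr0.
have T1 x : al <= x <= bt -> 0 <= om x * (G x - m) ^+ 2.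
  by move=> _; rewrite mulr_ge0// sqr_ge0.
exists m => x axb; have := der_ge0_flat dT T1 (etrans Tal (esym Tbt)) axb.
move=> /eqP; rewrite mulf_eq0 gt_eqF ?om_in//= sqrf_eq0 subr_eq0 => /eqP//.
Unshelve. all: by end_near. Qed.

(** Regularity comes for free: near [s] the merely continuous flux equals a constant plus the
    primitive of a continuous function. *)
Lemma euler_lagrange (s : R) : 0 < s -> der s g (q s).
Proof.
move=> s0; have H : s / 2 < s < 2 * s by apply/andP; split; lra.
have [m Gm] := du_bois_reymond (divr_gt0 s0 (ltr0n _ 2)) H.
have : der s (fun x => m + Qp x) (q s).
  by apply: der_eq; [apply: derD; [exact: derC|exact: primitive_der_cont]|rewrite add0r].
apply: der_near; near=> x.
rewrite -(Gm x) /G ?subrK//; apply/andP; split; near: x; [apply: lt_nbhsr|apply: lt_nbhsl]; lra.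
Unshelve. all: by end_near. Qed.

Definition prof2 s := ((B ^+ 2 / 4 * s + vh s - lam) * F s / (4 * h ^+ 2) - prof1 phi s) / s.

Lemma der_prof1 (s : R) : 0 < s -> der s (prof1 phi) (prof2 s).
Proof.
move=> s0; have h0' := h0.
have E x : 0 < x -> prof1 phi x = (4 * h ^+ 2)^-1 * (g x * x^-1).
  move=> x0; have sx : 0 < Num.sqrt x by rewrite sqrtr_gt0.
  have -> : x^-1 = (Num.sqrt x ^+ 2)^-1 by rewrite sqr_sqrtr// ltW.
  by rewrite /prof1 /g; field; nz.
have : der s (fun x => (4 * h ^+ 2)^-1 * (g x * x^-1)) (prof2 s).
  apply: der_eq.
    apply: derM; first exact: derC.
    apply: derM; first exact: euler_lagrange.
    by apply: derV; [exact: derI|nz].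
  by rewrite /prof2 E// -/(q s) /q; field; nz.
apply: der_near; near=> x; rewrite E//; near: x; exact: lt_nbhsr.
Unshelve. all: by end_near. Qed.

Lemma prof_ode (s : R) : 0 < s -> 4 * h ^+ 2 * (s * prof2 s + prof1 phi s) =
  (s * (B ^+ 2 / 4) + vh s - lam) * F s.
Proof. by move=> s0; have h0' := h0; rewrite /prof2; field; nz. Qed.

Lemma prof1_0 : s * prof1 phi s @[s --> (0 : R)^'+] --> (0 : R).
Proof.
have : (fun s => 2^-1 * (Num.sqrt s * Kf s)) x @[x --> (0 : R)] --> 2^-1 * (Num.sqrt 0 * Kf 0).
  by apply: cvgMr; apply: cvgM; [exact: sqrt_continuous|exact: cK].
rewrite sqrtr0 mul0r mulr0 => /cvg_at_right_filter; apply: cvg_trans.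
apply: near_eq_cvg; near=> s.
have s0 : 0 < s by near: s; exact: nbhs_right_gt.
have sx : 0 < Num.sqrt s by rewrite sqrtr_gt0.
apply/esym; rewrite /prof1 -{1}(sqr_sqrtr (ltW s0)); field; nz.
Unshelve. all: by end_near. Qed.

Lemma IP_ge_itv f (X Y : R) : 0 <= X -> X < Y -> igP f -> (forall s, 0 < s -> 0 <= f s) ->
  (forall s, X < s <= Y -> 1 <= f s) -> Y - X <= IP f.
Proof.
move=> X0 XY fi f0 f1; have mP : measurable P by exact: measurable_itv.
rewrite -lee_fin -(IP_E fi).
have <- : (\int[leb]_(s in `]X, Y]) (1%:E) = (Y - X)%:E)%E.
  by rewrite integral_cst//= lebesgue_measure_itv/= lte_fin XY mul1e.
have sub : `]X, Y] `<=` P by move=> s /=; rewrite !in_itv/= andbT => /andP[Xs _]; exact: le_lt_trans Xs.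
apply: (@le_trans _ _ (\int[leb]_(s in `]X, Y]) (f s)%:E)%E).
  apply: ge0_le_integral => //.
  by have := measurable_int _ (integrableS mP (measurable_itv _) sub fi).
apply: ge0_subset_integral => //.
  by have := measurable_int _ fi.
by move=> s /=; rewrite in_itv/= andbT lee_fin; exact: f0.
Qed.

(* otherwise the integrable functions [s F^2] and [Kf^2 = 4 s F1^2] would be bounded below
   near infinity *)
Lemma prof_inf (X e : R) : 0 < e -> exists2 s, X < s & s * F s ^+ 2 <= e /\ s * prof1 phi s ^+ 2 <= e.
Proof.
move=> e0; have h0' := h0; have B0' := B0; apply: contrapT => H.
(* This [k] gives [k * mag >= (s * F ^+ 2 + Kf ^+ 2) / e], which is at least 1 beyond [X] if the
   claim fails. On an interval of length [IP M + 1] the integral of [M] would then exceed [IP M]. *)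
pose k := e^-1 * (4 / B ^+ 2 + 1 / h ^+ 2).
have k0 : 0 < k by rewrite /k; pp.
pose M s := k * mag F (fun s => Kf s ^+ 2) s.
have iM : igP M by apply: igPZ; exact: igP_mag_prof gs.
have M0 s : 0 < s -> 0 <= M s by move=> s0; rewrite /M /mag; nn.
pose X0 := Num.max X 0; pose Y := X0 + IP M + 1.
have IM0 : 0 <= IP M.
  by apply: Rintegral_ge0 => s /=; rewrite in_itv/= andbT; exact: M0.
have X00 : 0 <= X0 by rewrite le_max lexx orbT.
suff : Y - X0 <= IP M by rewrite /Y; lra.
apply: IP_ge_itv => //; first by rewrite /Y; lra.
move=> s /andP[Xs _]; have s0 : 0 < s by exact: le_lt_trans Xs.
have Xs' : X < s by apply: le_lt_trans Xs; rewrite le_max lexx.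
have sx : 0 < Num.sqrt s by rewrite sqrtr_gt0.
have E : s * prof1 phi s ^+ 2 = Kf s ^+ 2 / 4.
  by rewrite /prof1 -{1}(sqr_sqrtr (ltW s0)); field; nz.
have lo : e <= s * F s ^+ 2 + Kf s ^+ 2.
  have [H1|H1] := leP (s * F s ^+ 2) e; last by have := sqr_ge0 (Kf s); lra.
  have [H2|H2] := leP (s * prof1 phi s ^+ 2) e; first by exfalso; apply: H; exists s.
  have : 0 <= s * F s ^+ 2 by nn.
  by have := sqr_ge0 (Kf s); rewrite E in H2; lra.
have -> : M s = e^-1 * (s * F s ^+ 2 + Kf s ^+ 2) +
    e^-1 * (4 * h ^+ 2 / B ^+ 2 * Kf s ^+ 2 + B ^+ 2 / (4 * h ^+ 2) * s * F s ^+ 2).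
  by rewrite /M /k /mag; field; nz.
have : 0 <= e^-1 * (4 * h ^+ 2 / B ^+ 2 * Kf s ^+ 2 + B ^+ 2 / (4 * h ^+ 2) * s * F s ^+ 2) by nn.
have : 1 <= e^-1 * (s * F s ^+ 2 + Kf s ^+ 2) by rewrite mulrC ler_pdivlMr// mul1r.
lra.
Qed.

Definition mass s := (\int[leb]_(t in `[0%R, s]) (c * F t ^+ 2))%R.
Local Notation N := mass.

Let cF2 : continuous (fun t => c * F t ^+ 2).
Proof. by move=> x; apply: cvgMr; apply: cvg_sqr; exact: cF. Qed.

Lemma der_mass (s : R) : 0 < s -> der s N (c * F s ^+ 2).
Proof. exact: primitive_der_cont. Qed.

Let c0 : 0 < c. Proof. exact: radial_c_gt0. Qed.

Lemma mass_0 : N s @[s --> (0 : R)^'+] --> (0 : R).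
Proof.
have H : {within `[0, 1], continuous N}.
  by apply: parameterized_integral_continuous => //; exact: integrable_cont_itv.
have /(continuous_within_itvP _ ltr01) [_ H1 _] := H.
by move: H1; rewrite {2}/mass set_itv1 Rintegral_set1.
Qed.

Let igF : igP (fun t => c * F t ^+ 2). Proof. by apply: igPZ; exact: igP_prof_sqr gs. Qed.

Let IPF : IP (fun t => c * F t ^+ 2) = 1.
Proof. by rewrite (IPZ _ (igP_prof_sqr gs)) (IP_prof_sqr gs). Qed.

Let massE (s : R) : 0 < s -> N s = (\int[leb]_(t in `]0%R, s]) (c * F t ^+ 2))%R.
Proof.
move=> s0; rewrite /mass -Rintegral_itv_obnd_cbnd//.
apply: integrableS (integrable_cont_itv 0 s cF2) => //.
by move=> t /=; rewrite !in_itv/= => /andP[/ltW -> ->].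
Qed.

Lemma mass_le1 (s : R) : 0 < s -> N s <= 1.
Proof.
move=> s0; have mP : measurable P by exact: measurable_itv.
rewrite massE// -IPF /IP /Rintegral fine_le//.
- apply: integrable_fin_num => //; apply: integrableS (integrable_cont_itv 0 s cF2) => //.
  by move=> t /=; rewrite !in_itv/= => /andP[/ltW -> ->].
- exact: integrable_fin_num.
- apply: ge0_subset_integral => //; first by have := measurable_int _ igF.
  + by move=> t _; rewrite lee_fin mulr_ge0// ?sqr_ge0// ltW.
  + by move=> t /=; rewrite !in_itv/= andbT => /andP[].
Qed.

Lemma mass_inf (X eps : R) : 0 < eps -> exists2 s, X < s & 1 - eps <= N s.
Proof.
move=> e0; have mP : measurable P by exact: measurable_itv.
have fE t : t \in P -> 0 <= c * F t ^+ 2 by move=> _; rewrite mulr_ge0// ?sqr_ge0// ltW.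
pose J n := [set` Interval (BRight (0 : R)) (BRight (n%:R : R))] : set (measurableTypeR R).
have PU : P = \bigcup_n J n.
  apply/seteqP; split => x /=.
    rewrite in_itv/= andbT => x0; exists (Num.bound x) => //=.
    by rewrite /J/= in_itv/= x0/= ltW// archi_boundP// ltW.
  by move=> [n _]; rewrite /J /= !in_itv/= => /andP[->].
have fm : measurable_fun [set: measurableTypeR R] (fun t => (c * F t ^+ 2)%:E).
  by apply/measurable_EFinP; exact: continuous_measurable_fun.
have : (\int[leb]_(t in J n) (c * F t ^+ 2)%:E)%E @[n --> \oo] --> (1 : \bar R)%E.
  rewrite -[X in _ --> X](_ : (\int[leb]_(t in P) (c * F t ^+ 2)%:E = 1)%E); last first.
    by rewrite (IP_E igF) IPF.
  rewrite PU; apply: ge0_nondecreasing_set_cvg_integral.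
  - move=> n k nk; apply/subsetPset => x; rewrite /J/= !in_itv/= => /andP[-> xn] /=.
    by apply: le_trans xn _; rewrite ler_nat.
  - by move=> n; exact: measurable_itv.
  - by move=> n; exact: measurable_funTS.
  - by move=> n x _; rewrite lee_fin mulr_ge0// ?sqr_ge0// ltW.
move=> /fine_cvgP[_ /cvgrPdist_lt /(_ _ e0) [n0 _ Hn]].
pose n := maxn n0 (Num.bound `|X|).+1.
have nX : X < n%:R.
  apply: le_lt_trans (ler_norm X) _; apply: lt_le_trans (archi_boundP (normr_ge0 X)) _.
  by rewrite ler_nat /n leq_max leqnSn orbT.
have n0' : 0 < (n%:R : R) by rewrite ltr0n /n leq_max orbT.
exists n%:R => //.
have := Hn n (leq_maxl _ _); rewrite (massE n0') /Rintegral /J /=.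
by rewrite ltr_norml => /andP[]; lra.
Qed.

End EulerLagrange.

(** * The Gaussian trial function *)

Section GaussianMoments.
Context {R : realType}.
Notation leb := (@lebesgue_measure R).
Notation P := (`]0%R, +oo[%classic : set (measurableTypeR R)).

Lemma igP_antideriv (g G : R -> R) : continuous g -> (forall s, 0 <= s -> 0 <= g s) ->
  (forall s : R, der s G (g s)) -> G s @[s --> +oo] --> (0 : R) -> igP g /\ IP g = - G 0.
Proof.
move=> cg g0 dG G0.
have E : (\int[leb]_(s in P) (g s)%:E = (- G 0)%:E)%E.
  rewrite (_ : (\int[leb]_(s in P) (g s)%:E = \int[leb]_(s in `[0%R, +oo[) (g s)%:E)%E); last first.
    rewrite integral_itv_obnd_cbnd//; apply: measurable_funTS.
    by apply/measurable_EFinP; exact: continuous_measurable_fun.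
  rewrite (@ge0_continuous_FTC2y R g G 0 0)//.
  - by rewrite -EFinB sub0r.
  - exact: continuous_subspaceT.
  - by move=> x _; have [] := dG x.
  - by apply: cvg_at_right_filter; exact: (der_cvg (dG 0)).
  - by move=> x _; rewrite derive1E; have [_ ->] := dG x.
have ig : igP g.
  apply/integrableP; split.
    by apply/measurable_EFinP; apply: measurable_funTS; exact: continuous_measurable_fun.
  rewrite (_ : (\int[leb]_(x in P) `|(EFin \o g) x| = \int[leb]_(s in P) (g s)%:E)%E); last first.
    by apply: eq_integral => s; rewrite inE/= in_itv/= andbT => s0; rewrite ger0_norm// g0// ltW.
  by rewrite E ltry.
by split=> //; apply: EFin_inj; rewrite -(IP_E ig) E.
Qed.

Lemma cubic_expRN (k s : R) : 0 < k -> 0 < s -> expR (- (k * s)) <= (3 / (k * s)) ^+ 3.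
Proof.
move=> k0 s0; have ks : 0 < k * s / 3 by pp.
have -> : expR (- (k * s)) = expR (- (k * s / 3)) ^+ 3.
  by rewrite -expRM_natl; congr expR; field.
rewrite lerXn2r ?nnegrE ?expR_ge0//; first by rewrite divr_ge0 ?ltW// mulr_gt0.
by rewrite (le_trans (expRN_le_inv ks))// invf_div.
Qed.

Lemma quadratic_expRN_cvg (k c0 c1 c2 : R) : 0 < k ->
  - ((c0 + c1 * s + c2 * s ^+ 2) * expR (- (k * s))) @[s --> +oo] --> (0 : R).
Proof.
move=> k0; pose C := (`|c0| + `|c1| + `|c2|) * 27 / k ^+ 3.
have cvgC : C * s^-1 @[s --> +oo] --> (0 : R).
  rewrite -[X in _ --> X](mulr0 C); apply: cvgMr.
  apply/gtr0_cvgV0; last exact: cvg_id.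
  by near=> s; near: s; exact: nbhs_pinfty_gt.
apply/norm_cvg0P; apply: (squeeze_cvgr _ (cvg_cst 0) cvgC); near=> s.
have s1 : 1 <= s by near: s; exact: nbhs_pinfty_ge.
have s0 : 0 < s by lra.
rewrite normr_ge0/= normrN normrM (ger0_norm (expR_ge0 _)).
have H : `|c0 + c1 * s + c2 * s ^+ 2| <= (`|c0| + `|c1| + `|c2|) * s ^+ 2.
  apply: le_trans (ler_normD _ _) _; rewrite [leRHS]mulrDl; apply: lerD; last first.
    by rewrite normrM (ger0_norm (sqr_ge0 s)).
  apply: le_trans (ler_normD _ _) _; rewrite [leRHS]mulrDl; apply: lerD.
    by rewrite ler_peMr// expr_ge1// ltW.
  by rewrite normrM (gtr0_norm s0) ler_wpM2l// expr2 ler_peMl// ltW.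
apply: (@le_trans _ _ ((`|c0| + `|c1| + `|c2|) * s ^+ 2 * (3 / (k * s)) ^+ 3)).
  by apply: ler_pM => //; exact: cubic_expRN.
by rewrite le_eqVlt; apply/orP; left; apply/eqP; rewrite /C; field; nz.
Unshelve. all: by end_near. Qed.

Variable k : R.
Hypothesis k0 : 0 < k.
Let ek s := expR (- (k * s)).

(** The [ci] are the coefficients of an explicit primitive [- (c0 + c1 s + c2 s^2) exp(- k s)]; the
    three equations match its derivative with the integrand, and the integral is minus its value at
    0. *)
Lemma gauss_moment (c0 c1 c2 d0 d1 d2 : R) : 0 <= d0 -> 0 <= d1 -> 0 <= d2 ->
  k * c0 - c1 = d0 -> k * c1 - 2 * c2 = d1 -> k * c2 = d2 ->
  igP (fun s => (d0 + d1 * s + d2 * s ^+ 2) * ek s) /\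
  IP (fun s => (d0 + d1 * s + d2 * s ^+ 2) * ek s) = c0.
Proof.
move=> d00 d10 d20 E0 E1 E2.
have dG s : der s (fun s => - ((c0 + c1 * s + c2 * s ^+ 2) * ek s))
    ((d0 + d1 * s + d2 * s ^+ 2) * ek s).
  by rewrite -E0 -E1 -E2 /ek; der_tac fail; ring.
have cg : continuous (fun s => (d0 + d1 * s + d2 * s ^+ 2) * ek s).
  have dg s : der s (fun s => (d0 + d1 * s + d2 * s ^+ 2) * ek s)
     ((d1 + 2 * d2 * s) * ek s - k * (d0 + d1 * s + d2 * s ^+ 2) * ek s).
    by rewrite /ek; der_tac fail; ring.
  by move=> s; exact: (der_cvg (dg s)).
have := igP_antideriv cg _ dG (quadratic_expRN_cvg c0 c1 c2 k0).
case.
  by move=> s s0; rewrite mulr_ge0 ?expR_ge0//; nn.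
move=> H1 ->; split=> //.
by rewrite mulr0 expr0n /ek !mulr0 !addr0 oppr0 expR0 mulr1 opprK.
Qed.

End GaussianMoments.

Section GaussianTrial.
Context {R : realType}.
Variables (v : R * R -> R) (B h b : R) (vh : R -> R) (phi : R * R -> R).
Hypotheses (B0 : 0 < B) (h0 : 0 < h) (cvh : continuous vh).
Hypothesis vE : forall z, v z = vh (nrm2 z).
Hypothesis vh_bound : forall s, - b <= vh s <= 0.
Hypothesis gs : radial_real_ground_state v B h phi.
Variables (kap K0 w : R).
Hypotheses (w0 : 0 < w) (w2 : w ^+ 2 = kap + B ^+ 2 / 4) (K00 : 0 <= K0).
Hypothesis vh_le : forall s, 0 < s -> vh s + b <= kap * s + K0 * s ^+ 2.

(** The trial function [exp(- w s / (2 h))] is the ground state of the harmonic approximation, where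
    [w ^+ 2] adds the well's curvature and the magnetic confinement. Its energy is [2 * w * h - b],
    and the quartic Taylor remainder costs [2 * K0 * h ^+ 2 / w ^+ 2]. *)
Lemma gs_lam_le : gs_lam B h vh phi + b <= 2 * w * h + 2 * K0 * h ^+ 2 / w ^+ 2.
Proof.
have h0' := h0; have w0' := w0.
pose k := w / h; have k0 : 0 < k by rewrite /k; pp.
pose H s := expR (- (k * s / 2)).
pose ek s := expR (- (k * s)).
have H2 s : H s ^+ 2 = ek s by rewrite /H /ek -expRM_natl; congr expR; field.
pose H1 s := - (k / 2) * H s.
have dH (s : R) : der s H (H1 s) by rewrite /H1 /H; der_tac fail; field.
have cH : continuous H by move=> s; exact: (der_cvg (dH s)).
have cH1 : continuous H1 by move=> s; apply: cvgMr; exact: cH.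
have HC := radial_C1_der dH cH1.
have [i0 I0] : igP (fun s => H s ^+ 2) /\ IP (fun s => H s ^+ 2) = k^-1.
  have -> : (fun s => H s ^+ 2) = fun s => (1 + 0 * s + 0 * s ^+ 2) * ek s.
    by apply/funext => s; rewrite H2; ring.
  by apply: (@gauss_moment _ _ k0 k^-1 0 0) => //; field; nz.
pose m1 := w ^+ 2 + B ^+ 2 / 4.
have [im Im] : igP (mag B h H (fun s => 4 * s * H1 s ^+ 2)) /\
    IP (mag B h H (fun s => 4 * s * H1 s ^+ 2)) = m1 / k ^+ 2.
  have -> : mag B h H (fun s => 4 * s * H1 s ^+ 2) = fun s => (0 + m1 * s + 0 * s ^+ 2) * ek s.
    apply/funext => s; rewrite /mag /H1 exprMn H2 /m1 /k; field; nz.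
  have m10 : 0 <= m1 by rewrite /m1; have B0' := B0; nn.
  by apply: (@gauss_moment _ _ k0 (m1 / k ^+ 2) (m1 / k) 0) => //; field; nz.
have kap_lo : 0 <= w ^+ 2 + B ^+ 2 / 4 by have B0' := B0; nn.
have := rayleigh cvh vE vh_bound gs HC im i0.
rewrite Im I0.
have iv := igP_vH cvh vh_bound HC i0.
(* The majorant [kap * s + K0 * s ^+ 2] of [vh + b] is split with [kap = w ^+ 2 - B ^+ 2 / 4], so
   that each of the two moments has nonnegative coefficients, as [gauss_moment] asks. *)
have [i3 I3] : igP (fun s => (0 + w ^+ 2 * s + K0 * s ^+ 2) * ek s) /\
    IP (fun s => (0 + w ^+ 2 * s + K0 * s ^+ 2) * ek s) = (w ^+ 2 + 2 * K0 / k) / k ^+ 2.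
  apply: (@gauss_moment _ _ k0 _ ((w ^+ 2 + 2 * K0 / k) / k) (K0 / k)) => //; try (field; nz).
  by nn.
have [i4 I4] : igP (fun s => (0 + B ^+ 2 / 4 * s + 0 * s ^+ 2) * ek s) /\
    IP (fun s => (0 + B ^+ 2 / 4 * s + 0 * s ^+ 2) * ek s) = (B ^+ 2 / 4) / k ^+ 2.
  apply: (@gauss_moment _ _ k0 _ ((B ^+ 2 / 4) / k) 0) => //; first [by field; nz | by have B0' := B0; nn].
have : IP (fun s => vh s * H s ^+ 2) <= IP (fun s => ((0 + w ^+ 2 * s + K0 * s ^+ 2) * ek s + -1 * ((0 + B ^+ 2 / 4 * s + 0 * s ^+ 2) * ek s)) + - b * H s ^+ 2).
  apply: le_IP => //; first exact: (igPD (igPD i3 (igPZ (-1) i4)) (igPZ (- b) i0)).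
  move=> s s0; rewrite H2.
  have -> : ((0 + w ^+ 2 * s + K0 * s ^+ 2) * ek s + -1 * ((0 + B ^+ 2 / 4 * s + 0 * s ^+ 2) * ek s)) + - b * ek s = (kap * s + K0 * s ^+ 2 - b) * ek s.
    by rewrite w2; ring.
  by rewrite ler_wpM2r ?expR_ge0//; have := vh_le s0; lra.
rewrite (IPD (igPD i3 (igPZ _ i4)) (igPZ _ i0)) (IPD i3 (igPZ _ i4)) (IPZ _ i4) (IPZ _ i0) I3 I4 I0.
move=> J1 J2.
have : gs_lam B h vh phi / k <= m1 / k ^+ 2 + ((w ^+ 2 + 2 * K0 / k) / k ^+ 2 + -1 * ((B ^+ 2 / 4) / k ^+ 2) + - b * k^-1) by lra.
rewrite ler_pdivrMr// => J3.
have E : (m1 / k ^+ 2 + ((w ^+ 2 + 2 * K0 / k) / k ^+ 2 + -1 * ((B ^+ 2 / 4) / k ^+ 2) + - b * k^-1)) * k = 2 * w * h + 2 * K0 * h ^+ 2 / w ^+ 2 - b.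
  by rewrite /m1 /k; field; nz.
rewrite E in J3; lra.
Qed.

End GaussianTrial.

(** * The potential as a function of the squared radius *)

Section EvenTaylor.
Context {R : realType}.
Variables (a : R) (g : nat -> R -> R).
Hypotheses (a_pos : 0 < a) (dg : forall n (x : R), der x (g n) (g n.+1 x)).
Hypotheses (g1_0 : g 1 0 = 0) (g3_0 : g 3 0 = 0) (g_out : forall x, a < x -> g 4 x = 0).

(** The fourth derivative is bounded on the half-line, by compactness and since it vanishes beyond
    [a]. Integrating this bound repeatedly from 0, where the odd derivatives vanish, gives each
    line. *)
Lemma even_taylor : exists2 M, 0 <= M & forall r, 0 <= r ->
  [/\ `|g 2 r - g 2 0| <= M * r ^+ 2 / 2, `|g 1 r - g 2 0 * r| <= M * r ^+ 3 / 6 &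
    `|g 0 r - g 0 0 - g 2 0 * r ^+ 2 / 2| <= M * r ^+ 4 / 24].
Proof.
have [M M0 HM] : exists2 M, 0 <= M & forall x, 0 <= x -> `|g 4 x| <= M.
  have cg : continuous (g 4) by move=> x; exact: (der_cvg (dg 4 x)).
  have cn : {within `[0, a + 1], continuous (fun x => `|g 4 x|)}.
    by apply: continuous_subspaceT => x; apply: continuous_comp; [exact: cg|exact: norm_continuous].
  have a1 : 0 <= a + 1 by have := a_pos; lra.
  have [c _ Hc] := EVT_max a1 cn.
  exists `|g 4 c|; first exact: normr_ge0.
  move=> x x0; have [xa|xa] := leP x (a + 1).
    by apply: Hc; rewrite in_itv/= x0 xa.
  by rewrite g_out ?normr0//; lra.
pose k2 := g 2 0.
have b3 r : 0 <= r -> `|g 3 r| <= M * r.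
  move=> r0; have := @der_bound _ (g 3) (fun r => M * r) (g 4) (fun=> M) 0 r r0.
  rewrite g3_0 subr0 mulr0 subr0; apply=> x /andP[x0 _]; [exact: dg| |exact: HM].
  by der_tac fail; ring.
have b2 r : 0 <= r -> `|g 2 r - k2| <= M * r ^+ 2 / 2.
  move=> r0; have := @der_bound _ (g 2) (fun r => M * r ^+ 2 / 2) (g 3) (fun r => M * r) 0 r r0.
  rewrite expr0n mulr0 mul0r subr0; apply=> x /andP[x0 _]; [exact: dg| |exact: b3].
  by der_tac fail; field.
have b1 r : 0 <= r -> `|g 1 r - k2 * r| <= M * r ^+ 3 / 6.
  move=> r0; have := @der_bound _ (fun r => g 1 r - k2 * r) (fun r => M * r ^+ 3 / 6)
    (fun r => g 2 r - k2) (fun r => M * r ^+ 2 / 2) 0 r r0.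
  rewrite g1_0 expr0n !mulr0 mul0r !subr0; apply=> x /andP[x0 _]; [|by der_tac fail; field|exact: b2].
  apply: der_eq; first by apply: derD; [exact: dg|apply: derN; apply: derM; [exact: derC|exact: derI]].
  by rewrite /=; ring.
have b0 r : 0 <= r -> `|g 0 r - g 0 0 - k2 * r ^+ 2 / 2| <= M * r ^+ 4 / 24.
  move=> r0; have := @der_bound _ (fun r => g 0 r - g 0 0 - k2 * r ^+ 2 / 2) (fun r => M * r ^+ 4 / 24)
    (fun r => g 1 r - k2 * r) (fun r => M * r ^+ 3 / 6) 0 r r0.
  rewrite !expr0n !(mulr0, mul0r, subr0) subrr subr0; apply=> x /andP[x0 _]; [|by der_tac fail; field|exact: b1].
  apply: der_eq.
    apply: derD; first by apply: derD; [exact: dg|exact: derC].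
    by apply: derN; apply: derM; [apply: derM; [exact: derC|apply: derX; exact: derI]|exact: derC].
  by rewrite /=; field.
exists M; first exact: M0.
by move=> r r0; split; [exact: b2|exact: b1|exact: b0].
Qed.

End EvenTaylor.

Section RadialPotential.
Context {R : realType}.
Variables (v : R * R -> R) (vp : R -> R) (a : R).
Hypothesis v_smooth : smooth2 v.
Hypothesis v_nonpos : forall z, v z <= 0.
Hypothesis v_radial : forall z, v z = vp (eucl_rad z).
Hypothesis v_min : forall z, z != (0, 0) -> v (0, 0) < v z.
Hypothesis v0_neg : v (0, 0) < 0.
Hypothesis v_nondeg : 0 < dx (dx v) (0, 0).
Hypotheses (a_pos : 0 < a) (a_supp : forall z, a < eucl_rad z -> v z = 0).

Let g n (x : R) := iter n (@dx R) v (x, 0).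

Let Ck_iter n m : Ck m (iter n (@dx R) v).
Proof.
elim: n m => [|n IH] m; first exact: v_smooth.
by have /= [_ []] := IH m.+1.
Qed.

Let dg n (x : R) : der x (g n) (g n.+1 x).
Proof. by have /= [df _] := Ck_iter n 1; exact: (der_dx (df (x, 0))). Qed.

Let g0E x : g 0 x = vp `|x|.
Proof. by rewrite /g/= v_radial /eucl_rad/= expr0n addr0 sqrtr_sqr. Qed.

(** Radiality makes [x |-> v (x, 0)] even, and parity alternates under differentiation; this is what
    annihilates the odd derivatives at 0. *)
Let parity n x : g n (- x) = (-1) ^+ n * g n x.
Proof.
elim: n x => [|n IH] x; first by rewrite !g0E normrN mul1r.
have H1 : der x (fun x => g n (- x)) (- g n.+1 (- x)).
  by apply: der_eq; [apply: der_comp (dg n (- x)) _; apply: derN; exact: derI|rewrite mulrN1].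
have H2 : der x (fun x => g n (- x)) ((-1) ^+ n * g n.+1 x).
  have /funext -> := IH; apply: der_eq; first by apply: derM; [exact: derC|exact: dg].
  by rewrite mulr0 addr0.
by rewrite exprS -mulrA -(der_uniq H1 H2); ring.
Qed.

Let g1_0 : g 1 0 = 0. Proof. by have := parity 1 0; rewrite oppr0 expr1; lra. Qed.
Let g3_0 : g 3 0 = 0. Proof. by have := parity 3 0; rewrite oppr0 !exprS expr0; lra. Qed.

Let g_out n x : a < x -> g n x = 0.
Proof.
elim: n x => [|n IH] x ax; first by rewrite /g/= a_supp// eucl_rad_axis// ltW// (lt_trans a_pos).
apply: (der_uniq (dg n x)); apply: der_near (derC 0 x).
by near=> y; rewrite IH//; near: y; exact: lt_nbhsr.
Unshelve. all: by end_near. Qed.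

Definition pot_h (s : R) := v (Num.sqrt s, 0).
Definition pot_b := - v (0, 0).
Definition pot_U s := pot_h s + pot_b.
Definition pot_U1 s := dx v (Num.sqrt s, 0) / (2 * Num.sqrt s).
Definition pot_U2 s := (dx (dx v) (Num.sqrt s, 0) - dx v (Num.sqrt s, 0) / Num.sqrt s) / (4 * s).
Definition pot_kap := dx (dx v) (0, 0) / 2.

Lemma pot_b_gt0 : 0 < pot_b. Proof. by rewrite oppr_gt0. Qed.

Lemma pot_kap_ge0 : 0 <= pot_kap. Proof. by rewrite divr_ge0// ltW. Qed.

Lemma pot_hE z : v z = pot_h (nrm2 z).
Proof. by rewrite /pot_h [RHS]v_radial eucl_rad_axis ?sqrtr_ge0// v_radial. Qed.

Lemma pot_h_continuous : continuous pot_h.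
Proof.
move=> s; apply: (@continuous_comp _ _ _ Num.sqrt (g 0)); first exact: sqrt_continuous.
exact: (der_cvg (dg 0 _)).
Qed.

Lemma pot_h_sqr (x : R) : pot_h (x ^+ 2) = v (x, 0).
Proof. by rewrite [RHS]pot_hE /nrm2/= expr0n addr0. Qed.

Lemma pot_h_bound s : - pot_b <= pot_h s <= 0.
Proof.
rewrite opprK v_nonpos andbT /pot_h.
have [->//|s0] := eqVneq (Num.sqrt s) 0; apply: ltW; apply: v_min.
by apply: contra s0 => /eqP[->].
Qed.

Lemma pot_h_out s : a ^+ 2 < s -> pot_h s = 0.
Proof.
move=> as1; apply: (g_out 0); have s0 : 0 <= s by apply: le_trans (ltW as1); exact: sqr_ge0.
by rewrite -(ger0_norm (ltW a_pos)) -sqrtr_sqr ltr_sqrt// (le_lt_trans (sqr_ge0 a)).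
Qed.

Lemma pot_dU s : 0 < s -> der s pot_U (pot_U1 s).
Proof.
move=> s0; apply: der_eq.
  apply: derD; last exact: derC.
  apply: (@der_comp _ Num.sqrt (g 0)); first exact: dg.
  by apply: der_sqrt; [exact: derI|].
by rewrite addr0 mul1r.
Qed.

Lemma pot_dU1 s : 0 < s -> der s pot_U1 (pot_U2 s).
Proof.
move=> s0; have sx : 0 < Num.sqrt s by rewrite sqrtr_gt0.
have ds : der s Num.sqrt (1 / (2 * Num.sqrt s)) by apply: der_sqrt; [exact: derI|].
apply: der_eq.
  apply: derM; first by apply: (@der_comp _ Num.sqrt (g 1)); [exact: dg|exact: ds].
  apply: derV; first by apply: derM; [exact: derC|exact: ds].
  by nz.
have -> : pot_U2 s = (dx (dx v) (Num.sqrt s, 0) - dx v (Num.sqrt s, 0) / Num.sqrt s) / (4 * Num.sqrt s ^+ 2).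
  by rewrite sqr_sqrtr// ltW.
by rewrite /g /=; field; nz.
Qed.

Lemma pot_U_ge0 s : 0 < s -> 0 <= pot_U s.
Proof. by move=> _; have := pot_h_bound s; rewrite /pot_U; lra. Qed.

Lemma pot_U_out s : a ^+ 2 < s -> pot_U s = pot_b /\ pot_U1 s = 0.
Proof.
move=> as1; split; first by rewrite /pot_U pot_h_out// add0r.
rewrite /pot_U1 (_ : dx v _ = 0) ?mul0r//; apply: (g_out 1).
have s0 : 0 <= s by apply: le_trans (ltW as1); exact: sqr_ge0.
by rewrite -(ger0_norm (ltW a_pos)) -sqrtr_sqr ltr_sqrt// (le_lt_trans (sqr_ge0 a)).
Qed.

(* Taylor's formula at the origin for the even function [x |-> v (x, 0)] *)
Lemma pot_U_taylor : exists2 K0, 0 <= K0 & forall s, 0 < s ->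
  [/\ `|pot_U2 s| <= K0, `|pot_U1 s - pot_kap| <= K0 * s & `|pot_U s - pot_kap * s| <= K0 * s ^+ 2].
Proof.
have [M M0 HM] := even_taylor a_pos dg g1_0 g3_0 (@g_out 4).
exists M; first exact: M0.
move=> s s0; pose r := Num.sqrt s.
have r0 : 0 < r by rewrite sqrtr_gt0.
have sE : s = r ^+ 2 by rewrite sqr_sqrtr// ltW.
have := HM r (ltW r0).
rewrite /pot_U /pot_U1 /pot_U2 /pot_h /pot_kap /pot_b -/r -[dx v (r, 0)]/(g 1 r) -[dx (dx v) (r, 0)]/(g 2 r)
  -[dx (dx v) (0, 0)]/(g 2 0) -[v (r, 0)]/(g 0 r) -[v (0, 0)]/(g 0 0) sE.
move: (g 2 r) (g 1 r) (g 0 r) (g 2 0) (g 0 0) => y2 y1 y0 k2 c0 [B2 B1 B0].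
split.
- have -> : (y2 - y1 / r) / (4 * r ^+ 2) = ((y2 - k2) - (y1 - k2 * r) / r) / (4 * r ^+ 2).
    by field; nz.
  rewrite normrM normfV (ger0_norm (_ : 0 <= 4 * r ^+ 2)); last by nn.
  rewrite ler_pdivrMr; last by pp.
  apply: le_trans (ler_normB _ _) _; rewrite normrM normfV (gtr0_norm r0).
  have : `|y1 - k2 * r| / r <= M * r ^+ 2 / 6.
    by rewrite ler_pdivrMr//; apply: (le_trans B1); rewrite le_eqVlt; apply/orP; left; apply/eqP; ring.
  have : 0 <= M * r ^+ 2 by nn.
  move=> H1 H2; have -> : M * (4 * r ^+ 2) = 4 * (M * r ^+ 2) by ring.
  lra.
- have -> : y1 / (2 * r) - k2 / 2 = (y1 - k2 * r) / (2 * r) by field; nz.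
  rewrite normrM normfV (ger0_norm (_ : 0 <= 2 * r)); last by nn.
  rewrite ler_pdivrMr; last by pp.
  apply: (le_trans B1); have : 0 <= M * r ^+ 3 by nn.
  have -> : M * r ^+ 2 * (2 * r) = 2 * (M * r ^+ 3) by ring.
  lra.
- have -> : y0 + - c0 - k2 / 2 * r ^+ 2 = y0 - c0 - k2 * r ^+ 2 / 2 by field.
  apply: (le_trans B0); have : 0 <= M * r ^+ 4 by nn.
  have -> : M * r ^+ 2 ^+ 2 = M * r ^+ 4 by ring.
  lra.
Qed.

End RadialPotential.

(** * The angular average of the translated ground state *)

Section AngularShift.
Context {R : realType}.
Notation leb := (@lebesgue_measure R).

(** The integral over a window of length [2 * pi] does not depend on the window, its derivative
    being zero by periodicity. Shifts are positive because the primitive used starts at 0. *)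
Lemma angint_shift (p : R -> R) (al : R) : continuous p -> (forall x, p (x + 2 * pi) = p x) ->
  0 < al -> angint (fun t => p (t + al)) = angint p.
Proof.
move=> cp pp al0; have pi0 : 0 < 2 * pi :> R by rewrite mulr_gt0// pi_gt0.
pose P x := (\int[leb]_(t in `[0%R, x]) p t)%R.
have dP (x : R) : 0 < x -> der x P (p x) by exact: primitive_der_cont.
have dPs (x c : R) : 0 < x + c -> der x (fun t => P (t + c)) (p (x + c)).
  move=> xc; apply: der_eq; last exact: mulr1.
  apply: (@der_comp _ (fun t => t + c)); first exact: dP.
  by apply: der_eq; [apply: derD; [exact: derI|exact: derC]|rewrite addr0].
have cps c : continuous (fun t => p (t + c)).
  move=> t; apply: (@continuous_comp _ _ _ (fun t => t + c) p); last exact: cp.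
  by apply: cvgD; [exact: cvg_id|exact: cvg_cst].
have E c : 0 < c -> angint (fun t => p (t + c)) = P (2 * pi + c) - P (0 + c).
  move=> c0; apply: (angint_der (f := fun t => P (t + c))); first exact: cps.
  by move=> t /andP[t0 _]; apply: dPs; exact: ltr_wpDl.
pose e x := P (x + 2 * pi) - P x.
have de (x : R) : 0 < x -> der x e 0.
  move=> x0; apply: der_eq; first by apply: derD; [apply: dPs; exact: addr_gt0|apply: derN; exact: dP].
  by rewrite pp subrr.
have ecst x y : 0 < x -> x <= y -> e x = e y.
  move=> x0 xy; apply/eqP; rewrite eq_sym -subr_eq0 -normr_le0.
  have := @der_bound _ e (fun=> 0) (fun=> 0) (fun=> 0) x y xy.
  rewrite subrr; apply => z /andP[xz _]; [apply: de; exact: lt_le_trans xz|exact: derC|by rewrite normr0].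
have eE c : 0 < c -> angint (fun t => p (t + c)) = e c by move=> c0; rewrite E// add0r /e (addrC c).
have -> : angint p = e (2 * pi) by rewrite -eE//; apply: eq_angint => t; rewrite pp.
rewrite eE//; have [H|/ltW H] := leP al (2 * pi); first exact: ecst.
by apply/esym; exact: ecst.
Qed.

(** The arc cosine, with the sign of [z.2], gives an angle; multiples of [2 * pi] are added to make
    it positive, as the shift lemma requires. *)
Lemma polar_angle (z : R * R) : exists2 al, 0 < al &
  z = (Num.sqrt (nrm2 z) * cos al, Num.sqrt (nrm2 z) * sin al).
Proof.
have pi0 : 0 < 2 * pi :> R by rewrite mulr_gt0// pi_gt0.
suff [al E] : exists al, z = (Num.sqrt (nrm2 z) * cos al, Num.sqrt (nrm2 z) * sin al).
  have per x : cos (x + 2 * pi) = cos x /\ sin (x + 2 * pi) = sin x :> R.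
    by rewrite mulr_natl; split; [exact: cosD2pi|exact: sinD2pi].
  have perN n : z = (Num.sqrt (nrm2 z) * cos (al + 2 * pi *+ n), Num.sqrt (nrm2 z) * sin (al + 2 * pi *+ n)).
    elim: n => [|n IH]; first by rewrite mulr0n addr0.
    by rewrite mulrSr addrA; have [-> ->] := per (al + 2 * pi *+ n).
  exists (al + 2 * pi *+ (Num.bound (`|al| / (2 * pi)))) => //.
  have := archi_boundP (divr_ge0 (normr_ge0 al) (ltW pi0)).
  rewrite ltr_pdivrMr// mulr_natl => H; have := ler_norm (- al); rewrite normrN; lra.
have [z0|z0] := eqVneq (nrm2 z) 0.
  by exists 0; rewrite z0 sqrtr0 !mul0r; exact: nrm2_eq0.
have r0 : 0 < Num.sqrt (nrm2 z) by rewrite sqrtr_gt0 lt_def z0 nrm2_ge0.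
set r := Num.sqrt (nrm2 z) in r0 *.
have r2 : r ^+ 2 = z.1 ^+ 2 + z.2 ^+ 2 by rewrite sqr_sqrtr// nrm2_ge0.
have x1 : -1 <= z.1 / r <= 1.
  rewrite -ler_norml normrM normfV (gtr0_norm r0) ler_pdivrMr// mul1r.
  rewrite -(ler_pXn2r (_ : 0 < 2)%N) ?nnegrE ?(ltW r0)// real_normK ?num_real// r2 lerDl.
  exact: sqr_ge0.
have sE : sin (acos (z.1 / r)) = `|z.2| / r.
  rewrite sin_acos//.
  have -> : 1 - (z.1 / r) ^+ 2 = (`|z.2| / r) ^+ 2.
    rewrite !exprMn real_normK ?num_real//.
    have -> : z.2 ^+ 2 = r ^+ 2 - z.1 ^+ 2 by rewrite r2; ring.
    by field; nz.
  by rewrite sqrtr_sqr ger0_norm// divr_ge0// ltW.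
have cE : cos (acos (z.1 / r)) = z.1 / r by rewrite acosK.
have [y0|y0] := leP 0 z.2.
  exists (acos (z.1 / r)); rewrite cE sE ger0_norm//.
  by rewrite ![r * _]mulrC !divfK ?gt_eqF//; case: (z).
exists (- acos (z.1 / r)); rewrite cosN sinN cE sE ltr0_norm//.
by rewrite mulrN mulNr mulrN opprK ![r * _]mulrC !divfK ?gt_eqF//; case: (z).
Qed.

End AngularShift.

Section AngularEquation.
Context {R : realType}.
Notation leb := (@lebesgue_measure R).
Variables (B L h a2 bet : R) (F F1 F2 : R -> R).
Hypotheses (B0 : 0 < B) (L0 : 0 < L) (h0 : 0 < h) (a20 : 0 < a2) (aL : a2 < L ^+ 2).
Hypothesis cF : continuous F.
Hypothesis dF : forall s : R, 0 < s -> der s F (F1 s).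
Hypothesis dF1 : forall s : R, 0 < s -> der s F1 (F2 s).
Hypothesis cF2 : forall s : R, 0 < s -> {for s, continuous F2}.
Hypothesis ode : forall s : R, a2 < s ->
  4 * h ^+ 2 * (s * F2 s + F1 s) = (s * (B ^+ 2 / 4) + bet) * F s.

Let be := B * L / h.
(** The squared distance from the point with polar coordinates [(x, t)] to the centre [(2 * L, 0)]
    of the other well, the first well being at the origin; [ka] is its derivative in [x]. *)
Let tau (x t : R) := x ^+ 2 - 4 * L * x * cos t + 4 * L ^+ 2.
Let C (x t : R) := cos (be * x * sin t).
Let S (x t : R) := sin (be * x * sin t).
Let ka (x t : R) := 2 * x - 4 * L * cos t.
(** The real part of [exp(i B L y / h)] times the ground state translated by [2 * L]. This phase is
    that of a magnetic translation, so the complex function solves the magnetic equation with the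
    translated potential; averaging over the angle removes the angular momentum term and leaves a
    radial equation. *)
Definition ang_f (x t : R) := F (x ^+ 2 - 4 * L * x * cos t + 4 * L ^+ 2) * cos (B * L / h * x * sin t).
Let f1 x t := F1 (tau x t) * ka x t * C x t - F (tau x t) * S x t * (be * sin t).
Let f2 x t := F2 (tau x t) * (ka x t) ^+ 2 * C x t + 2 * F1 (tau x t) * C x t
  - 2 * F1 (tau x t) * ka x t * S x t * (be * sin t) - F (tau x t) * C x t * (be * sin t) ^+ 2.
Definition ang_j x := angint (ang_f x).
Definition ang_j1 x := angint (f1 x).
Definition ang_j2 x := angint (f2 x).
Let v := 3 * L / 2.

Let tau_ge x t : (2 * L - `|x|) ^+ 2 <= tau x t.
Proof.
have L0' := L0; rewrite -subr_ge0.
have -> : tau x t - (2 * L - `|x|) ^+ 2 = 4 * L * (`|x| - x * cos t).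
  by rewrite /tau sqrrB real_normK ?num_real//; ring.
rewrite mulr_ge0//; first by nn.
rewrite subr_ge0 (le_trans (ler_norm _))// normrM ler_piMr//.
by rewrite ler_norml cos_geN1 cos_le1.
Qed.

Let tau_itv x t : - v < x < v -> L ^+ 2 / 4 <= tau x t <= 13 * L ^+ 2.
Proof.
rewrite -ltr_norml /v => xv; have L0' := L0; have x0 := normr_ge0 x.
apply/andP; split; first by apply: le_trans (tau_ge x t); nra.
have : x * cos t >= - `|x|.
  rewrite lerNl -mulrN (le_trans (ler_norm _))// normrM ler_piMr// normrN.
  by rewrite ler_norml cos_geN1 cos_le1.
have : x ^+ 2 <= (3 * L / 2) ^+ 2.
  by rewrite -(real_normK (num_real x)); apply: lerXn2r; rewrite ?nnegrE//; lra.
move=> H1 H2; have : 4 * L * (x * cos t) >= 4 * L * - `|x| by rewrite ler_pM2l//; pp.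
rewrite /tau; move: H1; move: (x * cos t) => y H1 H3; nra.
Qed.

Let tau_gt0 x t : - v < x < v -> 0 < tau x t.
Proof. by move=> /tau_itv - /(_ t) /andP[H _]; apply: lt_le_trans H; have L0' := L0; pp. Qed.

Let dtau_x (x t : R) : der x (tau^~ t) (ka x t).
Proof. by rewrite /tau /ka; der_tac fail; ring. Qed.
Let dtau_t (x t : R) : der t (tau x) (4 * L * x * sin t).
Proof. by rewrite /tau; der_tac fail; ring. Qed.
Let dC_x (x t : R) : der x (C^~ t) (- S x t * (be * sin t)).
Proof. by rewrite /C /S; der_tac fail; ring. Qed.
Let dS_x (x t : R) : der x (S^~ t) (C x t * (be * sin t)).
Proof. by rewrite /C /S; der_tac fail; ring. Qed.
Let dC_t (x t : R) : der t (C x) (- S x t * (be * x * cos t)).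
Proof. by rewrite /C /S; der_tac fail; ring. Qed.
Let dS_t (x t : R) : der t (S x) (C x t * (be * x * cos t)).
Proof. by rewrite /C /S; der_tac fail; ring. Qed.

Let df (x t : R) : - v < x < v -> der x (ang_f^~ t) (f1 x t).
Proof.
move=> xv; apply: der_eq.
  apply: derM; last exact: dC_x.
  by apply: (@der_comp _ (tau^~ t)); [apply: dF; exact: tau_gt0|exact: dtau_x].
by rewrite /f1 -/(tau x t) -/be -/(C x t); ring.
Qed.

Let dka (x t : R) : der x (ka^~ t) 2.
Proof. by rewrite /ka; der_tac fail; ring. Qed.

Let df1 (x t : R) : - v < x < v -> der x (f1^~ t) (f2 x t).
Proof.
move=> xv; have t0 := tau_gt0 t xv; apply: der_eq.
  apply: derD.
    apply: derM; last exact: dC_x.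
    by apply: derM; [apply: (@der_comp _ (tau^~ t)); [exact: dF1|exact: dtau_x]|exact: dka].
  apply: derN; apply: derM; last exact: derC.
  by apply: derM; [apply: (@der_comp _ (tau^~ t)); [exact: dF|exact: dtau_x]|exact: dS_x].
by rewrite /f2; ring.
Qed.

Let dFt (x t : R) : - v < x < v -> der t (fun t => F (tau x t)) (F1 (tau x t) * (4 * L * x * sin t)).
Proof. by move=> xv; apply: der_comp (dtau_t x t); apply: dF; exact: tau_gt0. Qed.
Let dF1t (x t : R) : - v < x < v -> der t (fun t => F1 (tau x t)) (F2 (tau x t) * (4 * L * x * sin t)).
Proof. by move=> xv; apply: der_comp (dtau_t x t); apply: dF1; exact: tau_gt0. Qed.

Let cc x : continuous (C x). Proof. by move=> t; exact: (der_cvg (dC_t x t)). Qed.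
Let cS x : continuous (S x). Proof. by move=> t; exact: (der_cvg (dS_t x t)). Qed.
Let cs : continuous (fun t => be * sin t).
Proof.
move=> t; have H : der t (fun t => be * sin t) (be * cos t) by der_tac fail; ring.
exact: (der_cvg H).
Qed.
Let cka x : continuous (ka x).
Proof.
move=> t; have H : der t (ka x) (4 * L * sin t) by rewrite /ka; der_tac fail; ring.
exact: (der_cvg H).
Qed.
Let ctau x : continuous (tau x). Proof. by move=> t; exact: (der_cvg (dtau_t x t)). Qed.

Lemma ang_f_continuous x : continuous (ang_f x).
Proof.
move=> t; apply: cvgM; last exact: cc.
by apply: (@continuous_comp _ _ _ (tau x) F); [exact: ctau|exact: cF].
Qed.

Let cFx x : - v < x < v -> [/\ continuous (fun t => F (tau x t)), continuous (fun t => F1 (tau x t)) &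
  continuous (fun t => F2 (tau x t))].
Proof.
move=> xv; split=> t; first exact: (der_cvg (dFt t xv)).
  exact: (der_cvg (dF1t t xv)).
by apply: (@continuous_comp _ _ _ (tau x) F2); [exact: ctau|apply: cF2; exact: tau_gt0].
Qed.

Let cf1 x : - v < x < v -> continuous (f1 x).
Proof.
move=> /cFx[c1 c2 _] t; apply: cvgB; apply: cvgM; try exact: cs.
- by apply: cvgM; [exact: c2|exact: cka].
- exact: cc.
- by apply: cvgM; [exact: c1|exact: cS].
Qed.

Let c2M (f : R -> R) k : continuous f -> continuous (fun t => k * f t).
Proof. by move=> cf t; apply: cvgMr; exact: cf. Qed.

Let cf2 x : - v < x < v -> continuous (f2 x).
Proof.
move=> /cFx[c1 c2 c3] t; apply: cvgB; first apply: cvgB; first apply: cvgD.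
- by apply: cvgM; [apply: cvgM; [exact: c3|apply: cvg_sqr; exact: cka]|exact: cc].
- by apply: cvgM; [apply: c2M; exact: c2|exact: cc].
- apply: cvgM; last exact: cs.
  by apply: cvgM; [apply: cvgM; [apply: c2M; exact: c2|exact: cka]|exact: cS].
- by apply: cvgM; [apply: cvgM; [exact: c1|exact: cc]|apply: cvg_sqr; exact: cs].
Qed.

Let bounded_itv (f : R -> R) : (forall s : R, 0 < s -> {for s, continuous f}) ->
  exists2 M, 0 <= M & forall s, L ^+ 2 / 4 <= s <= 13 * L ^+ 2 -> `|f s| <= M.
Proof.
move=> cf; have L0' := L0; have L20 : 0 < L ^+ 2 by pp.
have cn : {within `[L ^+ 2 / 4, 13 * L ^+ 2], continuous (fun x => `|f x|)}.
  apply: continuous_in_subspaceT => x; rewrite inE/= in_itv/= => /andP[x1 _].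
  apply: continuous_comp; last exact: norm_continuous.
  by apply: cf; apply: lt_le_trans x1; pp.
have le : L ^+ 2 / 4 <= 13 * L ^+ 2 by lra.
have [c _ Hc] := EVT_max le cn.
by exists `|f c| => // s sI; apply: Hc; rewrite in_itv.
Qed.

Let nM (x y X Y : R) : `|x| <= X -> `|y| <= Y -> `|x * y| <= X * Y.
Proof. by move=> ? ?; rewrite normrM ler_pM. Qed.
Let nD (x y X Y : R) : `|x| <= X -> `|y| <= Y -> `|x + y| <= X + Y.
Proof. by move=> ? ?; apply: le_trans (ler_normD _ _) _; exact: lerD. Qed.
Let nB (x y X Y : R) : `|x| <= X -> `|y| <= Y -> `|x - y| <= X + Y.
Proof. by move=> ? ?; apply: le_trans (ler_normB _ _) _; exact: lerD. Qed.
Let n2 (x X : R) : `|x| <= X -> `|x ^+ 2| <= X ^+ 2.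
Proof. by move=> ?; rewrite normrX lerXn2r// nnegrE// (le_trans (normr_ge0 x)). Qed.

Let bounds : exists K, forall x t, - v < x < v -> `|f1 x t| <= K /\ `|f2 x t| <= K.
Proof.
have L0' := L0.
have [M0 M00 HM0] := bounded_itv (fun s _ => @cF s).
have [M1 M10 HM1] := bounded_itv (fun s s0 => der_cvg (dF1 s0)).
have [M2 M20 HM2] := bounded_itv cF2.
pose K1 := M1 * (7 * L) * 1 + M0 * 1 * (`|be| * 1).
pose K2 := M2 * (7 * L) ^+ 2 * 1 + 2 * M1 * 1 + 2 * M1 * (7 * L) * 1 * (`|be| * 1) + M0 * 1 * (`|be| * 1) ^+ 2.
exists (Num.max K1 K2) => x t xv; have tI := tau_itv t xv.
have nC : `|C x t| <= 1 by rewrite ler_norml cos_geN1 cos_le1.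
have nS : `|S x t| <= 1 by rewrite ler_norml sin_geN1 sin_le1.
have ns : `|be * sin t| <= `|be| * 1.
  by rewrite normrM ler_wpM2l// ler_norml sin_geN1 sin_le1.
have nk : `|ka x t| <= 7 * L.
  have -> : 7 * L = 3 * L + 4 * L * 1 by ring.
  apply: nB.
    by move: xv; rewrite -ltr_norml /v normrM ger0_norm// => H; lra.
  by apply: nM; [rewrite ger0_norm//; nn|rewrite ler_norml cos_geN1 cos_le1].
have m0 := HM0 _ tI; have m1 := HM1 _ tI; have m2 := HM2 _ tI.
have mm1 : `|2 * F1 (tau x t)| <= 2 * M1 by apply: nM => //; rewrite ger0_norm.
rewrite !le_max; split; apply/orP; [left|right].
  by rewrite /f1 /K1; apply: nB; do 2 (apply: nM => //).
rewrite /f2 /K2; apply: nB; first apply: nB; first apply: nD.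
- by apply: nM => //; apply: nM => //; exact: n2.
- by apply: nM.
- by do 3 (apply: nM => //).
- by apply: nM => //; [exact: nM|exact: n2].
Qed.

Lemma ang_dj (x : R) : - v < x < v -> der x ang_j (ang_j1 x).
Proof.
move=> xv; have [K HK] := bounds.
apply: (der_angint (K := K) xv) => [y t yv|y yv|y t yv]; [exact: df|exact: ang_f_continuous|].
by have [] := HK y t yv.
Qed.

Lemma ang_dj1 (x : R) : - v < x < v -> der x ang_j1 (ang_j2 x).
Proof.
move=> xv; have [K HK] := bounds.
apply: (der_angint (K := K) xv) => [y t yv|y yv|y t yv]; [exact: df1|exact: cf1|].
by have [] := HK y t yv.
Qed.

Lemma ang_j_0 : ang_j 0 = 2 * pi * F (4 * L ^+ 2).
Proof.
rewrite /ang_j (@eq_angint _ _ (fun=> F (4 * L ^+ 2))); first by rewrite angint_cst mulrC.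
by move=> t; rewrite /ang_f expr0n !mulr0 !mul0r subr0 add0r cos0 mulr1.
Qed.

(* The equation for the angular average: applying the free radial operator to the integrand
   gives the [t]-derivative of [Th], which is periodic. *)
Lemma ang_ode r : 0 < r <= L -> h ^+ 2 * (r * ang_j2 r + ang_j1 r) = r * (B ^+ 2 * r ^+ 2 / 4 + bet) * ang_j r.
Proof.
move=> /andP[r0 rL]; have L0' := L0; have h0' := h0.
have rv : - v < r < v by apply/andP; rewrite /v; split; lra.
pose Th t := - (h * B) * r * (F (tau r t) * S r t) - h ^+ 2 * (4 * L * (sin t * (F1 (tau r t) * C r t)) -
  be * (cos t * (F (tau r t) * S r t))).
pose q2 := r * (B ^+ 2 * r ^+ 2 / 4 + bet).
have dTh (t : R) : der t Th ((h ^+ 2 * r * f2 r t + h ^+ 2 * f1 r t) + - q2 * ang_f r t).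
  apply: der_eq.
    apply: derD.
      by apply: derM; [exact: derC|apply: derM; [exact: dFt|exact: dS_t]].
    apply: derN; apply: derM; first exact: derC.
    apply: derD.
      apply: derM; first exact: derC.
      apply: derM; first by apply: der_sin; exact: derI.
      by apply: derM; [exact: dF1t|exact: dC_t].
    apply: derN; apply: derM; first exact: derC.
    apply: derM; first by apply: der_cos; exact: derI.
    by apply: derM; [exact: dFt|exact: dS_t].
  (* On circles of radius at most [L] the distance to the other centre is at least [L], hence
     outside its well; this is where the separation [a < L] enters. *)
  have a2t : a2 < tau r t.
    apply: (lt_le_trans aL); apply: le_trans (tau_ge r t); rewrite (gtr0_norm r0).
    by rewrite lerXn2r ?nnegrE//; [exact: ltW|lra|lra].
  have X0 : 4 * h ^+ 2 * (tau r t * F2 (tau r t) + F1 (tau r t)) - (tau r t * (B ^+ 2 / 4) + bet) * F (tau r t) = 0.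
    by rewrite ode// subrr.
  have Y0 : sin t ^+ 2 + cos t ^+ 2 - 1 = 0 by rewrite [sin t ^+ 2 + _]addrC cos2Dsin2 subrr.
  apply/eqP; rewrite eq_sym -subr_eq0; apply/eqP.
  (* The identity is a combination of the radial equation at [tau] and of [sin ^ 2 + cos ^ 2 = 1];
     the coefficient of the latter collects the terms in [F2] and in [F] coming from both
     variables. *)
  transitivity (r * C r t * (4 * h ^+ 2 * (tau r t * F2 (tau r t) + F1 (tau r t)) - (tau r t * (B ^+ 2 / 4) + bet) * F (tau r t))
    + (16 * L ^+ 2 * h ^+ 2 * r * C r t * F2 (tau r t) - h ^+ 2 * be ^+ 2 * r * F (tau r t) * C r t) * (sin t ^+ 2 + cos t ^+ 2 - 1)); last first.
    by rewrite X0 Y0 !mulr0 addr0.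
  rewrite /f2 /f1 /ang_f -/be -/(tau r t) -/(C r t) /ka /q2.
  move: (F2 (tau r t)) (F1 (tau r t)) (F (tau r t)) (C r t) (S r t) => y2 y1 y0 cc0 ss0.
  by rewrite /tau /be; move: (sin t) (cos t) => s0 c0; field; nz.
have [c1 c2 c3] := And3 (cf2 rv) (cf1 rv) (ang_f_continuous (x := r)).
have cA : continuous (fun t => h ^+ 2 * r * f2 r t + h ^+ 2 * f1 r t).
  by move=> t; apply: cvgD; apply: c2M.
have cB : continuous (fun t => - q2 * ang_f r t) by exact: c2M.
have := @angint_der _ Th (fun t => (h ^+ 2 * r * f2 r t + h ^+ 2 * f1 r t) + - q2 * ang_f r t) _ (fun t _ => dTh t).
rewrite angintD// angintD//; [|exact: c2M|exact: c2M].
rewrite !angintZ// -/(ang_j2 r) -/(ang_j1 r) -/(ang_j r).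
have s2pi : sin (2 * pi) = 0 :> R by rewrite mulr_natl sin2pi.
have -> : Th (2 * pi) - Th 0 = 0.
  by rewrite /Th /S s2pi sin0 !mulr0 sin0 !(mulr0, mul0r) subrr.
move=> /(_ (fun t => cvgD (cA t) (cB t))) E; rewrite /q2 in E.
have -> : h ^+ 2 * (r * ang_j2 r + ang_j1 r) = (h ^+ 2 * r * ang_j2 r + h ^+ 2 * ang_j1 r + - (r * (B ^+ 2 * r ^+ 2 / 4 + bet)) * ang_j r)
  + r * (B ^+ 2 * r ^+ 2 / 4 + bet) * ang_j r by ring.
by rewrite E add0r.
Qed.

End AngularEquation.

(** * Reduction of the hopping coefficient to boundary values *)

Section Fubini3.
Context {d1 d2 d3 : measure_display} {T1 : measurableType d1} {T2 : measurableType d2}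
  {T3 : measurableType d3} {R : realType}.
Variables (m1 : {sigma_finite_measure set T1 -> \bar R})
  (m2 : {sigma_finite_measure set T2 -> \bar R}) (m3 : {sigma_finite_measure set T3 -> \bar R}).

Lemma sigma_finite_prod : sigma_finite setT (m1 \x m2)%E.
Proof.
have /sigma_finiteP[A [TA ndA Aoo]] := sigma_finiteT m1.
have /sigma_finiteP[D [TD ndD Doo]] := sigma_finiteT m2.
exists (fun n => A n `*` D n) => [|n].
  apply/seteqP; split=> // -[x y] _.
  have [i _ Ai] : (\bigcup_n A n) x by rewrite -TA.
  have [k _ Dk] : (\bigcup_n D n) y by rewrite -TD.
  exists (maxn i k) => //; split; [move: Ai|move: Dk].
    by apply/subsetPset/ndA; exact: leq_maxl.
  by apply/subsetPset/ndD; exact: leq_maxr.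
have [mA fA] := Aoo n; have [mD fD] := Doo n.
by split; [exact: measurableX|rewrite product_measure1E// lte_mul_pinfty// ge0_fin_numE].
Qed.

(** Integrability is checked on a dominating kernel [g], whose iterated integral is easier to
    compute than that of the rotated integrand [f]. *)
Lemma Fubini3 (f g : (T1 * T2) * T3 -> \bar R) : measurable_fun setT f -> measurable_fun setT g ->
  (forall z, `|f z| <= `|g z|)%E -> (\int[(m1 \x m2)%E]_z \int[m3]_t `|g (z, t)| < +oo)%E ->
  (\int[(m1 \x m2)%E]_z \int[m3]_t f (z, t) = \int[m3]_t \int[(m1 \x m2)%E]_z f (z, t))%E.
Proof.
move=> mf mg fg H.
pose m : {sigma_finite_measure set (T1 * T2)%type -> \bar R} :=
  HB.pack (product_measure1 m1 m2) (Measure_isSigmaFinite.Build _ _ _ (product_measure1 m1 m2) sigma_finite_prod).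
have ig : (m \x m3)%E.-integrable setT g by apply: (integrable12ltyP m m3 mg).2; exact: H.
have i : (m \x m3)%E.-integrable setT f by apply: (le_integrable _ mf _ ig).
exact: (Fubini i).
Qed.

End Fubini3.

Section RotationAverage.
Context {R : realType}.
Notation leb := (@lebesgue_measure R).
Notation RR := (measurableTypeR R).
Notation m2 := (leb \x leb)%E.
Variables (B L h a2 : R) (a F : R -> R).
Hypotheses (L0 : 0 < L) (a20 : 0 < a2).
Hypotheses (ca : continuous a) (cF : continuous F) (a_out : forall s, a2 < s -> a s = 0).

Let be := B * L / h.
(** The hopping integrand with the first well moved to the origin. The kernel [k] is [cos] for the
    real and [sin] for the imaginary part, so that measurability and integrability are proved
    once. *)
Definition osc (k : R -> R) (z : RR * RR) :=
  a (nrm2 z) * (F (nrm2 ((z.1 - 2 * L, z.2) : RR * RR)) * k (B * L / h * z.2)).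

Let bound_F : exists2 M, 0 <= M & forall s, 0 <= s <= 2 * a2 + 8 * L ^+ 2 -> `|F s| <= M.
Proof.
have L0' := L0; have le : 0 <= 2 * a2 + 8 * L ^+ 2 by have a20' := a20; nn.
have cn : {within `[0, 2 * a2 + 8 * L ^+ 2], continuous (fun x => `|F x|)}.
  apply: continuous_subspaceT => x; apply: continuous_comp; [exact: cF|exact: norm_continuous].
have [c _ Hc] := EVT_max le cn.
by exists `|F c| => // s sI; apply: Hc; rewrite in_itv.
Qed.

Section Kernel.
Variable k : R -> R.
Hypotheses (ck : continuous k) (k1 : forall x, `|k x| <= 1).

Lemma measurable_osc : measurable_fun setT (osc k).
Proof.
apply: measurable_funM.
  exact: (measurableT_comp (continuous_measurable_fun ca) measurable_nrm2).
have [ms _] := @scales_shear1 R 0 (- (2 * L)).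
apply: measurable_funM.
  rewrite (_ : (fun z : RR * RR => F (nrm2 ((z.1 - 2 * L, z.2) : RR * RR))) =
     (F \o nrm2) \o (fun z : RR * RR => (z.1 + 0 * z.2 + - (2 * L), z.2) : RR * RR)); last first.
    by apply/funext => z /=; rewrite mul0r addr0.
  apply: measurableT_comp ms.
  exact: (measurableT_comp (continuous_measurable_fun cF) measurable_nrm2).
rewrite (_ : (fun z : RR * RR => k (B * L / h * z.2)) = (fun y : RR => k (B * L / h * y)) \o snd) //.
apply: measurableT_comp => //; apply: continuous_measurable_fun => y.
apply: (@continuous_comp _ _ _ (fun y => B * L / h * y) k); last exact: ck.
by apply: cvgMr; exact: cvg_id.
Qed.

Lemma osc_le : exists2 M, 0 <= M & forall z, `|osc k z| <= M * `|a (nrm2 z)|.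
Proof.
have [M M0 HM] := bound_F; exists M => // z; rewrite /osc normrM mulrC.
have [za|za] := leP (nrm2 z) a2; last by rewrite a_out// normr0 !mulr0.
rewrite ler_wpM2r// normrM -[leRHS]mulr1 ler_pM// HM// nrm2_ge0/=.
move: za; rewrite /nrm2 /= => za.
have : (z.1 - 2 * L) ^+ 2 <= 2 * z.1 ^+ 2 + 8 * L ^+ 2.
  rewrite -subr_ge0; have -> : 2 * z.1 ^+ 2 + 8 * L ^+ 2 - (z.1 - 2 * L) ^+ 2 = (z.1 + 2 * L) ^+ 2 by ring.
  exact: sqr_ge0.
by have := sqr_ge0 z.2; lra.
Qed.

Lemma osc_integrable : m2.-integrable setT (EFin \o osc k).
Proof.
have [M M0 HM] := osc_le.
have cMa : continuous (fun s => M * `|a s|).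
  move=> s; apply: cvgMr; apply: continuous_comp; [exact: ca|exact: norm_continuous].
have iMa : igP (fun s => M * `|a s|).
  by apply: (igP_compact cMa (b := a2)) => s /a_out ->; rewrite normr0 mulr0.
have := radial_integrable (continuous_measurable_fun cMa) iMa.
apply: le_integrable => //; first by apply/measurable_EFinP; exact: measurable_osc.
move=> z _ /=; rewrite lee_fin (le_trans (HM z))//; exact: ler_norm.
Qed.

End Kernel.

(** The integrand is odd under the reflection of [y], which preserves the measure and both radial
    factors. *)
Lemma osc_sin : (\int[m2]_z osc sin z = 0)%R.
Proof.
have i : m2.-integrable setT (EFin \o osc sin).
  apply: osc_integrable; first exact: continuous_sin.
  by move=> x; rewrite ler_norml sin_geN1 sin_le1.
have := scales_Rintegral scales_flip2 i.
rewrite (_ : (fun z => osc sin (z.1, - z.2)) = fun z => -1 * osc sin z); last first.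
  by apply/funext => z; rewrite /osc /nrm2/= sqrrN mulrN sinN !mulrN mulN1r.
by rewrite RintegralZl//; lra.
Qed.

Let D := (`[0%R, 2 * pi]%classic : set RR).

Let mD : measurable D. Proof. exact: measurable_itv. Qed.

Let ind_int (g : R -> R) : continuous g -> (\int[leb]_t (g t * \1_D t)%:E = (angint g)%:E)%E.
Proof.
move=> cg; rewrite /angint /Rintegral fineK; last first.
  by apply: integrable_fin_num => //; exact: angint_integrable.
rewrite [RHS]integral_mkcond; apply: eq_integral => t _.
by rewrite patchE indicE; case: ifPn => tD; rewrite ?tD ?(negbTE tD) ?mulr1 ?mulr0.
Qed.

Lemma osc_polar z al t : z = (Num.sqrt (nrm2 z) * cos al, Num.sqrt (nrm2 z) * sin al) ->
  osc cos (rotv (cos t) (sin t) z) = a (nrm2 z) * ang_f B L h F (Num.sqrt (nrm2 z)) (t + al).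
Proof.
set r := Num.sqrt (nrm2 z) => zE.
have cs1 := cos2Dsin2 t; have z2 : nrm2 (rotv (cos t) (sin t) z) = nrm2 z.
  rewrite /nrm2 /rotv/=; transitivity ((cos t ^+ 2 + sin t ^+ 2) * (z.1 ^+ 2 + z.2 ^+ 2)); first by ring.
  by rewrite cs1 mul1r.
have rE : rotv (cos t) (sin t) z = (r * cos (t + al), r * sin (t + al)).
  by rewrite zE /rotv /= cosD sinD; congr (_, _); ring.
rewrite /osc z2 rE /ang_f /nrm2/=; congr (_ * (F _ * cos _)); last by ring.
have -> : (r * cos (t + al) - 2 * L) ^+ 2 + (r * sin (t + al)) ^+ 2 =
  r ^+ 2 * (cos (t + al) ^+ 2 + sin (t + al) ^+ 2) - 4 * L * r * cos (t + al) + 4 * L ^+ 2 by ring.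
by rewrite cos2Dsin2 mulr1.
Qed.

Definition osc_avg s := a s * ang_j B L h F (Num.sqrt s).

Let cosc z : continuous (fun t => osc cos (rotv (cos t) (sin t) z)) /\
  angint (fun t => osc cos (rotv (cos t) (sin t) z)) = osc_avg (nrm2 z).
Proof.
have [al al0 zE] := polar_angle z.
have E : (fun t => osc cos (rotv (cos t) (sin t) z)) =
   fun t => a (nrm2 z) * ang_f B L h F (Num.sqrt (nrm2 z)) (t + al).
  by apply/funext => t; exact: osc_polar.
have cA := @ang_f_continuous R B L h F cF (Num.sqrt (nrm2 z)).
have cAs : continuous (fun t => ang_f B L h F (Num.sqrt (nrm2 z)) (t + al)).
  move=> t; apply: (@continuous_comp _ _ _ (fun t => t + al)); last exact: cA.
  by apply: cvgD; [exact: cvg_id|exact: cvg_cst].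
rewrite E; split; first by move=> t; apply: cvgMr; exact: cAs.
rewrite angintZ// (angint_shift cA _ al0)// => t.
by rewrite /ang_f (mulr_natl pi 2) cosD2pi sinD2pi.
Qed.

(** Every rotation preserves area, so the left-hand side is the integral over the angle of a
    constant. After Fubini the inner integral runs over a full circle through [z], on which the
    polar angle of [z] is only a shift of a periodic function. *)
Lemma rotation_average : 2 * pi * (\int[m2]_z osc cos z)%R = (\int[m2]_z osc_avg (nrm2 z))%R.
Proof.
have i : m2.-integrable setT (EFin \o osc cos).
  apply: osc_integrable; first exact: continuous_cos.
  by move=> x; rewrite ler_norml cos_geN1 cos_le1.
have cos1 (x : R) : `|cos x| <= 1 by rewrite ler_norml cos_geN1 cos_le1.
have [M M0 HM] := osc_le cos1.
pose f (z : (RR * RR) * RR) := (osc cos (rotv (cos z.2) (sin z.2) z.1) * \1_D z.2)%:E.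
pose g (z : (RR * RR) * RR) := (M * `|a (nrm2 z.1)| * \1_D z.2)%:E.
have m1D : measurable_fun setT (fun z : (RR * RR) * RR => \1_D z.2 : R).
  have mi : measurable_fun [set: RR] (\1_D : RR -> R) by exact: measurable_indic.
  exact: (measurableT_comp mi).
have mcos : measurable_fun [set: RR] (cos : RR -> RR) by apply: continuous_measurable_fun; exact: continuous_cos.
have msin : measurable_fun [set: RR] (sin : RR -> RR) by apply: continuous_measurable_fun; exact: continuous_sin.
have mrot : measurable_fun setT (fun z : (RR * RR) * RR => rotv (cos z.2) (sin z.2) z.1).
  have mc : measurable_fun setT (fun z : (RR * RR) * RR => cos z.2 : RR) by exact: (measurableT_comp mcos).
  have ms : measurable_fun setT (fun z : (RR * RR) * RR => sin z.2 : RR) by exact: (measurableT_comp msin).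
  have m11 : measurable_fun setT (fun z : (RR * RR) * RR => z.1.1 : RR) by exact: (measurableT_comp (f := fst)).
  have m12 : measurable_fun setT (fun z : (RR * RR) * RR => z.1.2 : RR) by exact: (measurableT_comp (f := snd)).
  apply: measurable_fun_pair.
    by apply: measurable_funB; apply: measurable_funM.
  by apply: measurable_funD; apply: measurable_funM.
have mf : measurable_fun setT f.
  apply/measurable_EFinP; apply: measurable_funM => //.
  by apply: measurableT_comp mrot; apply: measurable_osc; exact: continuous_cos.
have cMa : continuous (fun s => M * `|a s|).
  move=> s; apply: cvgMr; apply: continuous_comp; [exact: ca|exact: norm_continuous].
have mg : measurable_fun setT g.
  apply/measurable_EFinP; apply: measurable_funM => //.
  apply: (measurableT_comp (f := fun z : RR * RR => M * `|a (nrm2 z)|)) => //.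
  exact: (measurableT_comp (continuous_measurable_fun cMa) measurable_nrm2).
have iMa : igP (fun s => M * `|a s|).
  by apply: (igP_compact cMa (b := a2)) => s /a_out ->; rewrite normr0 mulr0.
have irad := radial_integrable (continuous_measurable_fun cMa) iMa.
have fg z : (`|f z| <= `|g z|)%E.
  have E : nrm2 (rotv (cos z.2) (sin z.2) z.1) = nrm2 z.1.
    rewrite /nrm2 /rotv/=.
    transitivity ((cos z.2 ^+ 2 + sin z.2 ^+ 2) * (z.1.1 ^+ 2 + z.1.2 ^+ 2)); first by ring.
    by rewrite cos2Dsin2 mul1r.
  rewrite /f /g !abse_EFin lee_fin; have := HM (rotv (cos z.2) (sin z.2) z.1); rewrite E.
  move: (osc cos _) => o Ho; rewrite (normrM o) (normrM (M * _)) (ger0_norm (_ : 0 <= M * _)).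
    exact: ler_wpM2r.
  exact: mulr_ge0.
have fin : (\int[m2]_z \int[leb]_t `|g (z, t)| < +oo)%E.
  rewrite (_ : (\int[m2]_z _)%E = (\int[m2]_z `|((2 * pi) * (M * `|a (nrm2 z)|))%:E|)%E).
    by have /integrableP[_] := integrableZl measurableT (2 * pi) irad.
  apply: eq_integral => z _.
  rewrite -[RHS]/((`|(2 * pi) * (M * `|a (nrm2 z)|)|)%:E) ger0_norm; last first.
    by rewrite mulr_ge0 ?mulr_ge0// ltW// pi_gt0.
  rewrite [in RHS]mulrC -angint_cst -ind_int; last by move=> t; exact: cvg_cst.
  apply: eq_integral => t _; rewrite /g /= ger0_norm//.
  by rewrite mulr_ge0 ?mulr_ge0// indicE.
have := Fubini3 (m1 := leb) (m2 := leb) (m3 := leb) mf mg fg fin.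
rewrite (_ : (\int[m2]_z \int[leb]_t f (z, t))%E = (\int[m2]_z (osc_avg (nrm2 z))%:E)%E); last first.
  by apply: eq_integral => z _; have [cz <-] := cosc z; rewrite -ind_int.
rewrite (_ : (\int[leb]_t \int[m2]_z f (z, t))%E = (2 * pi * (\int[m2]_z osc cos z)%R)%:E); last first.
  rewrite mulrC -angint_cst -ind_int; last by move=> t; exact: cvg_cst.
  apply: eq_integral => t _.
  have sr : scales_m2 1 (rotv (cos t) (sin t)) by apply: scales_rot; exact: cos2Dsin2.
  have ir := scales_integrable sr i.
  rewrite -(scales_Rintegral sr i) mulrC EFinM /Rintegral fineK; last exact: integrable_fin_num.
  rewrite -integralZl//; apply: eq_integral => z _; rewrite /f /= mulrC EFinM//.
by move=> E; rewrite [RHS]/Rintegral E.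
Qed.

End RotationAverage.

(** * The Wronskian identity for the hopping integral *)

Section Hopping.
Context {R : realType}.
Notation leb := (@lebesgue_measure R).
Variables (v : R * R -> R) (B L h a2 bet : R) (vh : R -> R) (phi : R * R -> R) (F F1 F2 : R -> R).
Hypotheses (B0 : 0 < B) (L0 : 0 < L) (h0 : 0 < h) (a20 : 0 < a2) (aL : a2 < L ^+ 2).
Hypotheses (cvh : continuous vh) (vE : forall z, v z = vh (nrm2 z)).
Hypotheses (vh_out : forall s, a2 < s -> vh s = 0) (phiE : forall z, phi z = F (nrm2 z)).
Hypothesis cF : continuous F.
Hypothesis dF : forall s : R, 0 < s -> der s F (F1 s).
Hypothesis dF1 : forall s : R, 0 < s -> der s F1 (F2 s).
Hypothesis cF2 : forall s : R, 0 < s -> {for s, continuous F2}.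
Hypothesis sF1_0 : s * F1 s @[s --> 0^'+] --> (0 : R).
Hypothesis odeF : forall s : R, 0 < s ->
  4 * h ^+ 2 * (s * F2 s + F1 s) = (s * (B ^+ 2 / 4) + vh s + bet) * F s.

Let a s := vh s * F s.
Let a_out s : a2 < s -> a s = 0. Proof. by move=> /vh_out as0; rewrite /a as0 mul0r. Qed.
Let ca : continuous a.
Proof. by move=> s; apply: cvgM; [exact: cvh|exact: cF]. Qed.

(** The two gauge phases differ by [sigma_r - sigma_l = - B L y], independent of [x]; hence the
    phase survives the horizontal shift that centres the first well. *)
Let shift_re z : osc B L h a F cos (z.1 + 0 * z.2 + L, z.2) =
  v (z.1 + L, z.2) * phi (z.1 + L, z.2) * phi (z.1 - L, z.2) * cos ((sigma_r B L z - sigma_l B L z) / h).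
Proof.
rewrite /osc vE !phiE /a /= mul0r addr0 -!mulrA; congr (_ * (_ * (F (nrm2 (_, _)) * _))); first by ring.
by rewrite -[LHS]cosN; congr cos; rewrite /sigma_r /sigma_l; field; have h0' := h0; nz.
Qed.

Let shift_im z : - osc B L h a F sin (z.1 + 0 * z.2 + L, z.2) =
  v (z.1 + L, z.2) * phi (z.1 + L, z.2) * phi (z.1 - L, z.2) * sin ((sigma_r B L z - sigma_l B L z) / h).
Proof.
rewrite /osc vE !phiE /a /= mul0r addr0 -!mulrA -!mulrN; congr (_ * (_ * (F (nrm2 (_, _)) * _))); first by ring.
by rewrite -[LHS]sinN; congr sin; rewrite /sigma_r /sigma_l; field; have h0' := h0; nz.
Qed.

Lemma hop_imE : hop_im v B L h phi = 0.
Proof.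
have i : (leb \x leb)%E.-integrable setT (EFin \o osc B L h a F sin).
  apply: (osc_integrable B h L0 a20 ca cF a_out); first exact: continuous_sin.
  by move=> x; rewrite ler_norml sin_geN1 sin_le1.
have sr := @scales_shear1 R 0 L.
rewrite /hop_im; under eq_Rintegral do rewrite -shift_im -mulN1r.
rewrite RintegralZl//; last exact: (scales_integrable sr i).
by rewrite (scales_Rintegral sr i) (osc_sin B h L0 a20 ca cF a_out) mulr0.
Qed.

Let odeJ (s : R) : a2 < s -> 4 * h ^+ 2 * (s * F2 s + F1 s) = (s * (B ^+ 2 / 4) + bet) * F s.
Proof. by move=> as0; rewrite odeF ?(lt_trans a20)// vh_out// addr0. Qed.

Local Notation j := (ang_j B L h F).
Local Notation j1 := (ang_j1 B L h F F1).
Local Notation j2 := (ang_j2 B L h F F1 F2).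
Let v3 := 3 * L / 2.
Let dj (x : R) : - v3 < x < v3 -> der x j (j1 x).
Proof. exact: (@ang_dj R B L h F F1 F2). Qed.
Let dj1 (x : R) : - v3 < x < v3 -> der x j1 (j2 x).
Proof. exact: (@ang_dj1 R B L h F F1 F2). Qed.

Let sqrt_itv (s : R) : 0 < s <= L ^+ 2 -> 0 < Num.sqrt s <= L.
Proof.
move=> /andP[s0 sL]; rewrite sqrtr_gt0 s0/= -(ger0_norm (ltW L0)) -sqrtr_sqr ler_sqrt//.
exact: sqr_ge0.
Qed.

Let itv_v3 (r : R) : 0 <= r <= L -> - v3 < r < v3.
Proof. by move=> /andP[r0 rL]; have L0' := L0; apply/andP; rewrite /v3; split; lra. Qed.

Let aj := osc_avg B L h a F.

Let caj : continuous aj.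
Proof.
(* Differentiability of [j] is known only for radii below [3 * L / 2]. Truncating the radius at [L]
   does not change the product, since [a] vanishes there. *)
have -> : aj = fun s => a s * j (Num.min (Num.sqrt s) L).
  apply/funext => s; rewrite /aj /osc_avg; have [sL|sL] := leP (Num.sqrt s) L; first by [].
  suff -> : a s = 0 by rewrite !mul0r.
  apply: a_out; apply: (lt_trans aL); rewrite -(sqr_sqrtr (_ : 0 <= s)); last first.
    by rewrite leNgt; apply/negP => s0; move: sL; rewrite ler0_sqrtr ?ltW// ltNge (ltW L0).
  by rewrite ltr_pXn2r ?nnegrE// ?sqrtr_ge0// ltW.
move=> s; apply: cvgM; first exact: ca.
apply: (@continuous_comp _ _ _ (fun s => Num.min (Num.sqrt s) L) j).
  by apply: (@continuous_min _ _ Num.sqrt (fun=> L)); [exact: sqrt_continuous|exact: cvg_cst].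
apply: (der_cvg (dj _)); apply: itv_v3; rewrite ge_min lexx orbT andbT le_min sqrtr_ge0.
exact: ltW.
Qed.

Let J s := j (Num.sqrt s).
Let J1 s := j1 (Num.sqrt s) / (2 * Num.sqrt s).
(** The Wronskian of [F] and [J] for the operator [4 h^2 (s f')']. The potential [vh] occurs in the
    equation of [F] but not in that of [J], so the derivative of [M] is [vh * F * J]. *)
Let M s := 4 * h ^+ 2 * (s * F1 s * J s - s * (F s * J1 s)).

Let dM (s : R) : 0 < s <= L ^+ 2 -> der s M (aj s).
Proof.
move=> sI; have /andP[s0 _] := sI; have rI := sqrt_itv sI; have /andP[r0 rL] := rI.
have rv : - v3 < Num.sqrt s < v3 by apply: itv_v3; rewrite ltW.
have ds : der s Num.sqrt (1 / (2 * Num.sqrt s)) by apply: der_sqrt; [exact: derI|].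
have h0' := h0.
apply: der_eq.
  apply: derM; first exact: derC.
  apply: derD.
    apply: derM; first by apply: derM; [exact: derI|exact: dF1].
    by apply: (@der_comp _ Num.sqrt j); [exact: dj|exact: ds].
  apply: derN; apply: derM; first exact: derI.
  apply: derM; first exact: dF.
  apply: derM; first by apply: (@der_comp _ Num.sqrt j1); [exact: dj1|exact: ds].
  apply: derV; first by apply: derM; [exact: derC|exact: ds].
  by nz.
have O1 := odeF s0.
have O2 := @ang_ode R B L h a2 bet F F1 F2 L0 h0 aL cF dF dF1 cF2 odeJ _ rI.
have sE : s = Num.sqrt s ^+ 2 by rewrite sqr_sqrtr// ltW.
rewrite /aj /osc_avg /a /J /J1.
move: O1 O2 r0; set r := Num.sqrt s in sE *; rewrite -/r.
move: (j r) (j1 r) (j2 r) (F2 s) (F1 s) (F s) (vh s) => y0 y1 y2 f2 f1 f0 vv O1 O2 r0.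
have X1 : 4 * h ^+ 2 * (s * f2 + f1) - (s * (B ^+ 2 / 4) + vv + bet) * f0 = 0 by rewrite O1 subrr.
have X2 : h ^+ 2 * (r * y2 + y1) - r * (B ^+ 2 * r ^+ 2 / 4 + bet) * y0 = 0 by rewrite O2 subrr.
apply/eqP; rewrite -subr_eq0; apply/eqP.
transitivity ((4 * h ^+ 2 * (s * f2 + f1) - (s * (B ^+ 2 / 4) + vv + bet) * f0) * y0
  - (h ^+ 2 * (r * y2 + y1) - r * (B ^+ 2 * r ^+ 2 / 4 + bet) * y0) * f0 / r); last by rewrite X1 X2 !mul0r subrr.
by rewrite !sE; field; nz.
Qed.

(** The radial integral stops at [L ^+ 2], beyond the support of [a]. There its primitive equals the
    Wronskian, both having derivative [aj] and limit 0 at the origin. *)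
Lemma hop_reE : 2 * pi * hop_re v B L h phi =
  radial_c (R := R) * (4 * h ^+ 2 * (L ^+ 2 * F1 (L ^+ 2) * j L - L / 2 * (F (L ^+ 2) * j1 L))).
Proof.
have L0' := L0; have L2 : 0 < L ^+ 2 by pp.
have i : (leb \x leb)%E.-integrable setT (EFin \o osc B L h a F cos).
  apply: (osc_integrable B h L0 a20 ca cF a_out); first exact: continuous_cos.
  by move=> x; rewrite ler_norml cos_geN1 cos_le1.
have -> : hop_re v B L h phi = (\int[(leb \x leb)%E]_z osc B L h a F cos z)%R.
  rewrite -(scales_Rintegral (@scales_shear1 R 0 L) i) /hop_re.
  by apply: eq_Rintegral => z _; rewrite shift_re.
have aj_out s : L ^+ 2 < s -> aj s = 0.
  by move=> sL; rewrite /aj /osc_avg a_out ?mul0r// (lt_trans aL).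
rewrite (rotation_average B h L0 a20 ca cF a_out).
rewrite (radial_Rintegral (continuous_measurable_fun caj) (igP_compact caj aj_out)).
congr (_ * _); rewrite -/(IP aj) (IP_compact caj aj_out).
pose P s := (\int[leb]_(t in `[0%R, s]) aj t)%R.
have P0 : P s @[s --> (0 : R)^'+] --> (0 : R).
  have H : {within `[0, 1], continuous P}.
    by apply: parameterized_integral_continuous => //; exact: integrable_cont_itv.
  have /(continuous_within_itvP _ ltr01) [_ H1 _] := H.
  by move: H1; rewrite {2}/P set_itv1 Rintegral_set1.
have z_v3 : - v3 < 0 < v3 by apply: itv_v3; rewrite lexx ltW.
have s0 : Num.sqrt s @[s --> (0 : R)^'+] --> (0 : R).
  by apply: cvg_at_right_filter; rewrite -[X in _ --> X]sqrtr0; exact: sqrt_continuous.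
have J_0 : J s @[s --> (0 : R)^'+] --> j 0.
  by apply: (cvg_comp _ _ s0); exact: (der_cvg (dj z_v3)).
have J1_0 : j1 (Num.sqrt s) @[s --> (0 : R)^'+] --> j1 0.
  by apply: (cvg_comp _ _ s0); exact: (der_cvg (dj1 z_v3)).
have F_0 : F s @[s --> (0 : R)^'+] --> F 0 by apply: cvg_at_right_filter; exact: cF.
have M0 : M s @[s --> (0 : R)^'+] --> (0 : R).
  rewrite -[X in _ --> X](_ : 4 * h ^+ 2 * (0 * j 0 - 2^-1 * (F 0 * (0 * j1 0))) = 0); last by ring.
  apply: cvgMr; apply: cvgB; first exact: (cvgM sF1_0 J_0).
  have : (fun s => 2^-1 * (F s * (Num.sqrt s * j1 (Num.sqrt s)))) s @[s --> (0 : R)^'+] -->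
      2^-1 * (F 0 * (0 * j1 0)).
    by apply: cvgMr; apply: cvgM; [exact: F_0|apply: cvgM; [exact: s0|exact: J1_0]].
  apply: cvg_trans; apply: near_eq_cvg; near=> s.
  have sp : 0 < s by near: s; exact: nbhs_right_gt.
  have sx : 0 < Num.sqrt s by rewrite sqrtr_gt0.
  apply/esym; rewrite -{1}(sqr_sqrtr (ltW sp)) /J1; field; nz.
have dPM s : 0 < s <= L ^+ 2 -> der s (fun s => P s - M s) 0.
  move=> sI; have /andP[sp _] := sI.
  apply: der_eq; first by apply: derD; [exact: (primitive_der_cont caj sp)|apply: derN; exact: dM].
  by rewrite subrr.
have n0 (s : R) : 0 < s <= L ^+ 2 -> `|0 : R| <= 0 by rewrite normr0.
have H := @der_bound0 _ (fun s => P s - M s) (fun=> 0) (fun=> 0) (fun=> 0) (L ^+ 2) (0 - 0) 0 L2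
  (cvgB P0 M0) (cvg_cst _) dPM (fun s _ => derC 0 s) n0.
have {}H : `|P (L ^+ 2) - M (L ^+ 2) - (0 - 0)| <= 0 - 0 by exact: H.
move: H; rewrite !subr0 normr_le0 subr_eq0 => /eqP; rewrite /P => ->.
rewrite /M /J /J1 sqrtr_sqr (gtr0_norm L0); congr (_ * _); field; nz.
Unshelve. all: by end_near. Qed.

End Hopping.

(** * Semiclassical limits *)

Section GroundStateEstimates.
Context {R : realType}.
Variables (B b a2 p00 K : R) (V p0 p0' p1 p1' d Q : R -> R).
Hypotheses (B0 : 0 < B) (b0 : 0 < b) (a20 : 0 < a2) (K1 : 1 <= K).
Hypothesis p0_sqr : forall s : R, 0 < s -> 4 * s * p0 s ^+ 2 = V s.
Hypothesis p0_ge : forall s : R, 0 < s -> B / 4 <= p0 s.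
Hypothesis p0_le : forall s : R, 0 < s -> p0 s <= K.
Hypothesis transport : forall s : R, 0 < s ->
  8 * s * p0 s * p1 s = 4 * (s * p0' s + p0 s) - 4 * p00.
Hypothesis dp0 : forall s : R, 0 < s -> der s p0 (p0' s).
Hypothesis dp1 : forall s : R, 0 < s -> der s p1 (p1' s).
Hypothesis p1_le : forall s : R, 0 < s -> `|p1 s| <= K.
Hypothesis sp1_le : forall s : R, 0 < s -> `|s * p1 s| <= K.
Hypothesis sp1'_le : forall s : R, 0 < s -> `|s * p1' s| <= K.
Hypothesis dd : forall s : R, 0 < s -> der s d (p0 s).
Hypothesis dQ : forall s : R, 0 < s -> der s Q (p1 s).
Hypothesis d_bound : forall s : R, 0 < s -> B / 4 * s <= d s <= K * s.
Hypothesis Q_bound : forall s : R, 0 < s -> `|Q s| <= K * s.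
Hypothesis Vb : forall s : R, a2 < s -> b <= V s.

Variables (h Lam : R) (F F1 F2 : R -> R).
Hypothesis h0 : 0 < h.
Hypothesis dF : forall s : R, 0 < s -> der s F (F1 s).
Hypothesis dF1 : forall s : R, 0 < s -> der s F1 (F2 s).
Hypothesis ode : forall s : R, 0 < s ->
  4 * h ^+ 2 * (s * F2 s + F1 s) = (V s - Lam) * F s.
Hypothesis F_0 : F s @[s --> 0^'+] --> F 0.
Hypothesis sF1_0 : s * F1 s @[s --> 0^'+] --> (0 : R).
Hypothesis F_inf : forall X e : R, 0 < e -> exists2 s, X < s &
  s * F s ^+ 2 <= e /\ s * F1 s ^+ 2 <= e.
Hypothesis F_neq0 : exists2 s, 0 < s & F s != 0.

Hypothesis h1 : h <= 1.
Hypothesis mu_ge : - (3 * K ^+ 2) <= gs_mu p00 h Lam.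
Hypothesis Lam_le : Lam <= b / 2.
Hypothesis hs : h * (16 * (K + 96 * K ^+ 2 / (a2 * B) + 1 + a2^-1)) <= B.
Variable s1 : R.
Hypotheses (as1 : a2 < s1) (d_0 : d 0 = 0) (Q_0 : Q 0 = 0).
Hypothesis hs5 : gs_K5 B a2 K s1 * Num.sqrt h <= 2^-1.
Variables (c : R) (N : R -> R).
Hypotheses (c0 : 0 < c) (N_0 : N s @[s --> 0^'+] --> (0 : R)).
Hypothesis dN : forall s : R, 0 < s -> der s N (c * F s ^+ 2).
Hypothesis N_le1 : forall s : R, 0 < s -> N s <= 1.
Hypothesis N_inf : forall X eps : R, 0 < eps -> exists2 s, X < s & 1 - eps <= N s.
Hypothesis p00_ge : B / 4 <= p00.
Hypothesis p0_sub : forall s : R, 0 < s -> `|p0 s - p00| <= K * s.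
Local Notation psi := (gs_psi d Q h 0).
Local Notation P := (gs_P p0 p1 h).

(** The ground state is determined up to sign only, while the comparison assumed [0 <= F s1].
    Hypotheses and conclusions are invariant under [F |-> - F], so the other case is reduced to
    it. *)
Lemma gs_estimates : [/\ F 0 != 0,
  forall s, 0 < s <= s1 ->
    `|F s - F 0 * psi s| <= 2 * gs_K5 B a2 K s1 * Num.sqrt h * `|F 0| * psi s /\
    `|s * (F1 s + P s * F s)| <= 2 * gs_K2 B a2 K s1 * h * `|F 0| * psi s &
  `|(c * F 0 ^+ 2)^-1 - h / (2 * p00)| <= gs_A5 B b a2 K s1 * (h * Num.sqrt h)].
Proof.
have [Fs1|/ltW Fs1] := leP 0 (F s1).
  split.
  - exact: (@gs_F0_neq0 R B b a2 p00 K V p0 p0' p1 p1' d Q B0 b0 a20 K1 p0_sqr p0_ge p0_le transport dp0 dp1 p1_le sp1_le sp1'_le dd dQ d_bound Q_bound Vb h Lam F F1 F2 h0 dF dF1 ode F_0 sF1_0 F_inf F_neq0 h1 mu_ge Lam_le hs s1 as1 Fs1 d_0 Q_0 hs5).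
  - exact: (@gs_main R B b a2 p00 K V p0 p0' p1 p1' d Q B0 b0 a20 K1 p0_sqr p0_ge p0_le transport dp0 dp1 p1_le sp1_le sp1'_le dd dQ d_bound Q_bound Vb h Lam F F1 F2 h0 dF dF1 ode F_0 sF1_0 F_inf F_neq0 h1 mu_ge Lam_le hs s1 as1 Fs1 d_0 Q_0 hs5).
  - exact: (@gs_norm R B b a2 p00 K V p0 p0' p1 p1' d Q B0 b0 a20 K1 p0_sqr p0_ge p0_le transport dp0 dp1 p1_le sp1_le sp1'_le dd dQ d_bound Q_bound Vb h Lam F F1 F2 h0 dF dF1 ode F_0 sF1_0 F_inf F_neq0 h1 mu_ge Lam_le hs s1 as1 Fs1 d_0 Q_0 hs5 c N c0 N_0 dN N_le1 N_inf p00_ge p0_sub).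
pose G s := - F s; pose G1 s := - F1 s; pose G2 s := - F2 s.
have dG s : 0 < s -> der s G (G1 s) by move=> ?; apply: derN; exact: dF.
have dG1 s : 0 < s -> der s G1 (G2 s) by move=> ?; apply: derN; exact: dF1.
have odeG s : 0 < s -> 4 * h ^+ 2 * (s * G2 s + G1 s) = (V s - Lam) * G s.
  move=> s0; rewrite /G /G1 /G2; transitivity (- (4 * h ^+ 2 * (s * F2 s + F1 s))); first by ring.
  by rewrite ode//; ring.
have G_0 : G s @[s --> 0^'+] --> G 0 by apply: cvgN; exact: F_0.
have sG1_0 : s * G1 s @[s --> 0^'+] --> (0 : R).
  have H := cvgN sF1_0; rewrite oppr0 in H.
  have E : (fun s => s * G1 s) = (fun s => - (s * F1 s)).
    by apply/funext => s; rewrite /G1 mulrN.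
  by rewrite E; exact: H.
have G_inf X e : 0 < e -> exists2 s, X < s & s * G s ^+ 2 <= e /\ s * G1 s ^+ 2 <= e.
  by move=> e0; have [s Xs H] := F_inf X e0; exists s => //; rewrite /G /G1 !sqrrN.
have G_neq0 : exists2 s, 0 < s & G s != 0.
  by have [s s0 H] := F_neq0; exists s => //; rewrite oppr_eq0.
have dNG s : 0 < s -> der s N (c * G s ^+ 2) by rewrite /G sqrrN; exact: dN.
have Gs1 : 0 <= G s1 by rewrite oppr_ge0.
split.
- have : G 0 != 0 by exact: (@gs_F0_neq0 R B b a2 p00 K V p0 p0' p1 p1' d Q B0 b0 a20 K1 p0_sqr p0_ge p0_le transport dp0 dp1 p1_le sp1_le sp1'_le dd dQ d_bound Q_bound Vb h Lam G G1 G2 h0 dG dG1 odeG G_0 sG1_0 G_inf G_neq0 h1 mu_ge Lam_le hs s1 as1 Gs1 d_0 Q_0 hs5).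
  by rewrite oppr_eq0.
- move=> s ss.
  have : `|G s - G 0 * psi s| <= 2 * gs_K5 B a2 K s1 * Num.sqrt h * `|G 0| * psi s /\
    `|s * (G1 s + P s * G s)| <= 2 * gs_K2 B a2 K s1 * h * `|G 0| * psi s.
    exact: (@gs_main R B b a2 p00 K V p0 p0' p1 p1' d Q B0 b0 a20 K1 p0_sqr p0_ge p0_le transport dp0 dp1 p1_le sp1_le sp1'_le dd dQ d_bound Q_bound Vb h Lam G G1 G2 h0 dG dG1 odeG G_0 sG1_0 G_inf G_neq0 h1 mu_ge Lam_le hs s1 as1 Gs1 d_0 Q_0 hs5).
  have -> : G s - G 0 * psi s = - (F s - F 0 * psi s) by rewrite /G; ring.
  have -> : s * (G1 s + P s * G s) = - (s * (F1 s + P s * F s)) by rewrite /G /G1; ring.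
  by rewrite /G !normrN.
- have : `|(c * G 0 ^+ 2)^-1 - h / (2 * p00)| <= gs_A5 B b a2 K s1 * (h * Num.sqrt h).
    exact: (@gs_norm R B b a2 p00 K V p0 p0' p1 p1' d Q B0 b0 a20 K1 p0_sqr p0_ge p0_le transport dp0 dp1 p1_le sp1_le sp1'_le dd dQ d_bound Q_bound Vb h Lam G G1 G2 h0 dG dG1 odeG G_0 sG1_0 G_inf G_neq0 h1 mu_ge Lam_le hs s1 as1 Gs1 d_0 Q_0 hs5 c N c0 N_0 dNG N_le1 N_inf p00_ge p0_sub).
  by rewrite /G sqrrN.
Qed.

Lemma gs_mu_bound : `|4 * p00 * h - Lam| <= 12 * K ^+ 2 * h ^+ 2.
Proof.
have h0' := h0.
have mu_le : gs_mu p00 h Lam <= 3 * K ^+ 2.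
  exact: (@gs_mu_le R B p00 K V p0 p0' p1 p1' B0 K1 p0_sqr p0_ge p0_le transport dp0 dp1 p1_le sp1_le sp1'_le h Lam F F1 F2 h0 dF dF1 ode F_0 sF1_0 F_inf F_neq0 h1).
have -> : 4 * p00 * h - Lam = 4 * h ^+ 2 * gs_mu p00 h Lam by rewrite /gs_mu; field; nz.
rewrite normrM (ger0_norm (_ : 0 <= 4 * h ^+ 2)); last by nn.
have : `|gs_mu p00 h Lam| <= 3 * K ^+ 2 by rewrite ler_norml mu_ge mu_le.
move=> H; have -> : 12 * K ^+ 2 * h ^+ 2 = 4 * h ^+ 2 * (3 * K ^+ 2) by ring.
by apply: ler_wpM2l; [nn|].
Qed.

End GroundStateEstimates.

Section Limits.
Context {R : realType}.
Notation leb := (@lebesgue_measure R).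
Implicit Types f g : R -> R.

Lemma cvg_sqrt_0 : Num.sqrt h @[h --> (0 : R)^'+] --> (0 : R).
Proof. by apply: cvg_at_right_filter; rewrite -[X in _ --> X]sqrtr0; exact: sqrt_continuous. Qed.

Lemma cvg_sqrt_bound f (l K : R) : (\forall h \near (0 : R)^'+, `|f h - l| <= K * Num.sqrt h) ->
  f h @[h --> (0 : R)^'+] --> l.
Proof.
move=> H; apply/subr_cvg0/norm_cvg0P.
have H0 : K * Num.sqrt h @[h --> (0 : R)^'+] --> (0 : R).
  by rewrite -[X in _ --> X](mulr0 K); apply: cvgMr; exact: cvg_sqrt_0.
apply: (squeeze_cvgr _ (cvg_cst 0) H0); near=> h.
by rewrite normr_ge0/=; near: h; exact: H.
Unshelve. all: by end_near. Qed.

Lemma le_sqrt (h : R) : 0 < h -> h <= 1 -> h <= Num.sqrt h.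
Proof.
move=> h0 h1; rewrite -{1}(sqr_sqrtr (ltW h0)) expr2 ler_piMr ?sqrtr_ge0//.
by rewrite -sqrtr1 ler_sqrt.
Qed.

Lemma primitive_cvg0 f : continuous f ->
  (\int[leb]_(t in `[0%R, s]) f t)%R @[s --> (0 : R)^'+] --> (0 : R).
Proof.
move=> cf; have H : {within `[0, 1], continuous (fun s => \int[leb]_(t in `[0%R, s]) f t)%R}.
  by apply: parameterized_integral_continuous => //; exact: integrable_cont_itv.
have /(continuous_within_itvP _ ltr01) [_ H1 _] := H.
have E : (\int[leb]_(t in `[0%R, 0%R]) f t)%R = 0 by rewrite set_itv1 Rintegral_set1.
by move: H1; rewrite E.
Qed.

Lemma der_unique0 f g (df : R -> R) (r : R) : 0 < r ->
  f x @[x --> (0 : R)^'+] --> (0 : R) -> g x @[x --> (0 : R)^'+] --> (0 : R) ->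
  (forall x : R, 0 < x <= r -> der x f (df x)) -> (forall x : R, 0 < x <= r -> der x g (df x)) ->
  f r = g r.
Proof.
move=> r0 f0 g0 Df Dg.
have dfg x : 0 < x <= r -> der x (fun x => f x - g x) 0.
  by move=> xr; apply: der_eq; [apply: derD; [exact: Df|apply: derN; exact: Dg]|rewrite subrr].
have n0 (s : R) : 0 < s <= r -> `|0 : R| <= 0 by rewrite normr0.
have H := @der_bound0 _ (fun s => f s - g s) (fun=> 0) (fun=> 0) (fun=> 0) r (0 - 0) 0 r0
  (cvgB f0 g0) (cvg_cst _) dfg (fun s _ => derC 0 s) n0.
have {}H : `|f r - g r - (0 - 0)| <= 0 - 0 by exact: H.
by move: H; rewrite !subr0 normr_le0 subr_eq0 => /eqP.
Qed.

(* [u] is the value of the radial ground state at the origin, [Fa], [Fb] its values at squared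
   distance [L^2] and [4 L^2], and [Ga] is [L^2] times its derivative at [L^2]. *)
Lemma hopping_prefactor (u Fa Fb Ga psi1 psi2 jL j1L Y Y0 Z w : R -> R) (c L K p0 p1 p00 q0 pi2 : R) :
  pi2 != 0 -> 0 < c -> 0 < L -> 0 < p00 ->
  (\forall h \near (0 : R)^'+, [/\ u h != 0, 0 < psi1 h, 0 < psi2 h, 0 < Y h & 0 < Y0 h]) ->
  (\forall h \near (0 : R)^'+,
    [/\ `|Fa h - u h * psi1 h| <= K * Num.sqrt h * `|u h| * psi1 h,
        `|Ga h + L ^+ 2 * (p0 / h + p1) * Fa h| <= K * h * `|u h| * psi1 h,
        `|Fb h - u h * psi2 h| <= K * Num.sqrt h * `|u h| * psi2 h &
        `|(c * u h ^+ 2)^-1 - h / (2 * p00)| <= K * (h * Num.sqrt h)]) ->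
  (\forall h \near (0 : R)^'+,
    [/\ `|jL h / Y h - pi2 * Fb h / Y0 h| <= K * h * `|pi2 * Fb h / Y0 h|,
        `|j1L h - Z h * jL h| <= K * h * `|pi2 * Fb h / Y0 h| * Y h,
        `|h * Z h - q0| <= K * h &
        pi2 * w h = c * (4 * h ^+ 2 * (Ga h * jL h - L / 2 * (Fa h * j1L h)))]) ->
  w h / (psi1 h * psi2 h * (Y h / Y0 h)) @[h --> (0 : R)^'+] -->
    8 * p00 * - (L ^+ 2 * p0 + L / 2 * q0).
Proof.
move=> pi0 c0 L0 p000 pos est1 est2.
(* Ratios to the model functions: [al], [bt], [ga] tend to 1, [ep] and [ze] are derivatives rescaled
   by [h] with finite limits, and [et] tends to [2 * p00] by the normalisation. *)
pose al h := Fa h / (u h * psi1 h); pose bt h := Fb h / (u h * psi2 h).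
pose ga h := jL h * Y0 h / (pi2 * Fb h * Y h).
pose ep h := h * Ga h / (u h * psi1 h); pose ze h := h * j1L h * Y0 h / (pi2 * Fb h * Y h).
pose et h := c * h * u h ^+ 2.
have h_small : \forall h \near (0 : R)^'+, 0 < h <= 1.
  by near=> h; apply/andP; split; near: h; [exact: nbhs_right_gt|apply: nbhs_right_le].
have ratio (x y e : R) : y != 0 -> `|x - y| <= e * `|y| -> `|x / y - 1| <= e.
  move=> y0 H; have -> : x / y - 1 = (x - y) / y by field.
  by rewrite normrM normfV ler_pdivrMr ?normr_gt0.
have alE : \forall h \near (0 : R)^'+, `|al h - 1| <= K * Num.sqrt h.
  near=> h; have [u0 P1 P2 Y1 Y2] : [/\ u h != 0, 0 < psi1 h, 0 < psi2 h, 0 < Y h & 0 < Y0 h] by near: h.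
  apply: ratio => //; first by nz.
  by rewrite normrM (gtr0_norm P1) mulrA; near: h; apply: filterS est1 => h [].
have btE : \forall h \near (0 : R)^'+, `|bt h - 1| <= K * Num.sqrt h.
  near=> h; have [u0 P1 P2 Y1 Y2] : [/\ u h != 0, 0 < psi1 h, 0 < psi2 h, 0 < Y h & 0 < Y0 h] by near: h.
  apply: ratio => //; first by nz.
  by rewrite normrM (gtr0_norm P2) mulrA; near: h; apply: filterS est1 => h [].
have al1 := cvg_sqrt_bound alE; have bt1 := cvg_sqrt_bound btE.
have idc : h @[h --> (0 : R)^'+] --> (0 : R) by exact: cvg_right_id.
have bt_neq0 : \forall h \near (0 : R)^'+, bt h != 0.
  by apply: (cvgr_neq0 _ bt1); exact: oner_neq0.
have Fb_neq0 : \forall h \near (0 : R)^'+, Fb h != 0.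
  by apply: filterS bt_neq0 => h; apply: contra => /eqP; rewrite /bt => ->; rewrite mul0r.
have gaE : \forall h \near (0 : R)^'+, `|ga h - 1| <= K * h.
  near=> h; have [u0 P1 P2 Y1 Y2] : [/\ u h != 0, 0 < psi1 h, 0 < psi2 h, 0 < Y h & 0 < Y0 h] by near: h.
  have Fb0 : Fb h != 0 by near: h.
  have -> : ga h = (jL h / Y h) / (pi2 * Fb h / Y0 h).
    rewrite /ga; field; nz.
  have y0 : pi2 * Fb h / Y0 h != 0 by nz.
  have H : `|jL h / Y h - pi2 * Fb h / Y0 h| <= K * h * `|pi2 * Fb h / Y0 h|.
    by near: h; apply: filterS est2 => h [].
  exact: (ratio _ _ _ y0 H).
have Kh : K * h @[h --> (0 : R)^'+] --> (0 : R).
  by rewrite -[X in _ --> X](mulr0 K); apply: cvgMr.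
have cvg_small f g l : (\forall h \near (0 : R)^'+, `|f h - l| <= g h) -> g h @[h --> (0 : R)^'+] --> (0 : R) ->
    f h @[h --> (0 : R)^'+] --> l.
  move=> H g0; apply/subr_cvg0/norm_cvg0P; apply: (squeeze_cvgr _ (cvg_cst 0) g0); near=> h.
  by rewrite normr_ge0/=; near: h; exact: H.
have ga1 := cvg_small _ _ _ gaE Kh.
have ep1 : ep h @[h --> (0 : R)^'+] --> - (L ^+ 2 * p0).
  have E : \forall h \near (0 : R)^'+, `|ep h + L ^+ 2 * (p0 + h * p1) * al h - 0| <= K * h * h.
    near=> h; have [u0 P1 P2 Y1 Y2] : [/\ u h != 0, 0 < psi1 h, 0 < psi2 h, 0 < Y h & 0 < Y0 h] by near: h.
    have /andP[h0 _] : 0 < h <= 1 by near: h.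
    have -> : ep h + L ^+ 2 * (p0 + h * p1) * al h - 0 = (Ga h + L ^+ 2 * (p0 / h + p1) * Fa h) * h / (u h * psi1 h).
      by rewrite /ep /al; field; nz.
    rewrite normrM normfV !normrM (gtr0_norm P1) (gtr0_norm h0) ler_pdivrMr; last by rewrite mulr_gt0 ?normr_gt0.
    have -> : K * h * h * (`|u h| * psi1 h) = K * h * `|u h| * psi1 h * h by ring.
    by rewrite ler_pM2r//; near: h; apply: filterS est1 => h [].
  have g0 : K * h * h @[h --> (0 : R)^'+] --> (0 : R).
    by rewrite -[X in _ --> X](mulr0 (0 : R)); apply: cvgM.
  have E1 := cvg_small _ _ _ E g0.
  have E2 : L ^+ 2 * (p0 + h * p1) * al h @[h --> (0 : R)^'+] --> L ^+ 2 * (p0 + 0 * p1) * 1.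
    apply: cvgM => //; apply: cvgMr; apply: cvgD; first exact: cvg_cst.
    by apply: cvgMl.
  rewrite -[X in _ --> X](_ : 0 - L ^+ 2 * (p0 + 0 * p1) * 1 = - (L ^+ 2 * p0)); last by ring.
  have EE : ep = fun h => ep h + L ^+ 2 * (p0 + h * p1) * al h - L ^+ 2 * (p0 + h * p1) * al h.
    by apply/funext => h; rewrite addrK.
  by rewrite EE; exact: cvgB E1 E2.
have hZ : h * Z h @[h --> (0 : R)^'+] --> q0.
  by apply: cvg_small Kh; apply: filterS est2 => h [].
have ze1 : ze h @[h --> (0 : R)^'+] --> q0.
  have E : \forall h \near (0 : R)^'+, `|ze h - (h * Z h) * ga h - 0| <= K * h * h.
    near=> h; have [u0 P1 P2 Y1 Y2] : [/\ u h != 0, 0 < psi1 h, 0 < psi2 h, 0 < Y h & 0 < Y0 h] by near: h.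
    have /andP[h0 _] : 0 < h <= 1 by near: h.
    have Fb0 : Fb h != 0 by near: h.
    have -> : ze h - (h * Z h) * ga h - 0 = (j1L h - Z h * jL h) * h / (pi2 * Fb h / Y0 h * Y h).
      by rewrite /ze /ga; field; nz.
    have a0 : 0 < `|pi2 * Fb h / Y0 h| by rewrite normr_gt0; nz.
    rewrite normrM normfV normrM (normrM _ (Y h)) (gtr0_norm Y1) (gtr0_norm h0) ler_pdivrMr; last exact: mulr_gt0.
    have -> : K * h * h * (`|pi2 * Fb h / Y0 h| * Y h) = K * h * `|pi2 * Fb h / Y0 h| * Y h * h by ring.
    by rewrite ler_pM2r//; near: h; apply: filterS est2 => h [].
  have g0 : K * h * h @[h --> (0 : R)^'+] --> (0 : R).
    by rewrite -[X in _ --> X](mulr0 (0 : R)); apply: cvgM.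
  rewrite -[X in _ --> X](_ : 0 + q0 * 1 = q0); last by ring.
  have EE : ze = fun h => ze h - (h * Z h) * ga h + (h * Z h) * ga h.
    by apply/funext => h; rewrite subrK.
  by rewrite EE; exact: cvgD (cvg_small _ _ _ E g0) (cvgM hZ ga1).
have et1 : et h @[h --> (0 : R)^'+] --> 2 * p00.
  have E : \forall h \near (0 : R)^'+, `|(et h)^-1 - (2 * p00)^-1| <= K * Num.sqrt h.
    near=> h; have [u0 P1 P2 Y1 Y2] : [/\ u h != 0, 0 < psi1 h, 0 < psi2 h, 0 < Y h & 0 < Y0 h] by near: h.
    have /andP[h0 _] : 0 < h <= 1 by near: h.
    have -> : (et h)^-1 - (2 * p00)^-1 = ((c * u h ^+ 2)^-1 - h / (2 * p00)) / h by rewrite /et; field; nz.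
    rewrite normrM normfV (gtr0_norm h0) ler_pdivrMr//.
    have -> : K * Num.sqrt h * h = K * (h * Num.sqrt h) by ring.
    by near: h; apply: filterS est1 => h [].
  have n0 : (2 * p00)^-1 != 0 by nz.
  rewrite -[X in _ --> X](invrK (2 * p00)).
  have EE : et = fun h => ((et h)^-1)^-1 by apply/funext => h; rewrite invrK.
  by rewrite EE; exact: cvgV n0 (cvg_sqrt_bound E).
(* This is the normalised hopping coefficient rewritten in the ratios; [et] takes one power of [h],
   and [ep] or [ze] the other, from the factor [h ^+ 2]. *)
have main : 4 * et h * bt h * (ep h * ga h - L / 2 * (al h * ze h)) @[h --> (0 : R)^'+] -->
    4 * (2 * p00) * 1 * (- (L ^+ 2 * p0) * 1 - L / 2 * (1 * q0)).
  apply: cvgM; first by apply: cvgM => //; apply: cvgMr.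
  by apply: cvgB; [exact: cvgM|apply: cvgMr; exact: cvgM].
have -> : 8 * p00 * - (L ^+ 2 * p0 + L / 2 * q0) = 4 * (2 * p00) * 1 * (- (L ^+ 2 * p0) * 1 - L / 2 * (1 * q0)) by ring.
move: main; apply: cvg_trans; apply: near_eq_cvg; near=> h.
have [u0 P1 P2 Y1 Y2] : [/\ u h != 0, 0 < psi1 h, 0 < psi2 h, 0 < Y h & 0 < Y0 h] by near: h.
have /andP[h0 _] : 0 < h <= 1 by near: h.
have Fb0 : Fb h != 0 by near: h.
have wE : w h = c * (4 * h ^+ 2 * (Ga h * jL h - L / 2 * (Fa h * j1L h))) / (pi2).
  have <- : pi2 * w h = c * (4 * h ^+ 2 * (Ga h * jL h - L / 2 * (Fa h * j1L h))).
    by near: h; apply: filterS est2 => h [].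
  by field; nz.
by rewrite wE /et /bt /ep /ga /al /ze; field; nz.
Unshelve. all: by end_near. Qed.

End Limits.

(** * The exponent of the free solution and its prefactor *)

Section ExponentialPrefactor.
Context {R : realType}.
Notation leb := (@lebesgue_measure R).

Lemma ftc_closed (f g : R -> R) (L : R) : 0 < L -> continuous g ->
  (forall t : R, 0 <= t <= L -> der t f (g t)) -> (\int[leb]_(t in `[0%R, L]) g t)%R = f L - f 0.
Proof.
move=> L0 cg fg.
have d0 : der (0 : R) f (g 0) by apply: fg; rewrite lexx ltW.
have d1 : der L f (g L) by apply: fg; rewrite lexx ltW.
have fI x : x \in `]0%R, L[ -> der x f (g x).
  by rewrite in_itv/= => /andP[? ?]; apply: fg; rewrite !ltW.
rewrite /Rintegral (continuous_FTC2 (F := f) L0) //.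
- exact: continuous_subspaceT.
- split; first by move=> x /fI[].
  + by apply: cvg_at_right_filter; exact: (der_cvg d0).
  + by apply: cvg_at_left_filter; exact: (der_cvg d1).
- by move=> x /fI[_ <-]; rewrite derive1E.
Qed.

Lemma near_le (C D : R) : 0 < D -> \forall h \near (0 : R)^'+, C * h <= D.
Proof.
move=> D0; have H : C * h @[h --> (0 : R)^'+] --> (0 : R).
  by rewrite -[X in _ --> X](mulr0 C); apply: cvgMr; exact: cvg_right_id.
near=> h; apply: ltW; near: h; exact: (cvgr_lt 0 H D D0).
Unshelve. all: by end_near. Qed.

Lemma near_sqrt_le (C D : R) : 0 < D -> \forall h \near (0 : R)^'+, C * Num.sqrt h <= D.
Proof.
move=> D0; have H : C * Num.sqrt h @[h --> (0 : R)^'+] --> (0 : R).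
  by rewrite -[X in _ --> X](mulr0 C); apply: cvgMr; exact: cvg_sqrt_0.
near=> h; apply: ltW; near: h; exact: (cvgr_lt 0 H D D0).
Unshelve. all: by end_near. Qed.

Variables (B b L p00 K : R).
Hypotheses (b0 : 0 < b) (L0 : 0 < L).
Let kp := Num.sqrt (b / 2).
Let kp0 : 0 < kp. Proof. by rewrite sqrtr_gt0 divr_gt0. Qed.

Lemma fs_q_continuous (bet : R) : 0 < bet -> continuous (fs_q B bet).
Proof.
move=> bet0 r; have e0 : 0 < B ^+ 2 * r ^+ 2 / 4 + bet by apply: ltr_wpDl => //; nn.
have H : der r (fs_q B bet) ((B ^+ 2 * r / 2) / (2 * Num.sqrt (B ^+ 2 * r ^+ 2 / 4 + bet))).
  by apply: der_eq; [apply: der_sqrt; [der_rec fail|exact: e0]|rewrite /=; congr (_ / _); field].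
exact: (der_cvg H).
Qed.

(** [La] is the difference of squares [(q0 - q) * (q0 + q)]; hence [q0 - q] is of order [La], and
    the second-order error is exactly [(q0 - q) ^+ 2 / (2 * q0)]. *)
Lemma fs_q_diff (La r : R) : `|La| <= b / 2 ->
  `|fs_q B b r - fs_q B (b - La) r| <= `|La| / kp /\
  `|fs_q B b r - fs_q B (b - La) r - La / 2 * (fs_q B b r)^-1| <= La ^+ 2 / kp ^+ 3.
Proof.
move=> La_b; have b0' := b0; have kp0' := kp0; have La1 := ler_norm La.
have q_ge bet : b / 2 <= bet -> kp <= fs_q B bet r.
  by move=> H; rewrite /kp ler_sqrt; [have : 0 <= B ^+ 2 * r ^+ 2 / 4 by nn|have : 0 <= B ^+ 2 * r ^+ 2 / 4 by nn]; lra.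
have q_sq bet : b / 2 <= bet -> fs_q B bet r ^+ 2 = B ^+ 2 * r ^+ 2 / 4 + bet.
  by move=> H; rewrite sqr_sqrtr// addr_ge0//; [nn|lra].
have H1 : b / 2 <= b by lra.
have H2 : b / 2 <= b - La by lra.
have G1 := q_ge _ H1; have G2 := q_ge _ H2; have S1 := q_sq _ H1; have S2 := q_sq _ H2.
set q0 := fs_q B b r in G1 S1 *; set q := fs_q B (b - La) r in G2 S2 *.
have q00 : 0 < q0 by exact: lt_le_trans G1. have q10 : 0 < q by exact: lt_le_trans G2.
have qq : 0 < q0 + q by exact: addr_gt0.
have E : La = (q0 - q) * (q0 + q).
  have -> : (q0 - q) * (q0 + q) = q0 ^+ 2 - q ^+ 2 by ring.
  by rewrite S1 S2; ring.
have D1 : `|q0 - q| <= `|La| / kp.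
  rewrite ler_pdivlMr// E normrM ler_wpM2l// gtr0_norm//; lra.
split=> //.
have -> : q0 - q - La / 2 * q0^-1 = (q0 - q) ^+ 2 / (2 * q0) * 1.
  by rewrite E; field; nz.
rewrite mulr1 ger0_norm; last by nn.
rewrite ler_pdivrMr; last by pp.
have D2 : (q0 - q) ^+ 2 <= La ^+ 2 / kp ^+ 2.
  have -> : La ^+ 2 / kp ^+ 2 = (`|La| / kp) ^+ 2 by rewrite exprMn real_normK ?num_real// exprVn.
  by rewrite -(real_normK (num_real (q0 - q))) lerXn2r ?nnegrE//; nn.
apply: (le_trans D2).
have -> : La ^+ 2 / kp ^+ 3 * (2 * q0) = La ^+ 2 / kp ^+ 2 * (2 * q0 / kp) by field; nz.
rewrite ler_peMr//; first by nn.
by rewrite ler_pdivlMr// mul1r; lra.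
Qed.

Let m (bet s : R) := (\int[leb]_(t in `[0%R, s]) fs_q B bet t)%R.
(** Twice the derivative of [m (bet) L] with respect to [bet] at [b]. *)
Definition tun_T := (\int[leb]_(t in `[0%R, L]) (fs_q B b t)^-1)%R.

Lemma tun_m_diff (La : R) : `|La| <= b / 2 ->
  `|m b L - m (b - La) L - La / 2 * tun_T| <= La ^+ 2 / kp ^+ 3 * L.
Proof.
move=> La_b; have b0' := b0; have La1 := ler_norm La.
have bL : 0 < b - La by lra.
have c1 := fs_q_continuous b0; have c2 := fs_q_continuous bL.
have c3 : continuous (fun t => (fs_q B b t)^-1).
  move=> t; apply: cvgV; last exact: c1.
  by rewrite gt_eqF// sqrtr_gt0 ltr_wpDl//; nn.
pose Tf s := (\int[leb]_(t in `[0%R, s]) (fs_q B b t)^-1)%R.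
have lim : m b s - m (b - La) s - La / 2 * Tf s @[s --> (0 : R)^'+] --> 0 - 0 - La / 2 * 0.
  apply: cvgB; first by apply: cvgB; exact: primitive_cvg0.
  by apply: cvgMr; exact: primitive_cvg0.
have g0 : La ^+ 2 / kp ^+ 3 * s @[s --> (0 : R)^'+] --> La ^+ 2 / kp ^+ 3 * 0.
  by apply: cvgMr; exact: cvg_right_id.
have df (s : R) : 0 < s <= L -> der s (fun s => m b s - m (b - La) s - La / 2 * Tf s)
    (fs_q B b s - fs_q B (b - La) s - La / 2 * (fs_q B b s)^-1).
  move=> /andP[s0 _]; apply: der_eq.
    apply: derD; first by apply: derD; [exact: (primitive_der_cont c1 s0)|apply: derN; exact: (primitive_der_cont c2 s0)].
    by apply: derN; apply: derM; [exact: derC|exact: (primitive_der_cont c3 s0)].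
  by rewrite /=; ring.
have dg (s : R) : 0 < s <= L -> der s (fun s => La ^+ 2 / kp ^+ 3 * s) (La ^+ 2 / kp ^+ 3).
  by move=> _; apply: der_eq; [apply: derM; [exact: derC|exact: derI]|rewrite /=; ring].
have H := @der_bound0 _ _ _ _ (fun=> La ^+ 2 / kp ^+ 3) L _ _ L0 lim g0 df dg (fun s _ => (fs_q_diff s La_b).2).
have {}H : `|m b L - m (b - La) L - La / 2 * Tf L - (0 - 0 - La / 2 * 0)| <=
  La ^+ 2 / kp ^+ 3 * L - La ^+ 2 / kp ^+ 3 * 0 by exact: H.
by move: H; rewrite !mulr0 !subr0.
Qed.

Variable Lam : R -> R.
Hypothesis Lam_near : \forall h \near (0 : R)^'+, `|4 * p00 * h - Lam h| <= K * h ^+ 2.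

Lemma Lam_linear : \forall h \near (0 : R)^'+, `|Lam h| <= (`|4 * p00| + `|K|) * h /\ `|Lam h| <= b / 2.
Proof.
have b2 : 0 < b / 2 by rewrite divr_gt0.
near=> h; have h0 : 0 < h by near: h; exact: nbhs_right_gt.
have h1 : h <= 1 by near: h; exact: nbhs_right_le.
have H : `|4 * p00 * h - Lam h| <= K * h ^+ 2 by near: h.
have H1 : `|Lam h| <= (`|4 * p00| + `|K|) * h.
  have -> : Lam h = 4 * p00 * h - (4 * p00 * h - Lam h) by ring.
  apply: le_trans (ler_normB _ _) _; rewrite [leRHS]mulrDl; apply: lerD.
    by rewrite normrM (gtr0_norm h0).
  apply: (le_trans H); apply: (@le_trans _ _ (`|K| * h ^+ 2)).
    by rewrite ler_wpM2r ?sqr_ge0// ler_norm.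
  by rewrite ler_wpM2l// expr2 ler_piMr// ltW.
split=> //; apply: (le_trans H1); near: h; exact: near_le.
Unshelve. all: by end_near. Qed.

Let bet h := b - Lam h.

(** [Lam] equals [4 * p00 * h] up to [O(h ^+ 2)], so replacing [bet] by [b] changes the exponent
    [m / h] by a quantity with a finite limit, and multiplies the amplitude by a constant. *)
Lemma tun_m_cvg : (m (bet h) L - m b L) / h @[h --> (0 : R)^'+] --> - (2 * p00 * tun_T).
Proof.
have kp0' := kp0; pose A := `|4 * p00| + `|K|; have A0 : 0 <= A by rewrite addr_ge0.
pose K' := A ^+ 2 / kp ^+ 3 * L + `|K| / 2 * `|tun_T|.
have L0' := L0; have K'0 : 0 <= K' by rewrite /K'; nn.
apply: (cvg_sqrt_bound (K := K')); near=> h.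
have h0 : 0 < h by near: h; exact: nbhs_right_gt.
have h1 : h <= 1 by near: h; exact: nbhs_right_le.
have [L1 L2] : `|Lam h| <= A * h /\ `|Lam h| <= b / 2 by near: h; exact: Lam_linear.
have H : `|4 * p00 * h - Lam h| <= K * h ^+ 2 by near: h.
have M1 := tun_m_diff L2.
apply: (@le_trans _ _ (K' * h)); last by rewrite ler_wpM2l// le_sqrt.
have -> : (m (bet h) L - m b L) / h - - (2 * p00 * tun_T) =
  (- (m b L - m (bet h) L - Lam h / 2 * tun_T) + (4 * p00 * h - Lam h) / 2 * tun_T) / h.
  by field; nz.
rewrite normrM normfV (gtr0_norm h0) ler_pdivrMr//.
apply: le_trans (ler_normD _ _) _; rewrite normrN.
have -> : K' * h * h = A ^+ 2 * h ^+ 2 / kp ^+ 3 * L + `|K| * h ^+ 2 / 2 * `|tun_T| by rewrite /K'; ring.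
apply: lerD.
  apply: (le_trans M1); apply: ler_wpM2r; first exact: ltW.
  apply: ler_wpM2r; first by nn.
  rewrite -exprMn -(real_normK (num_real (Lam h))) lerXn2r ?nnegrE//.
  by rewrite mulr_ge0// ltW.
rewrite !normrM ler_wpM2r// (ger0_norm (_ : 0 <= 2^-1)); last by rewrite invr_ge0.
rewrite ler_wpM2r ?invr_ge0//; apply: (le_trans H).
by rewrite ler_wpM2r ?sqr_ge0// ler_norm.
Unshelve. all: by end_near. Qed.

(** The argument [x = sqrt bet * L / h] tends to infinity, where [bessel 0 x] behaves like
    [l * exp(x) / sqrt x]. The exponential cancels the term [sqrt bet * L] in [fs_Y], and
    [1 / sqrt x] supplies the factor [sqrt h]. *)
Lemma exp_prefactor (C l : R) : (forall x : R, 2 <= x ->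
    `|Num.sqrt x * expR (- x) * bessel 0 x - l| <= C / x) ->
  fs_Y B (bet h) h (m (bet h)) L / fs_Y0 (bet h) / (Num.sqrt h * expR (m b L / h)) @[h --> (0 : R)^'+] -->
    l * expR (- (2 * p00 * tun_T)) / (Num.sqrt L * Num.sqrt (fs_q B b L) * (2 * pi)).
Proof.
move=> bes; have kp0' := kp0; have L0' := L0; have b0' := b0.
pose x h := Num.sqrt (bet h) * L / h.
have q0 : 0 < fs_q B b L by rewrite sqrtr_gt0 ltr_wpDl//; nn.
have Lam0 : Lam h @[h --> (0 : R)^'+] --> (0 : R).
  apply: (cvg_sqrt_bound (K := `|4 * p00| + `|K|)); near=> h.
  have h0 : 0 < h by near: h; exact: nbhs_right_gt.
  have h1 : h <= 1 by near: h; exact: nbhs_right_le.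
  rewrite subr0; have [L1 _] : `|Lam h| <= (`|4 * p00| + `|K|) * h /\ `|Lam h| <= b / 2.
    by near: h; exact: Lam_linear.
  by apply: (le_trans L1); rewrite ler_wpM2l ?addr_ge0// le_sqrt.
have betc : bet h @[h --> (0 : R)^'+] --> b.
  by rewrite -[X in _ --> X](subr0 b); apply: cvgB; [exact: cvg_cst|exact: Lam0].
have qc : fs_q B (bet h) L @[h --> (0 : R)^'+] --> fs_q B b L.
  have arg : B ^+ 2 * L ^+ 2 / 4 + bet h @[h --> (0 : R)^'+] --> B ^+ 2 * L ^+ 2 / 4 + b.
    by apply: cvgD; [exact: cvg_cst|exact: betc].
  exact: (cvg_comp _ _ arg (@sqrt_continuous R _)).
have gc : Num.sqrt (x h) * expR (- x h) * bessel 0 (x h) @[h --> (0 : R)^'+] --> l.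
  apply: (cvg_sqrt_bound (K := `|C| / (kp * L))); near=> h.
  have h0 : 0 < h by near: h; exact: nbhs_right_gt.
  have h1 : h <= 1 by near: h; exact: nbhs_right_le.
  have [_ L2] : `|Lam h| <= (`|4 * p00| + `|K|) * h /\ `|Lam h| <= b / 2 by near: h; exact: Lam_linear.
  have sb : kp <= Num.sqrt (bet h).
    by rewrite ler_sqrt /bet; have := ler_norm (Lam h); lra.
  have xh : kp * L / h <= x h by rewrite ler_pM2r ?invr_gt0// ler_pM2r.
  have hk : 2 * h <= kp * L by near: h; apply: near_le; exact: mulr_gt0.
  have x2 : 2 <= x h by apply: le_trans xh; rewrite ler_pdivlMr.
  have x0 : 0 < x h by lra.
  apply: (le_trans (bes _ x2)).
  apply: (@le_trans _ _ (`|C| / (kp * L) * h)); last by rewrite ler_wpM2l ?le_sqrt//; nn.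
  rewrite ler_pdivrMr//; apply: (le_trans (ler_norm _)).
  have -> : `|C| / (kp * L) * h * x h = `|C| * (x h / (kp * L / h)) by field; nz.
  by rewrite ler_peMr// ler_pdivlMr ?mul1r//; pp.
have ec : expR ((m (bet h) L - m b L) / h) @[h --> (0 : R)^'+] --> expR (- (2 * p00 * tun_T)).
  exact: (cvg_comp _ _ tun_m_cvg (@continuous_expR R _)).
have sq : Num.sqrt (fs_q B (bet h) L) @[h --> (0 : R)^'+] --> Num.sqrt (fs_q B b L).
  exact: (cvg_comp _ _ qc (@sqrt_continuous R _)).
have [pp ppE] : exists pp : R, pp = 2 * pi by exists (2 * pi).
have pp0 : 0 < pp by rewrite ppE mulr_gt0// pi_gt0.
have main : Num.sqrt (x h) * expR (- x h) * bessel 0 (x h) * expR ((m (bet h) L - m b L) / h) /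
    (Num.sqrt L * Num.sqrt (fs_q B (bet h) L) * pp) @[h --> (0 : R)^'+] -->
    l * expR (- (2 * p00 * tun_T)) / (Num.sqrt L * Num.sqrt (fs_q B b L) * pp).
  apply: cvgM; first by apply: cvgM; [exact: gc|exact: ec].
  apply: cvgV; first by rewrite !mulf_neq0 ?gt_eqF// sqrtr_gt0.
  by apply: cvgMl; apply: cvgMr; exact: sq.
rewrite -ppE; move: main; apply: cvg_trans; apply: near_eq_cvg; near=> h.
have h0 : 0 < h by near: h; exact: nbhs_right_gt.
have [_ L2] : `|Lam h| <= (`|4 * p00| + `|K|) * h /\ `|Lam h| <= b / 2 by near: h; exact: Lam_linear.
have bet0 : 0 < bet h by rewrite /bet; have := ler_norm (Lam h); lra.
have sb0 : 0 < Num.sqrt (bet h) by rewrite sqrtr_gt0.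
have q1 : 0 < fs_q B (bet h) L by rewrite sqrtr_gt0 ltr_wpDl//; nn.
have sx : Num.sqrt (x h) = Num.sqrt (Num.sqrt (bet h)) * Num.sqrt L / Num.sqrt h.
  by rewrite /x sqrtrM ?mulr_ge0 ?ltW// sqrtrM ?ltW// sqrtrV// ltW.
have e1 : expR ((m (bet h) L - Num.sqrt (bet h) * L) / h) = expR (- x h) * expR ((m (bet h) L - m b L) / h) * expR (m b L / h).
  by rewrite -!expRD; congr expR; rewrite /x; field; nz.
rewrite /fs_Y /fs_Y0 -ppE e1 sx -/(x h).
have := expR_gt0 (m b L / h); have s1 : 0 < Num.sqrt (Num.sqrt (bet h)) by rewrite sqrtr_gt0.
have s2 : 0 < Num.sqrt L by rewrite sqrtr_gt0.
have s3 : 0 < Num.sqrt h by rewrite sqrtr_gt0.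
have s4 : 0 < Num.sqrt (fs_q B (bet h) L) by rewrite sqrtr_gt0.
move: (bessel 0 _) (expR (- x h)) (expR (_ / h)) (expR (m b L / h)) => e2 e3 e4 e5 e50.
move: s1 s2 s3 s4; move: (Num.sqrt (Num.sqrt (bet h))) (Num.sqrt L) (Num.sqrt h) (Num.sqrt (fs_q B _ L)) => r1 r2 r3 r4 s1 s2 s3 s4.
by field; nz.
Unshelve. all: by end_near. Qed.

End ExponentialPrefactor.

(** * Assembly *)

Section Model.
Context {R : realType}.
Notation leb := (@lebesgue_measure R).
Variables (v : R * R -> R) (vp : R -> R) (a B L : R).
Hypothesis v_smooth : smooth2 v.
Hypothesis v_nonpos : forall z, v z <= 0.
Hypothesis v_radial : forall z, v z = vp (eucl_rad z).
Hypothesis v_min : forall z, z != (0, 0) -> v (0, 0) < v z.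
Hypothesis v0_neg : v (0, 0) < 0.
Hypothesis v_nondeg : 0 < dx (dx v) (0, 0).
Hypotheses (a_pos : 0 < a) (a_supp : forall z, a < eucl_rad z -> v z = 0).
Hypotheses (B0 : 0 < B) (L_gt : a < L).

Local Notation vh := (pot_h v).
Local Notation b := (pot_b v).
Local Notation kap := (pot_kap v).
Local Notation U := (pot_U v).
Local Notation U1 := (pot_U1 v).
Local Notation U2 := (pot_U2 v).
Local Notation a2 := (a ^+ 2).
Local Notation s1 := (4 * L ^+ 2).
Local Notation c := (@radial_c R).
Local Notation p00 := (wkb_p00 B kap).
Local Notation p0 := (wkb_p0 B U).
Local Notation p0' := (wkb_p0' B U U1).
Local Notation p1 := (wkb_p1 B kap U U1).
Local Notation p1' := (wkb_p1' B kap U U1 U2).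

Let L0 : 0 < L. Proof. exact: lt_trans L_gt. Qed.
Let L20 : 0 < L ^+ 2. Proof. exact: exprn_gt0. Qed.
Let a20 : 0 < a2. Proof. exact: exprn_gt0. Qed.
Let aL : a2 < L ^+ 2. Proof. by rewrite ltr_pXn2r ?nnegrE// ltW. Qed.
Let as1 : a2 < s1. Proof. by have := aL; have := L20; lra. Qed.
Let b0 : 0 < b. Proof. exact: pot_b_gt0. Qed.
Let kap0 : 0 <= kap. Proof. exact: pot_kap_ge0. Qed.
Let U0 s : 0 < s -> 0 <= U s. Proof. exact: pot_U_ge0. Qed.
Let Ub s : a2 < s -> U s = b /\ U1 s = 0. Proof. exact: pot_U_out. Qed.
Let dU s : 0 < s -> der s U (U1 s). Proof. exact: pot_dU. Qed.
Let dU1 s : 0 < s -> der s U1 (U2 s). Proof. exact: pot_dU1. Qed.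
Let vhE z : v z = vh (nrm2 z). Proof. exact: pot_hE v_radial z. Qed.
Let cvh : continuous vh. Proof. exact: pot_h_continuous. Qed.
Let vh_bound s : - b <= vh s <= 0. Proof. exact: pot_h_bound. Qed.
Let vh_out s : a2 < s -> vh s = 0. Proof. exact: pot_h_out. Qed.
Let c0 : 0 < c. Proof. exact: radial_c_gt0. Qed.
Let p00_ge : B / 4 <= p00. Proof. exact: wkb_p00_ge. Qed.
Let p000 : 0 < p00. Proof. by apply: lt_le_trans p00_ge; rewrite divr_gt0. Qed.
Let p0_ge s : 0 < s -> B / 4 <= p0 s. Proof. by move=> s0; apply: wkb_p0_ge. Qed.
Let dp0 s : 0 < s -> der s p0 (p0' s). Proof. by move=> s0; apply: wkb_dp0. Qed.
Let dp1 s : 0 < s -> der s p1 (p1' s). Proof. by move=> s0; apply: wkb_dp1. Qed.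
Let transport s : 0 < s -> 8 * s * p0 s * p1 s = 4 * (s * p0' s + p0 s) - 4 * p00.
Proof. by move=> s0; apply: wkb_transport. Qed.

Let V s := s * (B ^+ 2 / 4) + U s.
Let p0_sqr s : 0 < s -> 4 * s * p0 s ^+ 2 = V s.
Proof.
move=> s0; have : 4 * p0 s ^+ 2 = wkb_W B U s by apply: wkb_p0_sqr.
have -> : 4 * s * p0 s ^+ 2 = s * (4 * p0 s ^+ 2) by ring.
by move=> ->; rewrite /V /wkb_W; field; nz.
Qed.
Let Vb s : a2 < s -> b <= V s.
Proof.
move=> as0; have [UE _] := Ub as0; have s0 : 0 < s by exact: lt_trans as0.
by rewrite /V UE lerDr; have B0' := B0; nn.
Qed.

(** A single constant dominates all bounds, as a sum of the individual ones. The summand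
    [K0 / (8 * p00 ^+ 2)] is there so that the error of the Gaussian trial energy stays within the
    range assumed for [gs_mu]. *)
Lemma model_constants : exists K K0, [/\ 1 <= K, 0 <= K0 /\ K0 / (8 * p00 ^+ 2) <= 3 * K ^+ 2,
  forall s, 0 < s -> vh s + b <= kap * s + K0 * s ^+ 2 &
  forall s, 0 < s -> [/\ p0 s <= K, `|p1 s| <= K, `|s * p1 s| <= K, `|s * p1' s| <= K & `|p0 s - p00| <= K * s]].
Proof.
have [K0 K00 tay] := pot_U_taylor v_smooth v_radial a_pos a_supp.
have bU2 s : 0 < s -> `|U2 s| <= K0 by move=> /tay[].
have bU1 s : 0 < s -> `|U1 s - kap| <= K0 * s by move=> /tay[].
have bU s : 0 < s -> `|U s - kap * s| <= K0 * s ^+ 2 by move=> /tay[].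
have [k1 H1] := wkb_bdd_p0 B0 b0 a20 kap0 bU2 bU U0 Ub.
have [k2 H2] := wkb_bdd_p1 B0 kap0 bU1 bU U0.
have [k3 H3] := wkb_bdd_sp1 B0 b0 a20 kap0 bU2 bU1 bU U0 Ub.
have [k4 H4] := wkb_bdd_sp1' B0 b0 a20 kap0 bU2 bU1 bU U0 Ub.
have [e1 e2] : k1 <= `|k1| /\ k2 <= `|k2| by split; exact: ler_norm.
have [e3 e4] : k3 <= `|k3| /\ k4 <= `|k4| by split; exact: ler_norm.
have [n1 n2] : 0 <= `|k1| /\ 0 <= `|k2| by split; exact: normr_ge0.
have [n3 n4] : 0 <= `|k3| /\ 0 <= `|k4| by split; exact: normr_ge0.
have B0' := B0; have p000' := p000.
have f1 : 0 <= K0 / (2 * B) by nn.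
have f2 : 0 <= K0 / (8 * p00 ^+ 2) by nn.
pose K := 1 + `|k1| + `|k2| + `|k3| + `|k4| + K0 / (2 * B) + K0 / (8 * p00 ^+ 2).
exists K, K0.
have K1 : 1 <= K by rewrite /K; lra.
split=> //.
- by split=> //; have : K0 / (8 * p00 ^+ 2) <= K by [rewrite /K; lra]; nra.
- by move=> s s0; have := bU s s0; rewrite ler_norml /pot_U; lra.
- move=> s s0; split.
  + by have := H1 s s0; have := ler_norm (p0 s); rewrite /K; lra.
  + by have := H2 s s0; rewrite /K; lra.
  + by have := H3 s s0; rewrite /K; lra.
  + by have := H4 s s0; rewrite /K; lra.
  + apply: (le_trans (wkb_p0_sub B0 kap0 bU U0 s0)).
    by apply: ler_wpM2r; [exact: ltW|rewrite /K; lra].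
Qed.

Variables (K K0 : R).
Hypotheses (K1 : 1 <= K) (K00 : 0 <= K0) (KK : K0 / (8 * p00 ^+ 2) <= 3 * K ^+ 2).
Hypothesis vh_le : forall s, 0 < s -> vh s + b <= kap * s + K0 * s ^+ 2.
Hypothesis pb : forall s, 0 < s -> [/\ p0 s <= K, `|p1 s| <= K, `|s * p1 s| <= K, `|s * p1' s| <= K & `|p0 s - p00| <= K * s].

Let p0_le s : 0 < s -> p0 s <= K. Proof. by move=> /pb[]. Qed.
Let p1_le s : 0 < s -> `|p1 s| <= K. Proof. by move=> /pb[]. Qed.
Let sp1_le s : 0 < s -> `|s * p1 s| <= K. Proof. by move=> /pb[]. Qed.
Let sp1'_le s : 0 < s -> `|s * p1' s| <= K. Proof. by move=> /pb[]. Qed.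
Let p0_sub s : 0 < s -> `|p0 s - p00| <= K * s. Proof. by move=> /pb[]. Qed.
Let p0_norm s : 0 < s -> `|p0 s| <= K.
Proof. by move=> s0; have := p0_le s0; have := p0_ge s0; have := B0; rewrite ler_norml; lra. Qed.

Definition agm_d (s : R) := (\int[leb]_(t in `[0%R, s]) p0 t)%R.
Definition agm_Q (s : R) := (\int[leb]_(t in `[0%R, s]) p1 t)%R.
Local Notation d := agm_d.
Local Notation Q := agm_Q.

Let dd (s : R) : 0 < s -> der s d (p0 s).
Proof.
move=> s0; apply: (primitive_der (K := fun=> K)) => // [y y0|_ y /andP[y0 _]]; last exact: p0_norm.
exact: (der_cvg (dp0 y0)).
Qed.
Let dQ (s : R) : 0 < s -> der s Q (p1 s).
Proof.
move=> s0; apply: (primitive_der (K := fun=> K)) => // [y y0|_ y /andP[y0 _]]; last exact: p1_le.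
exact: (der_cvg (dp1 y0)).
Qed.
Let Q_bound s : 0 < s -> `|Q s| <= K * s.
Proof.
move=> s0; apply: primitive_bound; first exact: ltW.
  by move=> y y0; exact: (der_cvg (dp1 y0)).
by move=> y /andP[y0 _]; exact: p1_le.
Qed.
Let d_norm s : 0 < s -> `|d s| <= K * s.
Proof.
move=> s0; apply: primitive_bound; first exact: ltW.
  by move=> y y0; exact: (der_cvg (dp0 y0)).
by move=> y /andP[y0 _]; exact: p0_norm.
Qed.
Let Ks0 : K * s @[s --> (0 : R)^'+] --> (0 : R).
Proof. by rewrite -[X in _ --> X](mulr0 K); apply: cvgMr; exact: cvg_right_id. Qed.
Let d_cvg0 : d s @[s --> (0 : R)^'+] --> (0 : R).
Proof. exact: (cvg0_norm_le d_norm Ks0). Qed.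
Let d_bound s : 0 < s -> B / 4 * s <= d s <= K * s.
Proof.
move=> s0; have := d_norm s0; have := ler_norm (d s) => H1 H2; apply/andP; split; last lra.
have lim : d s - B / 4 * s @[s --> (0 : R)^'+] --> 0 - B / 4 * 0.
  by apply: cvgB; [exact: d_cvg0|apply: cvgMr; exact: cvg_right_id].
have Dd (x : R) : 0 < x <= s -> der x (fun s => d s - B / 4 * s) (p0 x - B / 4).
  move=> /andP[x0 _]; apply: der_eq.
    by apply: derD; [exact: dd|apply: derN; apply: derM; [exact: derC|exact: derI]].
  by rewrite /=; ring.
have := der_mono0 s0 lim Dd; rewrite mulr0 subr0 subr_ge0; apply => x /andP[x0 _].
by rewrite subr_ge0; exact: p0_ge.
Qed.
Let d_0 : d 0 = 0. Proof. by rewrite /d set_itv1 Rintegral_set1. Qed.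
Let Q_0 : Q 0 = 0. Proof. by rewrite /Q set_itv1 Rintegral_set1. Qed.

Let f (t : R) := Num.sqrt (B ^+ 2 * t ^+ 2 / 4 + v (t, 0) + b).
Let D (r : R) := (\int[leb]_(t in `[0%R, r]) f t)%R.
Let cf : continuous f.
Proof.
pose w t := B ^+ 2 * t ^+ 2 / 4 + v (t, 0) + b.
have sq (t : R) : x ^+ 2 @[x --> t] --> t ^+ 2 by apply: cvg_sqr; exact: cvg_id.
have cv (t : R) : v (x, 0) @[x --> t] --> v (t, 0).
  have E : (fun t : R => v (t, 0)) = fun t => vh (t ^+ 2).
    by apply/funext => x; rewrite -(pot_h_sqr v_radial).
  have H : vh (x ^+ 2) @[x --> t] --> vh (t ^+ 2).
    by apply: (@continuous_comp _ _ _ (fun x : R => x ^+ 2) vh); [exact: sq|exact: cvh].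
  have Et : vh (t ^+ 2) = v (t, 0) by exact: (pot_h_sqr v_radial).
  by rewrite -Et E; exact: H.
have cw (t : R) : w x @[x --> t] --> w t.
  apply: cvgD; last exact: cvg_cst.
  by apply: cvgD; [apply: cvgM; [apply: cvgMr; exact: sq|exact: cvg_cst]|exact: cv].
by move=> t; exact: (cvg_comp _ _ (cw t) (@sqrt_continuous R (w t))).
Qed.

(** Change of variable [s = r ^+ 2]: [2 * r * p0 (r ^+ 2)] is the square root of [V (r ^+ 2)], so
    [agm_d] is the Agmon distance to the well along a radius. *)
Let dE r : 0 < r -> d (r ^+ 2) = D r.
Proof.
move=> r0.
have lim : K * x ^+ 2 @[x --> (0 : R)^'+] --> (0 : R).
  rewrite -[X in _ --> X](_ : K * 0 ^+ 2 = 0); last by ring.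
  by apply: cvgMr; apply: cvg_sqr; exact: cvg_right_id.
have d2_le x : 0 < x -> `|d (x ^+ 2)| <= K * x ^+ 2.
  by move=> x0; apply: d_norm; exact: exprn_gt0.
have dd2 (x : R) : 0 < x <= r -> der x (fun r => d (r ^+ 2)) (f x).
  move=> /andP[x0 _]; have x2 : 0 < x ^+ 2 by exact: exprn_gt0.
  apply: der_eq.
    by apply: (@der_comp _ (fun r => r ^+ 2) d); [exact: dd|apply: derX; exact: derI].
  rewrite /= mulr1 expr1 /f -(pot_h_sqr v_radial).
  rewrite (_ : B ^+ 2 * x ^+ 2 / 4 + vh (x ^+ 2) + b = x ^+ 2 * wkb_W B U (x ^+ 2)); last first.
    by rewrite /wkb_W /pot_U; field; nz.
  by rewrite sqrtrM ?(ltW x2)// sqrtr_sqr (gtr0_norm x0) /wkb_p0; field.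
have dD (x : R) : 0 < x <= r -> der x D (f x).
  by move=> /andP[x0 _]; exact: (primitive_der_cont cf x0).
exact: (der_unique0 r0 (cvg0_norm_le d2_le lim) (primitive_cvg0 cf) dd2 dD).
Qed.

Local Notation m0 := (\int[leb]_(t in `[0%R, L]) fs_q B b t)%R.

(** Since [v] vanishes beyond [a < L], the integral of the first root in [action_S] is the Agmon
    length from [L] to [2 * L], that is [D (2 * L) - D L]. Together with [2 * D L] and [- m0] this
    is the exponent produced by the Wronskian. *)
Lemma action_SE : action_S vp (v (0, 0)) B L = d (L ^+ 2) + d s1 - m0.
Proof.
have vpE t : 0 <= t -> vp t = v (t, 0) by move=> t0; rewrite v_radial eucl_rad_axis.
have -> : d s1 = D (2 * L).
  by rewrite -dE ?mulr_gt0//; congr (d _); rewrite exprMn -natrX.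
rewrite dE// /action_S.
have -> : agmon_d vp (v (0, 0)) B L = D L.
  apply: eq_Rintegral => t; rewrite inE/= in_itv/= => /andP[t0 _].
  by rewrite vpE// /f /pot_b.
pose g t := f (2 * L - t).
have cg : continuous g.
  move=> t; apply: (@continuous_comp _ _ _ (fun t => 2 * L - t) f); last exact: cf.
  by apply: cvgB; [exact: cvg_cst|exact: cvg_id].
have cq : continuous (fs_q B b) by exact: fs_q_continuous.
have dG (t : R) : 0 <= t <= L -> der t (fun t => - D (2 * L - t)) (g t).
  move=> /andP[_ tL]; have x0 : 0 < 2 * L - t by have := L0; lra.
  apply: der_eq.
    apply: derN; apply: (@der_comp _ (fun t => 2 * L - t) D); first exact: (primitive_der_cont cf x0).
    by apply: derD; [exact: derC|apply: derN; exact: derI].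
  by rewrite /= add0r mulrN1 opprK.
have Ig := ftc_closed L0 cg dG.
have -> : (\int[leb]_(r in `[0%R, L]) (Num.sqrt (B ^+ 2 * (2 * L - r) ^+ 2 / 4 - v (0, 0)) -
    Num.sqrt (B ^+ 2 * r ^+ 2 / 4 - v (0, 0))))%R = (\int[leb]_(r in `[0%R, L]) (g r - fs_q B b r))%R.
  apply: eq_Rintegral => t; rewrite inE/= in_itv/= => /andP[t0 tL].
  have LL := L_gt; have L0' := L0.
  have x0 : 0 <= 2 * L - t by lra.
  have vz : v (2 * L - t, 0) = 0 by apply: a_supp; rewrite eucl_rad_axis//; lra.
  by rewrite /g /f vz addr0 /fs_q /pot_b.
rewrite RintegralB//; last 2 first.
- exact: integrable_cont_itv.
- exact: integrable_cont_itv.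
rewrite Ig subr0 (_ : 2 * L - L = L); last by ring.
by ring.
Qed.

Variable Cb : R.
Hypothesis Cb0 : 0 < Cb.
Hypothesis bessel_ld : forall x : R, 0 < x ->
  `|bessel 1 x / bessel 0 x - 1 + (2 * x)^-1| <= Cb / x ^+ 2 /\
  `|bessel 1 x / bessel 0 x - 1| <= Cb / x.

(** For small [h], [bet] lies between [b / 2] and [3 * b / 2]. Using [2 * b] in the root and [b / 2]
    in the denominator makes the constant independent of [h]. *)
Local Notation Kz := (2 * fs_q B (2 * b) L + B ^+ 2 * L / (8 * (b / 2))).
Local Notation K3 := (fs_K3 B (b / 2) Cb Kz).
Local Notation K5 := (gs_K5 B a2 K s1).
Local Notation K2 := (gs_K2 B a2 K s1).
Local Notation A5 := (gs_A5 B b a2 K s1).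

(** * Estimates at a fixed value of [h] *)

Section SemiclassicalParameter.
Variables (h : R) (phi : R * R -> R).
Hypotheses (h0 : 0 < h) (h1 : h <= 1).
Hypothesis gs : radial_real_ground_state v B h phi.
Local Notation F := (prof phi).
Local Notation F1 := (prof1 phi).
Local Notation F2 := (prof2 B h vh phi).
Local Notation lam := (gs_lam B h vh phi).
Definition gs_Lam := lam + b.
Local Notation Lam := gs_Lam.
Local Notation bet := (b - Lam).
Local Notation j := (ang_j B L h F).
Local Notation j1 := (ang_j1 B L h F F1).
Local Notation j2 := (ang_j2 B L h F F1 F2).

Let dF (s : R) : 0 < s -> der s F (F1 s). Proof. exact: der_prof gs s. Qed.
Let dF1 (s : R) : 0 < s -> der s F1 (F2 s). Proof. exact: (der_prof1 h0 cvh vhE vh_bound gs). Qed.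
Let cF : continuous F. Proof. exact: continuous_prof gs. Qed.
Let ode0 (s : R) : 0 < s -> 4 * h ^+ 2 * (s * F2 s + F1 s) = (s * (B ^+ 2 / 4) + vh s - lam) * F s.
Proof. exact: prof_ode. Qed.
Let ode (s : R) : 0 < s -> 4 * h ^+ 2 * (s * F2 s + F1 s) = (V s - Lam) * F s.
Proof. by move=> s0; rewrite ode0// /V /gs_Lam /pot_U; congr (_ * _); ring. Qed.
Let odeK (s : R) : 0 < s -> 4 * h ^+ 2 * (s * F2 s + F1 s) = (s * (B ^+ 2 / 4) + vh s + bet) * F s.
Proof. by move=> s0; rewrite ode0// /gs_Lam; congr (_ * _); ring. Qed.
Let odeJ (s : R) : a2 < s -> 4 * h ^+ 2 * (s * F2 s + F1 s) = (s * (B ^+ 2 / 4) + bet) * F s.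
Proof. by move=> as0; rewrite odeK ?(lt_trans a20)// vh_out// addr0. Qed.
Let cF2 (s : R) : 0 < s -> {for s, continuous F2}.
Proof.
move=> s0; apply: cvgM; last by apply: cvgV; [rewrite gt_eqF|exact: cvg_id].
apply: cvgB; last exact: (der_cvg (dF1 s0)).
apply: cvgM; last exact: cvg_cst.
apply: cvgM; last exact: cF.
apply: cvgB; last exact: cvg_cst.
by apply: cvgD; [apply: cvgMr; exact: cvg_id|exact: cvh].
Qed.
Let F_0 : F s @[s --> (0 : R)^'+] --> F 0. Proof. by apply: cvg_at_right_filter; exact: cF. Qed.
Let sF1_0 : s * F1 s @[s --> (0 : R)^'+] --> (0 : R). Proof. exact: (prof1_0 gs). Qed.
Let F_inf X e : 0 < e -> exists2 s, X < s & s * F s ^+ 2 <= e /\ s * F1 s ^+ 2 <= e.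
Proof. exact: (prof_inf B0 h0 gs). Qed.
Let F_neq0 : exists2 s, 0 < s & F s != 0.
Proof.
apply: contrapT => H; have := IP_prof_sqr gs.
suff -> : IP (fun s => F s ^+ 2) = 0 by rewrite mulr0 => /eqP; rewrite eq_sym oner_eq0.
rewrite /IP /Rintegral integral0_eq// => s /=; rewrite in_itv/= andbT => s0.
have [->|Fs] := eqVneq (F s) 0; first by rewrite expr0n.
by exfalso; apply: H; exists s.
Qed.

Lemma gs_Lam_le : Lam <= 4 * p00 * h + K0 / (2 * p00 ^+ 2) * h ^+ 2.
Proof.
have p000' := p000; have w0 : 0 < 2 * p00 by pp.
have w2 : (2 * p00) ^+ 2 = kap + B ^+ 2 / 4.
  by rewrite exprMn -natrX; apply: wkb_p00_sqr.
have := gs_lam_le B0 h0 cvh vhE vh_bound gs w0 w2 K00 vh_le.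
have -> : 2 * (2 * p00) * h + 2 * K0 * h ^+ 2 / (2 * p00) ^+ 2 = 4 * p00 * h + K0 / (2 * p00 ^+ 2) * h ^+ 2.
  by field; nz.
by [].
Qed.

(** The Gaussian upper bound on the energy, read as a lower bound on [gs_mu]: the excess
    [K0 / (2 * p00 ^+ 2) * h ^+ 2], divided by [4 * h ^+ 2], is the quantity placed below
    [3 * K ^+ 2] by the choice of [K]. *)
Let mu_ge : - (3 * K ^+ 2) <= gs_mu p00 h Lam.
Proof.
have h0' := h0; have p000' := p000; rewrite /gs_mu ler_pdivlMr; last by pp.
have H1 := gs_Lam_le; have h2 : 0 <= 4 * h ^+ 2 by nn.
have : K0 / (8 * p00 ^+ 2) * (4 * h ^+ 2) <= 3 * K ^+ 2 * (4 * h ^+ 2) by exact: ler_wpM2r.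
have -> : K0 / (8 * p00 ^+ 2) * (4 * h ^+ 2) = K0 / (2 * p00 ^+ 2) * h ^+ 2 by field; nz.
by rewrite mulNr; lra.
Qed.

Lemma gs_Lam_bound : `|4 * p00 * h - Lam| <= 12 * K ^+ 2 * h ^+ 2.
Proof.
exact: (@gs_mu_bound R B p00 K V p0 p0' p1 p1' B0 K1 p0_sqr p0_ge p0_le transport dp0 dp1 p1_le sp1_le sp1'_le
  h Lam F F1 F2 h0 dF dF1 ode F_0 sF1_0 F_inf F_neq0 h1 mu_ge).
Qed.

Hypothesis Lam_le : `|Lam| <= b / 2.
Hypothesis hs : h * (16 * (K + 96 * K ^+ 2 / (a2 * B) + 1 + a2^-1)) <= B.
Hypothesis hs5 : K5 * Num.sqrt h <= 2^-1.
Hypothesis hs1 : 2 * fs_Kk B (b / 2) Cb * h ^+ 2 <= b / 2.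
Hypothesis hs2 : K3 * h * L <= 2^-1.
Local Notation psi := (gs_psi d Q h 0).

Lemma model_gs : [/\ F 0 != 0,
  forall s, 0 < s <= s1 ->
    `|F s - F 0 * psi s| <= 2 * K5 * Num.sqrt h * `|F 0| * psi s /\
    `|s * (F1 s + gs_P p0 p1 h s * F s)| <= 2 * K2 * h * `|F 0| * psi s &
  `|(c * F 0 ^+ 2)^-1 - h / (2 * p00)| <= A5 * (h * Num.sqrt h)].
Proof.
have Lam_le' : Lam <= b / 2 by exact: le_trans (ler_norm _) Lam_le.
exact: (@gs_estimates R B b a2 p00 K V p0 p0' p1 p1' d Q B0 b0 a20 K1 p0_sqr p0_ge p0_le transport dp0 dp1
  p1_le sp1_le sp1'_le dd dQ d_bound Q_bound Vb h Lam F F1 F2 h0 dF dF1 ode F_0 sF1_0 F_inf F_neq0 h1 mu_ge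
  Lam_le' hs s1 as1 d_0 Q_0 hs5 c (mass phi) c0 (mass_0 gs) (der_mass gs) (mass_le1 gs) (mass_inf gs) p00_ge p0_sub).
Qed.

Let bet_ge : b / 2 <= bet. Proof. by have := ler_norm Lam; have := Lam_le; lra. Qed.
Let b20 : 0 < b / 2. Proof. by rewrite divr_gt0. Qed.
Local Notation m := (fun s => \int[leb]_(t in `[0%R, s]) fs_q B bet t)%R.
Local Notation Y := (fs_Y B bet h m L).
Local Notation Y0 := (fs_Y0 bet).

Lemma model_fs : [/\ `|j L / Y - 2 * pi * F s1 / Y0| <= 2 * K3 * h * L * `|2 * pi * F s1 / Y0|,
  `|j1 L - fs_Z B bet h L * j L| <= 2 * K3 * h * `|2 * pi * F s1 / Y0| * Y &
  `|h * fs_Z B bet h L - fs_q B bet L| <= h * ((Cb + B ^+ 2 * L ^+ 2 / (8 * (b / 2))) / L)].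
Proof.
have bet0 : 0 < bet by exact: lt_le_trans bet_ge.
have cq : continuous (fs_q B bet) by exact: fs_q_continuous.
have v3 (r : R) : 0 <= r <= L -> - (3 * L / 2) < r < 3 * L / 2.
  by move=> /andP[r0 rL]; have L0' := L0; apply/andP; split; lra.
have dj (r : R) : 0 <= r <= L -> der r j (j1 r) by move=> /v3; exact: (ang_dj B h L0 cF dF dF1 cF2).
have dj1 (r : R) : 0 <= r <= L -> der r j1 (j2 r) by move=> /v3; exact: (ang_dj1 B h L0 cF dF dF1 cF2).
have z0 : 0 <= (0 : R) <= L by rewrite lexx ltW.
have lt_le (r : R) : 0 < r <= L -> 0 <= r <= L by move=> /andP[/ltW -> ->].
have odej (r : R) : 0 < r <= L -> h ^+ 2 * (r * j2 r + j1 r) = r * fs_q B bet r ^+ 2 * j r.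
  move=> rL; rewrite (ang_ode L0 h0 aL cF dF dF1 cF2 odeJ rL) sqr_sqrtr//.
  by apply: addr_ge0; [nn|exact: ltW].
have j_0 : j r @[r --> (0 : R)^'+] --> j 0.
  by apply: cvg_at_right_filter; exact: (der_cvg (dj _ z0)).
have rj1_0 : r * j1 r @[r --> (0 : R)^'+] --> (0 : R).
  rewrite -[X in _ --> X](mul0r (j1 0)); apply: cvgM; first exact: cvg_right_id.
  by apply: cvg_at_right_filter; exact: (der_cvg (dj1 _ z0)).
have Kz_ge : 2 * fs_q B bet L + B ^+ 2 * L / (8 * (b / 2)) <= Kz.
  rewrite lerD2r ler_pM2l// ler_sqrt ?lerD2l.
    by have := ler_norm (- Lam); rewrite normrN; have := Lam_le; have := b0; lra.
  by apply: addr_ge0; [nn|have := b0; lra].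
have dm (r : R) : 0 < r -> der r m (fs_q B bet r) by exact: primitive_der_cont.
have m_0 : m r @[r --> (0 : R)^'+] --> (0 : R) by exact: primitive_cvg0.
have [H1 H2] := @fs_main R B (b / 2) bet Cb h L Kz m j j1 j2 B0 b20 bet_ge Cb0 h0 h1 L0 bessel_ld dm m_0
  (fun r rL => dj r (lt_le r rL)) (fun r rL => dj1 r (lt_le r rL)) odej j_0 rj1_0 Kz_ge hs1 hs2.
rewrite ang_j_0 in H1 H2; split=> //.
exact: (fs_Z_rho B0 b20 bet_ge h0 L0 bessel_ld).
Qed.

Lemma model_hop : hop_im v B L h phi = 0 /\ 2 * pi * hop_re v B L h phi =
  c * (4 * h ^+ 2 * (L ^+ 2 * F1 (L ^+ 2) * j L - L / 2 * (F (L ^+ 2) * j1 L))).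
Proof.
have phiE z : phi z = F (nrm2 z) by exact: (phi_prof gs).
split; first exact: (hop_imE B L0 h0 a20 cvh vhE vh_out phiE cF).
exact: (hop_reE L0 h0 a20 aL cvh vhE vh_out phiE cF dF dF1 cF2 sF1_0 odeK).
Qed.

End SemiclassicalParameter.

End Model.

(** * Passage to the limit *)

Section Assembly.
Context {R : realType}.
Notation leb := (@lebesgue_measure R).
Variables (v : R * R -> R) (vp : R -> R) (a B L : R).
Hypotheses (v_smooth : smooth2 v) (v_nonpos : forall z, v z <= 0).
Hypothesis v_radial : forall z, v z = vp (eucl_rad z).
Hypothesis v_min : forall z, z != (0, 0) -> v (0, 0) < v z.
Hypotheses (v0_neg : v (0, 0) < 0) (nd : 0 < dx (dx v) (0, 0)).
Hypotheses (a_pos : 0 < a) (a_supp : forall z, a < eucl_rad z -> v z = 0).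
Hypotheses (B_pos : 0 < B) (L_gt : a < L).
Variable phi : R -> R * R -> R.
Hypothesis phi_gs : exists2 h0 : R, 0 < h0 &
  forall h, 0 < h -> h < h0 -> radial_real_ground_state v B h (phi h).

Local Notation b := (pot_b v).
Local Notation p00 := (wkb_p00 B (pot_kap v)).
Local Notation p0 := (wkb_p0 B (pot_U v)).
Local Notation p1 := (wkb_p1 B (pot_kap v) (pot_U v) (pot_U1 v)).
Local Notation d := (agm_d v B).
Local Notation Q := (agm_Q v B).
Let Lam h := gs_Lam v B h (phi h).
Local Notation m bet := (fun s => \int[leb]_(t in `[0%R, s]) fs_q B bet t)%R.
Local Notation m0 := (\int[leb]_(t in `[0%R, L]) fs_q B b t)%R.
Let L0 : 0 < L. Proof. exact: lt_trans L_gt. Qed.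
Let b0 : 0 < b. Proof. exact: pot_b_gt0. Qed.

Let small_h : \forall h \near (0 : R)^'+, [/\ 0 < h, h <= 1 & radial_real_ground_state v B h (phi h)].
Proof.
have [h0 h00 Hgs] := phi_gs; near=> h.
have hp : 0 < h by near: h; exact: nbhs_right_gt.
split=> //; first by near: h; exact: nbhs_right_le.
by apply: Hgs => //; near: h; exact: nbhs_right_lt.
Unshelve. all: by end_near. Qed.

Variables (K K0 Cb Cl l : R).
Hypotheses (K1 : 1 <= K) (K00 : 0 <= K0) (KK : K0 / (8 * p00 ^+ 2) <= 3 * K ^+ 2).
Hypothesis vh_le : forall s, 0 < s -> pot_h v s + b <= pot_kap v * s + K0 * s ^+ 2.
Hypothesis pb : forall s, 0 < s -> [/\ p0 s <= K, `|p1 s| <= K, `|s * p1 s| <= K,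
  `|s * wkb_p1' B (pot_kap v) (pot_U v) (pot_U1 v) (pot_U2 v) s| <= K & `|p0 s - p00| <= K * s].
Hypotheses (Cb0 : 0 < Cb) (l0 : 0 < l).
Hypothesis bessel_ld : forall x : R, 0 < x ->
  `|bessel 1 x / bessel 0 x - 1 + (2 * x)^-1| <= Cb / x ^+ 2 /\
  `|bessel 1 x / bessel 0 x - 1| <= Cb / x.
Hypothesis bessel_lim : forall x : R, 2 <= x -> `|Num.sqrt x * expR (- x) * bessel 0 x - l| <= Cl / x.

Local Notation Kz := (2 * fs_q B (2 * b) L + B ^+ 2 * L / (8 * (b / 2))).
Local Notation K3 := (fs_K3 B (b / 2) Cb Kz).
Local Notation K5 := (gs_K5 B (a ^+ 2) K (4 * L ^+ 2)).
Local Notation K2 := (gs_K2 B (a ^+ 2) K (4 * L ^+ 2)).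
Local Notation A5 := (gs_A5 B b (a ^+ 2) K (4 * L ^+ 2)).
Local Notation Kk := (fs_Kk B (b / 2) Cb).
Local Notation psi h := (gs_psi d Q h 0).
Local Notation Y h := (fs_Y B (b - Lam h) h (m (b - Lam h)) L).
Local Notation Y0 h := (fs_Y0 (b - Lam h)).
Local Notation q0 := (fs_q B b L).

Let Lam_near : \forall h \near (0 : R)^'+, `|4 * p00 * h - Lam h| <= 12 * K ^+ 2 * h ^+ 2.
Proof.
apply: filterS small_h => h [hp h1 g].
exact: (gs_Lam_bound v_smooth v_nonpos v_radial v_min nd B_pos K1 K00 KK vh_le pb hp h1 g).
Qed.

Let Ka := `|4 * p00| + `|12 * K ^+ 2|.
Let Lam_lin : \forall h \near (0 : R)^'+, `|Lam h| <= Ka * h /\ `|Lam h| <= b / 2.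
Proof. by apply: Lam_linear => //; exact: Lam_near. Qed.

Let b20 : 0 < b / 2. Proof. by rewrite divr_gt0. Qed.

Let bet_gt0 : \forall h \near (0 : R)^'+, 0 < b - Lam h.
Proof. by apply: filterS Lam_lin => h [_ H]; have := ler_norm (Lam h); have := b20; lra. Qed.

Let psi_gt0 h s : 0 < psi h s. Proof. exact: expR_gt0. Qed.

Let q0_gt0 : 0 < q0. Proof. by rewrite sqrtr_gt0 ltr_wpDl//; nn. Qed.

Let Y_gt0 : \forall h \near (0 : R)^'+, 0 < Y h /\ 0 < Y0 h.
Proof.
apply: filterS bet_gt0 => h bet0; split; rewrite divr_gt0//.
- by rewrite mulr_gt0 ?expR_gt0//; exact: bessel0_gt0.
- by rewrite !sqrtr_gt0 ltr_wpDl//; nn.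
- by rewrite mulr_gt0// pi_gt0.
- by rewrite !sqrtr_gt0.
Qed.

Let gs_near : \forall h \near (0 : R)^'+, [/\ prof (phi h) 0 != 0,
  forall s, 0 < s <= 4 * L ^+ 2 ->
    `|prof (phi h) s - prof (phi h) 0 * psi h s| <= 2 * K5 * Num.sqrt h * `|prof (phi h) 0| * psi h s /\
    `|s * (prof1 (phi h) s + gs_P p0 p1 h s * prof (phi h) s)| <= 2 * K2 * h * `|prof (phi h) 0| * psi h s &
  `|(radial_c * prof (phi h) 0 ^+ 2)^-1 - h / (2 * p00)| <= A5 * (h * Num.sqrt h)].
Proof.
near=> h; have [hp h1 g] : [/\ 0 < h, h <= 1 & radial_real_ground_state v B h (phi h)] by near: h.
have [_ Lb] : `|Lam h| <= Ka * h /\ `|Lam h| <= b / 2 by near: h.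
have hs : h * (16 * (K + 96 * K ^+ 2 / (a ^+ 2 * B) + 1 + a ^- 2)) <= B.
  by rewrite mulrC; near: h; exact: near_le.
have hs5 : K5 * Num.sqrt h <= 2^-1 by near: h; apply: near_sqrt_le; rewrite invr_gt0.
exact: (model_gs v_smooth v_nonpos v_radial v_min v0_neg nd a_pos a_supp B_pos L_gt K1 K00 KK vh_le pb hp h1 g Lb hs hs5).
Unshelve. all: by end_near. Qed.

Let fs_near : \forall h \near (0 : R)^'+,
  [/\ `|ang_j B L h (prof (phi h)) L / Y h - 2 * pi * prof (phi h) (4 * L ^+ 2) / Y0 h| <=
        2 * K3 * h * L * `|2 * pi * prof (phi h) (4 * L ^+ 2) / Y0 h|,
      `|ang_j1 B L h (prof (phi h)) (prof1 (phi h)) L - fs_Z B (b - Lam h) h L * ang_j B L h (prof (phi h)) L| <=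
        2 * K3 * h * `|2 * pi * prof (phi h) (4 * L ^+ 2) / Y0 h| * Y h &
      `|h * fs_Z B (b - Lam h) h L - fs_q B (b - Lam h) L| <= h * ((Cb + B ^+ 2 * L ^+ 2 / (8 * (b / 2))) / L)].
Proof.
near=> h; have [hp h1 g] : [/\ 0 < h, h <= 1 & radial_real_ground_state v B h (phi h)] by near: h.
have [_ Lb] : `|Lam h| <= Ka * h /\ `|Lam h| <= b / 2 by near: h.
have hs1 : 2 * Kk * h ^+ 2 <= b / 2.
  apply: (@le_trans _ _ (`|2 * Kk| * h)); last by near: h; exact: near_le.
  apply: (@le_trans _ _ (`|2 * Kk| * h ^+ 2)); first by rewrite ler_wpM2r ?sqr_ge0// ler_norm.
  by rewrite ler_wpM2l// expr2 ler_piMr// ltW.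
have hs2 : K3 * h * L <= 2^-1 by rewrite mulrAC; near: h; apply: near_le; rewrite invr_gt0.
exact: (model_fs v_smooth v_nonpos v_radial v_min v0_neg a_pos a_supp B_pos L_gt Cb0 bessel_ld hp h1 g Lb hs1 hs2).
Unshelve. all: by end_near. Qed.

Let hop_near : \forall h \near (0 : R)^'+, hop_im v B L h (phi h) = 0 /\
  2 * pi * hop_re v B L h (phi h) = radial_c *
  (4 * h ^+ 2 * (L ^+ 2 * prof1 (phi h) (L ^+ 2) * ang_j B L h (prof (phi h)) L -
    L / 2 * (prof (phi h) (L ^+ 2) * ang_j1 B L h (prof (phi h)) (prof1 (phi h)) L))).
Proof.
apply: filterS small_h => h [hp _ g].
exact: (model_hop v_smooth v_nonpos v_radial v_min a_pos a_supp L_gt hp g).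
Qed.

Let Zq_near : \forall h \near (0 : R)^'+,
  `|h * fs_Z B (b - Lam h) h L - q0| <= ((Cb + B ^+ 2 * L ^+ 2 / (8 * (b / 2))) / L + Ka / Num.sqrt (b / 2)) * h.
Proof.
near=> h; have [L1 L2] : `|Lam h| <= Ka * h /\ `|Lam h| <= b / 2 by near: h.
have H : `|h * fs_Z B (b - Lam h) h L - fs_q B (b - Lam h) L| <= h * ((Cb + B ^+ 2 * L ^+ 2 / (8 * (b / 2))) / L).
  by near: h; apply: filterS fs_near => h [].
have [D1 _] := fs_q_diff B b0 L L2.
have -> : h * fs_Z B (b - Lam h) h L - q0 = (h * fs_Z B (b - Lam h) h L - fs_q B (b - Lam h) L) - (q0 - fs_q B (b - Lam h) L).
  by ring.
apply: le_trans (ler_normB _ _) _; rewrite [leRHS]mulrDl; apply: lerD; first by rewrite [leRHS]mulrC.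
apply: (le_trans D1); have kp0 : 0 < Num.sqrt (b / 2) by rewrite sqrtr_gt0.
by rewrite mulrAC ler_pM2r ?invr_gt0.
Unshelve. all: by end_near. Qed.

Let L20 : 0 < L ^+ 2. Proof. exact: exprn_gt0. Qed.

Let p00_gt0 : 0 < p00.
Proof.
apply: (@lt_le_trans _ _ (B / 4)); first by rewrite divr_gt0.
by apply: wkb_p00_ge => //; exact: pot_kap_ge0.
Qed.

Let prefactor : hop_re v B L h (phi h) / (psi h (L ^+ 2) * psi h (4 * L ^+ 2) * (Y h / Y0 h))
  @[h --> (0 : R)^'+] --> 8 * p00 * - (L ^+ 2 * p0 (L ^+ 2) + L / 2 * q0).
Proof.
pose kz := (Cb + B ^+ 2 * L ^+ 2 / (8 * (b / 2))) / L + Ka / Num.sqrt (b / 2).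
pose k := `|2 * K5| + `|2 * K2| + `|A5| + `|2 * K3 * L| + `|2 * K3| + `|kz|.
have [k1 k2] : 2 * K5 <= k /\ 2 * K2 <= k.
  have := (ler_norm (2 * K5), ler_norm (2 * K2), normr_ge0 (2 * K5), normr_ge0 (2 * K2), normr_ge0 A5).
  have := (normr_ge0 (2 * K3 * L), normr_ge0 (2 * K3), normr_ge0 kz).
  by rewrite /k; move=> [[? ?] ?] [[[[? ?] ?] ?] ?]; split; lra.
have [k3 k4] : A5 <= k /\ 2 * K3 * L <= k.
  have := (ler_norm A5, ler_norm (2 * K3 * L), normr_ge0 (2 * K5), normr_ge0 (2 * K2), normr_ge0 A5).
  have := (normr_ge0 (2 * K3 * L), normr_ge0 (2 * K3), normr_ge0 kz).
  by rewrite /k; move=> [[? ?] ?] [[[[? ?] ?] ?] ?]; split; lra.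
have [k5 k6] : 2 * K3 <= k /\ kz <= k.
  have := (ler_norm (2 * K3), ler_norm kz, normr_ge0 (2 * K5), normr_ge0 (2 * K2), normr_ge0 A5).
  have := (normr_ge0 (2 * K3 * L), normr_ge0 (2 * K3), normr_ge0 kz).
  by rewrite /k; move=> [[? ?] ?] [[[[? ?] ?] ?] ?]; split; lra.
have pi2 : 2 * pi != 0 :> R by rewrite mulf_neq0// gt_eqF// pi_gt0.
have s1 : 0 < L ^+ 2 <= 4 * L ^+ 2 by rewrite L20/=; have := L20; lra.
have s2 : 0 < 4 * L ^+ 2 <= 4 * L ^+ 2 by rewrite lexx andbT; have := L20; lra.
apply: (@hopping_prefactor R (fun h => prof (phi h) 0) (fun h => prof (phi h) (L ^+ 2))
  (fun h => prof (phi h) (4 * L ^+ 2)) (fun h => L ^+ 2 * prof1 (phi h) (L ^+ 2))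
  (fun h => psi h (L ^+ 2)) (fun h => psi h (4 * L ^+ 2)) (fun h => ang_j B L h (prof (phi h)) L)
  (fun h => ang_j1 B L h (prof (phi h)) (prof1 (phi h)) L) (fun h => Y h) (fun h => Y0 h)
  (fun h => fs_Z B (b - Lam h) h L) (fun h => hop_re v B L h (phi h)) radial_c L k (p0 (L ^+ 2))
  (p1 (L ^+ 2)) p00 q0 (2 * pi)) => //.
- exact: radial_c_gt0.
- near=> h; have [u0 _ _] : [/\ prof (phi h) 0 != 0,
    forall s, 0 < s <= 4 * L ^+ 2 ->
    `|prof (phi h) s - prof (phi h) 0 * psi h s| <= 2 * K5 * Num.sqrt h * `|prof (phi h) 0| * psi h s /\
    `|s * (prof1 (phi h) s + gs_P p0 p1 h s * prof (phi h) s)| <= 2 * K2 * h * `|prof (phi h) 0| * psi h s &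
    `|(radial_c * prof (phi h) 0 ^+ 2)^-1 - h / (2 * p00)| <= A5 * (h * Num.sqrt h)] by near: h; exact: gs_near.
  have [y1 y2] : 0 < Y h /\ 0 < Y0 h by near: h; exact: Y_gt0.
  by split.
- near=> h; have [_ G1 G2] : [/\ prof (phi h) 0 != 0,
    forall s, 0 < s <= 4 * L ^+ 2 ->
    `|prof (phi h) s - prof (phi h) 0 * psi h s| <= 2 * K5 * Num.sqrt h * `|prof (phi h) 0| * psi h s /\
    `|s * (prof1 (phi h) s + gs_P p0 p1 h s * prof (phi h) s)| <= 2 * K2 * h * `|prof (phi h) 0| * psi h s &
    `|(radial_c * prof (phi h) 0 ^+ 2)^-1 - h / (2 * p00)| <= A5 * (h * Num.sqrt h)] by near: h; exact: gs_near.
  have [hp _ _] : [/\ 0 < h, h <= 1 & radial_real_ground_state v B h (phi h)] by near: h.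
  have [G11 G12] := G1 _ s1; have [G21 _] := G1 _ s2.
  have hp' := ltW hp; have p1' := ltW (psi_gt0 h (L ^+ 2)); have p2' := ltW (psi_gt0 h (4 * L ^+ 2)).
  split.
  + by apply: (le_trans G11); do 3 (apply: ler_wpM2r; first by nn).
  + have -> : L ^+ 2 * prof1 (phi h) (L ^+ 2) + L ^+ 2 * (p0 (L ^+ 2) / h + p1 (L ^+ 2)) * prof (phi h) (L ^+ 2) =
       L ^+ 2 * (prof1 (phi h) (L ^+ 2) + gs_P p0 p1 h (L ^+ 2) * prof (phi h) (L ^+ 2)) by rewrite /gs_P; ring.
    by apply: (le_trans G12); do 3 (apply: ler_wpM2r; first by nn).
  + by apply: (le_trans G21); do 3 (apply: ler_wpM2r; first by nn).
  + by apply: (le_trans G2); apply: ler_wpM2r; first by nn.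
- near=> h; have [hp _ _] : [/\ 0 < h, h <= 1 & radial_real_ground_state v B h (phi h)] by near: h.
  have hp' := ltW hp.
  have [y1 y2] : 0 < Y h /\ 0 < Y0 h by near: h; exact: Y_gt0.
  have y1' := ltW y1.
  split.
  + apply: (@le_trans _ _ (2 * K3 * h * L * `|2 * pi * prof (phi h) (4 * L ^+ 2) / Y0 h|)).
      by near: h; apply: filterS fs_near => h [].
    by apply: ler_wpM2r; [nn|rewrite mulrAC ler_wpM2r].
  + apply: (@le_trans _ _ (2 * K3 * h * `|2 * pi * prof (phi h) (4 * L ^+ 2) / Y0 h| * Y h)).
      by near: h; apply: filterS fs_near => h [].
    by do 3 (apply: ler_wpM2r; first by nn).
  + apply: (@le_trans _ _ (kz * h)); first by near: h; exact: Zq_near.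
    by apply: ler_wpM2r.
  + by near: h; apply: filterS hop_near => h [].
Unshelve. all: by end_near. Qed.

(** The constant has three sources: [8 * p00 * X] from the Wronskian at distance [L] together with
    the normalisation, [QQ] from the WKB amplitudes at squared distances [L ^+ 2] and [4 * L ^+ 2],
    and [E0] from the growth of the angular average. *)
Lemma hopping_asymptotics : exists2 C : R, 0 < C &
  ((fun h => hop_re v B L h (phi h) / (- C * Num.sqrt h * expR (- action_S vp (v (0, 0)) B L / h)))
     @ (0:R)^'+ --> (1:R)) /\
  ((fun h => hop_im v B L h (phi h) / (- C * Num.sqrt h * expR (- action_S vp (v (0, 0)) B L / h)))
     @ (0:R)^'+ --> (0:R)).
Proof.
have SE := action_SE v_smooth v_nonpos v_radial v_min v0_neg a_pos a_supp B_pos L_gt pb.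
set S := action_S _ _ _ _ in SE *.
have [E0 E00 tun] : exists2 E0 : R, 0 < E0 &
    Y h / Y0 h / (Num.sqrt h * expR (m0 / h)) @[h --> (0 : R)^'+] --> E0.
  eexists; last exact: (exp_prefactor b0 L0 Lam_near bessel_lim).
  have s1 : 0 < Num.sqrt L by rewrite sqrtr_gt0.
  have s2 : 0 < Num.sqrt q0 by rewrite sqrtr_gt0; exact: q0_gt0.
  have pi0 : 0 < pi :> R by exact: pi_gt0.
  apply: divr_gt0; first by apply: mulr_gt0 => //; exact: expR_gt0.
  by apply: mulr_gt0; exact: mulr_gt0.
pose QQ := expR (- (Q (L ^+ 2) + Q (4 * L ^+ 2))); have QQ0 : 0 < QQ by exact: expR_gt0.
pose X := L ^+ 2 * p0 (L ^+ 2) + L / 2 * q0.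
have p0L : 0 < p0 (L ^+ 2).
  apply: (@lt_le_trans _ _ (B / 4)); first by rewrite divr_gt0.
  by apply: wkb_p0_ge => // s s0; exact: pot_U_ge0.
have X0 : 0 < X by rewrite /X; have L0' := L0; have q00 := q0_gt0; pp.
pose C := 8 * p00 * X * (E0 * QQ).
have C0 : 0 < C by rewrite /C; have p000 := p00_gt0; pp.
exists C => //; split.
  have : hop_re v B L h (phi h) / (psi h (L ^+ 2) * psi h (4 * L ^+ 2) * (Y h / Y0 h)) *
      (Y h / Y0 h / (Num.sqrt h * expR (m0 / h))) * (QQ / - C) @[h --> (0 : R)^'+] -->
      8 * p00 * - (L ^+ 2 * p0 (L ^+ 2) + L / 2 * q0) * E0 * (QQ / - C).
    by apply: cvgM; [apply: cvgM; [exact: prefactor|exact: tun]|exact: cvg_cst].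
  have p000 := p00_gt0.
  have -> : 8 * p00 * - (L ^+ 2 * p0 (L ^+ 2) + L / 2 * q0) * E0 * (QQ / - C) = 1.
    by rewrite -/X /C; field; nz.
  apply: cvg_trans; apply: near_eq_cvg; near=> h.
  have [y1 y2] : 0 < Y h /\ 0 < Y0 h by near: h; exact: Y_gt0.
  have hp : 0 < h by near: h; exact: nbhs_right_gt.
  have sh : 0 < Num.sqrt h by rewrite sqrtr_gt0.
  (* Here [action_SE] enters: the exponents of the two WKB values add up to [S + m0], and [m0] is
     compensated by the growth of the free solution. *)
  have psiE : psi h (L ^+ 2) * psi h (4 * L ^+ 2) = expR (- S / h) * QQ / expR (m0 / h).
    rewrite -expRN -!expRD; congr expR; rewrite SE; field; nz.
  have e1 := expR_gt0 (- S / h); have e2 := expR_gt0 (m0 / h).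
  rewrite /= psiE; move: (expR (- S / h)) (expR (m0 / h)) e1 e2 => x1 x2 e1 e2.
  by move: (Y h) (Y0 h) y1 y2 (hop_re _ _ _ _ _) => y y0 y1 y2 w; field; nz.
have : (0 : R) @[h --> (0 : R)^'+] --> (0 : R) by exact: cvg_cst.
apply: cvg_trans; apply: near_eq_cvg; near=> h.
have [-> _] : hop_im v B L h (phi h) = 0 /\ 2 * pi * hop_re v B L h (phi h) = radial_c *
  (4 * h ^+ 2 * (L ^+ 2 * prof1 (phi h) (L ^+ 2) * ang_j B L h (prof (phi h)) L -
    L / 2 * (prof (phi h) (L ^+ 2) * ang_j1 B L h (prof (phi h)) (prof1 (phi h)) L))).
  by near: h; exact: hop_near.
by rewrite mul0r.
Unshelve. all: by end_near. Qed.

End Assembly.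

Unset Implicit Arguments.

Theorem theorem4p1 (R : realType) (v : R * R -> R) (vp : R -> R) (a B L : R)
  (v_smooth : smooth2 v)
  (v_nonpos : forall z, v z <= 0)
  (v_radial : forall z, v z = vp (eucl_rad z))
  (v_min : forall z, z != (0, 0) -> v (0, 0) < v z)
  (v0_neg : v (0, 0) < 0)
  (v_nondeg : 0 < dx (dx v) (0, 0) /\
     0 < dx (dx v) (0, 0) * dy (dy v) (0, 0) - dx (dy v) (0, 0) ^+ 2)
  (a_pos : 0 < a)
  (a_supp : forall z, a < eucl_rad z -> v z = 0)
  (a_min : forall b, 0 < b -> (forall z, b < eucl_rad z -> v z = 0) -> a <= b)
  (B_pos : 0 < B) (L_gt : a < L)
  (phi : R -> R * R -> R)
  (phi_gs : exists2 h0 : R, 0 < h0 &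
     forall h, 0 < h -> h < h0 -> radial_real_ground_state v B h (phi h)) :
  let S := action_S vp (v (0, 0)) B L in
  exists2 C : R, 0 < C &
    ((fun h => hop_re v B L h (phi h) / (- C * Num.sqrt h * expR (- S / h)))
       @ (0:R)^'+ --> (1:R)) /\
    ((fun h => hop_im v B L h (phi h) / (- C * Num.sqrt h * expR (- S / h)))
       @ (0:R)^'+ --> (0:R)).
Proof.
have [nd _] := v_nondeg.
have [Cb Cb0 bld] := @bessel_log_derivative R.
have [Cl [l [_ l0 blim]]] := @bessel_limit R.
have [K [K0 [K1 [K00 KK] vhle pb]]] :=
  model_constants v_smooth v_nonpos v_radial v_min v0_neg nd a_pos a_supp B_pos.
exact: (hopping_asymptotics v_smooth v_nonpos v_radial v_min v0_neg nd a_pos a_supp B_pos L_gt phi_gs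
  K1 K00 KK vhle pb Cb0 l0 bld blim).
Qed.
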